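(* Put $r_{\mathrm{ad}}=\sum_{j=1}^hr_j$, $W_{\mathrm{ad}}=\bigoplus_{j=1}^hW_j$, and $L^2_{\mathrm{Eis,ad}}=\bigoplus_{j=1}^hL^2_{\mathrm{Eis}}(Y_j)$. Order the columns of $E_s^{\mathrm{ad}}$ by the bijection $\bigsqcup_j\Gamma_j\backslash\mathbf G(k)/P(k)\to P(k)\backslash G_f/K_f$, $\Gamma_j\gamma P(k)\mapsto P(k)\gamma^{-1}g_jK_f$. Then the map given, initially on vectors whose component restrictions are finitely supported, by $$(\mathcal F_{\mathrm{Eis}}^{\mathrm{ad}}f)(\theta)=\frac1{\sqrt{q+1}}W_{\mathrm{ad}}^{-1/2}(E_{s_\theta}^{\mathrm{ad}})^*f,\qquad s_\theta=\frac12+\frac{i\theta}{\log q},$$ extends uniquely to a unitary operator $$\mathcal F_{\mathrm{Eis}}^{\mathrm{ad}}:L^2_{\mathrm{Eis,ad}}\longrightarrow L^2\!\left((0,\pi),\mathbb C^{r_{\mathrm{ad}}};\frac{d\theta}{2\pi}\right).$$ It conjugates $\mathsf T_\infty$ to multiplication by $2\sqrt q\cos\theta$. Thus the fixed-level spherical automorphic Eisenstein transform and the orthogonal direct sum over $j$ of the Jacobi scattering transforms $\mathcal F_{\mathrm{ac},j}$ of the operators $U_jA_jU_j^{-1}$ are unitarily identified by the stabilizer conjugations $U_j$ and the displayed cusp-width normalization.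
   Context: Arithmetic setting. Let $k$ be a global function field with constant field $\mathbb F_q$, $\infty$ a place of degree one, $k_\infty$ identified with $K=\mathbb F_q(\!(t^{-1})\!)$, $\varpi=t^{-1}$, $v_\infty(\varpi)=1$, $\mathcal O=\mathbb F_q[\![t^{-1}]\!]$, $\mathbf G=\mathrm{PGL}_2$, $G_\infty=\mathbf G(k_\infty)$, $\mathcal K=\mathrm{PGL}_2(\mathcal O)$, $G_f=\mathbf G(\mathbb A_{k,f})$ (finite adeles, away from $\infty$), $K_f<G_f$ compact open. Let $g_1,\dots,g_h$ represent the finite set $\mathbf G(k)\backslash G_f/K_f$, $\Gamma_j=\mathbf G(k)\cap g_jK_fg_j^{-1}<G_\infty$. Then $\mathbf G(k)\backslash\mathbf G(\mathbb A_k)/(K_f\mathcal K)\cong\bigsqcup_j\Gamma_j\backslash G_\infty/\mathcal K=\bigsqcup_jV(Y_j)$, where $Y_j=\Gamma_j\backslash\mathcal T$, $\mathcal T$ the Bruhat–Tits tree of $G_\infty$ with $V(\mathcal T)=G_\infty/\mathcal K$; Haar measures are normalized by $\operatorname{vol}(\mathcal K)=\operatorname{vol}(K_f)=1$, so the measure on $V(Y_j)$ is $\lambda_j(v)=|\Gamma_{j,v}|^{-1}$, $\Gamma_{j,v}$ the stabilizer of a lift of $v$. The adjacency operator $A_j$ on $L^2(Y_j,\lambda_j)$ is, on left $\Gamma_j$-invariant functions on $V(\mathcal T)$, the sum over the $q+1$ neighbours; it is bounded and self-adjoint, and $L^2_{\mathrm{Eis}}(Y_j)$ is its absolutely continuous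 spectral subspace. $(\mathsf T_\infty F)(g)=\int_{\mathcal K\operatorname{diag}(\varpi,1)\mathcal K}F(gh)\,dh$ is the unnormalized spherical Hecke operator at $\infty$ on right $\mathcal K$-invariant functions. Cusps. Fix a rational minimal parabolic $P<\mathbf G$ with fixed endpoint $\xi_P\in\mathbb P^1(k)$, root character $\alpha:P\to\mathbb G_m$, and an integer-valued Busemann function $h_P$ on $G_\infty/\mathcal K$, increasing towards $\xi_P$, with $h_P(pg\mathcal K)-h_P(g\mathcal K)=-v_\infty(\alpha(p))$ for $p\in P(k)$. Let $\mathscr C_j=\Gamma_j\backslash\mathbf G(k)/P(k)$ (the cusps of $Y_j$), $r_j=|\mathscr C_j|$; for $c\in\mathscr C_j$ choose $\gamma_{j,c}\in\mathbf G(k)$ with $c=\Gamma_j\gamma_{j,c}P(k)$ and put $\Gamma_{j,c}=\Gamma_j\cap\gamma_{j,c}P(k)\gamma_{j,c}^{-1}$. Choose an integer-valued Busemann height $h_{j,c}$ increasing towards $\gamma_{j,c}\xi_P$ and cut the cusps so deep that the retained vertices $(c,n)$, $n\ge1$, of the cusp ray lie at height $h_{j,c}=n$, distinct $\Gamma_j$-translates of the horoballs $\{h_{j,c}\ge1\}$ are disjoint, each horoball has stabilizer $\Gamma_{j,c}$, and $\Gamma_{j,c}\backslash h_{j,c}^{-1}(n)$ maps to the single vertex $(c,n)$. Then the remaining vertices form a finite core, $A_jf(c,n)=qf(c,n-1)+f(c,n+1)$ for $n\ge2$, and $\lambda_j(c,n)=w_{j,c}(q+1)q^{-n}$; $W_j=\operatorname{diag}(w_{j,c})_{c\in\mathscr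 C_j}$ is the cusp-width matrix. Adelic family. For $\mathfrak c\in P(k)\backslash G_f/K_f$ corresponding to $(j,c)$ under the bijection in the statement put $\gamma_{\mathfrak c}=\gamma_{j,c}$, $x_{\mathfrak c}=\gamma_{\mathfrak c}^{-1}g_j$, and let $\kappa_{\mathfrak c}\in\mathbb Z$ satisfy $h_{j,c}(g\mathcal K)=h_P(\gamma_{\mathfrak c}^{-1}g\mathcal K)+\kappa_{\mathfrak c}$. Define $$\phi_{\mathfrak c,s}(g_\infty,g_f)=\begin{cases}q^{s\{h_P(p^{-1}g_\infty\mathcal K)+\kappa_{\mathfrak c}\}},&g_f=px_{\mathfrak c}k_f,\ p\in P(k),\ k_f\in K_f,\\0,&g_f\notin P(k)x_{\mathfrak c}K_f,\end{cases}$$ $E_{\mathfrak c}^{\mathrm{ad}}(g,s)=\sum_{\delta\in P(k)\backslash\mathbf G(k)}\phi_{\mathfrak c,s}(\delta g)$ for $\Re s>1$, continued meromorphically in $s$, and $E_s^{\mathrm{ad}}=(E_{\mathfrak c}^{\mathrm{ad}})_{\mathfrak c}$. For $f$ with finitely supported component restrictions, $(E_s^{\mathrm{ad}})^*f=(\langle f,E_{\mathfrak c}^{\mathrm{ad}}(\cdot,s)\rangle)_{\mathfrak c}$, pairings in $\bigoplus_jL^2(Y_j,\lambda_j)$, linear in the first variable; the transform of $f$ is regarded as the transform of its projection to $L^2_{\mathrm{Eis,ad}}$. Jacobi transforms. Let $a=\sqrt q$, $U_jf=\lambda_j^{1/2}f$. $J_j=U_jA_jU_j^{-1}$ acts on $\mathbb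 C^{d_j}\oplus\bigoplus_{c}\ell^2(\mathbb N)$ as $J_j(u,g)=(H_{C,j}u+V_jg(1),h)$, $h(1)=ag(2)+V_j^*u$, $h(n)=a\{g(n-1)+g(n+1)\}$ ($n\ge2$). With $F_j(\zeta)=H_{C,j}-a(\zeta+\zeta^{-1})I+\frac{\zeta^{-1}}aV_jV_j^*$, $S_j(\zeta)=-I+\frac{\zeta^{-1}-\zeta}aV_j^*F_j(\zeta)^{-1}V_j$ and $\Psi_{j,\theta}\alpha=\bigl((\zeta^{-1}-\zeta)F_j(\zeta)^{-1}V_j\alpha,(\zeta^n\alpha+\zeta^{-n}S_j(\zeta)\alpha)_{n\ge1}\bigr)$ at $\zeta=e^{i\theta}$, $\mathcal F_{\mathrm{ac},j}$ is the unitary extension of $f\mapsto\Psi_{j,\theta}^*f=(\langle f,\Psi_{j,\theta}e_c\rangle)_c$ from the absolutely continuous subspace of $J_j$ to $L^2((0,\pi),\mathbb C^{r_j};\frac{d\theta}{2\pi})$. *)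

(* Defs.v *)
From HB Require Import structures.
From mathcomp Require Import all_boot all_order all_algebra.
From mathcomp Require Import all_classical all_reals all_analysis.
From mathcomp Require Import finmap complex.
Set Implicit Arguments.
Unset Strict Implicit.
Unset Printing Implicit Defensive.
Import Order.TTheory GRing.Theory Num.Theory.
Import numFieldNormedType.Exports.
Local Open Scope classical_set_scope.
Local Open Scope quotient_scope.
Local Open Scope ring_scope.
Local Open Scope complex_scope.

Definition global_function_field (Fq : finFieldType) (k : fieldType)
    (iota : {rmorphism Fq -> k}) : Prop :=
  (exists x : k, ~ algebraicOver iota x /\
     exists (n : nat) (b : 'I_n -> k), forall y : k,
       exists num den : 'I_n -> {poly Fq}, (forall i, den i != 0) /\
         y = \sum_i (map_poly iota (num i)).[x] / (map_poly iota (den i)).[x] * b i)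
  /\ (forall y : k, algebraicOver iota y -> exists a : Fq, y = iota a).

(* The value at 0 is a dummy (the true one is +oo); it is pinned to 0 so that
   a place has only one representative. *)
Record valuation (F : fieldType) := Valuation {
  val_fun :> F -> int;
  val_0 : val_fun 0 = 0;
  val_M : forall x y : F, x != 0 -> y != 0 ->
    val_fun (x * y) = val_fun x + val_fun y;
  val_D : forall x y : F, x != 0 -> y != 0 -> x + y != 0 ->
    Num.min (val_fun x) (val_fun y) <= val_fun (x + y);
  val_surj : exists2 x : F, x != 0 & val_fun x = 1 }.

Definition val_ge (F : fieldType) (v : valuation F) (n : int) (x : F) : Prop :=
  x = 0 \/ n <= v x.

(* Every valuation is trivial on the finite field of constants, so the places
   of a global function field are exactly its normalized discrete valuations. *)
Notation place := valuation (only parsing).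

(* The residue field is the field of constants. *)
Definition degree_one (Fq : finFieldType) (k : fieldType)
    (iota : {rmorphism Fq -> k}) (v : place k) : Prop :=
  forall x : k, val_ge v 0 x -> exists a : Fq, val_ge v 1 (x - iota a).

Record completion (k : fieldType) (v : place k) := Completion {
  compl :> fieldType;
  compl_emb : {rmorphism k -> compl};
  compl_val : valuation compl;
  compl_ext : forall x : k, compl_val (compl_emb x) = v x;
  compl_dense : forall (y : compl) (n : int),
    exists x : k, val_ge compl_val n (y - compl_emb x);
  compl_complete : forall u : nat -> compl,
    (forall n : int, exists N : nat, forall i j : nat, (N <= i)%N -> (N <= j)%N ->
       val_ge compl_val n (u i - u j)) ->
    exists l : compl, forall n : int, exists N : nat, forall i : nat, (N <= i)%N ->
       val_ge compl_val n (u i - l) }.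

Section PGL2.
Variable F : fieldType.

Definition GL2 := {A : 'M[F]_2 | A \in unitmx}.

Definition gl_one : GL2 :=
  exist (fun A : 'M[F]_2 => A \in unitmx) 1%:M (unitmx1 F 2).

Lemma gl_mul_subproof (A B : GL2) : val A *m val B \in unitmx.
Proof. by rewrite unitmx_mul (valP A) (valP B). Qed.
Definition gl_mul (A B : GL2) : GL2 :=
  exist (fun A : 'M[F]_2 => A \in unitmx) _ (gl_mul_subproof A B).

Lemma gl_inv_subproof (A : GL2) : invmx (val A) \in unitmx.
Proof. by rewrite unitmx_inv (valP A). Qed.
Definition gl_inv (A : GL2) : GL2 :=
  exist (fun A : 'M[F]_2 => A \in unitmx) _ (gl_inv_subproof A).

Definition homothetic (A B : GL2) : bool :=
  `[< exists2 c : F, c != 0 & val B = c *: val A >].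

Lemma homothetic_refl : reflexive homothetic.
Proof. by move=> A; apply/asboolP; exists 1; rewrite ?oner_eq0 ?scale1r. Qed.

Lemma homothetic_sym : symmetric homothetic.
Proof.
suff h A B : homothetic A B -> homothetic B A by move=> A B; apply/idP/idP; apply: h.
move=> /asboolP[c c0 e]; apply/asboolP; exists c^-1; first by rewrite invr_eq0.
by rewrite e scalerA mulVf // scale1r.
Qed.

Lemma homothetic_trans : transitive homothetic.
Proof.
move=> B A C /asboolP[c c0 e] /asboolP[d d0 e']; apply/asboolP.
by exists (d * c); rewrite ?mulf_neq0 // e' e scalerA.
Qed.

Canonical homothetic_equiv :=
  EquivRel homothetic homothetic_refl homothetic_sym homothetic_trans.

Definition PGL2 := {eq_quot homothetic_equiv}.
HB.instance Definition _ := Choice.on PGL2.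

Definition pgl_class (A : GL2) : PGL2 := \pi_PGL2 A.
Definition pgl_repr (x : PGL2) : GL2 := repr x.

Lemma pgl_reprK x : pgl_class (pgl_repr x) = x.
Proof. exact: reprK. Qed.

Lemma pgl_eqP (A B : GL2) :
  (exists2 c : F, c != 0 & val B = c *: val A) <-> pgl_class A = pgl_class B.
Proof.
split=> [h|/eqquotP/asboolP //].
by apply/eqquotP/asboolP.
Qed.

Definition pgl_one : PGL2 := pgl_class gl_one.
Definition pgl_mul (x y : PGL2) : PGL2 :=
  pgl_class (gl_mul (pgl_repr x) (pgl_repr y)).
Definition pgl_inv (x : PGL2) : PGL2 := pgl_class (gl_inv (pgl_repr x)).

Lemma pgl_reprE A : exists2 c : F, c != 0 & val A = c *: val (pgl_repr (pgl_class A)).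
Proof. by apply/pgl_eqP; rewrite pgl_reprK. Qed.

Lemma pgl_classM A B : pgl_mul (pgl_class A) (pgl_class B) = pgl_class (gl_mul A B).
Proof.
apply/pgl_eqP; have [c c0 eA] := pgl_reprE A; have [d d0 eB] := pgl_reprE B.
exists (c * d); first by rewrite mulf_neq0.
by rewrite /= eA eB -scalemxAl -scalemxAr scalerA.
Qed.

Lemma pgl_mulA : associative pgl_mul.
Proof.
move=> x y z; rewrite -(pgl_reprK x) -(pgl_reprK y) -(pgl_reprK z) !pgl_classM.
by congr pgl_class; apply: val_inj; rewrite /= mulmxA.
Qed.

Lemma pgl_mul1 : left_id pgl_one pgl_mul.
Proof.
move=> x; rewrite -(pgl_reprK x) pgl_classM.
by congr pgl_class; apply: val_inj; rewrite /= mul1mx.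
Qed.

Lemma pgl_mulr1 : right_id pgl_one pgl_mul.
Proof.
move=> x; rewrite -(pgl_reprK x) pgl_classM.
by congr pgl_class; apply: val_inj; rewrite /= mulmx1.
Qed.

Lemma pgl_mulV : left_inverse pgl_one pgl_inv pgl_mul.
Proof.
move=> x; rewrite -[X in pgl_mul _ X](pgl_reprK x) pgl_classM.
by congr pgl_class; apply: val_inj; rewrite /= mulVmx // (valP (pgl_repr x)).
Qed.

Lemma pgl_mulrV : right_inverse pgl_one pgl_inv pgl_mul.
Proof.
move=> x; rewrite -[X in pgl_mul X _](pgl_reprK x) pgl_classM.
by congr pgl_class; apply: val_inj; rewrite /= mulmxV // (valP (pgl_repr x)).
Qed.

HB.instance Definition _ :=
  isGroup.Build PGL2 pgl_mulA pgl_mul1 pgl_mulr1 pgl_mulV pgl_mulrV.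

Definition mxrep (x : PGL2) : 'M[F]_2 := val (pgl_repr x).
(* pgl_of A is 1 when A is singular. *)
Definition pgl_of (A : 'M[F]_2) : PGL2 := pgl_class (insubd gl_one A).

Definition diag2 (a : F) : 'M[F]_2 :=
  \matrix_(i, j) (if i == j then (if i == 0 then a else 1) else 0).

Variable v : valuation F.

Definition pgl_int : set PGL2 :=
  [set x | exists A : GL2, [/\ x = pgl_class A,
     forall i j, val_ge v 0 (val A i j) & v (\det (val A)) = 0]].

Definition pgl_cong (n : int) : set PGL2 :=
  [set x | exists A : GL2, x = pgl_class A /\
     forall i j, val_ge v n (val A i j - (1%:M : 'M[F]_2) i j)].

End PGL2.

Definition pgl_map (F L : fieldType) (f : {rmorphism F -> L}) (x : PGL2 F) : PGL2 L :=
  pgl_of (map_mx f (mxrep x)).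

Record is_subgroup (G : groupType) (H : set G) : Prop := IsSubgroup {
  subgroup_1 : H 1%g;
  subgroup_M : forall x y, H x -> H y -> H (x * y)%g;
  subgroup_V : forall x, H x -> H (x^-1)%g }.

Section Orbits.
Variables (G X : Type) (a : G -> X -> X) (H : set G).

Definition orb (x : X) : set X := [set a g x | g in H].
Definition orbits := {O : set X | exists x, O = orb x}.
HB.instance Definition _ := gen_eqMixin orbits.
HB.instance Definition _ := gen_choiceMixin orbits.
Definition oproj (x : X) : orbits :=
  exist (fun O : set X => exists x, O = orb x) (orb x) (ex_intro _ x erefl).
Definition orep (O : orbits) : X := projT1 (cid (proj2_sig O)).

End Orbits.

Section Adelic.
Variables (k : fieldType) (oo : place k) (Kc : forall v : place k, completion v).

Definition fplace := {v : place k | v <> oo}.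

(* The full product of the PGL_2(k_v), v <> oo, containing the restricted
   product PGL_2(A_f) as the set Gf. *)
Definition Gprod := forall v : fplace, PGL2 (Kc (sval v)).
HB.instance Definition _ := gen_eqMixin Gprod.
HB.instance Definition _ := gen_choiceMixin Gprod.

Definition gp_one : Gprod := fun=> 1%g.
Definition gp_mul (x y : Gprod) : Gprod := fun v => (x v * y v)%g.
Definition gp_inv (x : Gprod) : Gprod := fun v => (x v)^-1%g.

Lemma gp_mulA : associative gp_mul.
Proof. by move=> x y z; apply: functional_extensionality_dep => v; exact: mulgA. Qed.
Lemma gp_mul1 : left_id gp_one gp_mul.
Proof. by move=> x; apply: functional_extensionality_dep => v; exact: mul1g. Qed.
Lemma gp_mulr1 : right_id gp_one gp_mul.
Proof. by move=> x; apply: functional_extensionality_dep => v; exact: mulg1. Qed.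
Lemma gp_mulV : left_inverse gp_one gp_inv gp_mul.
Proof. by move=> x; apply: functional_extensionality_dep => v; exact: mulVg. Qed.
Lemma gp_mulrV : right_inverse gp_one gp_inv gp_mul.
Proof. by move=> x; apply: functional_extensionality_dep => v; exact: mulgV. Qed.

HB.instance Definition _ :=
  isGroup.Build Gprod gp_mulA gp_mul1 gp_mulr1 gp_mulV gp_mulrV.

Definition Gf : set Gprod :=
  [set x | finite_set [set v | ~ pgl_int (compl_val (Kc (sval v))) (x v)]].

Definition congruence (S : set fplace) (n : int) : set Gprod :=
  [set x | forall v, pgl_int (compl_val (Kc (sval v))) (x v) /\
     (S v -> pgl_cong (compl_val (Kc (sval v))) n (x v))].

(* The congruence sets are a basis of neighbourhoods of 1.  On Gf this is the
   restricted-product topology. *)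
Definition gp_open (A : set Gprod) : Prop :=
  forall g, A g -> exists (S : set fplace) (n : int),
    finite_set S /\ forall u, congruence S n u -> A (g * u)%g.

Lemma gp_openT : gp_open setT.
Proof. by move=> g _; exists set0, 0; split. Qed.

Lemma pgl_congW (F : fieldType) (v : valuation F) (m n : int) x :
  m <= n -> pgl_cong v n x -> pgl_cong v m x.
Proof.
move=> mn [A [-> h]]; exists A; split=> // i j.
by case: (h i j) => [->|le]; [left|right; apply: le_trans le].
Qed.

Lemma gp_openI : setI_closed gp_open.
Proof.
move=> A B oA oB g [Ag Bg].
have [S [m [fS hA]]] := oA _ Ag; have [T [n [fT hB]]] := oB _ Bg.
exists (S `|` T), (Num.max m n); split; first by rewrite finite_setU.
move=> u hu; split; [apply: hA|apply: hB] => v; have [h1 h2] := hu v; split=> //.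
- by move=> Sv; apply: pgl_congW (h2 (or_introl Sv)); rewrite le_max lexx.
- by move=> Tv; apply: pgl_congW (h2 (or_intror Tv)); rewrite le_max lexx orbT.
Qed.

Lemma gp_open_bigU (I : Type) (f : I -> set Gprod) :
  (forall i, gp_open (f i)) -> gp_open (\bigcup_i f i).
Proof.
move=> fo g [i _ fg]; have [S [n [fS h]]] := fo i _ fg.
by exists S, n; split=> // u /h; exists i.
Qed.

HB.instance Definition _ :=
  isOpenTopological.Build Gprod gp_openT gp_openI gp_open_bigU.

Definition diagf (x : PGL2 k) : Gprod := fun v => pgl_map (compl_emb (Kc (sval v))) x.

Definition koo : fieldType := Kc oo.
Definition voo : valuation koo := compl_val (Kc oo).
Definition Goo := PGL2 koo.
Definition emb (x : PGL2 k) : Goo := pgl_map (compl_emb (Kc oo)) x.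
Definition Koo : set Goo := pgl_int voo.

Definition tree : Type := orbits (fun (u g : Goo) => g * u)%g Koo.
HB.instance Definition _ := Choice.on tree.
Definition vtx (g : Goo) : tree := oproj _ _ g.
Definition lift (x : tree) : Goo := orep x.
Definition act (g : Goo) (x : tree) : tree := vtx (g * lift x)%g.
Definition actk (g : PGL2 k) (x : tree) : tree := act (emb g) x.

Variable varpi : koo.

Definition double_coset : set Goo :=
  [set u | exists u1 u2, [/\ Koo u1, Koo u2 & u = (u1 * pgl_of (diag2 varpi) * u2)%g]].

Definition adj (x y : tree) : Prop := double_coset ((lift x)^-1 * lift y)%g.

Inductive walk : tree -> tree -> nat -> Prop :=
| walk0 x : walk x x 0
| walkS x y z n : adj x y -> walk y z n -> walk x z n.+1.

Definition tree_dist (x y : tree) (n : nat) : Prop :=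
  walk x y n /\ forall m, walk x y m -> (n <= m)%N.

(* The vertices g diag(varpi^-m, 1) K form a geodesic ray whose end is the line
   spanned by the first column of g.  The Busemann function is normalized to
   increase by 1 along the ray. *)
Definition busemann (xi : 'cV[k]_2) (h : tree -> int) : Prop :=
  forall B : GL2 koo,
    (exists a : koo, col ord0 (val B) = a *: map_mx (compl_emb (Kc oo)) xi) ->
    exists C : int, forall x : tree, exists N : nat, forall m : nat, (N <= m)%N ->
      exists2 n : nat,
        tree_dist x (vtx (pgl_class B * pgl_of (diag2 (varpi ^- m)))%g) n &
        h x = C + m%:Z - n%:Z.

Definition parabolic (xi : 'cV[k]_2) : set (PGL2 k) :=
  [set p | exists a : k, mxrep p *m xi = a *: xi].

(* If a representative A of p has eigenvalue a on the fixed line, it acts on the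
   quotient by (\det A) / a, and the root character is their ratio. *)
Definition root_char (xi : 'cV[k]_2) (p : PGL2 k) (al : k) : Prop :=
  exists2 a : k, mxrep p *m xi = a *: xi & al = a ^+ 2 / \det (mxrep p).

Variable Kf : set Gprod.

Definition Gamma (g : Gprod) : set (PGL2 k) :=
  [set a | Kf (g^-1 * diagf a * g)%g].

Definition Y (g : Gprod) : Type := orbits actk (Gamma g).
HB.instance Definition _ g := Choice.on (Y g).
Definition yproj (g : Gprod) (x : tree) : Y g := oproj _ _ x.

Definition stab (g : Gprod) (x : tree) : set (PGL2 k) :=
  [set a | Gamma g a /\ actk a x = x].

Definition horoball (h : tree -> int) : set tree := [set x | 1 <= h x].

Definition cusp_group (g : Gprod) (xi : 'cV[k]_2) (ga : PGL2 k) : set (PGL2 k) :=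
  [set a | Gamma g a /\ exists2 p, parabolic xi p & a = (ga * p * ga^-1)%g].

Section Functions.
Variable R : realType.

Definition lam (g : Gprod) (y : Y g) : R :=
  (#|` fset_set (stab g (orep y)) |%:R)^-1.

Definition Adj (g : Gprod) (f : Y g -> R[i]) (y : Y g) : R[i] :=
  \sum_(x \in [set x | adj (orep y) x]) f (yproj g x).

Definition automorphic (F : Goo -> Gprod -> R[i]) : Prop :=
  forall (a : PGL2 k) (u : Goo) (w : Gprod) g gf, Koo u -> Kf w -> Gf gf ->
    F (emb a * g * u)%g (diagf a * gf * w)%g = F g gf.

(* The Haar integral over K diag(varpi,1) K of a right K-invariant function,
   with vol(K) = 1, is the sum over the cosets uK contained in it. *)
Definition Too (F : Goo -> Gprod -> R[i]) (g : Goo) (gf : Gprod) : R[i] :=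
  \sum_(x \in [set vtx u | u in double_coset]) F (g * lift x)%g gf.

End Functions.
End Adelic.

Arguments emb {k} oo Kc x.
Arguments diagf {k} oo Kc x.
Arguments tree_dist {k oo Kc}.
Arguments busemann {k oo Kc}.
Arguments Adj {k oo Kc} varpi {Kf R g} f y.
Arguments lam {k oo Kc Kf} R {g} y.

Section Analysis.
Variable R : realType.
Notation C := R[i].

Definition rsum (I : choiceType) (f : I -> R) : R :=
  fine (\esum_(i in setT) (Num.max (f i) 0)%:E)
  - fine (\esum_(i in setT) (Num.max (- f i) 0)%:E).

(* Meaningful for absolutely summable families only. *)
Definition csum (I : choiceType) (f : I -> C) : C :=
  rsum (fun i => complex.Re (f i)) +i* rsum (fun i => complex.Im (f i)).

Definition cexp (z : C) : C :=
  (expR (complex.Re z))%:C * (cos (complex.Im z) +i* sin (complex.Im z)).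

Definition qpow (q : nat) (z : C) : C := cexp (z * (ln q%:R)%:C).

Definition cvg_pseries (a : nat -> C) (z : C) : Prop :=
  summable setT (fun n => (Normc.normc (a n * z ^+ n))%:E).

Definition pseries (a : nat -> C) (z : C) : C := csum (fun n => a n * z ^+ n).

Definition holomorphic_at (f : C -> C) (s0 : C) : Prop :=
  exists (a : nat -> C) (r : R), 0 < r /\
    forall s, Normc.normc (s - s0) < r ->
      cvg_pseries a (s - s0) /\ f s = pseries a (s - s0).

(* The value at a pole is set to 0, so that a meromorphic function is determined
   by its germ anywhere. *)
Definition pole_at (f : C -> C) (s0 : C) : Prop :=
  f s0 = 0 /\ exists (m : nat) (a : nat -> C) (r : R),
    [/\ (0 < m)%N, a 0%N != 0, 0 < r &
      forall s, 0 < Normc.normc (s - s0) < r ->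
        cvg_pseries a (s - s0) /\ (s - s0) ^+ m * f s = pseries a (s - s0)].

Definition meromorphic (f : C -> C) : Prop :=
  forall s0, holomorphic_at f s0 \/ pole_at f s0.

(* It is 0 when f has no meromorphic continuation. *)
Definition mero_continuation (f : C -> C) : C -> C :=
  xget (fun=> 0)
    [set F | meromorphic F /\ forall s, 1 < complex.Re s -> F s = f s].

End Analysis.

Section L2.
Variables (R : realType) (X : choiceType) (w : X -> R).
Notation C := R[i].

Definition l2norm2 (f : X -> C) : \bar R :=
  \esum_(x in setT) (w x * Normc.normc (f x) ^+ 2)%:E.
Definition l2 (f : X -> C) : Prop := (l2norm2 f < +oo)%E.
Definition ip (f g : X -> C) : C := csum (fun x => (w x)%:C * (f x * (g x)^*)).
Definition finsupp (f : X -> C) : Prop := finite_set [set x | f x != 0].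

(* The spectral measure of f for a bounded self-adjoint T is the compactly
   supported measure with < T^n f, f > as moments; by Weierstrass it is unique. *)
Definition spectral_measure (T : (X -> C) -> X -> C) (f : X -> C)
    (mu : {finite_measure set (measurableTypeR R) -> \bar R}) : Prop :=
  (exists M : R, mu (~` `[- M, M]) = 0%E) /\
  forall n : nat, ip (iter n T f) f = (\int[mu]_x (x ^+ n))%:C.

Definition ac_subspace (T : (X -> C) -> X -> C) : set (X -> C) :=
  [set f | l2 f /\ exists2 mu : {finite_measure set (measurableTypeR R) -> \bar R},
     spectral_measure T f mu & mu `<< (@lebesgue_measure R)].

Definition is_projection (D : set (X -> C)) (f p : X -> C) : Prop :=
  D p /\ forall d, D d -> ip (fun x => f x - p x) d = 0.

Variable I : finType.

Definition ae_eq0pi (u v : R -> I -> C) : Prop :=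
  {ae @lebesgue_measure R, forall t, `]0, (pi : R)[%classic t -> u t = v t}.

Definition outnorm2 (u : R -> I -> C) : \bar R :=
  (\int[@lebesgue_measure R]_(t in `]0%R, pi[)
     (\sum_c Normc.normc (u t c) ^+ 2 / (2 * pi))%:E)%E.

Definition L2out (u : R -> I -> C) : Prop :=
  (forall c, measurable_fun `]0, (pi : R)[ (fun t => complex.Re (u t c)) /\
             measurable_fun `]0, (pi : R)[ (fun t => complex.Im (u t c))) /\
  (outnorm2 u < +oo)%E.

Definition unitary_onto_L2 (D : set (X -> C)) (U : (X -> C) -> R -> I -> C) : Prop :=
  [/\ forall f, D f -> L2out (U f),
      forall (a : C) f g, D f -> D g ->
        ae_eq0pi (U (fun x => a * f x + g x)) (fun t c => a * U f t c + U g t c),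
      forall f, D f -> outnorm2 (U f) = l2norm2 f
    & forall u, L2out u -> exists2 f, D f & ae_eq0pi (U f) u].

(* T0, given on finitely supported f, is read as the transform of the projection
   of f to D. *)
Definition unitary_extension (D : set (X -> C))
    (T0 U : (X -> C) -> R -> I -> C) : Prop :=
  unitary_onto_L2 D U /\
  forall f, finsupp f -> exists2 p, is_projection D f p & ae_eq0pi (U p) (T0 f).

End L2.

Section Jacobi.
Variables (R : realType) (q d r : nat).
Notation C := R[i].
Variables (H : 'M[C]_d) (V : 'M[C]_(d, r)).

(* inl i is the i-th core vertex; inr (c, n) is the vertex (c, n + 1) of the
   cusp ray c. *)
Definition jidx : Type := ('I_d + 'I_r * nat)%type.
HB.instance Definition _ := Choice.on jidx.

Definition sqrtq : C := (Num.sqrt q%:R)%:C.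

Definition adjmx (m n : nat) (A : 'M[C]_(m, n)) : 'M[C]_(n, m) :=
  \matrix_(i, j) (A j i)^*.

Definition jacobi (f : jidx -> C) (x : jidx) : C :=
  match x with
  | inl i => \sum_i' H i i' * f (inl i') + \sum_c V i c * f (inr (c, 0%N))
  | inr (c, 0%N) =>
      sqrtq * f (inr (c, 1%N)) + \sum_i adjmx V c i * f (inl i)
  | inr (c, n.+1) => sqrtq * (f (inr (c, n)) + f (inr (c, n.+2)))
  end.

Definition Fmx (z : C) : 'M[C]_d :=
  H - (sqrtq * (z + z^-1))%:M + (z^-1 / sqrtq) *: (V *m adjmx V).

Definition Smx (z : C) : 'M[C]_r :=
  - 1%:M + ((z^-1 - z) / sqrtq) *: (adjmx V *m invmx (Fmx z) *m V).

Definition Psi (t : R) (al : 'cV[C]_r) (x : jidx) : C :=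
  let z : C := cos t +i* sin t in
  match x with
  | inl i => ((z^-1 - z) *: (invmx (Fmx z) *m V *m al)) i ord0
  | inr (c, n) => z ^+ n.+1 * al c ord0 + z ^- n.+1 * (Smx z *m al) c ord0
  end.

Definition jacobi_transform (f : jidx -> C) (t : R) (c : 'I_r) : C :=
  ip (fun=> 1) f (Psi t (delta_mx c ord0)).

End Jacobi.

Section Family.
Variables (R : realType) (k : fieldType) (oo : place k).
Variable Kc : forall v : place k, completion v.
Variables (varpi : koo oo Kc) (Kf : set (Gprod oo Kc)) (q : nat).
Variables (h : nat) (g : 'I_h -> Gprod oo Kc).
Notation C := R[i].

Definition Yall : Type := {j : 'I_h & Y Kf (g j)}.
HB.instance Definition _ := Choice.on Yall.
Definition lam_all (y : Yall) : R := lam R (projT2 y).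
Definition component (f : Yall -> C) (j : 'I_h) (y : Y Kf (g j)) : C :=
  f (existT (fun j => Y Kf (g j)) j y).

Definition L2Eis (j : 'I_h) : set (Y Kf (g j) -> C) :=
  ac_subspace (lam R (g := g j)) (Adj varpi).

Definition L2Eis_ad : set (Yall -> C) := [set f | forall j, L2Eis (component f (j := j))].

Definition res (F : Goo oo Kc -> Gprod oo Kc -> C) (y : Yall) : C :=
  F (lift (orep (projT2 y))) (g (projT1 y)).

Variables (xi : 'cV[k]_2) (hP : tree oo Kc -> int).
Let P := parabolic xi.

Definition phi (x : Gprod oo Kc) (kap : int) (s : C) (go : Goo oo Kc) (gf : Gprod oo Kc) : C :=
  let S := [set p : PGL2 k | P p /\ exists2 w, Kf w & gf = (diagf oo Kc p * x * w)%g] in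
  if `[< S !=set0 >] then
    qpow q (s * (hP (vtx ((emb oo Kc (xget 1%g S))^-1 * go)%g) + kap)%:~R)
  else 0.

Definition PG := orbits (fun p a : PGL2 k => p * a)%g P.
HB.instance Definition _ := Choice.on PG.

Definition Eis_sum (x : Gprod oo Kc) (kap : int) (s : C)
    (go : Goo oo Kc) (gf : Gprod oo Kc) : C :=
  csum (fun O : PG => phi x kap s (emb oo Kc (orep O) * go)%g (diagf oo Kc (orep O) * gf)%g).

Definition Eis (x : Gprod oo Kc) (kap : int) (s : C)
    (go : Goo oo Kc) (gf : Gprod oo Kc) : C :=
  mero_continuation (fun s' => Eis_sum x kap s' go gf) s.

(* The index set of the columns, of cardinality \sum_j r j. *)
Variable r : 'I_h -> nat.
Definition cusps : finType := {j : 'I_h & 'I_(r j)}.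
Variables (gam : forall j, 'I_(r j) -> PGL2 k) (kap : forall j, 'I_(r j) -> int).
Variable (wid : forall j, 'I_(r j) -> R).

Definition s_theta (t : R) : C := 2^-1 +i* (t / ln q%:R).

Definition Eis_transform (f : Yall -> C) (t : R) (c : cusps) : C :=
  let: existT j i := c in
  ((Num.sqrt q.+1%:R)^-1 * (Num.sqrt (wid i))^-1)%:C *
  ip lam_all f (res (Eis ((diagf oo Kc (gam i))^-1 * g j)%g (kap i) (s_theta t))).

(* U_j, followed by the labelling of V(Y_j) by core and cusp vertices. *)
Definition conjU (j : 'I_h) (d n : nat) (core : 'I_d -> Y Kf (g j))
    (cusp : 'I_n -> nat -> Y Kf (g j)) (f : Y Kf (g j) -> C) (x : jidx d n) : C :=
  let y := match x with inl i => core i | inr (c, m) => cusp c m.+1 end in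
  (Num.sqrt (lam R y))%:C * f y.

End Family.

Arguments lam_all R {k oo Kc} Kf {h} g y.
Arguments L2Eis R {k oo Kc} varpi Kf {h} g j.
Arguments L2Eis_ad R {k oo Kc} varpi Kf {h} g.
Arguments res {R k oo Kc} Kf {h} g F y.
Arguments component {R k oo Kc Kf h g} f j y.
Arguments Eis_transform {R k oo Kc Kf} q {h g} xi hP {r} gam kap wid f t c.

(* Main.v *)
(** Reduction theory identifies each quotient [Y_j], conjugated by [U_j], with a finite core glued to half-lines on which the adjacency operator is the Jacobi operator [J_j].
For [Re s > 1] the Eisenstein series converges, is an eigenfunction of the adjacency operator, and on the cusps is an explicit incoming wave plus a decaying term.  By uniqueness of such eigenfunctions [U_j] maps it to [sqrt (w (q + 1))] times the scattering solution [Psi] at [zeta = q^(s - 1/2)]; as [Psi] is rational in [zeta], this gives the continuation to the critical line.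
Unitarity of the Jacobi transform follows from a contour form of the resolvent identity: for a polynomial [Q] clearing the poles of [Psi] on the unit circle, the matrix entries of [Q(J_j)] are integrals of [Q] against [Psi Psi^*].  The ranges of such cut-offs fill the absolutely continuous subspace, and the adelic transform is the direct sum over [j]. *)

From HB Require Import structures.
From mathcomp Require Import all_boot all_order all_algebra.
From mathcomp Require Import all_classical all_reals all_analysis.
From mathcomp Require Import finmap complex ring lra zify measurable_realfun perm.
Require Import Defs.
Set Implicit Arguments.
Unset Strict Implicit.
Unset Printing Implicit Defensive.
Import Order.TTheory GRing.Theory Num.Theory.
Import numFieldNormedType.Exports.
Local Open Scope classical_set_scope.
Local Open Scope ring_scope.
Local Open Scope complex_scope.

(** The matrix-entry identity is obtained without moving a contour. Call defect the difference
    between an entry of [Q(J)] and the integral of [Q] against the kernel built from [Psi]. Deep in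
    the cusps the defect is zero: a short walk between two far cusp vertices does not feel the core,
    and the scattering terms carry only non-zero frequencies. The defect obeys the same recurrence
    in both of its arguments, which transports this zero down the cusps until only core indices are
    left; a characteristic polynomial removes those. Since the identity holds only after
    multiplication by [Q], norms and ranges are recovered from the polynomials [1 - (1 - Q/B)^n],
    which are divisible by [Q] and tend to 1 off finitely many points. Spectral measures enter only
    through their moments. On the arithmetic side the Eisenstein series is read as a sum over
    disjoint horoballs of the tree; counting walks gives convergence and the growth in each cusp.
    The value of a meromorphic function at a pole is fixed to be 0, as for division by zero, so a
    quotient of coprime polynomials in [zeta] is its own continuation. *)

Notation re := complex.Re.
Notation im := complex.Im.

(** * Summable real families over an arbitrary index type *)

Section RealSums.
Variable R : realType.
Implicit Types I J : choiceType.

Definition nsum I (f : I -> R) : \bar R := \esum_(i in setT) (f i)%:E.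
Definition rsummable I (f : I -> R) : Prop := (nsum (fun i => `|f i|%R) < +oo)%E.

Lemma nsum_ge0 I (f : I -> R) : (forall i, 0 <= f i) -> (0 <= nsum f)%E.
Proof. by move=> f0; apply: esum_ge0 => i _; rewrite lee_fin. Qed.
Lemma le_nsum I (f g : I -> R) : (forall i, f i <= g i) -> (nsum f <= nsum g)%E.
Proof. by move=> fg; apply: le_esum => i _; rewrite lee_fin. Qed.

Lemma nsumD I (f g : I -> R) : (forall i, 0 <= f i) -> (forall i, 0 <= g i) ->
  nsum (fun i => f i + g i) = (nsum f + nsum g)%E.
Proof.
move=> f0 g0; rewrite /nsum -esumD; last 2 first.
- by move=> i _; rewrite lee_fin.
- by move=> i _; rewrite lee_fin.
by apply: eq_esum => i _; rewrite EFinD.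
Qed.

Lemma nsum_norm I (f : I -> R) : (forall i, 0 <= f i) ->
  nsum (fun i => `|f i|) = nsum f.
Proof. by move=> f0; apply: eq_esum => i _; rewrite ger0_norm. Qed.

Lemma rsummable_le I (f g : I -> R) : rsummable g -> (forall i, `|f i| <= g i) ->
  rsummable f.
Proof.
move=> sg fg; apply: le_lt_trans sg; apply: le_nsum => i.
exact: le_trans (fg i) (ler_norm _).
Qed.

Lemma rsummableD I (f g : I -> R) : rsummable f -> rsummable g ->
  rsummable (fun i => f i + g i).
Proof.
move=> sf sg; apply: (@le_lt_trans _ _ (nsum (fun i => `|f i|%R + `|g i|%R)%R)).
  by apply: le_nsum => i; exact: ler_normD.
by rewrite nsumD// lte_add_pinfty.
Qed.

Lemma rsummableN I (f : I -> R) : rsummable f -> rsummable (fun i => - f i).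
Proof. by move=> sf; apply: le_lt_trans sf; apply: le_nsum => i; rewrite normrN. Qed.

Lemma nsumZ_le I (c : R) (f : I -> R) : 0 <= c -> (forall i, 0 <= f i) ->
  (nsum (fun i => c * f i)%R <= c%:E * nsum f)%E.
Proof.
move=> c0 f0; apply: ge_ereal_sup => _ [X [finX _] <-].
rewrite (_ : \sum_(x \in X) (c * f x)%:E = c%:E * \sum_(x \in X) (f x)%:E)%E; last first.
  rewrite !fsbig_finite//= !sumEFin -EFinM; congr (_%:E).
  by rewrite mulr_sumr.
apply: lee_wpmul2l; first by rewrite lee_fin.
by apply: esum_ge; exists X.
Qed.

Lemma nsumZ I (c : R) (f : I -> R) : 0 <= c -> (forall i, 0 <= f i) ->
  nsum (fun i => c * f i) = (c%:E * nsum f)%E.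
Proof.
move=> c0 f0; apply/eqP; rewrite eq_le nsumZ_le//=.
have [->|cn0] := eqVneq c 0; first by rewrite mul0e nsum_ge0// => i; rewrite mul0r.
have cp : 0 < c by rewrite lt_neqAle eq_sym cn0.
rewrite -lee_pdivlMl//.
apply: le_trans (nsumZ_le (c := c^-1) (f := fun i => c * f i) _ _); last 2 first.
- by rewrite invr_ge0.
- by move=> i; rewrite mulr_ge0.
by apply: le_nsum => i; rewrite mulKf.
Qed.

Lemma rsummableZ I (c : R) (f : I -> R) : rsummable f -> rsummable (fun i => c * f i).
Proof.
move=> sf; rewrite /rsummable.
rewrite (_ : (fun i => _) = (fun i => `|c| * `|f i|)); last first.
  by apply/funext => i; rewrite normrM.
by rewrite nsumZ// lte_mul_pinfty.
Qed.

Lemma nsum_fin I (f : I -> R) : (forall i, 0 <= f i) -> rsummable f ->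
  nsum f \is a fin_num.
Proof.
move=> f0 sf; rewrite ge0_fin_numE; last exact: nsum_ge0.
by rewrite -nsum_norm.
Qed.

(** The definition of [rsum] cuts [f] by sign, but every splitting into summable non-negative parts
    gives the same value: [p + b = n + a] holds pointwise and non-negative sums are additive.
    Linearity of [rsum] rests on this freedom. *)
Lemma rsumEsplit I (f a b : I -> R) : (forall i, 0 <= a i) -> (forall i, 0 <= b i) ->
  rsummable a -> rsummable b -> (forall i, f i = a i - b i) ->
  rsum f = fine (nsum a) - fine (nsum b).
Proof.
move=> a0 b0 sa sb fab; rewrite /rsum -/(nsum _) -/(nsum _).
set p := fun i => Num.max (f i) 0; set n := fun i => Num.max (- f i) 0.
have p0 i : 0 <= p i by rewrite /p le_max lexx orbT.
have n0 i : 0 <= n i by rewrite /n le_max lexx orbT.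
have sp : rsummable p.
  apply: (rsummable_le sa) => i; rewrite ger0_norm// /p ge_max a0 andbT fab.
  by rewrite gerBl.
have sn : rsummable n.
  apply: (rsummable_le sb) => i; rewrite ger0_norm// /n ge_max b0 andbT fab opprB.
  by rewrite gerBl.
have e : (nsum p + nsum b = nsum n + nsum a)%E.
  rewrite -!nsumD//; apply: eq_esum => i _; congr (_%:E).
  by have := fab i; rewrite /p /n; case: (leP (f i) 0); case: (leP (- f i) 0); lra.
move/(congr1 fine): e; rewrite !fineD ?nsum_fin//; lra.
Qed.

Lemma rsum_nsum I (f : I -> R) : (forall i, 0 <= f i) -> rsummable f ->
  (rsum f)%:E = nsum f.
Proof.
move=> f0 sf.
have z0 : nsum (fun _ : I => 0 : R) = 0%E by apply: esum1.
have s0 : rsummable (fun _ : I => 0 : R).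
  by rewrite /rsummable nsum_norm// z0.
rewrite (@rsumEsplit _ f f (fun=> 0))//; last by move=> i; rewrite subr0.
by rewrite z0 /= subr0 fineK// nsum_fin.
Qed.

Definition ppart I (f : I -> R) i := Num.max (f i) 0.
Definition npart I (f : I -> R) i := Num.max (- f i) 0.

Lemma ppart_ge0 I (f : I -> R) i : 0 <= ppart f i.
Proof. by rewrite /ppart le_max lexx orbT. Qed.
Lemma npart_ge0 I (f : I -> R) i : 0 <= npart f i.
Proof. by rewrite /npart le_max lexx orbT. Qed.
Lemma ppart_npart I (f : I -> R) i : f i = ppart f i - npart f i.
Proof. by rewrite /ppart /npart; case: (leP (f i) 0); case: (leP (- f i) 0); lra. Qed.
Lemma rsummable_ppart I (f : I -> R) : rsummable f -> rsummable (ppart f).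
Proof.
move=> sf; apply: le_lt_trans sf; apply: le_nsum => i.
rewrite ger0_norm ?ppart_ge0// /ppart ge_max normr_ge0 andbT; exact: ler_norm.
Qed.
Lemma rsummable_npart I (f : I -> R) : rsummable f -> rsummable (npart f).
Proof.
move=> sf; apply: le_lt_trans sf; apply: le_nsum => i.
by rewrite ger0_norm ?npart_ge0// /npart ge_max normr_ge0 andbT -normrN ler_norm.
Qed.

Lemma rsum_parts I (f : I -> R) : rsummable f ->
  rsum f = fine (nsum (ppart f)) - fine (nsum (npart f)).
Proof.
move=> sf; apply: rsumEsplit => [i|i|||i]; first exact: ppart_ge0.
- exact: npart_ge0.
- exact: rsummable_ppart.
- exact: rsummable_npart.
exact: ppart_npart.
Qed.

Lemma rsumD I (f g : I -> R) : rsummable f -> rsummable g ->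
  rsum (fun i => f i + g i) = rsum f + rsum g.
Proof.
move=> sf sg.
rewrite (@rsumEsplit _ _ (fun i => ppart f i + ppart g i) (fun i => npart f i + npart g i)).
- rewrite !nsumD; try by move=> i; rewrite ?ppart_ge0 ?npart_ge0.
  rewrite !fineD; try (apply: nsum_fin; [by move=> i; rewrite ?ppart_ge0 ?npart_ge0|
     by [apply: rsummable_ppart|apply: rsummable_npart]]).
  rewrite (rsum_parts sf) (rsum_parts sg); lra.
- by move=> i; rewrite addr_ge0// ppart_ge0.
- by move=> i; rewrite addr_ge0// npart_ge0.
- by apply: rsummableD; apply: rsummable_ppart.
- by apply: rsummableD; apply: rsummable_npart.
- by move=> i; rewrite (ppart_npart f) (ppart_npart g); lra.
Qed.

Lemma rsumN I (f : I -> R) : rsum (fun i => - f i) = - rsum f.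
Proof.
rewrite /rsum; under [in X in _ - X]eq_esum do rewrite opprK.
by rewrite opprB.
Qed.

Lemma rsumZ I (c : R) (f : I -> R) : rsummable f -> rsum (fun i => c * f i) = c * rsum f.
Proof.
have pos (d : R) : 0 <= d -> rsummable f -> rsum (fun i => d * f i) = d * rsum f.
  move=> d0 sf.
  rewrite (rsum_parts sf) (@rsumEsplit _ _ (fun i => d * ppart f i) (fun i => d * npart f i)).
  - rewrite !nsumZ//; last 2 first.
      by move=> i; exact: npart_ge0.
      by move=> i; exact: ppart_ge0.
    rewrite !fineM//; last 2 first.
      by apply: nsum_fin; [exact: npart_ge0|exact: rsummable_npart].
      by apply: nsum_fin; [exact: ppart_ge0|exact: rsummable_ppart].
    by rewrite /= mulrBr.
  - by move=> i; rewrite mulr_ge0// ppart_ge0.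
  - by move=> i; rewrite mulr_ge0// npart_ge0.
  - by apply: rsummableZ; apply: rsummable_ppart.
  - by apply: rsummableZ; apply: rsummable_npart.
  - by move=> i; rewrite -mulrBr -ppart_npart.
move=> sf; have [c0|c0] := leP 0 c; first exact: pos.
rewrite -[LHS]opprK -rsumN.
rewrite (_ : (fun i => _) = (fun i => (- c) * f i)); last by apply/funext => i; rewrite mulNr.
by rewrite pos ?oppr_ge0 ?(ltW c0)// mulNr opprK.
Qed.

Lemma rsumB I (f g : I -> R) : rsummable f -> rsummable g ->
  rsum (fun i => f i - g i) = rsum f - rsum g.
Proof. by move=> sf sg; rewrite rsumD// ?rsumN//; exact: rsummableN. Qed.

Lemma rsum_ge0 I (f : I -> R) : (forall i, 0 <= f i) -> 0 <= rsum f.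
Proof.
move=> f0; rewrite /rsum [X in _ - X](_ : _ = 0) ?subr0.
  by rewrite fine_ge0// esum_ge0// => i _; rewrite lee_fin le_max lexx orbT.
rewrite esum1// => i _; congr (_%:E); apply/max_idPr; rewrite oppr_le0; exact: f0.
Qed.

Lemma rsummable0 I : rsummable (fun _ : I => 0 : R).
Proof. by rewrite /rsummable nsum_norm//= /nsum esum1. Qed.

Lemma rsum0 I : rsum (fun _ : I => 0 : R) = 0.
Proof.
have := rsumZ 0 (rsummable0 I); under eq_fun do rewrite mul0r.
by rewrite mul0r.
Qed.

Lemma ler_rsum I (f g : I -> R) : rsummable f -> rsummable g ->
  (forall i, f i <= g i) -> rsum f <= rsum g.
Proof.
move=> sf sg fg; rewrite -subr_ge0 -rsumB//; apply: rsum_ge0 => i.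
by rewrite subr_ge0.
Qed.

Lemma rsummable_norm I (f : I -> R) : rsummable f -> rsummable (fun i => `|f i|).
Proof. by move=> sf; rewrite /rsummable nsum_norm. Qed.

Lemma ler_norm_rsum I (f : I -> R) : rsummable f -> `|rsum f| <= rsum (fun i => `|f i|).
Proof.
move=> sf; have sn := rsummable_norm sf.
rewrite ler_norml -rsumN; apply/andP; split; apply: ler_rsum => //.
- exact: rsummableN.
- by move=> i; rewrite lerNl -normrN ler_norm.
- by move=> i; rewrite ler_norm.
Qed.

Lemma nsum_reindex I J (e : I -> J) (f : J -> R) : set_bij setT setT e ->
  nsum (fun i => f (e i)) = nsum f.
Proof. by move=> be; rewrite /nsum [RHS](reindex_esum _ _ _ _ be). Qed.

Lemma rsum_reindex I J (e : I -> J) (f : J -> R) : set_bij setT setT e ->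
  rsum (fun i => f (e i)) = rsum f.
Proof.
by move=> be; rewrite /rsum [X in _ = fine X - _](reindex_esum _ _ _ _ be)
  [X in _ = _ - fine X](reindex_esum _ _ _ _ be).
Qed.

Lemma nsum_pair I J (f : I * J -> R) : (forall p, 0 <= f p) ->
  nsum f = (\esum_(i in setT) nsum (fun j => f (i, j)))%E.
Proof.
move=> f0; rewrite /nsum esum_esum; last by move=> *; rewrite lee_fin.
rewrite (_ : setT `*`` _ = setT); last by apply/seteqP; split.
by apply: eq_esum => -[].
Qed.

Lemma rsummable_pair1 I J (f : I * J -> R) : rsummable f ->
  forall i, rsummable (fun j => f (i, j)).
Proof.
move=> sf i; apply: le_lt_trans sf; rewrite [leRHS]nsum_pair//.
rewrite -(@esum_set1 _ _ i (fun i => nsum (fun j => `|f (i, j)|))) ?nsum_ge0//.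
rewrite [leLHS]esum_mkcond; apply: le_esum => i' _.
by case: ifP => // _; rewrite nsum_ge0.
Qed.

Lemma rsum_pair_nneg I J (f : I * J -> R) : (forall p, 0 <= f p) -> rsummable f ->
  rsummable (fun i => rsum (fun j => f (i, j))) /\
  rsum f = rsum (fun i => rsum (fun j => f (i, j))).
Proof.
move=> f0 sf.
have e : nsum f = nsum (fun i => rsum (fun j => f (i, j))).
  rewrite nsum_pair//; apply: eq_esum => i _; rewrite rsum_nsum//.
  exact: rsummable_pair1.
have s : rsummable (fun i => rsum (fun j => f (i, j))).
  rewrite /rsummable nsum_norm; last by move=> i; apply: rsum_ge0.
  by rewrite -e -nsum_norm.
split=> //; apply/EFin_inj; rewrite !rsum_nsum// => i; exact: rsum_ge0.
Qed.

Lemma rsum_pair I J (f : I * J -> R) : rsummable f ->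
  rsummable (fun i => rsum (fun j => f (i, j))) /\
  rsum f = rsum (fun i => rsum (fun j => f (i, j))).
Proof.
move=> sf; have sp := rsummable_ppart sf; have sn := rsummable_npart sf.
have [s1 e1] := rsum_pair_nneg (@ppart_ge0 _ f) sp.
have [s2 e2] := rsum_pair_nneg (@npart_ge0 _ f) sn.
have eq i : rsum (fun j => f (i, j)) =
    rsum (fun j => ppart f (i, j)) - rsum (fun j => npart f (i, j)).
  rewrite -rsumB; try exact: rsummable_pair1.
  by congr rsum; apply/funext => j; rewrite -ppart_npart.
under [X in rsummable X]eq_fun do rewrite eq.
under [X in _ = rsum X]eq_fun do rewrite eq.
split; first by apply: rsummableD => //; exact: rsummableN.
rewrite rsumB// -e1 -e2 -rsumB//; congr rsum.
by apply/funext => p; rewrite -ppart_npart.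
Qed.

Lemma rsummable_fin I (f : I -> R) (s : seq I) : (forall i, i \notin s -> f i = 0) ->
  rsummable f.
Proof.
move=> fs; rewrite /rsummable /nsum.
rewrite (_ : \esum_(i in setT) _ = \esum_(i in [set` s]) (`|f i|)%:E)%E.
  rewrite esum_fset; [|exact: finite_seq|by move=> i _; rewrite lee_fin].
  by rewrite fsbig_finite//= sumEFin ltry.
rewrite [RHS]esum_mkcond; apply: eq_esum => i _.
case: ifPn => //; rewrite notin_setE /= => /negP /fs ->; by rewrite normr0.
Qed.

Lemma rsum_fin I (f : I -> R) (s : seq I) : uniq s -> (forall i, i \notin s -> f i = 0) ->
  rsum f = \sum_(i <- s) f i.
Proof.
elim: s f => [|a s IH] f /=.
  move=> _ f0; rewrite big_nil -(rsum0 I); congr rsum; apply/funext => i; exact: f0.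
move=> /andP[nas us] fs.
pose g i := if i == a then 0 else f i; pose d i := if i == a then f a else 0.
have gs i : i \notin s -> g i = 0.
  by move=> nis; rewrite /g; case: eqP => // /eqP ia; rewrite fs// inE negb_or ia.
have ds i : i \notin [:: a] -> d i = 0 by rewrite inE /d => /negbTE ->.
rewrite (_ : f = fun i => d i + g i); last first.
  by apply/funext => i; rewrite /d /g; case: eqP => [->|]; rewrite ?addr0 ?add0r.
rewrite rsumD; [|exact: (rsummable_fin ds)|exact: (rsummable_fin gs)].
have ga : g a = 0 by rewrite /g eqxx.
rewrite (IH g us gs) big_cons ga addr0; congr (_ + _); last first.
  rewrite !big_seq; apply: eq_bigr => i iis.
  have ia : (i == a) = false by apply/negbTE; apply: contraNneq nas => <-.
  by rewrite /d /g ia add0r.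
rewrite /rsum.
have da : d a = f a by rewrite /d eqxx.
(* Here [h] stands for the positive or the negative part, so both halves of [rsum] of the one-point
   family are computed at once. *)
have H (h : R -> R) : h 0 = 0 -> (0 <= h (f a)) ->
    (\esum_(i in setT) (h (d i))%:E = (h (f a))%:E)%E.
  move=> h0 hp; rewrite -[X in h X]da.
  rewrite -(@esum_set1 _ _ a (fun i => (h (d i))%:E)); last by rewrite da lee_fin.
  rewrite [RHS]esum_mkcond; apply: eq_esum => i _; case: ifPn => //.
  by rewrite notin_setE /= => /eqP /negbTE ia; rewrite /d ia h0.
rewrite (H (fun x => Num.max x 0)) ?maxxx ?le_max ?lexx ?orbT//.
rewrite (H (fun x => Num.max (- x) 0)) ?oppr0 ?maxxx ?le_max ?lexx ?orbT//=.
by rewrite da; case: (leP (f a) 0); case: (leP (- f a) 0); lra.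
Qed.

Lemma rsum_sum I (T : finType) (f : T -> I -> R) : (forall t, rsummable (f t)) ->
  rsummable (fun i => \sum_t f t i) /\ rsum (fun i => \sum_t f t i) = \sum_t rsum (f t).
Proof.
move=> sf; elim: (index_enum T) => [|t s [IH1 IH2]].
  under [X in rsummable X]eq_fun do rewrite big_nil.
  under [X in rsum X]eq_fun do rewrite big_nil.
  by rewrite big_nil rsum0; split=> //; exact: rsummable0.
under [X in rsummable X]eq_fun do rewrite big_cons.
under [X in rsum X]eq_fun do rewrite big_cons.
by rewrite big_cons rsumD// IH2; split=> //; exact: rsummableD.
Qed.

(** A finite partial sum within [e] of the supremum leaves a tail of mass less than [e]; the density
    of finitely supported functions comes from here. *)
Lemma rsum_approx I (f : I -> R) (e : R) : rsummable f -> 0 < e ->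
  exists2 s : seq I, uniq s &
    rsum (fun i => if i \in s then 0 else `|f i|) < e.
Proof.
move=> sf e0; have sn := rsummable_norm sf.
have : ((rsum (fun i => `|f i|)%R - e)%:E < nsum (fun i => `|f i|)%R)%E.
  by rewrite -rsum_nsum// lte_fin ltrBlDr ltrDl.
move=> /ereal_sup_gt[_ [X [finX _] <-]].
rewrite fsbig_finite//= sumEFin lte_fin => H.
set s := fset_set X in H *; exists (enum_fset s); first exact: fset_uniq.
have s1 : rsummable (fun i => if i \in s then `|f i| else 0).
  by apply: (@rsummable_fin _ _ (enum_fset s)) => i /negbTE ->.
rewrite (_ : (fun i => _) = (fun i => `|f i| - if i \in s then `|f i| else 0)); last first.
  apply/funext => i; rewrite -[i \in enum_fset s]/(i \in s).
  by case: (i \in s); rewrite ?subrr ?subr0.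
rewrite rsumB// (@rsum_fin _ (fun i => if i \in s then `|f i| else 0) (enum_fset s)).
- rewrite big_seq (eq_bigr (fun i => `|f i|)); last by move=> i ->.
  by rewrite -big_seq; move: H; set A := \sum_(_ <- _) _; lra.
- exact: fset_uniq.
- by move=> i /negbTE ->.
Qed.

Lemma rsum_cvg_series (f : nat -> R) : rsummable f ->
  (fun n => \sum_(0 <= i < n) f i) @ \oo --> rsum f.
Proof.
have pos (g : nat -> R) : (forall i, 0 <= g i) -> rsummable g ->
    (fun n => \sum_(0 <= i < n) g i) @ \oo --> rsum g.
  move=> g0 sg; suff /fine_cvgP[] : (EFin \o (fun n => \sum_(0 <= i < n) g i)) @ \oo --> (rsum g)%:E by [].
  rewrite rsum_nsum// /nsum -nneseries_esumT; last by move=> n; rewrite lee_fin.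
  rewrite (_ : EFin \o _ = fun n => (\sum_(0 <= i < n) (g i)%:E)%E); last first.
    by apply/funext => n /=; rewrite sumEFin.
  by apply: is_cvg_nneseries => n _ _; rewrite lee_fin.
move=> sf; have sp := rsummable_ppart sf; have sn := rsummable_npart sf.
rewrite (_ : rsum f = rsum (ppart f) - rsum (npart f)); last first.
  by rewrite -rsumB//; congr rsum; apply/funext => i; exact: ppart_npart.
rewrite (_ : (fun n => _) = (fun n => \sum_(0 <= i < n) ppart f i -
                               \sum_(0 <= i < n) npart f i)); last first.
  by apply/funext => n; rewrite -sumrB; apply: eq_bigr => i _; exact: ppart_npart.
apply: cvgB; apply: pos => //; [exact: ppart_ge0|exact: npart_ge0].
Qed.

End RealSums.

(** * Real and imaginary parts, squared modulus *)

Section ComplexBasics.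
Variable R : realType.
Notation C := R[i].
Implicit Types z w : C.

Lemma reM z w : re (z * w) = re z * re w - im z * im w.
Proof. by case: z w => [a b] [c d]. Qed.
Lemma imM z w : im (z * w) = re z * im w + im z * re w.
Proof. by case: z w => [a b] [c d]. Qed.
Lemma reD z w : re (z + w) = re z + re w.
Proof. by case: z w => [a b] [c d]. Qed.
Lemma imD z w : im (z + w) = im z + im w.
Proof. by case: z w => [a b] [c d]. Qed.
Lemma reN z : re (- z) = - re z. Proof. by case: z. Qed.
Lemma imN z : im (- z) = - im z. Proof. by case: z. Qed.
Lemma re_conj z : re (z^*) = re z. Proof. by case: z. Qed.
Lemma im_conj z : im (z^*) = - im z. Proof. by case: z. Qed.
Lemma re_RC (a : R) : re (a%:C) = a. Proof. by []. Qed.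
Lemma im_RC (a : R) : im (a%:C) = 0. Proof. by []. Qed.
Lemma re0 : re (0 : C) = 0. Proof. by []. Qed.
Lemma im0 : im (0 : C) = 0. Proof. by []. Qed.
Lemma re1 : re (1 : C) = 1. Proof. by []. Qed.
Lemma im1 : im (1 : C) = 0. Proof. by []. Qed.

Lemma re_i : re ('i : C) = 0. Proof. by []. Qed.
Lemma im_i : im ('i : C) = 1. Proof. by []. Qed.

Definition reimE := (re_i, im_i, reM, imM, reD, imD, reN, imN, re_conj, im_conj, re_RC, im_RC,
  re0, im0, re1, im1).

Lemma complexP z w : re z = re w -> im z = im w -> z = w.
Proof. by case: z w => [a b] [c d] /= -> ->. Qed.

Lemma re_sum (T : Type) (s : seq T) (P : pred T) (f : T -> C) :
  re (\sum_(i <- s | P i) f i) = \sum_(i <- s | P i) re (f i).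
Proof. by elim/big_rec2: _ => // i a b _ <-; rewrite reD. Qed.
Lemma im_sum (T : Type) (s : seq T) (P : pred T) (f : T -> C) :
  im (\sum_(i <- s | P i) f i) = \sum_(i <- s | P i) im (f i).
Proof. by elim/big_rec2: _ => // i a b _ <-; rewrite imD. Qed.

Definition nsq z : R := re z ^+ 2 + im z ^+ 2.
(** The real part of [z * w^*]. With this real form every sum and integral stays real; the Hermitian
    pairing is recovered from the values at [w] and at ['i * w]. *)
Definition rdot z w : R := re z * re w + im z * im w.

Lemma normc_sq z : Normc.normc z ^+ 2 = nsq z.
Proof. by case: z => a b; rewrite /Normc.normc sqr_sqrtr// addr_ge0 ?sqr_ge0. Qed.
Lemma nsq_ge0 z : 0 <= nsq z.
Proof. by rewrite addr_ge0 ?sqr_ge0. Qed.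
Lemma nsqM z w : nsq (z * w) = nsq z * nsq w.
Proof. by rewrite /nsq !reimE; ring. Qed.
Lemma nsq_conj z : nsq (z^*) = nsq z.
Proof. by rewrite /nsq !reimE sqrrN. Qed.
Lemma nsq_RC (a : R) : nsq a%:C = a ^+ 2.
Proof. by rewrite /nsq !reimE expr0n addr0. Qed.
Lemma nsq_eq0 z : nsq z = 0 -> z = 0.
Proof.
move=> /eqP; rewrite paddr_eq0 ?sqr_ge0// !sqrf_eq0 => /andP[/eqP a /eqP b].
exact: complexP.
Qed.
Lemma nsq0 : nsq 0 = 0. Proof. by rewrite /nsq expr0n addr0. Qed.
Lemma mulCJ z : z * z^* = (nsq z)%:C.
Proof. by apply: complexP; rewrite /nsq !reimE; ring. Qed.
Lemma rdotC z w : rdot z w = rdot w z.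
Proof. by rewrite /rdot; ring. Qed.
Lemma rdotzz z : rdot z z = nsq z.
Proof. by rewrite /rdot /nsq !expr2. Qed.
Lemma rdotE z w : rdot z w = re (z * w^*).
Proof. by rewrite /rdot !reimE; ring. Qed.
Lemma rdotMl a z w : rdot (a * z) w = rdot z (a^* * w).
Proof. by rewrite /rdot !reimE; ring. Qed.
Lemma rdot_bound z w : `|rdot z w| <= nsq z + nsq w.
Proof.
rewrite /rdot /nsq ler_norml; have := sqr_ge0 (re z + re w).
have := sqr_ge0 (re z - re w); have := sqr_ge0 (im z - im w).
have := sqr_ge0 (im z + im w).
have := sqr_ge0 (re z); have := sqr_ge0 (im z); have := sqr_ge0 (re w).
have := sqr_ge0 (im w); move=> *; apply/andP; split; nra.
Qed.
Lemma nsq_lc a z w : nsq (a * z + w) <= 2 * nsq a * nsq z + 2 * nsq w.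
Proof.
have h : nsq (a * z + w) <= 2 * nsq (a * z) + 2 * nsq w.
  rewrite /nsq !reD !imD; have := sqr_ge0 (re (a * z) - re w).
  by have := sqr_ge0 (im (a * z) - im w); nra.
by apply: le_trans h _; rewrite nsqM mulrA.
Qed.

End ComplexBasics.

(** * An abstract integral and its Hilbert space inequalities *)

Section PositiveFunctional.
Variables (R : realType) (W : Type).

(** Common interface of the weighted sums over vertices and of the integral over [(0, pi)] with
    finitely many channels, so that Cauchy-Schwarz and the norm inequalities are proved once.
    Pointwise bounds are demanded only on [pdom], and [pI_ge0] asks for no integrability because
    both instances give a non-negative value to every non-negative function. *)
Record pfun := PFun {
  pdom : W -> Prop;
  pmeas : (W -> R) -> Prop;
  pintg : (W -> R) -> Prop;
  pI : (W -> R) -> R;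
  pmeasD : forall f g, pmeas f -> pmeas g -> pmeas (fun x => f x + g x);
  pmeasM : forall f g, pmeas f -> pmeas g -> pmeas (fun x => f x * g x);
  pmeas_cst : forall c, pmeas (fun=> c);
  pintg_meas : forall f, pintg f -> pmeas f;
  pintg_le : forall f g, pmeas f -> pintg g ->
    (forall x, pdom x -> `|f x| <= g x) -> pintg f;
  pintg_lc : forall a f g, pintg f -> pintg g -> pintg (fun x => a * f x + g x);
  pI_lc : forall a f g, pintg f -> pintg g ->
    pI (fun x => a * f x + g x) = a * pI f + pI g;
  pI_ge0 : forall f, (forall x, pdom x -> 0 <= f x) -> 0 <= pI f;
  pI0 : pintg (fun=> 0) /\ pI (fun=> 0) = 0 }.

Variable L : pfun.
Notation C := R[i].
Implicit Types f g h : W -> C.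

Definition sq_int f : Prop :=
  [/\ pmeas L (fun x => re (f x)), pmeas L (fun x => im (f x))
    & pintg L (fun x => nsq (f x))].
Definition form f g : R := pI L (fun x => rdot (f x) (g x)).

Lemma pmeas_reM f g : pmeas L (fun x => re (f x)) -> pmeas L (fun x => im (f x)) ->
  pmeas L (fun x => re (g x)) -> pmeas L (fun x => im (g x)) ->
  pmeas L (fun x => re (f x * g x)).
Proof.
move=> f1 f2 g1 g2; rewrite (_ : (fun x => _) =
  (fun x => re (f x) * re (g x) + (-1) * (im (f x) * im (g x)))); last first.
  by apply/funext => x; rewrite reM mulN1r.
by apply: pmeasD; [exact: pmeasM|apply: pmeasM; [exact: pmeas_cst|exact: pmeasM]].
Qed.

Lemma pmeas_imM f g : pmeas L (fun x => re (f x)) -> pmeas L (fun x => im (f x)) ->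
  pmeas L (fun x => re (g x)) -> pmeas L (fun x => im (g x)) ->
  pmeas L (fun x => im (f x * g x)).
Proof.
move=> f1 f2 g1 g2; rewrite (_ : (fun x => _) =
  (fun x => re (f x) * im (g x) + im (f x) * re (g x))); last first.
  by apply/funext => x; rewrite imM.
by apply: pmeasD; exact: pmeasM.
Qed.

Lemma pintgD (f g : W -> R) : pintg L f -> pintg L g -> pintg L (fun x => f x + g x).
Proof.
move=> sf sg; have := pintg_lc 1 sf sg.
by congr pintg; apply/funext => x; rewrite mul1r.
Qed.

Lemma pintgZ a (f : W -> R) : pintg L f -> pintg L (fun x => a * f x).
Proof.
move=> sf; have := pintg_lc a sf (pI0 L).1.
by congr pintg; apply/funext => x; rewrite addr0.
Qed.

Lemma sq_int_lc a f g : sq_int f -> sq_int g -> sq_int (fun x => a * f x + g x).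
Proof.
move=> [f1 f2 f3] [g1 g2 g3].
have m1 : pmeas L (fun x => re (a * f x + g x)).
  rewrite (_ : (fun x => _) = (fun x => re (a * f x) + re (g x))); last first.
    by apply/funext => x; rewrite reD.
  by apply: pmeasD => //; apply: (pmeas_reM (f := fun=> a)) => //; exact: pmeas_cst.
have m2 : pmeas L (fun x => im (a * f x + g x)).
  rewrite (_ : (fun x => _) = (fun x => im (a * f x) + im (g x))); last first.
    by apply/funext => x; rewrite imD.
  by apply: pmeasD => //; apply: (pmeas_imM (f := fun=> a)) => //; exact: pmeas_cst.
split=> //.
apply: (@pintg_le L _ (fun x => 2 * nsq a * nsq (f x) + 2 * nsq (g x))).
- rewrite /nsq; under eq_fun do rewrite !expr2.
  by apply: pmeasD; exact: pmeasM.
- by apply: pintg_lc => //; exact: pintgZ.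
- by move=> x _; rewrite ger0_norm ?nsq_ge0//; exact: nsq_lc.
Qed.

Lemma sq_int0 : sq_int (fun=> 0).
Proof.
split; try exact: pmeas_cst.
by under eq_fun do rewrite nsq0; exact: (pI0 L).1.
Qed.

Lemma sq_intZ a f : sq_int f -> sq_int (fun x => a * f x).
Proof.
move=> sf; have := sq_int_lc a sf sq_int0.
by congr sq_int; apply/funext => x; rewrite addr0.
Qed.

Lemma sq_intD f g : sq_int f -> sq_int g -> sq_int (fun x => f x + g x).
Proof.
move=> sf sg; have := sq_int_lc 1 sf sg.
by congr sq_int; apply/funext => x; rewrite mul1r.
Qed.

Lemma sq_intB f g : sq_int f -> sq_int g -> sq_int (fun x => f x - g x).
Proof.
move=> sf sg; have := sq_int_lc (-1) sg sf.
by congr sq_int; apply/funext => x; rewrite mulN1r addrC.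
Qed.

Lemma sq_int_sum (T : eqType) (s : seq T) (F : T -> W -> C) :
  (forall t, t \in s -> sq_int (F t)) -> sq_int (fun x => \sum_(t <- s) F t x).
Proof.
elim: s => [_|t s IH sF].
  by under eq_fun do rewrite big_nil; exact: sq_int0.
under eq_fun do rewrite big_cons; apply: sq_intD.
  by apply: sF; rewrite inE eqxx.
by apply: IH => t' ts; apply: sF; rewrite inE ts orbT.
Qed.

Lemma rdot_intg f g : sq_int f -> sq_int g -> pintg L (fun x => rdot (f x) (g x)).
Proof.
move=> [f1 f2 f3] [g1 g2 g3].
apply: (@pintg_le L _ (fun x => nsq (f x) + nsq (g x))).
- by apply: pmeasD; exact: pmeasM.
- exact: pintgD.
- by move=> x _; exact: rdot_bound.
Qed.

Lemma formC f g : form f g = form g f.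
Proof. by congr pI; apply/funext => x; rewrite rdotC. Qed.

Lemma form_lc (a : R) f g h : sq_int f -> sq_int g -> sq_int h ->
  form (fun x => a%:C * f x + g x) h = a * form f h + form g h.
Proof.
move=> sf sg sh; rewrite /form -pI_lc; try exact: rdot_intg.
by congr pI; apply/funext => x; rewrite /rdot !reimE; ring.
Qed.

Lemma formMl a f g : form (fun x => a * f x) g = form f (fun x => a^* * g x).
Proof. by congr pI; apply/funext => x; rewrite rdotMl. Qed.

Lemma form0l g : form (fun=> 0) g = 0.
Proof.
rewrite /form (_ : (fun x => _) = (fun=> 0)) ?(pI0 L).2//.
by apply/funext => x; rewrite /rdot !reimE !mul0r addr0.
Qed.

Lemma formD f g h : sq_int f -> sq_int g -> sq_int h ->
  form (fun x => f x + g x) h = form f h + form g h.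
Proof.
move=> sf sg sh; rewrite -[form f h]mul1r -form_lc//; congr form.
by apply/funext => x; rewrite mul1r.
Qed.

Lemma formDr f g h : sq_int f -> sq_int g -> sq_int h ->
  form h (fun x => f x + g x) = form h f + form h g.
Proof. by move=> *; rewrite formC formD// !(formC h). Qed.

Lemma formZ (a : R) f h : sq_int f -> sq_int h ->
  form (fun x => a%:C * f x) h = a * form f h.
Proof.
move=> sf sh; have := form_lc a sf sq_int0 sh.
rewrite form0l addr0 => <-; congr form; by apply/funext => x; rewrite addr0.
Qed.

Lemma formZr (a : R) f h : sq_int f -> sq_int h ->
  form h (fun x => a%:C * f x) = a * form h f.
Proof. by move=> *; rewrite formC formZ// formC. Qed.

Lemma formB f g h : sq_int f -> sq_int g -> sq_int h ->
  form (fun x => f x - g x) h = form f h - form g h.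
Proof.
move=> sf sg sh; have := form_lc (-1) sg sf sh.
rewrite mulN1r addrC => <-; congr form; apply/funext => x.
by rewrite rmorphN rmorph1 mulN1r addrC.
Qed.

Lemma formBr f g h : sq_int f -> sq_int g -> sq_int h ->
  form h (fun x => f x - g x) = form h f - form h g.
Proof. by move=> *; rewrite formC formB// !(formC h). Qed.

Lemma form_sum (T : eqType) (s : seq T) (F : T -> W -> C) h :
  (forall t, t \in s -> sq_int (F t)) -> sq_int h ->
  form (fun x => \sum_(t <- s) F t x) h = \sum_(t <- s) form (F t) h.
Proof.
move=> sF sh; elim: s sF => [_|t s IH sF].
  by rewrite big_nil -(form0l h); congr form; apply/funext => x; rewrite big_nil.
rewrite big_cons -IH; last by move=> t' ts; apply: sF; rewrite inE ts orbT.
rewrite -formD//; first by congr form; apply/funext => x; rewrite big_cons.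
  by apply: sF; rewrite inE eqxx.
by apply: sq_int_sum => t' ts; apply: sF; rewrite inE ts orbT.
Qed.

Lemma form_ge0 f : 0 <= form f f.
Proof. by apply: pI_ge0 => x _; rewrite rdotzz nsq_ge0. Qed.

Lemma form_sub2 f g : sq_int f -> sq_int g ->
  form (fun x => f x - g x) (fun x => f x - g x) = form f f - 2 * form f g + form g g.
Proof.
move=> sf sg; rewrite formB ?formBr//; try exact: sq_intB.
by rewrite (formC g f); ring.
Qed.

Lemma form_add2 f g : sq_int f -> sq_int g ->
  form (fun x => f x + g x) (fun x => f x + g x) = form f f + 2 * form f g + form g g.
Proof.
move=> sf sg; rewrite formD ?formDr//; try exact: sq_intD.
by rewrite (formC g f); ring.
Qed.

(** Positivity of the quadratic polynomial in [t] given by the norm of [t f + g]; as the form is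
    real-valued, real [t] suffice. *)
Lemma form_CS f g : sq_int f -> sq_int g -> form f g ^+ 2 <= form f f * form g g.
Proof.
move=> sf sg; have H (t : R) : 0 <= t ^+ 2 * form f f + 2 * t * form f g + form g g.
  have := form_ge0 (fun x => t%:C * f x + g x).
  rewrite form_lc//; last exact: sq_int_lc.
  rewrite [form f _]formC [form g _]formC !form_lc// (formC g f).
  by congr (_ <= _); ring.
have [f0|f0] := eqVneq (form f f) 0.
  suff -> : form f g = 0 by rewrite expr0n f0 mul0r.
  apply/eqP; apply: contraT => fg0.
  (* When [form f f = 0] the polynomial is affine, and this [t] would give it the value [-1]. *)
  have := H (- (form g g + 1) / (2 * form f g)).
  rewrite f0 mulr0 add0r.
  rewrite (_ : 2 * _ * form f g = - (form g g + 1)); last by field.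
  by lra.
have fp : 0 < form f f by rewrite lt_neqAle eq_sym f0 form_ge0.
have := H (- form f g / form f f).
rewrite (_ : _ + _ + _ = form g g - form f g ^+ 2 / form f f); last by field.
by rewrite subr_ge0 ler_pdivrMr// mulrC.
Qed.

Definition nrm f : R := Num.sqrt (form f f).

Lemma nrm_ge0 f : 0 <= nrm f. Proof. exact: sqrtr_ge0. Qed.
Lemma nrm_sq f : nrm f ^+ 2 = form f f.
Proof. by rewrite sqr_sqrtr// form_ge0. Qed.

Lemma form_le f g : sq_int f -> sq_int g -> `|form f g| <= nrm f * nrm g.
Proof.
move=> sf sg; rewrite -(@ler_sqr R) ?nnegrE ?mulr_ge0 ?nrm_ge0 ?normr_ge0//.
by rewrite exprMn !nrm_sq -normrX ger0_norm ?sqr_ge0// form_CS.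
Qed.

Lemma nrmD f g : sq_int f -> sq_int g -> nrm (fun x => f x + g x) <= nrm f + nrm g.
Proof.
move=> sf sg; rewrite -(@ler_sqr R) ?nnegrE ?addr_ge0 ?nrm_ge0//.
rewrite nrm_sq form_add2// sqrrD !nrm_sq lerD2r lerD2l.
have := le_trans (ler_norm _) (form_le sf sg); lra.
Qed.

Lemma nrmN f : nrm (fun x => - f x) = nrm f.
Proof.
rewrite /nrm; congr Num.sqrt; congr pI; apply/funext => x.
by rewrite /rdot !reimE; ring.
Qed.

Lemma nrm_dist f g h : sq_int f -> sq_int g -> sq_int h ->
  nrm (fun x => f x - h x) <= nrm (fun x => f x - g x) + nrm (fun x => g x - h x).
Proof.
move=> sf sg sh; apply: le_trans (nrmD (sq_intB sf sg) (sq_intB sg sh)).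
by rewrite le_eqVlt; apply/orP; left; apply/eqP; congr nrm; apply/funext => x; ring.
Qed.

Lemma nrmBC f g : nrm (fun x => f x - g x) = nrm (fun x => g x - f x).
Proof. by rewrite -nrmN; congr nrm; apply/funext => x; rewrite opprB. Qed.

End PositiveFunctional.

(** * Weighted square-summable functions *)

Section WeightedL2.
Variables (R : realType) (X : choiceType) (w : X -> R).
Hypothesis w0 : forall x, 0 <= w x.
Notation C := R[i].

Lemma pl2_le (f g : X -> R) : True -> rsummable (fun x => w x * g x) ->
  (forall x, True -> `|f x| <= g x) -> rsummable (fun x => w x * f x).
Proof.
move=> _ sg fg; apply: (rsummable_le sg) => x.
by rewrite normrM (ger0_norm (w0 x)) ler_wpM2l// fg.
Qed.

Lemma pl2_lc a (f g : X -> R) : rsummable (fun x => w x * f x) ->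
  rsummable (fun x => w x * g x) -> rsummable (fun x => w x * (a * f x + g x)).
Proof.
move=> sf sg; have := rsummableD (rsummableZ a sf) sg.
by congr rsummable; apply/funext => x; ring.
Qed.

Lemma pl2_I_lc a (f g : X -> R) : rsummable (fun x => w x * f x) ->
  rsummable (fun x => w x * g x) ->
  rsum (fun x => w x * (a * f x + g x)) =
  a * rsum (fun x => w x * f x) + rsum (fun x => w x * g x).
Proof.
move=> sf sg; rewrite -rsumZ// -rsumD//; last exact: rsummableZ.
by congr rsum; apply/funext => x; ring.
Qed.

Lemma pl2_ge0 (f : X -> R) : (forall x, True -> 0 <= f x) ->
  0 <= rsum (fun x => w x * f x).
Proof. by move=> f0; apply: rsum_ge0 => x; rewrite mulr_ge0// f0. Qed.

Lemma pl2_0 : rsummable (fun x => w x * 0) /\ rsum (fun x => w x * 0) = 0.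
Proof.
by under eq_fun do rewrite mulr0; split; [exact: rsummable0|exact: rsum0].
Qed.

Definition pl2 : pfun R X := @PFun R X (fun=> True) (fun=> True)
  (fun f => rsummable (fun x => w x * f x)) (fun f => rsum (fun x => w x * f x))
  (fun _ _ _ _ => I) (fun _ _ _ _ => I) (fun=> I) (fun _ _ => I) pl2_le pl2_lc
  pl2_I_lc pl2_ge0 pl2_0.

Implicit Types f g : X -> C.

Lemma sq_int_l2P f : sq_int pl2 f <-> rsummable (fun x => w x * nsq (f x)).
Proof. by split=> [[]|]. Qed.
Lemma nsum_l2 f : l2norm2 w f = nsum (fun x => w x * nsq (f x)).
Proof. by apply: eq_esum => x _; rewrite normc_sq. Qed.
Lemma wnsq_ge0 f x : 0 <= w x * nsq (f x).
Proof. by rewrite mulr_ge0// nsq_ge0. Qed.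

Lemma l2P f : l2 w f <-> sq_int pl2 f.
Proof.
rewrite sq_int_l2P /l2 nsum_l2 /rsummable nsum_norm//; exact: wnsq_ge0.
Qed.

Lemma l2norm2E f : sq_int pl2 f -> l2norm2 w f = (form pl2 f f)%:E.
Proof.
move=> /sq_int_l2P sf; rewrite nsum_l2 -rsum_nsum//; exact: wnsq_ge0.
Qed.

Lemma ipE f g : ip w f g = form pl2 f g +i* form pl2 f (fun x => 'i * g x).
Proof.
rewrite /ip /csum /form /=; apply: complexP => /=; congr rsum; apply/funext => x;
  by rewrite /rdot !reimE; ring.
Qed.

Lemma finsupp_seq f : finsupp f -> exists2 s : seq X, uniq s &
  forall x, x \notin s -> f x = 0.
Proof.
move=> ff; exists (enum_fset (fset_set [set x | f x != 0])); first exact: fset_uniq.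
move=> x; rewrite -[_ \in enum_fset _]/(x \in fset_set _) in_fset_set//.
by rewrite notin_setE /= => /negP; rewrite negbK => /eqP.
Qed.

Lemma seq_finsupp f (s : seq X) : (forall x, x \notin s -> f x = 0) -> finsupp f.
Proof.
move=> fs; apply: (@sub_finite_set _ _ [set` s]); last exact: finite_seq.
by move=> x /=; apply: contraNT => /fs ->.
Qed.

Lemma finsupp_sq_int f : finsupp f -> sq_int pl2 f.
Proof.
move=> /finsupp_seq[s us fs]; apply/sq_int_l2P.
by apply: (@rsummable_fin _ _ _ s) => x /fs ->; rewrite nsq0 mulr0.
Qed.

Lemma form_finl f g (s : seq X) : uniq s -> (forall x, x \notin s -> f x = 0) ->
  form pl2 f g = \sum_(x <- s) w x * rdot (f x) (g x).
Proof.
move=> us fs; rewrite /form /= (rsum_fin us)// => x /fs ->.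
by rewrite /rdot !reimE !mul0r addr0 mulr0.
Qed.

Lemma form_finr f g (s : seq X) : uniq s -> (forall x, x \notin s -> g x = 0) ->
  form pl2 f g = \sum_(x <- s) w x * rdot (f x) (g x).
Proof.
move=> us gs; rewrite formC (form_finl f us gs); apply: eq_bigr => x _.
by rewrite rdotC.
Qed.

Definition cdelta (x : X) (c : C) : X -> C := fun y => if y == x then c else 0.

Lemma cdelta_out x c y : y \notin [:: x] -> cdelta x c y = 0.
Proof. by rewrite inE /cdelta => /negbTE ->. Qed.
Lemma finsupp_cdelta x c : finsupp (cdelta x c).
Proof. exact: (@seq_finsupp _ [:: x]) (cdelta_out c). Qed.

Lemma form_cdelta f x c : form pl2 f (cdelta x c) = w x * rdot (f x) c.
Proof.
rewrite (@form_finr _ _ [:: x])//; last exact: cdelta_out.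
by rewrite big_seq1 /cdelta eqxx.
Qed.

Definition trunc (s : seq X) f : X -> C := fun x => if x \in s then f x else 0.

Lemma finsupp_trunc s f : finsupp (trunc s f).
Proof. by apply: (@seq_finsupp _ s) => x /negbTE xs; rewrite /trunc xs. Qed.

Lemma l2_approx f e : sq_int pl2 f -> 0 < e ->
  exists s : seq X, nrm pl2 (fun x => f x - trunc s f x) < e.
Proof.
move=> /sq_int_l2P sf e0; have [s us H] := rsum_approx sf (exprn_gt0 2 e0).
exists s; rewrite -(@ltr_sqr R) ?nnegrE ?nrm_ge0 ?(ltW e0)// nrm_sq.
apply: le_lt_trans H; rewrite le_eqVlt; apply/orP; left; apply/eqP.
congr rsum; apply/funext => x; rewrite rdotzz /trunc.
case: (x \in s); first by rewrite subrr nsq0 mulr0.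
by rewrite subr0 ger0_norm// wnsq_ge0.
Qed.

Lemma form_trunc s f : form pl2 f (trunc s f) = form pl2 (trunc s f) (trunc s f).
Proof.
congr rsum; apply/funext => x; rewrite /trunc; case: (x \in s) => //.
by rewrite /rdot !reimE !mulr0.
Qed.

(** The truncations are the finite partial sums whose supremum is the norm. This is how an adjoint
    vector is shown to be square summable: by testing it against its own truncations. *)
Lemma form_sq_int f M : (forall s : seq X, form pl2 (trunc s f) (trunc s f) <= M) ->
  sq_int pl2 f /\ form pl2 f f <= M.
Proof.
move=> H; have nM : (nsum (fun x => w x * nsq (f x))%R <= M%:E)%E.
  apply: ge_ereal_sup => _ [Y [finY _] <-].
  rewrite fsbig_finite//= sumEFin lee_fin.
  have := H (enum_fset (fset_set Y)); congr (_ <= _).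
  rewrite (@form_finl _ _ (enum_fset (fset_set Y))).
  - by rewrite !big_seq; apply: eq_bigr => x xs; rewrite /trunc xs rdotzz.
  - exact: fset_uniq.
  - by move=> x /negbTE xs; rewrite /trunc xs.
have sf : sq_int pl2 f.
  apply/sq_int_l2P; rewrite /rsummable nsum_norm; last exact: wnsq_ge0.
  exact: le_lt_trans nM (ltry _).
by split=> //; rewrite -lee_fin -l2norm2E// nsum_l2.
Qed.

Lemma form_eq0 f : (forall x, 0 < w x) -> sq_int pl2 f -> form pl2 f f = 0 ->
  forall x, f x = 0.
Proof.
move=> wp sf f0 x; have := form_CS sf (finsupp_sq_int (finsupp_cdelta x (f x))).
rewrite f0 mul0r form_cdelta rdotzz => H.
have /eqP : (w x * nsq (f x)) ^+ 2 = 0 by apply/le_anti; rewrite H sqr_ge0.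
rewrite sqrf_eq0 mulf_eq0 (gt_eqF (wp x)) /= => /eqP; exact: nsq_eq0.
Qed.

End WeightedL2.

(** * Square-integrable vector functions on [(0, pi)] *)

Section OutL2.
Variables (R : realType) (I : finType).
Notation C := R[i].
Notation mu := (@lebesgue_measure R).
Notation D := (`]0, (pi : R)[%classic : set R).

Lemma measurable_D : measurable D. Proof. exact: measurable_itv. Qed.

Definition oint (f : R * I -> R) : Prop :=
  forall c, mu.-integrable D (EFin \o (fun t => f (t, c))).
Definition omeas (f : R * I -> R) : Prop :=
  forall c, measurable_fun D (fun t => f (t, c)).
Definition oI (f : R * I -> R) : R :=
  \sum_c Rintegral mu D (fun t => f (t, c)) / (2 * pi).

Lemma omeasD f g : omeas f -> omeas g -> omeas (fun x => f x + g x).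
Proof. by move=> mf mg c; apply: measurable_funD; [exact: mf|exact: mg]. Qed.
Lemma omeasM f g : omeas f -> omeas g -> omeas (fun x => f x * g x).
Proof. by move=> mf mg c; apply: measurable_funM; [exact: mf|exact: mg]. Qed.
Lemma omeas_cst (a : R) : omeas (fun=> a).
Proof. by move=> c; exact: measurable_cst. Qed.
Lemma oint_meas f : oint f -> omeas f.
Proof. by move=> sf c; apply/measurable_EFinP; exact: (measurable_int mu (sf c)). Qed.
Lemma oint_le f g : omeas f -> oint g -> (forall x, D x.1 -> `|f x| <= g x) -> oint f.
Proof.
move=> mf sg fg c; apply: (@le_integrable _ _ _ mu D measurable_D _ _ _ _ (sg c)).
  by apply/measurable_EFinP; exact: mf.
move=> t Dt /=; rewrite lee_fin; apply: le_trans (ler_norm _); exact: fg.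
Qed.
Lemma oint_lc a f g : oint f -> oint g -> oint (fun x => a * f x + g x).
Proof.
move=> sf sg c.
rewrite (_ : EFin \o _ = ((fun t => a%:E * (EFin \o (fun t => f (t, c))) t)
   \+ (EFin \o (fun t => g (t, c))))%E); last first.
  by apply/funext => t /=; rewrite EFinD EFinM.
by apply: integrableD; [exact: measurable_D|apply: integrableZl; [exact: measurable_D|exact: sf]|exact: sg].
Qed.
Lemma oI_lc a f g : oint f -> oint g ->
  oI (fun x => a * f x + g x) = a * oI f + oI g.
Proof.
move=> sf sg; rewrite /oI mulr_sumr -big_split /=; apply: eq_bigr => c _.
rewrite RintegralD//; last first.
  have s0 : oint (fun=> 0).
    by move=> c'; rewrite (_ : EFin \o _ = cst 0%E)//; exact: integrable0.
  suff -> : EFin \o (fun t => a * f (t, c)) = EFin \o (fun t => a * f (t, c) + 0).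
    exact: (oint_lc a sf s0 c).
  by apply/funext => t /=; rewrite addr0.
rewrite RintegralZl//.
by rewrite mulrDl mulrA.
Qed.
Lemma oI_ge0 f : (forall x, D x.1 -> 0 <= f x) -> 0 <= oI f.
Proof.
move=> f0; apply: sumr_ge0 => c _; apply: divr_ge0.
  by apply: Rintegral_ge0 => t Dt; exact: f0.
by rewrite mulr_ge0// pi_ge0.
Qed.
Lemma oI_0 : oint (fun=> 0) /\ oI (fun=> 0) = 0.
Proof.
split=> [c|]; first by rewrite (_ : EFin \o _ = cst 0%E)//; exact: integrable0.
by rewrite /oI big1// => c _; rewrite Rintegral_cst ?mul0r//; exact: measurable_D.
Qed.

Lemma oint_fin f c : oint f -> (\int[mu]_(t in D) (f (t, c))%:E)%E \is a fin_num.
Proof.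
move=> i; have := @integrable_fin_num _ _ _ mu D measurable_D _ (i c); exact.
Qed.

Definition pout : pfun R (R * I) := @PFun R (R * I) (fun x => D x.1) omeas oint oI
  omeasD omeasM omeas_cst oint_meas oint_le oint_lc oI_lc oI_ge0 oI_0.

Definition uncur (u : R -> I -> C) : R * I -> C := fun p => u p.1 p.2.
Definition cur (u : R * I -> C) : R -> I -> C := fun t c => u (t, c).

Lemma omeas_nsq u : omeas (fun x => re (u x)) ->
  omeas (fun x => im (u x)) -> omeas (fun x => nsq (u x)).
Proof.
move=> m1 m2; rewrite /nsq; under eq_fun do rewrite !expr2.
exact: (omeasD (omeasM m1 m1) (omeasM m2 m2)).
Qed.

Lemma int_scale (f : R -> C) : measurable_fun D (fun t => nsq (f t)) ->
  (\int[mu]_(t in D) (nsq (f t) / (2 * pi))%:E =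
     (2 * pi)^-1%:E * \int[mu]_(t in D) (nsq (f t))%:E)%E.
Proof.
move=> mf; rewrite -ge0_integralZl_EFin//.
- by apply: eq_integral => t _; rewrite -EFinM mulrC.
- by move=> t _; rewrite lee_fin nsq_ge0.
- by apply/measurable_EFinP.
- by rewrite invr_ge0 mulr_ge0// pi_ge0.
Qed.

Lemma ae_S (P Q : R -> Prop) : (forall t, P t -> Q t) -> {ae mu, forall t, P t} ->
  {ae mu, forall t, Q t}.
Proof.
by move=> PQ; apply: (@filterS _ _ (ae_filter_ringOfSetsType mu)) => t; exact: PQ.
Qed.

Lemma ae_S2 (P Q S : R -> Prop) : (forall t, P t -> Q t -> S t) ->
  {ae mu, forall t, P t} -> {ae mu, forall t, Q t} -> {ae mu, forall t, S t}.
Proof.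
by move=> PQ; apply: (@filterS2 _ _ (ae_filter_ringOfSetsType mu)) => t; exact: PQ.
Qed.

Lemma outnorm2_sum (u : R -> I -> C) : omeas (fun x => nsq (uncur u x)) ->
  outnorm2 u = (\sum_c \int[mu]_(t in D) (nsq (u t c) / (2 * pi))%:E)%E.
Proof.
move=> mu2; rewrite /outnorm2.
under eq_integral do under eq_bigr do rewrite normc_sq.
under eq_integral do rewrite -sumEFin.
rewrite ge0_integral_sum//.
- move=> c; apply/measurable_EFinP; apply: measurable_funM; last exact: measurable_cst.
  exact: mu2.
- by move=> c t _; rewrite lee_fin divr_ge0 ?nsq_ge0// mulr_ge0// pi_ge0.
Qed.

Lemma L2outP (u : R -> I -> C) : L2out u <-> sq_int pout (uncur u).
Proof.
have twopi : 0 <= (2 * pi : R)^-1 by rewrite invr_ge0 mulr_ge0// pi_ge0.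
split=> [[m fin]|[m1 m2 i]].
  have m1 : omeas (fun x => re (uncur u x)) by move=> c; exact: (m c).1.
  have m2 : omeas (fun x => im (uncur u x)) by move=> c; exact: (m c).2.
  split=> // c; apply/integrableP; split.
    by apply/measurable_EFinP; exact: (omeas_nsq m1 m2).
  move: fin; rewrite outnorm2_sum; last exact: omeas_nsq.
  move=> fin; have : (\int[mu]_(t in D) (nsq (u t c) / (2 * pi))%:E < +oo)%E.
    apply: le_lt_trans fin; rewrite (bigD1 c)//= leeDl// sume_ge0// => c' _.
    by apply: integral_ge0 => t _; rewrite lee_fin mulr_ge0// nsq_ge0.
  rewrite (int_scale (omeas_nsq m1 m2 c)).
  rewrite (_ : (\int[mu]_(x in D) `|(EFin \o _) x| =
     \int[mu]_(t in D) (nsq (u t c))%:E)%E); last first.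
    by apply: eq_integral => t _ /=; rewrite ger0_norm ?nsq_ge0.
  set A := (\int[mu]_(t in D) _)%E.
  have A0 : (0 <= A)%E by apply: integral_ge0 => t _; rewrite lee_fin nsq_ge0.
  clearbody A; case: A A0 => [r _ _|_|//]; first exact: ltry.
  by rewrite mulry gtr0_sg ?mul1e// invr_gt0 mulr_gt0// pi_gt0.
split=> [c|]; first by split; [exact: m1|exact: m2].
rewrite outnorm2_sum; last exact: omeas_nsq.
apply/lte_sum_pinfty => c _.
rewrite (int_scale (omeas_nsq m1 m2 c)).
apply: lte_mul_pinfty => //.
have /integrableP[_] := i c.
congr (_ < _)%E; apply: eq_integral => t _ /=; by rewrite ger0_norm ?nsq_ge0.
Qed.

Lemma outnorm2E (u : R -> I -> C) : sq_int pout (uncur u) ->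
  outnorm2 u = (form pout (uncur u) (uncur u))%:E.
Proof.
have twopi : 0 <= (2 * pi : R)^-1 by rewrite invr_ge0 mulr_ge0// pi_ge0.
move=> [m1 m2 i]; rewrite outnorm2_sum; last exact: omeas_nsq.
rewrite /form /= /oI -sumEFin; apply: eq_bigr => c _.
rewrite (int_scale (omeas_nsq m1 m2 c)).
rewrite muleC EFinM; congr (_ * _)%E; rewrite /Rintegral fineK.
  by apply: eq_integral => t _; rewrite rdotzz.
rewrite (_ : (\int[mu]_(t in D) _)%E = (\int[mu]_(t in D) (nsq (u t c))%:E)%E).
  exact: (oint_fin c i).
by apply: eq_integral => t _; rewrite rdotzz.
Qed.

Lemma ae0piP (u v : R -> I -> C) :
  ae_eq0pi u v <-> forall c, ae_eq mu D (fun t => u t c) (fun t => v t c).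
Proof.
rewrite /ae_eq0pi; split=> H.
  by move=> c; apply: ae_S H => t H Dt; rewrite H.
have : {ae mu, forall t, forall c, c \in index_enum I -> D t -> u t c = v t c}.
  elim: (index_enum I) => [|c s IH].
    apply: (@filterS _ _ (ae_filter_ringOfSetsType mu) setT); first by [].
    exact: (@filterT _ _ (ae_filter_ringOfSetsType mu)).
  apply: (ae_S2 _ IH (H c)) => t IHt Hc c'; rewrite inE => /predU1P[->|]//.
  exact: IHt.
by apply: ae_S => t Ht Dt; apply/funext => c; apply: Ht => //; rewrite mem_index_enum.
Qed.

Lemma ae0pi_trans (u v z : R -> I -> C) : ae_eq0pi u v -> ae_eq0pi v z -> ae_eq0pi u z.
Proof. by rewrite /ae_eq0pi; apply: ae_S2 => t a b Dt; rewrite a// b. Qed.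
Lemma ae0pi_sym (u v : R -> I -> C) : ae_eq0pi u v -> ae_eq0pi v u.
Proof. by rewrite /ae_eq0pi; apply: ae_S => t a Dt; rewrite a. Qed.

Lemma ae0pi_form (u v z : R -> I -> C) : sq_int pout (uncur u) ->
  sq_int pout (uncur v) -> sq_int pout (uncur z) ->
  ae_eq0pi u v -> form pout (uncur u) (uncur z) = form pout (uncur v) (uncur z).
Proof.
move=> su sv sz uv; rewrite /form /= /oI; apply: eq_bigr => c _; congr (_ / _).
rewrite /Rintegral; congr fine; apply: ae_eq_integral => //.
- by apply/measurable_EFinP; exact: (oint_meas (rdot_intg su sz)).
- by apply/measurable_EFinP; exact: (oint_meas (rdot_intg sv sz)).
- by move: uv; apply: ae_S => t H Dt /=; rewrite /uncur /= H.
Qed.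

Lemma ae0pi_eq0 (u v : R -> I -> C) : sq_int pout (uncur u) ->
  sq_int pout (uncur v) ->
  form pout (fun x => uncur u x - uncur v x) (fun x => uncur u x - uncur v x) = 0 ->
  ae_eq0pi u v.
Proof.
move=> su sv; have [m1 m2 i] := sq_intB su sv; rewrite /form /= /oI => H.
have twopi : 0 < (2 * pi : R)^-1 by rewrite invr_gt0 mulr_gt0// pi_gt0.
apply/ae0piP => c.
have /eqP : Rintegral mu D (fun t => nsq (u t c - v t c)) = 0 :> R.
  move: H => /eqP; rewrite psumr_eq0; last first.
    move=> c' _; rewrite divr_ge0//; last by rewrite mulr_ge0// pi_ge0.
    by apply: Rintegral_ge0 => t _; rewrite rdotzz nsq_ge0.
  move=> /allP /(_ c (mem_index_enum _)); rewrite /= mulf_eq0 (gt_eqF twopi) orbF => /eqP e0.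
  by rewrite -[RHS]e0; apply: eq_Rintegral => t _; rewrite rdotzz.
rewrite -eqe /Rintegral fineK => [/eqP e|]; last exact: (oint_fin c i).
have : ae_eq mu D (fun t => (nsq (u t c - v t c))%:E) (cst 0%E).
  apply/ae_eq_integral_abs; first exact: measurable_D.
    by apply/measurable_EFinP; exact: (oint_meas i).
  by rewrite -[RHS]e; apply: eq_integral => t _; rewrite gee0_abs// lee_fin nsq_ge0.
by apply: ae_S => t H' Dt; have := H' Dt; case=> /nsq_eq0 /eqP; rewrite subr_eq0 => /eqP.
Qed.

End OutL2.

(** * Polynomials in the cosine determine an integrable function *)

Section Approximation.
Variable R : realType.
Notation mu := (@lebesgue_measure R).
Notation D := (`]0, (pi : R)[%classic : set R).

Lemma bernoulli_ge (x : R) n : -1 <= x -> 1 + n%:R * x <= (1 + x) ^+ n.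
Proof.
move=> x1; elim: n => [|n IH]; first by rewrite mul0r addr0 expr0.
have x0 : 0 <= 1 + x by rewrite -lerBlDl sub0r.
have := ler_wpM2r x0 IH; rewrite -exprSr; apply: le_trans.
have := sqr_ge0 x; have : 0 <= n%:R :> R by exact: ler0n.
by rewrite -[n.+1]addn1 natrD; nra.
Qed.

(** Classical polynomials approximating a step on [[0, 1]]: the limit is 1 below [1/2] and 0 above
    it. *)
Definition bump (y : R) n := (1 - y ^+ n) ^+ (2 ^ n).

Lemma bump_ge0 (y : R) n : 0 <= y <= 1 -> 0 <= bump y n.
Proof. by move=> /andP[y0 y1]; rewrite exprn_ge0// subr_ge0 exprn_ile1. Qed.

Lemma bump_le1 (y : R) n : 0 <= y <= 1 -> bump y n <= 1.
Proof.
move=> /andP[y0 y1]; apply: exprn_ile1; first by rewrite subr_ge0 exprn_ile1.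
by rewrite gerBl exprn_ge0.
Qed.

Lemma bump_cvg1 (y : R) : 0 <= y < 2^-1 -> bump y @ \oo --> (1 : R).
Proof.
move=> /andP[y0 y2].
apply: (@squeeze_cvgr _ _ _ _ (fun n => 1 - (2 * y) ^+ n) (fun=> 1)).
- apply: nearW => n; have y01 : 0 <= y <= 1 by lra.
  rewrite bump_le1// andbT.
  have := @bernoulli_ge (- y ^+ n) (2 ^ n); rewrite exprMn -natrX mulrN; apply.
  by rewrite lerN2 exprn_ile1//; lra.
- rewrite -[X in _ --> X]subr0; apply: cvgB; first exact: cvg_cst.
  by apply: cvg_expr; rewrite ger0_norm; lra.
- exact: cvg_cst.
Qed.

(** Multiplied by [(1 + y^n)^(2^n)] the polynomial becomes [(1 - y^(2n))^(2^n) <= 1], while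
    Bernoulli bounds that factor below by [(2 y)^n]; so [bump y n] is at most [(2 y)^(-n)]. *)
Lemma bump_cvg0 (y : R) : 2^-1 < y <= 1 -> bump y @ \oo --> (0 : R).
Proof.
move=> /andP[y2 y1].
apply: (@squeeze_cvgr _ _ _ _ (fun=> 0) (fun n => ((2 * y)^-1) ^+ n)).
- apply: nearW => n; have y01 : 0 <= y <= 1 by lra.
  rewrite bump_ge0//=.
  have p0 : 0 < (2 * y) ^+ n by rewrite exprn_gt0//; lra.

  have h1 : bump y n * (1 + y ^+ n) ^+ (2 ^ n) <= 1.
    rewrite /bump -exprMn -subr_sqr expr1n exprn_ile1//.
      by rewrite subr_ge0 exprn_ile1 ?exprn_ge0 ?exprn_ile1//; lra.
    by rewrite gerBl sqr_ge0.
  have h2 : (2 * y) ^+ n <= (1 + y ^+ n) ^+ (2 ^ n).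
    rewrite exprMn -natrX; apply: le_trans (@bernoulli_ge (y ^+ n) (2 ^ n) _).
      by rewrite lerDr.
    by apply: (@le_trans _ _ 0) => //; rewrite exprn_ge0//; lra.
  have h3 : bump y n * (2 * y) ^+ n <= 1.
    by apply: le_trans h1; rewrite ler_wpM2l// bump_ge0.
  by rewrite exprVn -[leRHS]mul1r ler_pdivlMr.
- exact: cvg_cst.
- apply: cvg_expr; rewrite ger0_norm ?invr_ge0; last by lra.
  by rewrite invf_lt1; lra.
Qed.

Lemma measurable_cos (A : set R) : measurable_fun A (@cos R).
Proof.
apply: (measurable_funS measurableT) => //.
by apply: continuous_measurable_fun; exact: continuous_cos.
Qed.

Lemma measurable_sin (A : set R) : measurable_fun A (@sin R).
Proof.
apply: (measurable_funS measurableT) => //.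
by apply: continuous_measurable_fun; exact: continuous_sin.
Qed.

Lemma measurable_horner (p : {poly R}) (f : R -> R) (A : set R) :
  measurable_fun A f -> measurable_fun A (fun t => p.[f t]).
Proof.
move=> mf; apply: (@measurableT_comp _ _ _ _ _ _ (horner p)) => //.
by apply: continuous_measurable_fun; exact: continuous_horner.
Qed.

Lemma cos_cD (x t : R) : D x -> D t -> (cos t < cos x) = (x < t).
Proof.
rewrite /= !in_itv /= => /andP[x0 xp] /andP[t0 tp].
by rewrite ltr_cos// in_itv /= ?(ltW x0) ?(ltW xp) ?(ltW t0) ?(ltW tp).
Qed.

Lemma measurable_step (x : R) (A : set R) :
  measurable_fun A (fun t : R => if (x < t)%R then 1 else 0 : R).
Proof.
rewrite (_ : (fun t => _) = \1_(`]x, +oo[%classic)); first exact: measurable_indic.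
apply/funext => t; rewrite indicE.
have -> : (t \in `]x, +oo[%classic) = (x < t).
  by apply/idP/idP => [/set_mem|H]; [|apply: mem_set]; rewrite /= in_itv /= andbT.
by case: (x < t).
Qed.

(** By dominated convergence the polynomials [bump] turn vanishing moments into vanishing integrals
    over every [(x, pi)]; the primitive is then zero and Lebesgue differentiation gives the
    function. *)
Lemma cos_moments_eq0 (f : R -> R) : mu.-integrable D (EFin \o f) ->
  (forall p : {poly R}, Rintegral mu D (fun t => f t * p.[cos t]) = 0) ->
  ae_eq mu D f (cst 0).
Proof.
move=> intf H.
have mf : measurable_fun D f by apply/measurable_EFinP; exact: (measurable_int mu intf).
have mD : measurable D by exact: measurable_itv.
have tail (x : R) : D x ->
    (\int[mu]_(t in D) (f t * (if (x < t)%R then 1 else 0))%:E = 0)%E.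
  (* The rescaling keeps [y] in [[0, 1]] and puts the threshold [1/2] exactly at [t = x]; the cosine
     decreases, so [y < 1/2] means [t > x]. *)
  move=> Dx; pose y t := (cos t - cos x) / 4 + 2^-1.
  have y01 t : 0 <= y t <= 1.
    have := cos_le1 t; have := cos_geN1 t; have := cos_le1 x; have := cos_geN1 x.
    by rewrite /y; lra.
  pose P n : {poly R} := (1 - (4^-1 *: ('X - (cos x)%:P) + (2^-1)%:P) ^+ n) ^+ (2 ^ n).
  have PE n t : (P n).[cos t] = bump (y t) n.
    by rewrite /P /bump /y !(hornerE, horner_exp) [4^-1 * _]mulrC.
  have mP n : measurable_fun D (fun t => f t * (P n).[cos t]).
    by apply: measurable_funM => //; apply: measurable_horner; exact: measurable_cos.
  have mif : measurable_fun D (fun t : R => if (x < t)%R then 1 else 0 : R).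
    exact: measurable_step.
  have [] := @dominated_convergence _ _ _ mu D mD
    (fun n t => (f t * (P n).[cos t])%:E) (fun t => (f t * (if (x < t)%R then 1 else 0))%:E)
    (fun t => `|(f t)%:E|%E).
  - by move=> n; apply/measurable_EFinP; exact: mP.
  - by apply/measurable_EFinP; exact: measurable_funM.
  - exists [set x]; split; [exact: measurable_set1|exact: lebesgue_measure_set1|].
    move=> t /=; apply: contra_notP => /eqP tx Dt.

    apply: cvg_EFin; first exact: nearW.
    apply: cvgM; first exact: cvg_cst.
    rewrite (_ : (fun n => _) = bump (y t)); last by apply/funext => n /=.
    case: ltP => xt.
      apply: bump_cvg1; have := y01 t; have := cos_cD Dx Dt; rewrite xt /y; lra.
    have tx' : (t : R) < x.
      by move: xt; rewrite le_eqVlt => /predU1P[e|//]; move: tx; rewrite e eqxx.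
    apply: bump_cvg0; have := y01 t; have := cos_cD Dt Dx.
    rewrite tx' /y; lra.
  - by apply/integrable_abse.
  - apply: (@filterS _ _ (ae_filter_ringOfSetsType mu) setT); last first.
      exact: (@filterT _ _ (ae_filter_ringOfSetsType mu)).
    move=> t _ n Dt; rewrite PE lee_fin normrM [X in _ * X]ger0_norm ?bump_ge0//.
    by rewrite ler_piMr// bump_le1.
  move=> _ _ /(cvg_lim (@ereal_hausdorff R)) <-.
  rewrite (_ : [sequence _]_n = fun=> 0%E) ?lim_cst//.
  apply/funext => n /=.
  have : mu.-integrable D (EFin \o (fun t => f t * (P n).[cos t])).
    apply: (@le_integrable _ _ _ mu D mD _ (EFin \o f)) => //.
      by apply/measurable_EFinP; exact: mP.
    move=> t Dt /=; rewrite lee_fin PE normrM [X in _ * X]ger0_norm ?bump_ge0//.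
    by rewrite ler_piMr// bump_le1.
  move=> i; have := @integrable_fin_num _ _ _ mu D mD _ i => fn.
  by rewrite -[LHS](fineK fn); congr EFin; exact: H.
pose g : R -> R := f \_ D.
have intg : mu.-integrable setT (EFin \o g).
  have e : (EFin \o f) \_ D = EFin \o g.
    by apply/funext => t; rewrite /g /patch /=; case: ifP.
  by move: ((@integrable_mkcond _ _ _ mu D (EFin \o f) mD).1 intf); rewrite e.
have Iz (x : R) : Rintegral mu `]-oo, x] g = 0.
  have e1 : (\int[mu]_(t in `]-oo, x]) (g t)%:E =
             \int[mu]_(t in D) (f t * (if (t <= x)%R then 1 else 0))%:E)%E.
    rewrite [LHS]integral_mkcond [RHS]integral_mkcond; apply: eq_integral => t _.
    rewrite /g /patch /=.
    have -> : (t \in `]-oo, x]%classic) = (t <= x).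
      by apply/idP/idP => [/set_mem|tx]; [|apply: mem_set]; rewrite /= in_itv.
    by case: (t <= x); case: (t \in D); rewrite ?mulr1 ?mulr0.
  rewrite /Rintegral e1.
  have [x0|x0] := leP x 0.
    rewrite (_ : (\int[mu]_(t in D) _)%E = 0%E)//.
    rewrite -[RHS](integral0 mu D); apply: eq_integral => t /set_mem /=.
    rewrite in_itv /= => /andP[t0 _].
    by rewrite leNgt (le_lt_trans x0 t0) mulr0.
  have If : (\int[mu]_(t in D) (f t)%:E)%E = 0%E.
    rewrite -[LHS](fineK (@integrable_fin_num _ _ _ mu D mD _ intf)); congr EFin.
    rewrite -[RHS](H 1) /Rintegral; congr fine; apply: eq_integral => t _.
    by rewrite hornerE mulr1.
  have [xp|xp] := leP pi x.
    rewrite (_ : (\int[mu]_(t in D) _)%E = 0%E)// -[RHS]If.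
    apply: eq_integral => t /set_mem /=; rewrite in_itv /= => /andP[_ tp].
    by rewrite (ltW (lt_le_trans tp xp)) mulr1.
  have Dx : D x by rewrite /= in_itv /= x0.
  have mif : measurable_fun D (fun t : R => if (x < t)%R then 1 else 0 : R).
    exact: measurable_step.
  rewrite (_ : (\int[mu]_(t in D) _)%E =
     (\int[mu]_(t in D) ((f t)%:E - (f t * (if (x < t)%R then 1 else 0))%:E))%E).
    rewrite integralB//.
    - by rewrite (tail x Dx) If sube0.
    - apply: (@le_integrable _ _ _ mu D mD _ (EFin \o f)) => //.
        by apply/measurable_EFinP; exact: measurable_funM.
      move=> t Dt /=; rewrite lee_fin normrM.
      by case: ifP => _; rewrite ?normr1 ?normr0 ?mulr1 ?mulr0.
  apply: eq_integral => t _; rewrite -EFinB leNgt; congr (_%:E).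
  by case: ltP => _ /=; rewrite ?mulr1 ?mulr0 ?subrr ?subr0.
have := @FTC1Ny R g _ _.
have intg' y : mu.-integrable `]-oo, y] (EFin \o g).
  by apply: (integrableS measurableT) => //; exact: measurable_itv.
have locg : locally_integrable [set: R] g.
  exact: (integrable_locally mD intf).
move=> /(_ intg' locg) /=; apply: ae_S => x [_].
rewrite (_ : (fun x => _) = cst 0); last by apply/funext => y; exact: Iz.
by rewrite derive1_cst /g /patch => e Dx; move: e; rewrite mem_set.
Qed.

End Approximation.

(** * Completeness of the square-integrable functions *)

Section RieszFischer.
Variable R : realType.
Notation mu := (@lebesgue_measure R).
Notation D := (`]0, (pi : R)[%classic : set R).

Lemma limn_einf_le (x : nat -> \bar R) b : (forall n, (x n <= b)%E) ->
  (limn_einf x <= b)%E.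
Proof.
move=> H; rewrite limn_einf_lim; apply: lime_le; first exact: is_cvg_einfs.
apply: nearW => n; apply: le_trans (H n); apply: ereal_inf_lbound.
by exists n => //=.
Qed.

Lemma geom_sum_le (K : R) N : 0 <= K -> \sum_(0 <= n < N) K * 2^-1 ^+ n <= 2 * K.
Proof.
move=> K0; have -> : \sum_(0 <= n < N) K * 2^-1 ^+ n = 2 * K - 2 * K * 2^-1 ^+ N.
  elim: N => [|N IH]; first by rewrite big_geq// expr0 mulr1 subrr.
  by rewrite big_nat_recr//= IH exprS; field.
by rewrite gerBl mulr_ge0 ?mulr_ge0 ?exprn_ge0 ?invr_ge0.
Qed.

(** The series of increments has finite integral, so it converges absolutely almost everywhere and
    the sequence telescopes. Writing the limit as a limit superior makes it measurable without
    discarding a null set. *)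
Lemma L1_fast_cauchy (f : nat -> R -> R) (K : R) :
  (forall n, measurable_fun D (f n)) ->
  (forall n, (\int[mu]_(t in D) (`|f n.+1 t - f n t|)%:E <= (K * 2^-1 ^+ n)%:E)%E) ->
  exists2 g : R -> R, measurable_fun D g &
    {ae mu, forall t, D t -> (fun n => f n t) @ \oo --> g t}.
Proof.
move=> mf H.
have mD : measurable D by exact: measurable_itv.
have K0 : 0 <= K.
  have := H 0%N; rewrite expr0 mulr1 => h; rewrite -lee_fin; apply: le_trans h.
  by apply: integral_ge0 => t _; rewrite lee_fin.
pose h n t : \bar R := (`|f n.+1 t - f n t|)%:E.
have mh n : measurable_fun D (h n).
  apply/measurable_EFinP; apply: measurableT_comp => //.
  by apply: measurable_funB; exact: mf.
have h0 n t : D t -> (0 <= h n t)%E by move=> _; rewrite lee_fin.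
pose G t := (\big[+%E/0%E]_(0 <= n <oo) h n t)%E.
have iG : mu.-integrable D G.
  apply/integrableP; split.
    by apply: ge0_emeasurable_sum => [n t Dt _|n _]; [exact: h0|exact: mh].
  rewrite (_ : (\int[mu]_(x in D) `|G x|)%E = (\int[mu]_(x in D) G x)%E); last first.
    by apply: eq_integral => t _; rewrite gee0_abs// nneseries_ge0// => n _ _; rewrite lee_fin.
  rewrite (integral_nneseries mu mD mh h0); apply: (@le_lt_trans _ _ (2 * K)%:E); last exact: ltry.
  apply: lime_le.
    by apply: is_cvg_nneseries => n _ _; apply: integral_ge0 => t Dt; exact: h0.
  apply: nearW => N; apply: le_trans (_ : ((\sum_(0 <= n < N) (K * 2^-1 ^+ n))%:E <= _)%E); last first.
    by rewrite lee_fin geom_sum_le.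
  by rewrite -sumEFin; apply: lee_sum => n _; exact: H.
exists (fun t => fine (limn_esup (fun n => (f n t)%:E))).
  apply: (@measurableT_comp _ _ _ _ _ _ (@fine R)); first exact: fine_measurable.
  by apply: measurable_fun_limn_esup => n; apply/measurable_EFinP.
have := @integrable_ae _ _ _ mu D mD _ iG; apply: ae_S => t + Dt => /(_ Dt) Gfin.
have st : rsummable (fun n => f n.+1 t - f n t).
  rewrite /rsummable /nsum -nneseries_esumT; last by move=> n; rewrite lee_fin.
  have G0 : (0 <= G t)%E by apply: nneseries_ge0 => n _ _; exact: h0.
  by move: Gfin; rewrite ge0_fin_numE.
have cv := rsum_cvg_series st.
have cf : (fun n => f n t) @ \oo --> f 0%N t + rsum (fun n => f n.+1 t - f n t).
  rewrite (_ : (fun n => f n t) = (fun n => f 0%N t + \sum_(0 <= i < n) (f i.+1 t - f i t))).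
    by apply: cvgD => //; exact: cvg_cst.
  by apply/funext => n; rewrite telescope_sumr// addrC subrK.
set l := _ + _ in cf.
have cE : (fun n => (f n t)%:E) @ \oo --> l%:E.
  by apply: cvg_EFin; [exact: nearW|exact: cf].
by rewrite (cvg_limn_einf_sup cE).2.
Qed.

Variable I : finType.
Notation C := R[i].
Notation L := (pout R I).

Lemma oI_component (f : R * I -> R) c : oint f -> (forall x, 0 <= f x) ->
  (\int[mu]_(t in D) (f (t, c))%:E <= (2 * pi * oI f)%:E)%E.
Proof.
move=> i f0; have p0 : 0 < 2 * pi :> R by rewrite mulr_gt0// pi_gt0.
rewrite -(fineK (oint_fin c i)) lee_fin /oI (bigD1 c)//= mulrDr.
rewrite mulrC divfK ?gt_eqF// lerDl mulr_ge0 ?(ltW p0)//.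
apply: sumr_ge0 => c' _; rewrite divr_ge0 ?(ltW p0)//.
by apply: Rintegral_ge0.
Qed.

Lemma omeas_prB (pr : C -> R) (f g : R * I -> C) : (forall z w, pr (z - w) = pr z - pr w) ->
  omeas (fun x => pr (f x)) -> omeas (fun x => pr (g x)) -> omeas (fun x => pr (f x - g x)).
Proof.
move=> prB mf mg; rewrite (_ : (fun x => _) = fun x => pr (f x) - pr (g x)); last exact/funext.
by move=> c; exact: measurable_funB (mf c) (mg c).
Qed.

Lemma reB (z w : C) : re (z - w) = re z - re w. Proof. by rewrite reD reN. Qed.
Lemma imB (z w : C) : im (z - w) = im z - im w. Proof. by rewrite imD imN. Qed.

Lemma nrm_le (W : Type) (M : pfun R W) f e : 0 <= e ->
  (nrm M f <= e) = (form M f f <= e ^+ 2).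
Proof. by move=> e0; rewrite -(@ler_sqr R) ?nnegrE ?nrm_ge0// nrm_sq. Qed.

(** A subsequence with increments below [2^-k] converges almost everywhere by [L1_fast_cauchy];
    Fatou's lemma then bounds the distance from the original sequence to the limit. *)
Lemma pout_complete (u : nat -> R * I -> C) : (forall n, sq_int L (u n)) ->
  (forall e, 0 < e -> exists N, forall m n, (N <= m)%N -> (N <= n)%N ->
     nrm L (fun x => u m x - u n x) <= e) ->
  exists2 v, sq_int L v & forall e, 0 < e -> exists N, forall n, (N <= n)%N ->
     nrm L (fun x => u n x - v x) <= e.
Proof.
move=> su H.
have mD : measurable D by exact: measurable_itv.
have p0 : 0 < 2 * pi :> R by rewrite mulr_gt0// pi_gt0.
have /choice[N0 HN0] : forall k : nat, exists N, forall m n, (N <= m)%N -> (N <= n)%N ->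
     nrm L (fun x => u m x - u n x) <= 2^-1 ^+ k.
  by move=> k; apply: H; rewrite exprn_gt0.
(* Summing the moduli makes [N] non-decreasing while keeping [N0 k <= N k]. *)
pose N k := (\sum_(i < k.+1) N0 i)%N.
have NN0 k : (N0 k <= N k)%N by rewrite /N big_ord_recr leq_addl.
have Nmono k m : (k <= m)%N -> (N k <= N m)%N.
  elim: m => [|m IH]; first by rewrite leqn0 => /eqP ->.
  rewrite leq_eqVlt => /predU1P[->//|]; rewrite ltnS => /IH /leq_trans; apply.
  by rewrite /N [X in (_ <= X)%N]big_ord_recr leq_addr.
pose f k := u (N k).
have df k m : (k <= m)%N -> nrm L (fun x => f m x - f k x) <= 2^-1 ^+ k.
  by move=> km; apply: HN0 => //; apply: leq_trans (NN0 k) _; exact: Nmono.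
have key (pr : C -> R) : (forall z w, pr (z - w) = pr z - pr w) ->
    (forall z, pr z ^+ 2 <= nsq z) ->
    (forall k, omeas (fun x => pr (f k x))) -> forall c,
    exists2 g : R -> R, measurable_fun D g &
      {ae mu, forall t, D t -> (fun n => pr (f n (t, c))) @ \oo --> g t}.
  move=> prB prn mpr c.
  apply: (@L1_fast_cauchy (fun n t => pr (f n (t, c))) (2 * pi)) => [n|n].
    exact: mpr.
  (* On a bounded interval the mean-square bound is traded for an integral bound through
     [2 |z| <= s |z|^2 + 1/s]; with [s = 2^n] both terms have order [2^-n]. *)
  pose s : R := 2 ^+ n; have s0 : 0 < s by rewrite exprn_gt0.
  have [m1 m2 i] := sq_intB (su (N n.+1)) (su (N n)).
  have ile : (\int[mu]_(t in D) (nsq (f n.+1 (t, c) - f n (t, c)))%:E <=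
      (2 * pi * (2^-1 ^+ n) ^+ 2)%:E)%E.
    apply: le_trans (oI_component c i _) _; first by move=> x; exact: nsq_ge0.
    rewrite lee_fin ler_pM2l//.
    by have := df n n.+1 (leqnSn n); rewrite nrm_le ?exprn_ge0 ?invr_ge0.
  have mF : measurable_fun D (fun t => nsq (f n.+1 (t, c) - f n (t, c))).
    exact: (oint_meas i).
  apply: (@le_trans _ _ (\int[mu]_(t in D) (s / 2 * nsq (f n.+1 (t, c) - f n (t, c)) +
      s^-1 / 2)%:E)%E).
    apply: ge0_le_integral => //.
    - by apply/measurable_EFinP; apply: measurableT_comp => //; apply: measurable_funB; exact: mpr.

    - by apply/measurable_EFinP; apply: measurable_funD => //; apply: measurable_funM.
    - move=> t _; rewrite lee_fin -prB; have := prn (f n.+1 (t, c) - f n (t, c)).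
      set z := pr _; set w := nsq _ => zw.
      have h : 2 * `|z| <= s * `|z| ^+ 2 + s^-1.
        have := sqr_ge0 (s * `|z| - 1) => h1.
        have h2 : 0 <= s^-1 * (s * `|z| - 1) ^+ 2 by rewrite mulr_ge0 ?invr_ge0 ?(ltW s0).
        rewrite (_ : s^-1 * _ = s * `|z| ^+ 2 - 2 * `|z| + s^-1) in h2; last by field; rewrite gt_eqF.
        lra.
      have : s * `|z| ^+ 2 <= s * w by rewrite ler_wpM2l ?(ltW s0)// real_normK ?num_real.
      lra.
  rewrite (_ : (\int[mu]_(t in D) _)%E = ((s / 2)%:E *
     \int[mu]_(t in D) (nsq (f n.+1 (t, c) - f n (t, c)))%:E + (s^-1 / 2 * pi)%:E)%E); last first.
    rewrite -ge0_integralZl_EFin//; last 3 first.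
    - by move=> t _; rewrite lee_fin nsq_ge0.
    - by apply/measurable_EFinP.
    - by rewrite divr_ge0 ?(ltW s0).
    rewrite (_ : (s^-1 / 2 * pi)%:E = \int[mu]_(t in D) (s^-1 / 2)%:E)%E; last first.
      by rewrite integral_cst//= lebesgue_measure_itv /= lte_fin pi_gt0 -EFinD subr0 -EFinM.
    rewrite -ge0_integralD//.
    - by move=> t _; rewrite -EFinM lee_fin mulr_ge0 ?nsq_ge0 ?divr_ge0 ?(ltW s0).
    - by apply/measurable_EFinP; apply: measurable_funM.
    - by move=> t _; rewrite lee_fin ?divr_ge0 ?invr_ge0 ?(ltW s0).
  apply: (@le_trans _ _ ((s / 2)%:E * (2 * pi * (2^-1 ^+ n) ^+ 2)%:E + (s^-1 / 2 * pi)%:E)%E).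
    by rewrite leeD2r// lee_wpmul2l// lee_fin divr_ge0 ?(ltW s0).
  rewrite -EFinM -EFinD lee_fin exprVn -/s.
  rewrite (_ : s / 2 * _ = pi * s^-1); last by field; rewrite gt_eqF.
  have : 0 <= pi * s^-1 by rewrite mulr_ge0 ?pi_ge0 ?invr_ge0 ?(ltW s0).
  by rewrite mulrAC; lra.
have /choice[g1 Hg1] : forall c, exists g : R -> R, measurable_fun D g /\
   {ae mu, forall t, D t -> (fun n => re (f n (t, c))) @ \oo --> g t}.
  move=> c; have [||k|g a b] := key (@complex.Re R) _ _ _ c; last by exists g.
  - exact: reB.
  - by move=> z; rewrite lerDl sqr_ge0.
  by have [] := su (N k).
have /choice[g2 Hg2] : forall c, exists g : R -> R, measurable_fun D g /\
   {ae mu, forall t, D t -> (fun n => im (f n (t, c))) @ \oo --> g t}.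
  move=> c; have [||k|g a b] := key (@complex.Im R) _ _ _ c; last by exists g.
  - exact: imB.
  - by move=> z; rewrite lerDr sqr_ge0.
  by have [] := su (N k).
pose v : R * I -> C := fun x => g1 x.2 x.1 +i* g2 x.2 x.1.
have mv1 : omeas (fun x => re (v x)) by move=> c; exact: (Hg1 c).1.
have mv2 : omeas (fun x => im (v x)) by move=> c; exact: (Hg2 c).1.
have bnd n k c : (N k <= n)%N ->
    (\int[mu]_(t in D) (nsq (u n (t, c) - v (t, c)))%:E <= (2 * pi * (2^-1 ^+ k) ^+ 2)%:E)%E.
  move=> kn.
  pose h m t := (nsq (u n (t, c) - f (k + m)%N (t, c)))%:E.
  have mh m : measurable_fun D (h m).
    have [_ _ i] := sq_intB (su n) (su (N (k + m)%N)).
    by apply/measurable_EFinP; exact: (oint_meas i).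
  have h0 m t : D t -> (0 <= h m t)%E by move=> _; rewrite lee_fin nsq_ge0.
  have mv : measurable_fun D (fun t => nsq (u n (t, c) - v (t, c))).
    have [m1 m2 _] := su n.
    exact: (omeas_nsq (omeas_prB reB m1 mv1) (omeas_prB imB m2 mv2)).
  rewrite (_ : (\int[mu]_(t in D) _)%E = (\int[mu]_(t in D) limn_einf (h^~ t))%E).
    apply: le_trans (fatou mu mD mh h0) _; apply: limn_einf_le => m.
    have [m1 m2 i] := sq_intB (su n) (su (N (k + m)%N)).
    apply: le_trans (oI_component c i _) _; first by move=> x; exact: nsq_ge0.
    rewrite lee_fin ler_pM2l//.
    have : nrm L (fun x => u n x - u (N (k + m)%N) x) <= 2^-1 ^+ k.
      apply: HN0; first exact: leq_trans (NN0 k) kn.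
      by apply: leq_trans (NN0 k) (Nmono _ _ _); rewrite leq_addr.
    by rewrite nrm_le ?exprn_ge0 ?invr_ge0.
  apply: ge0_ae_eq_integral => //.
  - by apply/measurable_EFinP.
  - rewrite (_ : (fun t => limn_einf (h^~ t)) =
        (fun t => - limn_esup (fun m => - h m t))%E).
      apply: (@measurableT_comp _ _ _ _ _ _ (@oppe R)) => //.
      apply: measurable_fun_limn_esup => m.
      by apply: (@measurableT_comp _ _ _ _ _ _ (@oppe R) _ (h m)) => //; exact: mh.
    by apply/funext => t; rewrite (limn_esupN (h^~ t)) oppeK.
  - by move=> t _; rewrite lee_fin nsq_ge0.
  - move=> t Dt; rewrite limn_einf_lim; apply: lime_ge; first exact: is_cvg_einfs.
    apply: nearW => m; apply: le_ereal_inf_tmp => _ [p /= _ <-]; exact: h0.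
  - apply: ae_S2 (Hg1 c).2 (Hg2 c).2 => t c1 c2 Dt.
    have cvh : (h^~ t) @ \oo --> (nsq (u n (t, c) - v (t, c)))%:E.
      apply: cvg_EFin; first exact: nearW.
      rewrite (_ : fine \o h^~ t = (fun m =>
         (re (u n (t, c)) - re (f (k + m)%N (t, c))) ^+ 2 +
         (im (u n (t, c)) - im (f (k + m)%N (t, c))) ^+ 2)); last first.
        by apply/funext => m /=; rewrite /nsq !reimE.
      rewrite /nsq !reimE /=.
      have sh (a : nat -> R) (l : R) : a @ \oo --> l -> (fun m => a (k + m)%N) @ \oo --> l.
        by move=> al; rewrite (_ : (fun m => _) = (fun m => a (m + k)%N)) ?cvg_shiftn//; apply/funext => m; rewrite addnC.
      have b1 : (fun m => re (u n (t, c)) - re (f (k + m)%N (t, c))) @ \oo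
          --> re (u n (t, c)) - g1 c t.
        by apply: cvgB; [exact: cvg_cst|exact: (sh _ _ (c1 Dt))].
      have b2 : (fun m => im (u n (t, c)) - im (f (k + m)%N (t, c))) @ \oo
          --> im (u n (t, c)) - g2 c t.
        by apply: cvgB; [exact: cvg_cst|exact: (sh _ _ (c2 Dt))].
      have := cvgD (cvgM b1 b1) (cvgM b2 b2); exact.
    by rewrite (cvg_limn_einf_sup cvh).1.
have sB k : sq_int L (fun x => u (N k) x - v x).
  have [m1 m2 _] := su (N k).
  have m3 := omeas_prB reB m1 mv1; have m4 := omeas_prB imB m2 mv2.
  split=> // c; apply/integrableP; split.
    by apply/measurable_EFinP; exact: (omeas_nsq m3 m4).
  rewrite (_ : (\int[mu]_(x in D) _)%E =
     (\int[mu]_(t in D) (nsq (u (N k) (t, c) - v (t, c)))%:E)%E); last first.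
    by apply: eq_integral => t _ /=; rewrite ger0_norm ?nsq_ge0.
  by apply: le_lt_trans (bnd (N k) k c (leqnn _)) (ltry _).
have sv : sq_int L v.
  have := sq_intB (su (N 0%N)) (sB 0%N); congr sq_int.
  by apply/funext => x; rewrite opprB addrC subrK.
exists v => // e e0.
(* The bound [bnd] is per channel, so the number of channels has to be absorbed in the choice of
   [k]. *)
have [k Hk] : exists k : nat, #|I|%:R * (2^-1 ^+ k) ^+ 2 <= e ^+ 2.
  have [k _ Hk] : \forall k \near \oo, (2^-1 : R) ^+ k < e ^+ 2 / (#|I|.+1)%:R.
    have c0 : (fun k => (2^-1 : R) ^+ k) @ \oo --> (0 : R).
      by apply: cvg_expr; rewrite ger0_norm//; lra.
    by apply: (cvgr_lt 0 c0); rewrite divr_gt0// exprn_gt0.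
  exists k; have := Hk k (leqnn k); rewrite /= ltr_pdivlMr// => h.
  set a := (2^-1 : R) ^+ k in h *.
  have a0 : 0 <= a by rewrite exprn_ge0.
  have a1 : a <= 1 by rewrite exprn_ile1//; lra.
  have I0 : 0 <= #|I|%:R :> R by exact: ler0n.
  by move: h; rewrite -[#|I|.+1]addn1 natrD; nra.
exists (N k) => n kn.
rewrite nrm_le ?(ltW e0)//; apply: le_trans Hk.
have [_ _ i] := sq_intB (su n) sv.
rewrite (_ : form _ _ _ = \sum_c Rintegral mu D (fun t => nsq (u n (t, c) - v (t, c))) / (2 * pi)); last first.
  by apply: eq_bigr => c _; congr (_ / _); apply: eq_Rintegral => t _; rewrite rdotzz.
rewrite (_ : #|I|%:R * _ = \sum_(c : I) (2^-1 ^+ k) ^+ 2); last first.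
  by rewrite sumr_const mulr_natl.
apply: ler_sum => c _.
rewrite ler_pdivrMr// mulrC -lee_fin /Rintegral fineK; first exact: bnd.
exact: (oint_fin c i).
Qed.

End RieszFischer.

(** * Algebra of the scattering matrix *)

Section JacobiAlgebra.
Variables (R : realType) (q d r : nat) (H : 'M[R[i]]_d) (V : 'M[R[i]]_(d, r)).
Notation C := R[i].
Hypothesis q0 : (0 < q)%N.
Hypothesis Hh : adjmx H = H.

Lemma NconjE (z : C) : Num.conj z = conjc z.
Proof. by []. Qed.
Lemma conjM (z w : C) : conjc (z * w) = conjc z * conjc w.
Proof. exact: (rmorphM (@conjc R)). Qed.
Lemma conjD (z w : C) : conjc (z + w) = conjc z + conjc w.
Proof. exact: (rmorphD (@conjc R)). Qed.
Lemma conjN (z : C) : conjc (- z) = - conjc z.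
Proof. exact: (rmorphN (@conjc R)). Qed.
Lemma conjV (z : C) : conjc z^-1 = (conjc z)^-1.
Proof. exact: conjc_inv. Qed.
Lemma conj1 : conjc (1 : C) = 1.
Proof. exact: rmorph1. Qed.

Lemma col0P m (u v : 'cV[C]_m) : (forall i, u i ord0 = v i ord0) -> u = v.
Proof.
by move=> uv; apply/matrixP => i [[|//] j0]; have -> : Ordinal j0 = ord0 by exact: val_inj.
Qed.

Lemma adjmxE m n (A : 'M[C]_(m, n)) : adjmx A = (map_mx (@conjc R) A)^T.
Proof. by apply/matrixP => i j; rewrite !mxE. Qed.
Lemma adjmxK m n (A : 'M[C]_(m, n)) : adjmx (adjmx A) = A.
Proof. by apply/matrixP => i j; rewrite !mxE conjcK. Qed.
Lemma adjmxM m n p (A : 'M[C]_(m, n)) (B : 'M[C]_(n, p)) :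
  adjmx (A *m B) = adjmx B *m adjmx A.
Proof. by rewrite !adjmxE map_mxM trmx_mul. Qed.
Lemma adjmxD m n (A B : 'M[C]_(m, n)) : adjmx (A + B) = adjmx A + adjmx B.
Proof. by rewrite !adjmxE map_mxD linearD. Qed.
Lemma adjmxN m n (A : 'M[C]_(m, n)) : adjmx (- A) = - adjmx A.
Proof. by rewrite !adjmxE map_mxN linearN. Qed.
Lemma adjmxZ m n (c : C) (A : 'M[C]_(m, n)) : adjmx (c *: A) = conjc c *: adjmx A.
Proof. by rewrite !adjmxE map_mxZ linearZ. Qed.
Lemma adjmx_scalar m (c : C) : adjmx (c%:M : 'M[C]_m) = (conjc c)%:M.
Proof. by rewrite !adjmxE map_scalar_mx tr_scalar_mx. Qed.
Lemma det_adjmx m (A : 'M[C]_m) : \det (adjmx A) = (\det A)^*.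
Proof. by rewrite adjmxE det_tr det_map_mx. Qed.

Definition ar : R := Num.sqrt q%:R.
Lemma ar_gt0 : 0 < ar. Proof. by rewrite sqrtr_gt0 ltr0n. Qed.

Notation a := (sqrtq R q).
Lemma sqrtqE : a = ar%:C. Proof. by []. Qed.
Lemma a_neq0 : a != 0.
Proof. by rewrite sqrtqE fmorph_eq0 gt_eqF// ar_gt0. Qed.
Lemma conj_a : conjc a = a. Proof. by rewrite sqrtqE conjc_real. Qed.

Notation F := (Fmx q H V).
Notation S := (Smx q H V).
Notation Vs := (adjmx V).

Lemma Fmx_conj z : adjmx (F z) = F (conjc z).
Proof.
rewrite /Fmx !adjmxD adjmxN adjmx_scalar adjmxZ adjmxM adjmxK Hh.
congr (_ - _%:M + _ *: _).
  by rewrite conjM conjD conjV conj_a.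
by rewrite conjM !conjV conj_a.
Qed.

Definition hdot m (u v : 'cV[C]_m) : C := (adjmx u *m v) ord0 ord0.
Lemma hdot_sum m (u v : 'cV[C]_m) : hdot u v = \sum_i (u i ord0)^* * v i ord0.
Proof. by rewrite /hdot mxE; apply: eq_bigr => i _; rewrite !mxE. Qed.
Lemma hdotuu m (u : 'cV[C]_m) : hdot u u = (\sum_i nsq (u i ord0))%:C.
Proof.
by rewrite hdot_sum rmorph_sum; apply: eq_bigr => i _; rewrite mulrC mulCJ.
Qed.
Lemma sum_nsq_eq0 m (u : 'cV[C]_m) : \sum_i nsq (u i ord0) = 0 -> u = 0.
Proof.
move=> /eqP; rewrite psumr_eq0; last by move=> i _; exact: nsq_ge0.
move=> /allP h; apply/matrixP => i j; rewrite mxE ord1; apply: nsq_eq0.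
by apply/eqP; exact: (h i (mem_index_enum _)).
Qed.
Lemma hdot_herm m (A : 'M[C]_m) (u : 'cV[C]_m) : adjmx A = A ->
  im (hdot u (A *m u)) = 0.
Proof.
move=> hA; have e : (hdot u (A *m u))^* = hdot u (A *m u).
  rewrite /hdot; set B := adjmx u *m (A *m u).
  have -> : (B ord0 ord0)^* = (adjmx B) ord0 ord0 by rewrite !mxE.
  by rewrite /B !adjmxM adjmxK hA mulmxA.
by have := congr1 (@complex.Im R) e; rewrite im_conj; lra.
Qed.

(** The imaginary part of the pairing of [F z u] with [u] is, up to sign, [im z] times a quantity
    that is positive as soon as [|z| > 1]. *)
Lemma Fmx_kernel_real z (u : 'cV[C]_d) : 1 < nsq z -> u != 0 -> F z *m u = 0 ->
  im z = 0.
Proof.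
move=> z1 u0 Fu.
have z2 : 0 < nsq z by apply: lt_trans z1.
have /(congr1 (@complex.Im R)) : hdot u (F z *m u) = 0.
  by rewrite Fu /hdot mulmx0 mxE.
rewrite /Fmx mulmxDl mulmxBl -scalemxAl mul_scalar_mx.
have hD (x y : 'cV[C]_d) : hdot u (x + y) = hdot u x + hdot u y.
  by rewrite /hdot mulmxDr mxE.
have hN (x : 'cV[C]_d) : hdot u (- x) = - hdot u x.
  by rewrite /hdot mulmxN mxE.
have hZ c (x : 'cV[C]_d) : hdot u (c *: x) = c * hdot u x.
  by rewrite /hdot -scalemxAr mxE.
have hV : hdot u (V *m Vs *m u) = hdot (Vs *m u) (Vs *m u).
  by rewrite /hdot adjmxM adjmxK !mulmxA.
rewrite !hD hN !hZ hV !hdotuu imD imD imN (hdot_herm u Hh) add0r.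
set nu := \sum_i _; set nv := \sum_i _.
have nu0 : 0 < nu.
  rewrite lt_neqAle sumr_ge0 ?andbT => [|i _]; last exact: nsq_ge0.
  by rewrite eq_sym; apply: contra_neq u0 => /sum_nsq_eq0.
have nv0 : 0 <= nv by apply: sumr_ge0 => i _; exact: nsq_ge0.
have invz : z^-1 = (nsq z)^-1%:C * z^*.
  have zn0 : z != 0.
    by apply: contraTneq z2 => ->; rewrite nsq0 ltxx.
  apply: (mulfI zn0); rewrite mulfV// mulrCA mulCJ -rmorphM mulVf ?rmorph1//.
  by rewrite gt_eqF.
have a0 := ar_gt0.
rewrite sqrtqE -fmorphV invz !reimE /= => h.
have : im z * (ar * (1 - (nsq z)^-1) * nu + (nsq z)^-1 * ar^-1 * nv) = 0.
  by move: h; set iz := im z; move=> h; rewrite -[RHS]oppr0 -h; ring.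
move=> /eqP; rewrite mulf_eq0 => /orP[/eqP//|]; rewrite gt_eqF//.
rewrite ltr_wpDr ?mulr_ge0 ?invr_ge0 ?(ltW a0) ?(ltW z2)//.
by rewrite !mulr_gt0// subr_gt0 invf_lt1.
Qed.

(** [Psi] at an arbitrary complex parameter: the convergent Eisenstein series live at [|z| > 1], the
    transform at [|z| = 1]. *)
Definition PsiZ (z : C) (al : 'cV[C]_r) (x : jidx d r) : C :=
  match x with
  | inl i => ((z^-1 - z) *: (invmx (F z) *m V *m al)) i ord0
  | inr (c, n) => z ^+ n.+1 * al c ord0 + z ^- n.+1 * (S z *m al) c ord0
  end.

Lemma PsiE t al x : Psi q H V t al x = PsiZ (cos t +i* sin t) al x.
Proof. by []. Qed.

Lemma Smx_mul z (al : 'cV[C]_r) : S z *m al = - al +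
  a^-1 *: (Vs *m ((z^-1 - z) *: (invmx (F z) *m V *m al))).
Proof.
rewrite /Smx; move: (invmx (F z)) => X.
by rewrite mulmxDl mulNmx mul1mx -scalemxAl -!scalemxAr scalerA !mulmxA [_ / _]mulrC.
Qed.

Lemma PsiZ_eigen z al x : z != 0 -> F z \in unitmx ->
  jacobi q H V (PsiZ z al) x = a * (z + z^-1) * PsiZ z al x.
Proof.
move=> z0 uF; have an0 := a_neq0.
set u := (z^-1 - z) *: (invmx (F z) *m V *m al).
have Fu : F z *m u = (z^-1 - z) *: (V *m al).
  by rewrite /u; move: (F z) uF => Fz uFz; rewrite -scalemxAr -mulmxA mulKVmx.
have Su : S z *m al = - al + a^-1 *: (Vs *m u) by exact: Smx_mul.
case: x => [i|[c [|n]]] /=.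
- have -> : \sum_i' H i i' * u i' ord0 = (H *m u) i ord0 by rewrite mxE.
  have -> : \sum_c V i c * (z ^+ 1 * al c ord0 + z ^- 1 * (S z *m al) c ord0) =
     (V *m (z *: al + z^-1 *: (S z *m al))) i ord0.
    by rewrite mxE; apply: eq_bigr => c _; rewrite !mxE expr1.
  have := congr1 (fun A : 'cV[C]_d => A i ord0) Fu.
  rewrite /Fmx mulmxDl mulmxBl -scalemxAl mul_scalar_mx Su -/u.
  clearbody u; rewrite mulmxDr -!scalemxAr mulmxDr mulmxN -scalemxAr mulmxA.
  move: (H *m u) (V *m al) (V *m Vs *m u) => X Y Z; rewrite !mxE.
  move: (X i ord0) (Y i ord0) (Z i ord0) (u i ord0) => x y0 z1 ui h.
  rewrite -[LHS]subr0 -(subrr ((z^-1 - z) * y0)) -{1}h.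
  by ring.
- have -> : \sum_i Vs c i * u i ord0 = (Vs *m u) c ord0 by rewrite mxE.
  have -> : (Vs *m u) c ord0 = a * ((S z *m al) c ord0 + al c ord0).
    by rewrite Su !mxE addrAC addNr add0r mulrA mulfV// mul1r.
  by move: (S z *m al) => Y; rewrite !expr1; field.
- by move: (S z *m al) => Y; rewrite !exprS; field; rewrite expf_neq0.
Qed.

(** On a ray the three-term recurrence has the independent solutions [z^n] and [z^-n], as
    [z^2 != 1]. The equations at the core and at the first ray vertices then determine the core
    values and the coefficients [b] from [al]. The second conclusion keeps the ray form at hand for
    matching growth. *)
Lemma eigen_is_PsiZ z (e : jidx d r -> C) : z != 0 -> z ^+ 2 != 1 -> F z \in unitmx ->
  (forall x, jacobi q H V e x = a * (z + z^-1) * e x) ->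
  exists al : 'cV[C]_r, (forall x, e x = PsiZ z al x) /\
    exists b : 'cV[C]_r, forall c n,
      e (inr (c, n)) = z ^+ n.+1 * al c ord0 + z ^- n.+1 * b c ord0.
Proof.
move=> z0 z21 uF Je; have an0 := a_neq0.
have zz : z ^+ 2 - 1 != 0 by rewrite subr_eq0.
pose al : 'cV[C]_r := \col_c ((e (inr (c, 1%N)) - z^-1 * e (inr (c, 0%N))) / (z ^+ 2 - 1)).
pose b : 'cV[C]_r := \col_c (z * (e (inr (c, 0%N)) - z * al c ord0)).
have bE c : b c ord0 = z * (e (inr (c, 0%N)) - z * al c ord0) by rewrite mxE.
have alE c : al c ord0 * (z ^+ 2 - 1) = e (inr (c, 1%N)) - z^-1 * e (inr (c, 0%N)).
  by rewrite mxE divfK.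
clearbody al b.
have form c n : e (inr (c, n)) = z ^+ n.+1 * al c ord0 + z ^- n.+1 * b c ord0 /\
    e (inr (c, n.+1)) = z ^+ n.+2 * al c ord0 + z ^- n.+2 * b c ord0.
  elim: n => [|n [IH1 IH2]].
    rewrite bE; have := alE c; set E0 := e (inr (c, 0%N)); set E1 := e (inr (c, 1%N)).
    move: (al c ord0) => A h.
    split; first by field.
    rewrite -[LHS](subrK (z^-1 * E0)) -h; by field.
  split=> //; have := Je (inr (c, n.+1)); rewrite /= IH1 IH2 => h.
  apply: (mulfI an0); apply: (addrI (a * (z ^+ n.+1 * al c ord0 + z ^- n.+1 * b c ord0))).
  rewrite -mulrDr h; move: (al c ord0) (b c ord0) => A B.
  by rewrite !exprS; field; rewrite expf_neq0.
pose u : 'cV[C]_d := \col_i e (inl i).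
have uE i : u i ord0 = e (inl i) by rewrite mxE.
have Vu : Vs *m u = a *: (al + b).
  apply: col0P => c; have := Je (inr (c, 0%N)); rewrite /=.
  have -> : \sum_i Vs c i * e (inl i) = (Vs *m u) c ord0.
    by rewrite [RHS]mxE; apply: eq_bigr => i _; rewrite uE.
  rewrite (form c 0%N).1 (form c 0%N).2.
  clear bE alE form; rewrite [(a *: (al + b)) c _]mxE [(al + b) c _]mxE.
  move: (Vs *m u) al b => Y A B.
  move: (Y c ord0) (A c ord0) (B c ord0) => y A0 B0 h.
  apply: (addrI (a * (z ^+ 2 * A0 + z ^- 2 * B0))); rewrite h.
  by field.
have Fu : F z *m u = (z^-1 - z) *: (V *m al).
  rewrite /Fmx mulmxDl mulmxBl -scalemxAl mul_scalar_mx -mulmxA Vu.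
  apply: col0P => i; have := Je (inl i); rewrite /=.
  have -> : \sum_i' H i i' * e (inl i') = (H *m u) i ord0.
    by rewrite [RHS]mxE; apply: eq_bigr => i' _; rewrite uE.
  have -> : \sum_c V i c * e (inr (c, 0%N)) = (V *m (z *: al + z^-1 *: b)) i ord0.
    rewrite [RHS]mxE; apply: eq_bigr => c _; rewrite (form c 0%N).1.
    by rewrite ![in RHS]mxE !expr1.
  rewrite mulmxDr -!scalemxAr mulmxDr -uE; clearbody u.
  move: (H *m u) (V *m al) (V *m b) => X Y Z; rewrite !mxE.
  move: (X i ord0) (Y i ord0) (Z i ord0) (u i ord0) => x y0 z1 ui h.
  rewrite mulrA divfK// -[RHS]addr0 -[in RHS](subrr (a * (z + z^-1) * ui)) -{1}h.
  by ring.
have ue : u = (z^-1 - z) *: (invmx (F z) *m V *m al).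
  by rewrite -mulmxA scalemxAr -Fu; move: (F z) uF => Fz uFz; rewrite mulKmx.
have be : b = S z *m al.
  by rewrite Smx_mul -ue Vu scalerA mulVf// scale1r addrA addNr add0r.
exists al; split; last by exists b => c n; exact: (form c n).1.
case=> [i|[c n]] /=; last by rewrite -be; exact: (form c n).1.
by rewrite -ue mxE.
Qed.

(** Only the last term of [F] changes under [z] to [z^-1]. *)
Lemma Fmx_sub z : z != 0 -> F z - F z^-1 = ((z^-1 - z) / a) *: (V *m Vs).
Proof.
move=> z0; rewrite /Fmx invrK.
have -> : a * (z^-1 + z) = a * (z + z^-1) by rewrite addrC.
rewrite opprD addrACA subrr add0r -scalerBl -mulrBl.
by [].
Qed.

Lemma resolvent_identity z : z != 0 -> F z \in unitmx -> F z^-1 \in unitmx ->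
  ((z^-1 - z) / a) *: (invmx (F z) *m (V *m Vs) *m invmx (F z^-1)) =
  invmx (F z^-1) - invmx (F z).
Proof.
move=> z0; have := Fmx_sub z0; move: (F z) (F z^-1) => F1 F2 h u1 u2.
rewrite scalemxAl scalemxAr -h mulmxBr mulmxBl mulVmx// mul1mx.
by rewrite -mulmxA mulmxV// mulmx1.
Qed.

(** The quadratic term of the product cancels the linear ones by [resolvent_identity] compressed
    with [V] on both sides. On the unit circle [z^-1] is the conjugate of [z], and with [Smx_adj]
    this is unitarity. *)
Lemma Smx_unitary z : z != 0 -> F z \in unitmx -> F z^-1 \in unitmx ->
  S z *m S z^-1 = 1%:M.
Proof.
move=> z0 u1 u2; have := resolvent_identity z0 u1 u2; rewrite /Smx invrK.
move: (invmx (F z)) (invmx (F z^-1)) => X1 X2.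
have -> : (z - z^-1) / a = - ((z^-1 - z) / a) by rewrite -mulNr opprB.
move: ((z^-1 - z) / a) => k key.
have AB : k *: ((Vs *m X1 *m V) *m (Vs *m X2 *m V)) = Vs *m X2 *m V - Vs *m X1 *m V.
  rewrite -mulmxBl -mulmxBr -key -!scalemxAr -!scalemxAl; congr (_ *: _).
  by rewrite !mulmxA.
move: AB; move: (Vs *m X1 *m V) (Vs *m X2 *m V) => A B AB.
rewrite mulmxDl mulNmx mul1mx mulmxDr mulmxN mulmx1 -!scalemxAl -scalemxAr.
apply/matrixP => i j; have := congr1 (fun M : 'M[C]_r => M i j) AB.
move: (A *m B) => Y; rewrite !mxE => h.
have h2 : k * (k * Y i j) = k * (B i j - A i j) by rewrite h.
by rewrite -[RHS]addr0 -[in RHS](subrr (k * (k * Y i j))) {1}h2; ring.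
Qed.

(** Functional equation of the core part of [PsiZ]: the resolvent identity again, compressed with
    [V] on the right only. *)
Lemma core_functional z : z != 0 -> F z \in unitmx -> F z^-1 \in unitmx ->
  ((z^-1 - z) *: (invmx (F z) *m V)) *m S z^-1 = (z - z^-1) *: (invmx (F z^-1) *m V).
Proof.
move=> z0 u1 u2; have := resolvent_identity z0 u1 u2; rewrite /Smx invrK.
move: (invmx (F z)) (invmx (F z^-1)) => X1 X2.
have -> : (z - z^-1) / a = - ((z^-1 - z) / a) by rewrite -mulNr opprB.
move: ((z^-1 - z) / a) => k key.
have AB : k *: ((X1 *m V) *m (Vs *m X2 *m V)) = X2 *m V - X1 *m V.
  by rewrite -mulmxBl -key -!scalemxAl; congr (_ *: _); rewrite !mulmxA.
move: AB; rewrite -scalemxAl mulmxDr mulmxN mulmx1 -scalemxAr.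
move: (X1 *m V *m _) => Y; move: (X1 *m V) (X2 *m V) => A B AB.
apply/matrixP => i j; have := congr1 (fun M : 'M[C]_(d, r) => M i j) AB.
rewrite !mxE => h.
by rewrite mulNr h; ring.
Qed.

Lemma Smx_adj z : S (conjc z) = adjmx (S z).
Proof.
rewrite /Smx adjmxD adjmxN adjmx_scalar conj1 adjmxZ !adjmxM adjmxK.
have -> : adjmx (invmx (F z)) = invmx (F (conjc z)).
  by rewrite -Fmx_conj !adjmxE map_invmx trmx_inv.
rewrite mulmxA; congr (_ + _ *: _).
by rewrite conjM conjD conjN !conjV conj_a.
Qed.

End JacobiAlgebra.

(** * Laurent polynomials and their symmetrization *)

Section Laurent.
Variable R : realType.
Notation C := R[i].

(** Equality is asked only off 0, where the inverse takes a default value. *)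
Definition laurent (f : C -> C) : Prop := exists (N : nat) (p : {poly C}),
  forall z : C, z != 0 -> f z = p.[z] / z ^+ N.

Lemma eq_laurent f g : (forall z : C, z != 0 -> f z = g z) -> laurent f -> laurent g.
Proof. by move=> fg [N [p h]]; exists N, p => z z0; rewrite -fg// h. Qed.
Lemma laurentC c : laurent (fun=> c).
Proof. by exists 0%N, c%:P => z _; rewrite hornerC expr0 divr1. Qed.
Lemma laurentX : laurent id.
Proof. by exists 0%N, 'X => z _; rewrite hornerX expr0 divr1. Qed.
Lemma laurentV : laurent GRing.inv.
Proof. by exists 1%N, 1 => z _; rewrite hornerE expr1 div1r. Qed.
Lemma laurentM f g : laurent f -> laurent g -> laurent (fun z => f z * g z).
Proof.
move=> [N [p hp]] [M [s hs]]; exists (N + M)%N, (p * s) => z z0.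
by rewrite hp// hs// hornerM exprD invfM mulrACA.
Qed.
Lemma laurentD f g : laurent f -> laurent g -> laurent (fun z => f z + g z).
Proof.
move=> [N [p hp]] [M [s hs]]; exists (N + M)%N, (p * 'X^M + s * 'X^N) => z z0.
rewrite hp// hs// !hornerE /= exprD; have := expf_neq0 N z0; have := expf_neq0 M z0.
by move: (z ^+ N) (z ^+ M) => a b b0 a0; field; rewrite ?a0 ?b0.
Qed.
Lemma laurentN f : laurent f -> laurent (fun z => - f z).
Proof.
move=> /(laurentM (laurentC (-1))); apply: eq_laurent => z _; exact: mulN1r.
Qed.
Lemma laurentB f g : laurent f -> laurent g -> laurent (fun z => f z - g z).
Proof. by move=> lf /laurentN; exact: laurentD. Qed.
Lemma laurent_sum (T : Type) (s : seq T) (F : T -> C -> C) :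
  (forall i, laurent (F i)) -> laurent (fun z => \sum_(i <- s) F i z).
Proof.
move=> lF; elim: s => [|i s IH].
  by under eq_fun do rewrite big_nil; exact: laurentC.
by under eq_fun do rewrite big_cons; exact: laurentD.
Qed.
Lemma laurent_prod (T : Type) (s : seq T) (F : T -> C -> C) :
  (forall i, laurent (F i)) -> laurent (fun z => \prod_(i <- s) F i z).
Proof.
move=> lF; elim: s => [|i s IH].
  by under eq_fun do rewrite big_nil; exact: laurentC.
by under eq_fun do rewrite big_cons; exact: laurentM.
Qed.
Lemma laurentXn f n : laurent f -> laurent (fun z => f z ^+ n).
Proof.
move=> lf; elim: n => [|n IH].
  by under eq_fun do rewrite expr0; exact: laurentC.
by under eq_fun do rewrite exprS; exact: laurentM.
Qed.
Lemma laurent_horner (p : {poly C}) f : laurent f -> laurent (fun z => p.[f z]).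
Proof.
move=> lf; under eq_fun do rewrite horner_coef.
by apply: laurent_sum => i; apply: laurentM; [exact: laurentC|exact: laurentXn].
Qed.
Lemma laurent_inv f : laurent f -> laurent (fun z => f z^-1).
Proof.
move=> [N [p hp]].
have : laurent (fun z => p.[z^-1] * z ^+ N).
  apply: laurentM; first by apply: laurent_horner; exact: laurentV.
  by apply: laurentXn; exact: laurentX.
by apply: eq_laurent => z z0; rewrite hp ?invr_eq0// exprVn invrK.
Qed.
Lemma laurent_det n (A : C -> 'M[C]_n) : (forall i j, laurent (fun z => A z i j)) ->
  laurent (fun z => \det (A z)).
Proof.
move=> lA; rewrite /determinant; apply: laurent_sum => s; apply: laurentM.
  exact: laurentC.
by apply: laurent_prod => i.
Qed.
Lemma laurent_adj n (A : C -> 'M[C]_n) : (forall i j, laurent (fun z => A z i j)) ->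
  forall i j, laurent (fun z => (\adj (A z)) i j).
Proof.
move=> lA i j; under eq_fun do rewrite mxE /cofactor.
apply: laurentM; first exact: laurentC.
by apply: laurent_det => k l; under eq_fun do rewrite !mxE; exact: lA.
Qed.
Lemma laurent_mulmx m n p (A : C -> 'M[C]_(m, n)) (B : C -> 'M[C]_(n, p)) :
  (forall i j, laurent (fun z => A z i j)) -> (forall i j, laurent (fun z => B z i j)) ->
  forall i j, laurent (fun z => (A z *m B z) i j).
Proof.
move=> lA lB i j; under eq_fun do rewrite mxE.
by apply: laurent_sum => k; exact: laurentM.
Qed.

(** Two consecutive degrees are carried together since the recurrence [t(k+2) = X t(k+1) - t(k)] has
    order two. *)
Lemma chebyshev (k : nat) : exists t : {poly C}, forall z : C, z != 0 ->
  t.[z + z^-1] = z ^+ k + z ^- k.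
Proof.
suff : exists t t' : {poly C}, forall z : C, z != 0 ->
    t.[z + z^-1] = z ^+ k + z ^- k /\ t'.[z + z^-1] = z ^+ k.+1 + z ^- k.+1.
  by move=> [t [t' h]]; exists t => z /h[].
elim: k => [|k [t [t' h]]].
  by exists (2%:P), 'X => z z0; rewrite !hornerE expr0 invr1 expr1.
exists t', ('X * t' - t) => z z0; have [h1 h2] := h _ z0; split=> //.
by rewrite !hornerE h1 h2 !exprS; field; rewrite expf_neq0.
Qed.

Lemma chebyshev2 (k l : nat) : exists t : {poly C}, forall z : C, z != 0 ->
  t.[z + z^-1] = z ^+ k / z ^+ l + z ^+ l / z ^+ k.
Proof.
wlog kl : k l / (k <= l)%N.
  move=> W; have [/W//|/ltnW/W[t h]] := leqP k l.
  by exists t => z /h ->; rewrite addrC.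
have [t h] := chebyshev (l - k); exists t => z z0; rewrite h//.
rewrite -(subnK kl) addnK exprD; have := expf_neq0 k z0; have := expf_neq0 (l - k) z0.
by move: (z ^+ k) (z ^+ (l - k)) => A B B0 A0; field; rewrite A0.
Qed.

(** The product is invariant under [z] to [z^-1]; averaging its expansion with the reflected one
    expresses it by sums [z^(k-l) + z^(l-k)], each a polynomial in [z + z^-1]. This turns a
    determinant into a function of the spectral parameter. *)
Lemma laurent_norm (f : C -> C) : laurent f -> exists p : {poly C},
  forall z : C, z != 0 -> p.[z + z^-1] = f z * f z^-1.
Proof.
move=> [N [s hs]].
pose T (k l : nat) := projT1 (cid (chebyshev2 k l)).
have TE k l z : z != 0 -> (T k l).[z + z^-1] = z ^+ k / z ^+ l + z ^+ l / z ^+ k.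
  by rewrite /T; case: cid => t /=; exact.
exists (2^-1 *: \sum_(k < size s) \sum_(l < size s) (s`_k * s`_l) *: T k l) => z z0.
rewrite hornerZ horner_sum hs// hs ?invr_eq0//.
have -> : s.[z] / z ^+ N * (s.[z^-1] / z^-1 ^+ N) = s.[z] * s.[z^-1].
  by rewrite exprVn; field; rewrite expf_neq0// expf_neq0// invr_eq0.
have e1 : s.[z] * s.[z^-1] = \sum_(k < size s) \sum_(l < size s) s`_k * s`_l * (z ^+ k / z ^+ l).
  rewrite !horner_coef mulr_suml; apply: eq_bigr => k _; rewrite mulr_sumr.
  by apply: eq_bigr => l _; rewrite exprVn; ring.
have e2 : s.[z] * s.[z^-1] = \sum_(k < size s) \sum_(l < size s) s`_k * s`_l * (z ^+ l / z ^+ k).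
  by rewrite e1 exchange_big; do 2![apply: eq_bigr => ? _]; ring.
apply: (mulfI (_ : 2 != 0 :> C)); first by rewrite pnatr_eq0.
rewrite mulrA divff ?mul1r ?pnatr_eq0// mulr_natl mulr2n {1}e1 e2 -big_split /=.
apply: eq_bigr => k _; rewrite horner_sum -big_split /=; apply: eq_bigr => l _.
by rewrite hornerZ TE// mulrDr.
Qed.

End Laurent.

(** * Integrals over the upper half circle *)

Section CircleIntegral.
Variable R : realType.
Notation C := R[i].
Notation mu := (@lebesgue_measure R).
Notation D := (`]0, (pi : R)[%classic : set R).

Definition zt (t : R) : C := cos t +i* sin t.

Lemma nsq_zt t : nsq (zt t) = 1.
Proof. by rewrite /nsq /= cos2Dsin2. Qed.
Lemma zt_neq0 t : zt t != 0.
Proof. by apply: contra_eqN (nsq_zt t) => /eqP ->; rewrite nsq0 eq_sym oner_eq0. Qed.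
Lemma unit_inv (z : C) : nsq z = 1 -> z^-1 = conjc z.
Proof.
move=> z1; have z0 : z != 0.
  by apply: contra_eqN z1 => /eqP ->; rewrite nsq0 eq_sym oner_eq0.
by apply: (mulfI z0); rewrite divff// mulCJ z1.
Qed.
Lemma zt_inv t : (zt t)^-1 = conjc (zt t).
Proof. exact: unit_inv (nsq_zt t). Qed.
Lemma ztX t k : zt t ^+ k = cos (k%:R * t) +i* sin (k%:R * t).
Proof.
elim: k => [|k IH]; first by rewrite expr0 mul0r cos0 sin0.
rewrite exprS IH (_ : k.+1%:R * t = t + k%:R * t); last by rewrite -natr1; ring.
rewrite cosD sinD /zt; set A := cos (_ * t); set B := sin (_ * t).
by apply: complexP => /=; ring.
Qed.
Lemma ztXX t k : zt t ^+ k + zt t ^- k = (2 * cos (k%:R * t))%:C.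
Proof.
rewrite -exprVn zt_inv -(rmorphXn (@conjc R)) ztX.
by apply: complexP; rewrite !reimE /=; ring.
Qed.
Lemma ztDV t : zt t + (zt t)^-1 = (2 * cos t)%:C.
Proof. by have := ztXX t 1; rewrite mul1r !expr1. Qed.
Lemma reDf (f g : R -> C) : (fun t => re (f t + g t)) = (fun t => re (f t) + re (g t)).
Proof. by apply/funext => t; rewrite reD. Qed.
Lemma imDf (f g : R -> C) : (fun t => im (f t + g t)) = (fun t => im (f t) + im (g t)).
Proof. by apply/funext => t; rewrite imD. Qed.
Lemma reMf (f g : R -> C) :
  (fun t => re (f t * g t)) = (fun t => re (f t) * re (g t) - im (f t) * im (g t)).
Proof. by apply/funext => t; rewrite reM. Qed.
Lemma imMf (f g : R -> C) :
  (fun t => im (f t * g t)) = (fun t => re (f t) * im (g t) + im (f t) * re (g t)).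
Proof. by apply/funext => t; rewrite imM. Qed.
Lemma reRMf (a : R) (f : R -> C) : (fun t => re (a%:C * f t)) = (fun t => a * re (f t)).
Proof. by apply/funext => t; rewrite !reimE mul0r subr0. Qed.
Lemma imRMf (a : R) (f : R -> C) : (fun t => im (a%:C * f t)) = (fun t => a * im (f t)).
Proof. by apply/funext => t; rewrite !reimE mul0r addr0. Qed.
Lemma reiMf (f : R -> C) : (fun t => re ('i * f t)) = (fun t => - im (f t)).
Proof. by apply/funext => t; rewrite !reimE mul0r mul1r sub0r. Qed.
Lemma imiMf (f : R -> C) : (fun t => im ('i * f t)) = (fun t => re (f t)).
Proof. by apply/funext => t; rewrite !reimE mul0r mul1r add0r. Qed.
Lemma reconjf (f : R -> C) : (fun t => re (conjc (f t))) = (fun t => re (f t)).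
Proof. by apply/funext => t; rewrite re_conj. Qed.
Lemma imconjf (f : R -> C) : (fun t => im (conjc (f t))) = (fun t => - im (f t)).
Proof. by apply/funext => t; rewrite im_conj. Qed.

Definition bmf (f : R -> C) : Prop :=
  [/\ measurable_fun D (fun t => re (f t)), measurable_fun D (fun t => im (f t))
    & exists B, forall t, nsq (f t) <= B].

Lemma bmfC c : bmf (fun=> c).
Proof. by split; try exact: measurable_cst; exists (nsq c). Qed.

Lemma bmfD f g : bmf f -> bmf g -> bmf (fun t => f t + g t).
Proof.
move=> [f1 f2 [A fA]] [g1 g2 [B gB]]; split.
- by rewrite reDf; exact: measurable_funD.
- by rewrite imDf; exact: measurable_funD.
exists (2 * A + 2 * B) => t.
have := nsq_lc 1 (f t) (g t); rewrite mul1r => /le_trans; apply.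
have -> : nsq (1 : C) = 1 by rewrite /nsq !reimE expr1n expr0n addr0.
by rewrite mulr1 lerD// ler_pM2l.
Qed.

Lemma bmfM f g : bmf f -> bmf g -> bmf (fun t => f t * g t).
Proof.
move=> [f1 f2 [A fA]] [g1 g2 [B gB]]; split.
- by rewrite reMf; apply: measurable_funB; exact: measurable_funM.
- by rewrite imMf; apply: measurable_funD; exact: measurable_funM.
by exists (A * B) => t; rewrite nsqM ler_pM// nsq_ge0.
Qed.

Lemma bmf_conj f : bmf f -> bmf (fun t => conjc (f t)).
Proof.
move=> [f1 f2 [A fA]]; split.
- by rewrite reconjf.
- rewrite imconjf (_ : (fun t => - im (f t)) = (fun t => 0 - im (f t))).
    by apply: measurable_funB => //; exact: measurable_cst.
  by apply/funext => t; rewrite sub0r.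
by exists A => t; rewrite nsq_conj.
Qed.

Lemma bmf_sum (T : Type) (s : seq T) (F : T -> R -> C) :
  (forall i, bmf (F i)) -> bmf (fun t => \sum_(i <- s) F i t).
Proof.
move=> lF; elim: s => [|i s IH].
  by under eq_fun do rewrite big_nil; exact: bmfC.
by under eq_fun do rewrite big_cons; exact: bmfD.
Qed.

Lemma bmfX f n : bmf f -> bmf (fun t => f t ^+ n).
Proof.
move=> bf; elim: n => [|n IH].
  by under eq_fun do rewrite expr0; exact: bmfC.
by under eq_fun do rewrite exprS; exact: bmfM.
Qed.

Lemma bmf_horner (p : {poly C}) f : bmf f -> bmf (fun t => p.[f t]).
Proof.
move=> bf; under eq_fun do rewrite horner_coef.
by apply: bmf_sum => i; apply: bmfM; [exact: bmfC|exact: bmfX].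
Qed.

Lemma bmf_zt : bmf zt.
Proof.
split; [exact: measurable_cos|exact: measurable_sin|].
by exists 1 => t; rewrite nsq_zt.
Qed.

Lemma bmf_laurent f : laurent f -> bmf (fun t => f (zt t)).
Proof.
move=> [N [p fE]]; have -> : (fun t => f (zt t)) = (fun t => p.[zt t] * conjc (zt t) ^+ N).
  by apply/funext => t; rewrite fE ?zt_neq0// -zt_inv exprVn.
apply: bmfM; first by apply: bmf_horner; exact: bmf_zt.
by apply: bmfX; apply: bmf_conj; exact: bmf_zt.
Qed.

Lemma finite_D : (mu D < +oo)%E.
Proof. by rewrite lebesgue_measure_itv /= lte_fin pi_gt0 -EFinB ltry. Qed.

Lemma bmf_re_int f : bmf f -> mu.-integrable D (EFin \o (fun t => re (f t))).
Proof.
move=> [f1 f2 [B fB]]; apply: measurable_bounded_integrable => //.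
- exact: finite_D.
exists (1 + B); split; first exact: num_real.
move=> M BM t _ /=; apply: le_trans (ltW BM); have := fB t; rewrite /nsq ler_norml.
have := sqr_ge0 (im (f t)); have := sqr_ge0 (re (f t) - 1); have := sqr_ge0 (re (f t) + 1).
by nra.
Qed.

Lemma bmf_im_int f : bmf f -> mu.-integrable D (EFin \o (fun t => im (f t))).
Proof.
move=> bf; have /bmf_re_int := bmfM (bmfC (- 'i)) bf.
congr (mu.-integrable _ (EFin \o _)); apply/funext => t.
by rewrite !reimE oppr0 mul0r sub0r mulN1r opprK.
Qed.

(** Half of a contour integral when the integrand is symmetric under [z] to [z^-1], as in
    [cI_laurent] and [cI_tz]. *)
Definition cI (f : R -> C) : C :=
  (Rintegral mu D (fun t => re (f t)) / (2 * pi)) +i*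
  (Rintegral mu D (fun t => im (f t)) / (2 * pi)).

Lemma eq_cI f g : (forall t, f t = g t) -> cI f = cI g.
Proof. by move=> fg; congr cI; apply/funext. Qed.

Lemma cID f g : bmf f -> bmf g -> cI (fun t => f t + g t) = cI f + cI g.
Proof.
move=> bf bg; apply: complexP; rewrite ?reD ?imD /cI /= -mulrDl; congr (_ / _).
- by rewrite reDf; apply: RintegralD => //; exact: bmf_re_int.
- by rewrite imDf; apply: RintegralD => //; exact: bmf_im_int.
Qed.

Lemma cIRZ (a : R) f : bmf f -> cI (fun t => a%:C * f t) = a%:C * cI f.
Proof.
move=> bf; apply: complexP; rewrite !reimE !mul0r ?subr0 ?addr0 /cI /= mulrA;
  congr (_ / _).
- by rewrite reRMf; apply: RintegralZl => //; exact: bmf_re_int.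
- by rewrite imRMf; apply: RintegralZl => //; exact: bmf_im_int.
Qed.

Lemma cIiZ f : bmf f -> cI (fun t => 'i * f t) = 'i * cI f.
Proof.
(* The imaginary part of this instance is the integral of [- im (f t)], which is what multiplication
   by ['i] puts in the real part. *)
move=> bf; have := congr1 (@complex.Im R) (cIRZ (-1) bf).
rewrite /cI /= imRMf reiMf imiMf mul0r addr0 => h; apply: complexP => /=; last by ring.
rewrite !mul0r sub0r mul1r -mulN1r -h; congr (Rintegral _ _ _ / _).
by apply/funext => t; rewrite mulN1r.
Qed.

Lemma cIZ a f : bmf f -> cI (fun t => a * f t) = a * cI f.
Proof.
move=> bf; have aE : a = (re a)%:C + (im a)%:C * 'i.
  by apply: complexP; rewrite !reimE; ring.
rewrite {2}aE mulrDl -mulrA -cIiZ// -cIRZ// -cIRZ; last by apply: bmfM => //; exact: bmfC.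
rewrite -cID; try by do ?[apply: bmfM => //; try exact: bmfC].
by apply: eq_cI => t; rewrite {1}aE; ring.
Qed.

Lemma cI_sum (T : Type) (s : seq T) (F : T -> R -> C) : (forall i, bmf (F i)) ->
  cI (fun t => \sum_(i <- s) F i t) = \sum_(i <- s) cI (F i).
Proof.
move=> bF; elim: s => [|i s IH].
  rewrite big_nil; under eq_fun do rewrite big_nil.
  rewrite -[RHS](mul0r (cI (fun=> 0))) -(cIRZ 0 (bmfC 0)).
  by apply: eq_cI => t; rewrite mul0r.
rewrite big_cons -IH -cID//; last exact: bmf_sum.
by apply: eq_cI => t; rewrite big_cons.
Qed.

Lemma Rintegral_cosk k : (0 < k)%N -> Rintegral mu D (fun t => cos (k%:R * t)) = 0.
Proof.
move=> k0; have kn0 : k%:R != 0 :> R by rewrite pnatr_eq0 -lt0n.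
pose F (t : R) := k%:R^-1 * sin (k%:R * t) : R.
have dk (t : R) : is_derive t 1 (fun t : R => k%:R * t : R) (k%:R : R).
  by have := is_deriveZ (k%:R : R) (is_derive_id t 1); rewrite /GRing.scale /= mulr1.
have dF (t : R) : is_derive t 1 F (cos (k%:R * t)).
  have := is_deriveZ (k%:R^-1 : R) (is_derive1_comp (is_derive_sin (k%:R * t)) (dk t)).
  by rewrite /GRing.scale /= mulrCA mulVf// mulr1.
have cF (t : R) : {for t, continuous F}.
  apply: differentiable_continuous; apply/derivable1_diffP.
  by case: (dF t).
have ck (t : R) : {for t, continuous (fun t : R => cos (k%:R * t) : R)}.
  apply: continuous_comp; last exact: continuous_cos.
  by apply: differentiable_continuous; apply/derivable1_diffP; case: (dk t).
rewrite /Rintegral -(@integral_itv_bndoo R 0 pi (fun t => (cos (k%:R * t))%:E) true false); last first.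
  apply/measurable_EFinP; apply: (@measurableT_comp _ _ _ _ _ _ (@cos R)); first exact: measurable_cos.
  by apply: measurable_funM => //; exact: measurable_cst.
rewrite (@continuous_FTC2 R _ F 0 pi (pi_gt0 R)).
- have := congr1 (@complex.Im R) (ztX pi k); rewrite /F /= => <-.
  have -> : zt pi = (-1)%:C by apply: complexP; rewrite /= ?cospi ?sinpi.
  by rewrite -(rmorphXn (@real_complex R)) /= !mulr0 sin0 mulr0 subrr.
- by apply: continuous_in_subspaceT => t _; exact: ck.
- split.
  + by move=> t _; exact: ex_derive.
  + by apply: cvg_at_right_filter; exact: cF.
  + by apply: cvg_at_left_filter; exact: cF.
- by move=> t _; rewrite derive1E derive_val.
Qed.

(** For [m >= size p] every term has become a cosine of positive frequency, and those integrate to 0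
    over [(0, pi)]. *)
Lemma cI_laurent f : laurent f -> exists M, forall m, (M <= m)%N ->
  cI (fun t => zt t ^- m * f (zt t) + zt t ^+ m * f (zt t)^-1) = 0.
Proof.
move=> [N [p fE]]; exists (size p) => m pm.
have e t : zt t ^- m * f (zt t) + zt t ^+ m * f (zt t)^-1 =
    \sum_(k < size p) p`_k * (2 * cos ((m + N - k)%:R * t))%:C.
  have z0 := zt_neq0 t; have zi0 : (zt t)^-1 != 0 by rewrite invr_eq0.
  rewrite (fE _ z0) (fE _ zi0) !horner_coef !mulr_suml !mulr_sumr.
  rewrite -big_split /=; apply: eq_bigr => k _; rewrite -ztXX.
  have kmN : (k <= m + N)%N by apply: ltnW; apply: (leq_trans (ltn_ord k)); exact: (leq_trans pm (leq_addr _ _)).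
  have -> : zt t ^+ (m + N - k) = zt t ^+ m * zt t ^+ N / zt t ^+ k.
    by rewrite -exprD -[in RHS](subnK kmN) exprD mulfK// expf_neq0.
  rewrite !exprVn !invrK; have := expf_neq0 k z0; have := expf_neq0 m z0.
  have := expf_neq0 N z0.
  move: (zt t ^+ m) (zt t ^+ N) (zt t ^+ k) => A B K B0 A0 K0.
  by field; rewrite ?A0 ?B0 ?K0.
rewrite (eq_cI e) cI_sum; last first.
  move=> k; apply: bmfM; first exact: bmfC.
  under eq_fun do rewrite -ztXX -exprVn zt_inv.
  by apply: bmfD; apply: bmfX; [|apply: bmf_conj]; exact: bmf_zt.
apply: big1 => k _; rewrite cIZ; last first.
  under eq_fun do rewrite -ztXX -exprVn zt_inv.
  by apply: bmfD; apply: bmfX; [|apply: bmf_conj]; exact: bmf_zt.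
have mk : (0 < m + N - k)%N.
  by rewrite subn_gt0; apply: (leq_trans (ltn_ord k)); apply: (leq_trans pm); exact: leq_addr.
rewrite /cI /=.
have -> : Rintegral mu D (fun t => 2 * cos ((m + N - k)%:R * t)) = 0.
  rewrite RintegralZl//; first by rewrite Rintegral_cosk// mulr0.
  have := bmf_re_int (bmfX (m + N - k) bmf_zt).
  by congr (mu.-integrable _ (EFin \o _)); apply/funext => t; rewrite ztX.
by rewrite Rintegral_cst// !mul0r mulr0.
Qed.

End CircleIntegral.

(** * Finite propagation and polynomials in the Jacobi operator *)

Section FinitePropagation.
Variables (R : realType) (q d r : nat) (H : 'M[R[i]]_d) (V : 'M[R[i]]_(d, r)).
Notation C := R[i].
Notation X := (jidx d r).
Notation J := (jacobi q H V).

(** Each row of [J] has finitely many entries, so [J] acts on all functions and commutes with sums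
    and integrals without any convergence question. *)
Lemma jacobi_fin (x : X) : exists s : seq (C * X), forall f, J f x = \sum_(p <- s) p.1 * f p.2.
Proof.
case: x => [i|[c [|n]]].
- exists ([seq (H i i', inl i') | i' <- index_enum 'I_d] ++
    [seq (V i c, inr (c, 0%N)) | c <- index_enum 'I_r]).
  by move=> f; rewrite big_cat !big_map.
- exists ((sqrtq R q, inr (c, 1%N)) :: [seq (adjmx V c i, inl i) | i <- index_enum 'I_d]).
  by move=> f; rewrite big_cons big_map.
- exists [:: (sqrtq R q, inr (c, n)); (sqrtq R q, inr (c, n.+2))].
  by move=> f; rewrite !big_cons big_nil addr0 /= mulrDr.
Qed.

Lemma eq_jacobi f g : (forall x, f x = g x) -> forall x, J f x = J g x.
Proof. by move=> /funext ->. Qed.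

Lemma jacobi_lc (a : C) f g x : J (fun y => a * f y + g y) x = a * J f x + J g x.
Proof.
have [s e] := jacobi_fin x; rewrite !e mulr_sumr -big_split /=.
by apply: eq_bigr => p _; ring.
Qed.

Lemma jacobi_sum (T : Type) (s : seq T) (F : T -> X -> C) x :
  J (fun y => \sum_(t <- s) F t y) x = \sum_(t <- s) J (F t) x.
Proof.
have [u e] := jacobi_fin x; rewrite e; under eq_bigr do rewrite mulr_sumr.
by rewrite exchange_big; apply: eq_bigr => t _; rewrite e.
Qed.

Lemma jacobiZ (a : C) f x : J (fun y => a * f y) x = a * J f x.
Proof.
have [s e] := jacobi_fin x; rewrite !e mulr_sumr.
by apply: eq_bigr => p _; ring.
Qed.

Lemma jacobi0 x : J (fun=> 0) x = 0.
Proof.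
rewrite -[RHS](mul0r (J (fun=> 0) x)) -jacobiZ.
by apply: eq_jacobi => y; rewrite mul0r.
Qed.

Definition poly_jacobi (P : {poly C}) (f : X -> C) : X -> C :=
  fun x => \sum_(j < size P) P`_j * iter j J f x.

Local Notation pJ := poly_jacobi.

Lemma pJ_wide n (P : {poly C}) f x : (size P <= n)%N -> pJ P f x = \sum_(j < n) P`_j * iter j J f x.
Proof.
move=> Pn; rewrite /pJ (big_ord_widen n (fun j => P`_j * iter j J f x))// big_mkcond /=.
by apply: eq_bigr => j _; case: ltnP => // h; rewrite nth_default// mul0r.
Qed.

Lemma pJD P G f x : pJ (P + G) f x = pJ P f x + pJ G f x.
Proof.
pose n := maxn (size P) (size G).
rewrite (@pJ_wide n) ?size_polyD// (@pJ_wide n P) ?leq_maxl// (@pJ_wide n G) ?leq_maxr//.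
by rewrite -big_split; apply: eq_bigr => j _; rewrite coefD mulrDl.
Qed.

Lemma pJZ c P f x : pJ (c *: P) f x = c * pJ P f x.
Proof.
rewrite (pJ_wide _ _ (size_scale_leq c P)) /pJ mulr_sumr.
by apply: eq_bigr => j _; rewrite coefZ mulrA.
Qed.

Lemma pJC c f x : pJ c%:P f x = c * f x.
Proof. by rewrite (pJ_wide _ _ (size_polyC_leq1 c)) big_ord1 coefC. Qed.

Lemma pJMX P f x : pJ (P * 'X) f x = J (pJ P f) x.
Proof.
have sP : (size (P * 'X)%R <= (size P).+1)%N.
  by apply: leq_trans (size_polyMleq _ _) _; rewrite size_polyX addn2.
rewrite (pJ_wide _ _ sP) big_ord_recl coefMX mul0r add0r jacobi_sum.
by apply: eq_bigr => j _; rewrite coefMX jacobiZ.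
Qed.

Lemma pJM P G f x : pJ (P * G) f x = pJ G (pJ P f) x.
Proof.
elim/poly_ind: G x => [|G c IH] x.
  by rewrite mulr0 -[0]/(0%:P) !pJC !mul0r.
rewrite mulrDr mulrA !pJD !pJMX pJC [P * c%:P]mulrC mul_polyC pJZ; congr (_ + _).
exact: eq_jacobi.
Qed.

Lemma pJ_fin P (x : X) : exists s : seq (C * X), forall f, pJ P f x = \sum_(p <- s) p.1 * f p.2.
Proof.
elim/poly_ind: P x => [|P c IH] x.
  by exists [::] => f; rewrite -[0 in LHS]/(0%:P) pJC mul0r big_nil.
have [s hs] := jacobi_fin x.
pose S (p : C * X) := projT1 (cid (IH p.2)).
have SE p f : pJ P f p.2 = \sum_(p' <- S p) p'.1 * f p'.2.
  by rewrite /S; case: cid => s' /= ->.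
exists ((c, x) :: flatten [seq [seq (p.1 * p'.1, p'.2) | p' <- S p] | p <- s]) => f.
rewrite pJD pJMX pJC big_cons addrC big_flatten big_map hs; congr (_ + _).
apply: eq_bigr => p _; rewrite SE big_map mulr_sumr.
by apply: eq_bigr => p' _; rewrite mulrA.
Qed.

End FinitePropagation.

(** * Matrix entries of polynomials in the Jacobi operator *)

Section MainIdentity.
Variables (R : realType) (q d r : nat) (H : 'M[R[i]]_d) (V : 'M[R[i]]_(d, r)).
Notation C := R[i].
Notation X := (jidx d r).
Hypothesis q0 : (0 < q)%N.
Hypothesis Hh : adjmx H = H.
Notation J := (jacobi q H V).
Notation Hc := (map_mx (@conjc R) H).
Notation Vc := (map_mx (@conjc R) V).
Notation Jc := (jacobi q Hc Vc).
Notation F := (Fmx q H V).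
Notation S := (Smx q H V).
Notation Vs := (adjmx V).
Notation a := (sqrtq R q).
Notation pJc := (poly_jacobi q Hc Vc).
Notation pJ := (poly_jacobi q H V).
Implicit Types x y : X.

Definition lamz (z : C) : C := a * (z + z^-1).

Lemma laurent_lamz : laurent lamz.
Proof.
apply: laurentM; first exact: laurentC.
by apply: laurentD; [exact: laurentX|exact: laurentV].
Qed.

Lemma laurent_Fmx i j : laurent (fun z => F z i j).
Proof.
under eq_fun do rewrite !mxE; apply: laurentD.
  apply: laurentB; first exact: laurentC.
  case: (i == j); last by under eq_fun do rewrite mulr0n; exact: laurentC.
  by under eq_fun do rewrite mulr1n; exact: laurent_lamz.
apply: laurentM; last exact: laurentC.
by apply: laurentM; [exact: laurentV|exact: laurentC].
Qed.

Definition Fdet (z : C) : C := \det (F z).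

Lemma det_Fmx_conj z : nsq z = 1 -> Fdet z^-1 = conjc (Fdet z).
Proof. by move=> z1; rewrite /Fdet (unit_inv z1) -Fmx_conj// det_adjmx. Qed.

(** A purely imaginary point outside the unit circle cannot carry a kernel vector, by
    [Fmx_kernel_real]. *)
Lemma det_Fmx_neq0 (y : R) : 1 < y -> Fdet (0 +i* y) != 0.
Proof.
move=> y1; rewrite /Fdet; apply/negP => /eqP; rewrite -det_tr => /eqP/det0P[v v0 hv].
have := @Fmx_kernel_real _ _ _ _ _ V q0 Hh (0 +i* y) v^T; rewrite /nsq /=.
have -> : 1 < 0 ^+ 2 + y ^+ 2 by nra.
have -> : v^T != 0 by apply: contra_neq v0 => /(congr1 trmx); rewrite trmxK trmx0.
have -> : F (0 +i* y) *m v^T = 0 by apply: trmx_inj; rewrite trmx_mul trmxK trmx0.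
by move=> /(_ isT isT erefl) y0; move: y1; rewrite y0 ltr10.
Qed.

(** The point is that [p] is non-zero: otherwise [Fdet] would vanish at the inverses of all the
    points [w n], where it is itself non-zero, and these are too many roots for its numerator. *)
Lemma det_norm_poly : exists2 p : {poly C}, p != 0 &
  forall z : C, z != 0 -> p.[lamz z] = Fdet z * Fdet z^-1.
Proof.
have lD : laurent Fdet by apply: laurent_det; exact: laurent_Fmx.
have [p0 hp] := laurent_norm lD.
have an0 := a_neq0 R q0.
pose p := p0 \Po (a^-1 *: 'X).
have pE (z : C) : z != 0 -> p.[lamz z] = Fdet z * Fdet z^-1.
  by move=> z0; rewrite horner_comp hornerZ hornerX /lamz mulKf// hp.
exists p => //; apply/eqP => p00; have [N [s hs]] := lD.
(* The shift by 2 keeps all these imaginary points outside the closed unit disc. *)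
pose w (n : nat) : C := 0 +i* n.+2%:R.
have w0 n : w n != 0.
  by apply/eqP => /(congr1 (@complex.Im R)) /eqP; rewrite /= pnatr_eq0.
have wD n : Fdet (w n) != 0 by apply: det_Fmx_neq0; rewrite ltr1n.
have wi0 n : (w n)^-1 != 0 by rewrite invr_eq0.
have gen u : u != 0 -> s.[u] / u ^+ N == 0 -> s.[u] == 0.
  by move=> u0; rewrite mulf_eq0 invr_eq0 expf_eq0 (negbTE u0) andbF orbF.
have gen2 u : u != 0 -> Fdet u != 0 -> root s u^-1.
  move=> u0 Du; have ui0 : u^-1 != 0 by rewrite invr_eq0.
  have := pE _ u0; rewrite p00 horner0 => /esym/eqP.
  by rewrite mulf_eq0 (negbTE Du) /= (hs _ ui0); exact: gen ui0.
have sw n : root s (w n)^-1 by exact: gen2 (w0 n) (wD n).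
have s0 : s != 0.
  by apply/eqP => s0; have := wD 0%N; rewrite hs// s0 horner0 mul0r eqxx.
have := @max_poly_roots _ s [seq (w n)^-1 | n <- iota 0 (size s)] s0.
rewrite size_map size_iota ltnn => /(_ _ _)/notF; apply.
  by apply/allP => _ /mapP[n _ ->]; exact: sw.
rewrite map_inj_uniq ?iota_uniq// => m n /invr_inj[] /eqP.
by rewrite eqr_nat => /eqP[].
Qed.

(** Cramer's rule: [p] is [Fdet z * Fdet z^-1] as a function of [lamz z], and [G] is [Fdet z^-1]
    times the adjugate. If [Fdet z = 0] on the circle then its conjugate [Fdet z^-1] vanishes as
    well, so both sides are 0 and the default value of [invmx] is multiplied by 0. *)
Lemma regularizer : exists (p : {poly C}) (G : C -> 'M[C]_d),
  [/\ p != 0, forall i j, laurent (fun z => G z i j),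
      forall z, nsq z = 1 -> p.[lamz z] *: invmx (F z) = G z
    & forall z, nsq z = 1 -> p.[lamz z] != 0 -> F z \in unitmx /\ F z^-1 \in unitmx].
Proof.
have [p p0 hp] := det_norm_poly.
have nz (z : C) : nsq z = 1 -> z != 0.
  by move=> z1; apply: contra_eqN z1 => /eqP ->; rewrite nsq0 eq_sym oner_eq0.
exists p, (fun z => Fdet z^-1 *: \adj (F z)); split=> //.
- move=> i j; under eq_fun do rewrite mxE; apply: laurentM.
    by apply: laurent_inv; apply: laurent_det; exact: laurent_Fmx.
  by apply: laurent_adj; exact: laurent_Fmx.
- move=> z z1; rewrite (hp _ (nz _ z1)) det_Fmx_conj//.
  have [D0|D0] := eqVneq (Fdet z) 0.
    by rewrite D0 mul0r conjc0 !scale0r.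
  rewrite /invmx unitmxE unitfE -/(Fdet z) D0 scalerA mulrAC divff// mul1r.
  by [].
move=> z z1; rewrite (hp _ (nz _ z1)) mulf_eq0 negb_or => /andP[D0 D1].
by split; rewrite unitmxE unitfE; [exact: D0|exact: D1].
Qed.

Definition psi (z : C) x (e : 'I_r) : C := PsiZ q H V z (delta_mx e ord0) x.
(** Candidate density of the spectral kernel at the angle of [z], linear in the [psi] at [y] and
    conjugate-linear in the one at [x]. *)
Definition ker x y (z : C) : C := \sum_e psi z y e * conjc (psi z x e).
Definition core_mx (z : C) : 'M[C]_(d, r) := (z^-1 - z) *: (invmx (F z) *m V).

Lemma psi_core z i e : psi z (inl i) e = core_mx z i e.
Proof.
rewrite /psi /core_mx /=; move: (invmx (F z) *m V) => A.
by rewrite -colE !mxE.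
Qed.

Lemma psi_cusp z c n e : psi z (inr (c, n)) e =
  (z ^+ n.+1 *: 1%:M + z ^- n.+1 *: S z) c e.
Proof.
rewrite /psi /=; move: (S z) => A.
by rewrite -colE ![in RHS]mxE ![in LHS]mxE eqxx andbT.
Qed.

Lemma psi_cusp_conj z c n e : nsq z = 1 -> conjc (psi z (inr (c, n)) e) =
  (z ^- n.+1 *: 1%:M + z ^+ n.+1 *: S z^-1) e c.
Proof.
move=> z1; rewrite psi_cusp (unit_inv z1) Smx_adj//.
rewrite -exprVn (unit_inv z1); move: (S z) => A; rewrite ![in RHS]mxE ![in LHS]mxE.
rewrite conjD !conjM -!(rmorphXn (@conjc R)) /= conjcK eq_sym; congr (_ * _ + _).
by case: (e == c); rewrite ?conjc1 ?conjc0.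
Qed.

(** Expanding the product of two waves, [S z *m S z^-1 = 1] turns the term quadratic in [S] into the
    second half of the free kernel; only terms linear in [S] remain besides it. *)
Lemma ker_cusp_cusp z c n c' n' : nsq z = 1 -> F z \in unitmx -> F z^-1 \in unitmx ->
  ker (inr (c, n)) (inr (c', n')) z =
  (c' == c)%:R * (z ^+ n.+1 / z ^+ n'.+1 + z ^+ n'.+1 / z ^+ n.+1) +
  (z ^- (n + n').+2 * S z c' c + z ^+ (n + n').+2 * S z^-1 c' c).
Proof.
move=> z1 u1 u2; rewrite /ker.
have z0 : z != 0 by apply: contra_eqN z1 => /eqP ->; rewrite nsq0 eq_sym oner_eq0.
transitivity (((z ^+ n'.+1 *: 1%:M + z ^- n'.+1 *: S z) *m
    (z ^- n.+1 *: 1%:M + z ^+ n.+1 *: S z^-1)) c' c).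
  by rewrite mxE; apply: eq_bigr => e _; rewrite psi_cusp psi_cusp_conj.
have := Smx_unitary z0 u1 u2; move: (S z) (S z^-1) => A B AB.
rewrite mulmxDl !mulmxDr -!scalemxAr -!scalemxAl AB !mulmx1 !mul1mx.
rewrite ![in LHS]mxE.
have -> : (n + n').+2 = (n.+1 + n'.+1)%N by rewrite addSn addnS.
rewrite exprD invfM; move: (z ^+ n.+1) (z ^+ n'.+1) => x y; ring.
Qed.

Lemma ker_cusp_core z c n i : nsq z = 1 -> F z \in unitmx -> F z^-1 \in unitmx ->
  ker (inr (c, n)) (inl i) z =
  z ^- n.+1 * core_mx z i c + z ^+ n.+1 * core_mx z^-1 i c.
Proof.
move=> z1 u1 u2; rewrite /ker.
have z0 : z != 0 by apply: contra_eqN z1 => /eqP ->; rewrite nsq0 eq_sym oner_eq0.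
transitivity ((core_mx z *m (z ^- n.+1 *: 1%:M + z ^+ n.+1 *: S z^-1)) i c).
  by rewrite mxE; apply: eq_bigr => e _; rewrite psi_core psi_cusp_conj.
have := core_functional z0 u1 u2; rewrite -/(core_mx z).
have -> : (z - z^-1) *: (invmx (F z^-1) *m V) = core_mx z^-1 by rewrite /core_mx invrK.
move: (core_mx z) (core_mx z^-1) (S z^-1) => A A' B AB.
by rewrite mulmxDr -!scalemxAr AB mulmx1 !mxE.
Qed.

Lemma conj_sum (T : Type) (s : seq T) (f : T -> C) :
  conjc (\sum_(i <- s) f i) = \sum_(i <- s) conjc (f i).
Proof. exact: (rmorph_sum (@conjc R)). Qed.

Lemma conj_jacobi f x : conjc (J f x) = Jc (fun y => conjc (f y)) x.
Proof.
case: x => [i|[c [|n]]] /=.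
- rewrite conjD !conj_sum; congr (_ + _); apply: eq_bigr => j _;
    by rewrite conjM mxE.
- rewrite conjD conjM conj_a conj_sum; congr (_ + _); apply: eq_bigr => j _.
  by rewrite conjM !mxE.
- by rewrite conjM conjD conj_a.
Qed.

Lemma conj_lamz z : nsq z = 1 -> conjc (lamz z) = lamz z.
Proof.
by move=> z1; rewrite /lamz (unit_inv z1) conjM conj_a conjD conjcK addrC.
Qed.

Lemma psi_eigen z x e : nsq z = 1 -> F z \in unitmx ->
  J (fun y => psi z y e) x = lamz z * psi z x e.
Proof.
move=> z1 uF; apply: PsiZ_eigen => //.
by apply: contra_eqN z1 => /eqP ->; rewrite nsq0 eq_sym oner_eq0.
Qed.

Lemma ker_eigenr z x y : nsq z = 1 -> F z \in unitmx ->
  J (fun y => ker x y z) y = lamz z * ker x y z.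
Proof.
move=> z1 uF; rewrite jacobi_sum mulr_sumr; apply: eq_bigr => e _.
rewrite (@eq_jacobi _ _ _ _ _ _ _ (fun y => conjc (psi z x e) * psi z y e)); last by move=> ?; exact: mulrC.
by rewrite jacobiZ psi_eigen// mulrCA [_ * psi _ _ _]mulrC.
Qed.

Lemma ker_eigenl z x y : nsq z = 1 -> F z \in unitmx ->
  Jc (fun x => ker x y z) x = lamz z * ker x y z.
Proof.
move=> z1 uF; rewrite jacobi_sum mulr_sumr; apply: eq_bigr => e _.
by rewrite jacobiZ -conj_jacobi psi_eigen// conjM conj_lamz// mulrCA.
Qed.

(** The Hermitian symmetry of [J] in the form used below: acting in the argument [x] takes the
    conjugate coefficients, hence [Jc]. *)
Lemma cdelta_swap x y : Jc (fun x => cdelta x 1 y) x = J (cdelta x 1) y.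
Proof.
have Hc' i j : conjc (H i j) = H j i by rewrite -{2}Hh mxE.
have sum0 m (f : 'I_m -> C) : \sum_i f i * 0 = 0.
  by apply: big1 => i _; rewrite mulr0.
have dl (f : 'I_d -> C) i0 : \sum_i f i * (if inl i0 == inl i :> X then 1 else 0) = f i0.
  rewrite (bigD1 i0)//= eqxx mulr1 big1 ?addr0// => i.
  rewrite eq_sym => /negbTE ii; rewrite (_ : (inl i0 == inl i :> X) = false) ?mulr0//.
have dl' (f : 'I_d -> C) i0 : \sum_i f i * (if inl i == inl i0 :> X then 1 else 0) = f i0.
  by under eq_bigr do rewrite eq_sym; exact: dl.
have inrE (c c' : 'I_r) (n n' : nat) : (inr (c, n) == inr (c', n') :> X) = (c == c') && (n == n').
  by [].
have dr (f : 'I_r -> C) c0 (n n' : nat) :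
    \sum_c f c * (if inr (c0, n) == inr (c, n') :> X then 1 else 0) = if n == n' then f c0 else 0.
  rewrite (bigD1 c0)//= inrE eqxx /= big1 ?addr0; last first.
    by move=> c; rewrite eq_sym inrE => /negbTE ->; rewrite mulr0.
  by case: eqP => _; rewrite ?mulr1 ?mulr0.
have dr' (f : 'I_r -> C) c0 (n n' : nat) :
    \sum_c f c * (if inr (c, n') == inr (c0, n) :> X then 1 else 0) = if n == n' then f c0 else 0.
  by under eq_bigr do rewrite eq_sym; exact: dr.
rewrite /cdelta; case: x => [i|[c [|n]]]; case: y => [i'|[c' [|n']]] /=;
  rewrite ?inrE ?dl ?dl' ?dr ?dr' ?sum0 ?eqxx ?mulr0 ?addr0 ?add0r ?mulr0 ?mxE ?conjcK ?Hc' //=.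
- by rewrite andbF addr0 eqSS.
- by rewrite andbF addr0 eqSS.
- by rewrite !eqSS addrC.
Qed.

Lemma jacobi_comm (m : X -> X -> C) x y :
  Jc (fun x => J (m x) y) x = J (fun y => Jc (m^~ y) x) y.
Proof.
have [s hs] := jacobi_fin q H V y; have [s' hs'] := jacobi_fin q Hc Vc x.
rewrite hs hs'; under eq_bigr do rewrite hs mulr_sumr.
rewrite exchange_big; apply: eq_bigr => p _; rewrite hs' mulr_sumr.
by apply: eq_bigr => p' _; rewrite mulrCA.
Qed.

Lemma iter_swap j x y : Jc (fun x => iter j J (cdelta x 1) y) x = J (iter j J (cdelta x 1)) y.
Proof.
elim: j y => [|j IH] y; first exact: cdelta_swap.
rewrite [LHS](jacobi_comm (fun x => iter j J (cdelta x 1)) x y).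
by apply: eq_jacobi => y'; rewrite IH.
Qed.

Lemma pJ_swap P x y : Jc (fun x => pJ P (cdelta x 1) y) x = J (pJ P (cdelta x 1)) y.
Proof.
rewrite !jacobi_sum; apply: eq_bigr => j _; rewrite !jacobiZ; congr (_ * _).
exact: iter_swap.
Qed.


Lemma jacobi_cI (H' : 'M[C]_d) (V' : 'M[C]_(d, r)) (f : X -> R -> C) x :
  (forall y, bmf (f y)) ->
  jacobi q H' V' (fun y => cI (f y)) x = cI (fun t => jacobi q H' V' (f^~ t) x).
Proof.
move=> bf; have [s hs] := jacobi_fin q H' V' x.
rewrite hs; under [in RHS]eq_cI do rewrite hs.
rewrite cI_sum => [|p]; last by apply: bmfM => //; exact: bmfC.
by apply: eq_bigr => p _; rewrite cIZ.
Qed.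

(** The free kernel [z^(k-l) + z^(l-k)] along a ray, with position 0 standing for the place where
    the ray meets the core. *)
Definition tz (k l : nat) (z : C) : C := z ^+ k / z ^+ l + z ^+ l / z ^+ k.

Lemma bmf_tz k l : bmf (fun t => tz k l (zt t)).
Proof.
have lV m : laurent (fun z : C => (z ^+ m)^-1).
  by under eq_fun do rewrite -exprVn; apply: laurentXn; exact: laurentV.
have lX m : laurent (fun z : C => z ^+ m) by apply: laurentXn; exact: laurentX.
by apply: (bmf_laurent (f := tz k l)); apply: laurentD; apply: laurentM.
Qed.

Lemma bmf_lamz : bmf (fun t => lamz (zt t)).
Proof. by apply: bmf_laurent; exact: laurent_lamz. Qed.
Lemma tzC k l z : tz k l z = tz l k z.
Proof. by rewrite /tz addrC. Qed.

Lemma tzSS k l t : tz k.+1 l.+1 (zt t) = tz k l (zt t).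
Proof.
rewrite /tz !exprS; have := zt_neq0 t; have := expf_neq0 k (zt_neq0 t).
have := expf_neq0 l (zt_neq0 t); move: (zt t) => z hl hk hz.
by field; rewrite ?hl ?hk ?hz.
Qed.

Lemma lamz_tz k l t : lamz (zt t) * tz k l.+1 (zt t) = a * (tz k l (zt t) + tz k l.+2 (zt t)).
Proof.
rewrite /tz /lamz !exprS; have := zt_neq0 t; have := expf_neq0 k (zt_neq0 t).
have := expf_neq0 l (zt_neq0 t); move: (zt t) => z hl hk hz.
by field; rewrite ?hl ?hk ?hz.
Qed.

Lemma cI_tz k l : cI (fun t => tz k l (zt t)) = (k == l)%:R.
Proof.
wlog kl : k l / (l <= k)%N.
  move=> W; have [/W//|/ltnW/W h] := leqP l k.
  by rewrite eq_sym -h; apply: eq_cI => t; exact: tzC.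
have e t : tz k l (zt t) = (2 * cos ((k - l)%:R * t))%:C.
  rewrite -ztXX /tz; have := zt_neq0 t; rewrite -{1 2}(subnK kl) exprD => z0.
  have := expf_neq0 l z0; have := expf_neq0 (k - l) z0.
  by move: (_ ^+ l) (_ ^+ (k - l)) => A B B0 A0; field; rewrite ?A0 ?B0.
rewrite (eq_cI e) /cI /= Rintegral_cst// mul0r mul0r.
have ic m : (@lebesgue_measure R).-integrable `]0, (pi : R)[%classic (EFin \o (fun t => cos (m%:R * t))).
  have := bmf_re_int (bmfX m (bmf_zt R)).
  by congr (_.-integrable _ (EFin \o _)); apply/funext => t; rewrite ztX.
have -> : Rintegral (@lebesgue_measure R) `]0, (pi : R)[ (fun t => 2 * cos ((k - l)%:R * t)) =
    2 * Rintegral (@lebesgue_measure R) `]0, (pi : R)[ (fun t => cos ((k - l)%:R * t)).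
  by rewrite RintegralZl.
have [->|kl'] := eqVneq k l; last first.
  by rewrite Rintegral_cosk ?mulr0 ?mul0r// subn_gt0 ltn_neqAle eq_sym kl' kl.
rewrite subnn; under eq_Rintegral do rewrite mul0r cos0.
rewrite Rintegral_cst//= lebesgue_measure_itv /= lte_fin pi_gt0 sube0 /= mul1r divff//.
by rewrite mulf_neq0// gt_eqF// pi_gt0.
Qed.

(** Each factor [lamz] shifts frequencies by one, so fewer than [k] factors never reach frequency
    0. *)
Lemma cI_lamz_tz0 j k : (j < k)%N -> cI (fun t => lamz (zt t) ^+ j * tz k 0 (zt t)) = 0.
Proof.
elim: j k => [|j IH] k jk.
  rewrite (eq_cI (g := fun t => tz k 0 (zt t))) => [|t]; last by rewrite expr0 mul1r.
  by rewrite cI_tz gtn_eqF.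
case: k jk => // k jk.
have e t : lamz (zt t) ^+ j.+1 * tz k.+1 0 (zt t) =
    a * (lamz (zt t) ^+ j * tz k 0 (zt t) + lamz (zt t) ^+ j * tz k.+2 0 (zt t)).
  rewrite exprSr -mulrA (tzC k.+1) lamz_tz (tzC 0 k) (tzC 0 k.+2).
  by rewrite -mulrDr mulrCA.
rewrite (eq_cI e).
have b m : bmf (fun t => lamz (zt t) ^+ j * tz m 0 (zt t)).
  by apply: bmfM; [apply: bmfX; exact: bmf_lamz|exact: bmf_tz].
rewrite cIZ; last exact: bmfD.
by rewrite cID// !IH ?addr0 ?mulr0//; lia.
Qed.

(** The vertex of index [n] is at distance [n + 1] from the core, so a walk through the core between
    the two vertices has at least [n + n' + 2] steps. Shorter walks see a free ray, and
    [cI_lamz_tz0] accounts for the absent neighbour at position 0. *)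
Lemma iter_cusp j c n :
  (forall c' n', (j < (n + n').+2)%N -> iter j J (cdelta (inr (c, n)) 1) (inr (c', n')) =
     (c' == c)%:R * cI (fun t => lamz (zt t) ^+ j * tz n.+1 n'.+1 (zt t))) /\
  ((j <= n)%N -> forall i, iter j J (cdelta (inr (c, n)) 1) (inl i) = 0).
Proof.
have b k m l : bmf (fun t => lamz (zt t) ^+ k * tz m l (zt t)).
  by apply: bmfM; [apply: bmfX; exact: bmf_lamz|exact: bmf_tz].
elim: j => [|j [IH1 IH2]].
  split=> // c' n' _; rewrite /= /cdelta -[_ == _]/((c' == c) && (n' == n)).
  rewrite (eq_cI (g := fun t => tz n.+1 n'.+1 (zt t))) => [|t]; last by rewrite expr0 mul1r.
  by rewrite cI_tz eqSS (eq_sym n); case: (c' == c); case: eqP => _ /=; rewrite ?mulr1 ?mulr0.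
have step m l : cI (fun t => lamz (zt t) ^+ j.+1 * tz m l.+1 (zt t)) =
    a * (cI (fun t => lamz (zt t) ^+ j * tz m l (zt t)) +
         cI (fun t => lamz (zt t) ^+ j * tz m l.+2 (zt t))).
  rewrite -cID// -cIZ; last exact: bmfD.
  by apply: eq_cI => t; rewrite exprSr -mulrA lamz_tz -mulrDr mulrCA.
split=> [c' [|n']|] jn.
- rewrite [LHS]/=; move: jn; rewrite addn0 ltnS => jn.
  rewrite IH1; last by lia.
  rewrite step cI_lamz_tz0// add0r big1 ?addr0; last first.
    by move=> i _; rewrite IH2// mulr0.
  by rewrite mulrCA.
- rewrite [LHS]/= !IH1; try lia.
  by rewrite step -mulrDr mulrCA.
- move=> i; rewrite [LHS]/= big1 => [|k _]; last by rewrite IH2 ?mulr0// ltnW.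
  rewrite add0r big1// => c' _; rewrite IH1; last by lia.
  rewrite (eq_cI (g := fun t => lamz (zt t) ^+ j * tz n 0 (zt t))) ?cI_lamz_tz0 ?mulr0//.
  by move=> t; rewrite tzSS.
Qed.

Lemma pJ_cusp (P : {poly C}) c n c' n' : (size P <= (n + n').+2)%N ->
  pJ P (cdelta (inr (c, n)) 1) (inr (c', n')) =
  (c' == c)%:R * cI (fun t => P.[lamz (zt t)] * tz n.+1 n'.+1 (zt t)).
Proof.
move=> sP; rewrite (eq_cI (g := fun t => \sum_(j < size P) P`_j *
    (lamz (zt t) ^+ j * tz n.+1 n'.+1 (zt t)))); last first.
  by move=> t; rewrite horner_coef mulr_suml; apply: eq_bigr => j _; rewrite mulrA.
have b k m l : bmf (fun t => lamz (zt t) ^+ k * tz m l (zt t)).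
  by apply: bmfM; [apply: bmfX; exact: bmf_lamz|exact: bmf_tz].
rewrite cI_sum => [|j]; last by apply: bmfM; [exact: bmfC|exact: b].
rewrite mulr_sumr; apply: eq_bigr => j _; rewrite cIZ//.
by rewrite (iter_cusp j c n).1 1?mulrCA//; apply: leq_trans sP.
Qed.

Lemma pJ_cusp_core (P : {poly C}) c n i : (size P <= n)%N -> pJ P (cdelta (inr (c, n)) 1) (inl i) = 0.
Proof.
move=> sP; apply: big1 => j _; rewrite (iter_cusp j c n).2 ?mulr0//.
exact: ltnW (leq_trans (ltn_ord j) sP).
Qed.


Section Regularized.
Variables (p : {poly C}) (G : C -> 'M[C]_d).
Hypothesis lG : forall i j, laurent (fun z => G z i j).
Hypothesis pG : forall z, nsq z = 1 -> p.[lamz z] *: invmx (F z) = G z.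
Hypothesis pU : forall z, nsq z = 1 -> p.[lamz z] != 0 -> F z \in unitmx /\ F z^-1 \in unitmx.

Definition regS (z : C) : 'M[C]_r :=
  - p.[lamz z]%:M + ((z^-1 - z) / a) *: (Vs *m G z *m V).
Definition regcore (z : C) : 'M[C]_(d, r) := (z^-1 - z) *: (G z *m V).

Lemma regSE z : nsq z = 1 -> p.[lamz z] *: S z = regS z.
Proof.
move=> z1; rewrite /regS -(pG z1) /Smx; move: (invmx (F z)) => A.
rewrite scalerDr scalerN scale_scalar_mx mulr1 -!scalemxAr -scalemxAl !scalerA.
by rewrite mulrC.
Qed.

Lemma regcoreE z : nsq z = 1 -> p.[lamz z] *: core_mx z = regcore z.
Proof.
move=> z1; rewrite /regcore -(pG z1) /core_mx; move: (invmx (F z)) => A.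
by rewrite -scalemxAl !scalerA mulrC.
Qed.

Lemma laurent_cst_mx m n (A : 'M[C]_(m, n)) i j : laurent (fun=> A i j).
Proof. exact: laurentC. Qed.
Lemma laurent_scale : laurent (fun z : C => z^-1 - z).
Proof. by apply: laurentB; [exact: laurentV|exact: laurentX]. Qed.
Lemma laurent_p (P : {poly C}) : laurent (fun z => P.[lamz z]).
Proof. by apply: laurent_horner; exact: laurent_lamz. Qed.

Lemma laurent_regS i j : laurent (fun z => regS z i j).
Proof.
under eq_fun do rewrite 3!mxE; apply: laurentD.
  apply: laurentN; case: (i == j).
    by under eq_fun do rewrite mulr1n; exact: laurent_p.
  by under eq_fun do rewrite mulr0n; exact: laurentC.
under eq_fun do rewrite mxE; apply: laurentM.
  by apply: laurentM; [exact: laurent_scale|exact: laurentC].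
apply: laurent_mulmx; last exact: laurent_cst_mx.
by apply: laurent_mulmx => //; exact: laurent_cst_mx.
Qed.

Lemma laurent_regcore i j : laurent (fun z => regcore z i j).
Proof.
under eq_fun do rewrite mxE; apply: laurentM; first exact: laurent_scale.
by apply: laurent_mulmx => //; exact: laurent_cst_mx.
Qed.

Lemma bmf_psi x e : bmf (fun t => p.[lamz (zt t)] * psi (zt t) x e).
Proof.
case: x => [i|[c n]].
  have -> : (fun t => p.[lamz (zt t)] * psi (zt t) (inl i) e) = (fun t => regcore (zt t) i e).
    by apply/funext => t; rewrite psi_core -(regcoreE (nsq_zt t)); move: (core_mx _) => A; rewrite mxE.
  exact: (bmf_laurent (laurent_regcore i e)).
have -> : (fun t => p.[lamz (zt t)] * psi (zt t) (inr (c, n)) e) =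
    (fun t => p.[lamz (zt t)] * (zt t ^+ n.+1 * (c == e)%:R) + (zt t)^-1 ^+ n.+1 * regS (zt t) c e).
  apply/funext => t; rewrite psi_cusp -(regSE (nsq_zt t)); move: (S _) => A.
  by rewrite !mxE exprVn; ring.
apply: (bmf_laurent (f := fun z => p.[lamz z] * (z ^+ n.+1 * (c == e)%:R) + z^-1 ^+ n.+1 * regS z c e)).
apply: laurentD; apply: laurentM.
- exact: laurent_p.
- by apply: laurentM; [apply: laurentXn; exact: laurentX|exact: laurentC].
- by apply: laurentXn; exact: laurentV.
- exact: laurent_regS.
Qed.

Definition pc : {poly C} := map_poly (@conjc R) p.
(** One factor for each of the two [psi] in [ker]; on the circle it is [|p|^2]. *)
Definition Q0 : {poly C} := p * pc.

Lemma pcE z : nsq z = 1 -> pc.[lamz z] = conjc p.[lamz z].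
Proof. by move=> z1; rewrite -{1}(conj_lamz z1) /pc horner_map. Qed.

Lemma bmf_ker x y (P : {poly C}) : bmf (fun t => (Q0 * P).[lamz (zt t)] * ker x y (zt t)).
Proof.
have -> : (fun t => (Q0 * P).[lamz (zt t)] * ker x y (zt t)) = (fun t => P.[lamz (zt t)] *
    \sum_e (p.[lamz (zt t)] * psi (zt t) y e) * conjc (p.[lamz (zt t)] * psi (zt t) x e)).
  apply/funext => t; rewrite !hornerM (pcE (nsq_zt t)) /ker !mulr_sumr; apply: eq_bigr => e _.
  by rewrite conjM; ring.
apply: bmfM; first by apply: bmf_horner; exact: bmf_lamz.
by apply: bmf_sum => e; apply: bmfM; [|apply: bmf_conj]; exact: bmf_psi.
Qed.

(** The defect of the formula to be proved; the aim is a multiple of [Q0] for which it vanishes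
    identically. *)
Definition bq (P : {poly C}) x y : C :=
  pJ P (cdelta x 1) y - cI (fun t => P.[lamz (zt t)] * ker x y (zt t)).

Lemma Q0_eq0 z (P : {poly C}) : p.[lamz z] = 0 -> (Q0 * P).[lamz z] = 0.
Proof. by move=> h; rewrite !hornerM h !mul0r. Qed.

Lemma bq_eigenr P x y : J (bq (Q0 * P) x) y = bq (Q0 * (P * 'X)) x y.
Proof.
rewrite /bq (@eq_jacobi _ _ _ _ _ _ _ (fun y =>
  -1 * cI (fun t => (Q0 * P).[lamz (zt t)] * ker x y (zt t)) + pJ (Q0 * P) (cdelta x 1) y)); last first.
  by move=> y'; rewrite mulN1r addrC.
rewrite jacobi_lc mulN1r addrC mulrA pJMX; congr (_ - _).
rewrite jacobi_cI => [|y']; last exact: bmf_ker.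
apply: eq_cI => t; rewrite jacobiZ hornerMX.
have [/(Q0_eq0 P) ->|h] := eqVneq p.[lamz (zt t)] 0; first by rewrite !mul0r.
by rewrite ker_eigenr ?nsq_zt ?(pU _ h).1 ?nsq_zt// mulrA.
Qed.

Lemma bq_eigenl P x y : Jc (fun x => bq (Q0 * P) x y) x = bq (Q0 * (P * 'X)) x y.
Proof.
rewrite /bq (@eq_jacobi _ _ _ _ _ _ _ (fun x =>
  -1 * cI (fun t => (Q0 * P).[lamz (zt t)] * ker x y (zt t)) + pJ (Q0 * P) (cdelta x 1) y)); last first.
  by move=> y'; rewrite mulN1r addrC.
rewrite jacobi_lc mulN1r addrC mulrA pJMX pJ_swap; congr (_ - _).
rewrite jacobi_cI => [|y']; last exact: bmf_ker.
apply: eq_cI => t; rewrite jacobiZ hornerMX.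
have [/(Q0_eq0 P) ->|h] := eqVneq p.[lamz (zt t)] 0; first by rewrite !mul0r.
by rewrite ker_eigenl ?nsq_zt ?(pU _ h).1 ?nsq_zt// mulrA.
Qed.

(** The recurrence shared by the two arguments is what lets zeros spread in [bq_cusp]. *)
Lemma bq_swap x y : Jc (fun x => bq Q0 x y) x = J (bq Q0 x) y.
Proof. by have := bq_eigenl 1 x y; rewrite -bq_eigenr mulr1. Qed.

Lemma bqD P P' x y : bq (Q0 * (P + P')) x y = bq (Q0 * P) x y + bq (Q0 * P') x y.
Proof.
rewrite /bq mulrDr pJD addrACA -opprD -cID; try exact: bmf_ker.
by congr (_ - _); apply: eq_cI => t; rewrite hornerD mulrDl.
Qed.

Lemma bqZ c P x y : bq (Q0 * (c *: P)) x y = c * bq (Q0 * P) x y.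
Proof.
rewrite /bq -scalerAr pJZ mulrBr -cIZ; last exact: bmf_ker.
by congr (_ - _); apply: eq_cI => t; rewrite hornerZ mulrA.
Qed.

Lemma bqMr P P' x y : (forall y, bq (Q0 * P) x y = 0) -> bq (Q0 * (P * P')) x y = 0.
Proof.
move=> h; elim/poly_ind: P' y => [|P' c IH] y.
  by rewrite mulr0 -(scale0r P) bqZ mul0r.
rewrite mulrDr bqD [P * c%:P]mulrC mul_polyC bqZ h mulr0 addr0 [P * (P' * _)]mulrA -bq_eigenr.
by rewrite (@eq_jacobi _ _ _ _ _ _ _ (fun=> 0)) ?jacobi0.
Qed.

Lemma iter_bq j x y : iter j Jc (fun x => bq Q0 x y) x = bq (Q0 * 'X^j) x y.
Proof.
elim: j x => [|j IH] x; first by rewrite expr0 mulr1.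
by rewrite /= (@eq_jacobi _ _ _ _ _ _ _ _ IH) bq_eigenl exprSr.
Qed.

Lemma bqM P x y : bq (Q0 * P) x y = pJc P (fun x => bq Q0 x y) x.
Proof.
rewrite /poly_jacobi -{1}(coefK P) poly_def.
elim/big_rec2: _ => [|i u v _ <-].
  by rewrite -(scale0r 1) bqZ mul0r.
by rewrite bqD bqZ iter_bq.
Qed.

Lemma lamz_inv z : lamz z^-1 = lamz z.
Proof. by rewrite /lamz invrK addrC. Qed.
Lemma nsq_zti (t : R) : nsq (zt t) = 1 /\ nsq (zt t)^-1 = 1.
Proof. by rewrite zt_inv nsq_conj nsq_zt. Qed.

Lemma Q0_ker_cusp c n c' n' t :
  let f z := pc.[lamz z] * regS z c' c in
  Q0.[lamz (zt t)] * ker (inr (c, n)) (inr (c', n')) (zt t) =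
  (c' == c)%:R * (Q0.[lamz (zt t)] * tz n.+1 n'.+1 (zt t)) +
  (zt t ^- (n + n').+2 * f (zt t) + zt t ^+ (n + n').+2 * f (zt t)^-1).
Proof.
move=> f; have [z1 iz1] := nsq_zti t.
have [h|h] := eqVneq p.[lamz (zt t)] 0.
  have Qz : Q0.[lamz (zt t)] = 0 by rewrite hornerM h mul0r.
  have fz z : lamz z = lamz (zt t) -> f z = 0.
    by move=> zE; rewrite /f zE (pcE z1) h conjc0 mul0r.
  by rewrite Qz !mul0r mulr0 add0r !fz ?mulr0 ?addr0// lamz_inv.
have [u1 u2] := pU z1 h.
rewrite ker_cusp_cusp// mulrDr mulrCA; congr (_ + _).
rewrite /f lamz_inv -!regSE// lamz_inv hornerM.
by move: (S (zt t)) (S (zt t)^-1) => A B; rewrite !mxE; ring.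
Qed.

Lemma Q0_ker_core c n i t :
  let f z := pc.[lamz z] * regcore z i c in
  Q0.[lamz (zt t)] * ker (inr (c, n)) (inl i) (zt t) =
  zt t ^- n.+1 * f (zt t) + zt t ^+ n.+1 * f (zt t)^-1.
Proof.
move=> f; have [z1 iz1] := nsq_zti t.
have [h|h] := eqVneq p.[lamz (zt t)] 0.
  have Qz : Q0.[lamz (zt t)] = 0 by rewrite hornerM h mul0r.
  have fz z : lamz z = lamz (zt t) -> f z = 0.
    by move=> zE; rewrite /f zE (pcE z1) h conjc0 mul0r.
  by rewrite Qz mul0r !fz ?mulr0 ?addr0// lamz_inv.
have [u1 u2] := pU z1 h.
rewrite ker_cusp_core// /f lamz_inv -!regcoreE// lamz_inv hornerM.
by move: (core_mx (zt t)) (core_mx (zt t)^-1) => A B; rewrite !mxE; ring.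
Qed.

Lemma bmf_sym (f : C -> C) m : laurent f ->
  bmf (fun t => zt t ^- m * f (zt t) + zt t ^+ m * f (zt t)^-1).
Proof.
move=> lf; apply: (bmf_laurent (f := fun z => z ^- m * f z + z ^+ m * f z^-1)).
apply: laurentD; apply: laurentM => //; last exact: laurent_inv.
  by under eq_fun do rewrite -exprVn; apply: laurentXn; exact: laurentV.
by apply: laurentXn; exact: laurentX.
Qed.

(** For far vertices the matrix entry is that of the free ray, the free part of the kernel
    integrates to the same number, and the part linear in [S] has the shape treated in
    [cI_laurent]. *)
Lemma bq_far : exists M,
  (forall c n c' n', (M <= n + n')%N -> bq Q0 (inr (c, n)) (inr (c', n')) = 0) /\
  (forall c n i, (M <= n)%N -> bq Q0 (inr (c, n)) (inl i) = 0).
Proof.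
have lS c c' : laurent (fun z => pc.[lamz z] * regS z c' c).
  by apply: laurentM; [exact: laurent_p|exact: laurent_regS].
have lC c i : laurent (fun z => pc.[lamz z] * regcore z i c).
  by apply: laurentM; [exact: laurent_p|exact: laurent_regcore].
pose MS c c' := projT1 (cid (cI_laurent (lS c c'))).
have MSP c c' m : (MS c c' <= m)%N -> _ := projT2 (cid (cI_laurent (lS c c'))) m.
pose MC c i := projT1 (cid (cI_laurent (lC c i))).
have MCP c i m : (MC c i <= m)%N -> _ := projT2 (cid (cI_laurent (lC c i))) m.
exists (size Q0 + (\sum_c \sum_c' MS c c' + \sum_c \sum_i MC c i))%N; split.
- move=> c n c' n' Mn; rewrite /bq pJ_cusp; last by lia.
  rewrite (eq_cI (Q0_ker_cusp c n c' n')) cID; last 2 first.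
  + apply: bmfM; first exact: bmfC.
    by apply: bmfM; [apply: bmf_horner; exact: bmf_lamz|exact: bmf_tz].
  + exact: (bmf_sym _ (lS c c')).
  rewrite MSP; last first.
    suff : (MS c c' <= \sum_c \sum_c' MS c c')%N by lia.
    by rewrite (bigD1 c)//= (bigD1 c')//= -addnA leq_addr.
  rewrite addr0 cIZ ?subrr//.
  by apply: bmfM; [apply: bmf_horner; exact: bmf_lamz|exact: bmf_tz].
move=> c n i Mn; rewrite /bq pJ_cusp_core; last by lia.
rewrite (eq_cI (Q0_ker_core c n i)) MCP ?subrr//.
suff : (MC c i <= \sum_c \sum_i MC c i)%N by lia.
by rewrite (bigD1 c)//= (bigD1 i)//= -addnA leq_addr.
Qed.

(** Downward induction on the threshold [M]. In [bq_swap] one step further out, every term but the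
    wanted one lies beyond the threshold, or at the same level with a smaller position in the second
    ray, which an inner induction covers. *)
Lemma bq_cusp c n y : bq Q0 (inr (c, n)) y = 0.
Proof.
have an0 := a_neq0 R q0.
suff H0 M : (forall c n c' n', (M <= n + n')%N -> bq Q0 (inr (c, n)) (inr (c', n')) = 0) /\
    (forall c n i, (M <= n)%N -> bq Q0 (inr (c, n)) (inl i) = 0) ->
    (forall c n c' n', bq Q0 (inr (c, n)) (inr (c', n')) = 0) /\
    (forall c n i, bq Q0 (inr (c, n)) (inl i) = 0).
  have [M /H0[h1 h2]] := bq_far.
  by case: y => [i|[c' n']].
elim: M => [[h1 h2]|M IH [h1 h2]]; first by split=> *; [exact: h1|exact: h2].
apply: IH; have core c0 n0 i : (M <= n0)%N -> bq Q0 (inr (c0, n0)) (inl i) = 0.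
  move=> Mn; have := bq_swap (inr (c0, n0.+1)) (inl i); rewrite /= [X in _ + X]h2; last by lia.
  rewrite addr0 !big1 ?addr0 => [/eqP|c1 _|i1 _].
  - by rewrite mulf_eq0 (negbTE an0) => /eqP.
  - by rewrite h1 ?mulr0//; lia.
  - by rewrite h2 ?mulr0//; lia.
split=> [c0 n0 c1 n1 Mn|c0 n0 i Mn]; last exact: core.
elim: n1 n0 Mn => [|n1 IH1] n0 Mn.
  have := bq_swap (inr (c0, n0.+1)) (inr (c1, 0%N)).
  rewrite /= (h1 c0 n0.+2); last by lia.
  rewrite (h1 c0 n0.+1); last by lia.
  rewrite addr0 mulr0 add0r big1 => [/eqP|i _]; last by rewrite core ?mulr0//; lia.
  by rewrite mulf_eq0 (negbTE an0) => /eqP.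
have := bq_swap (inr (c0, n0.+1)) (inr (c1, n1.+1)).
rewrite /= (h1 c0 n0.+2); last by lia.
rewrite (h1 c0 n0.+1 c1 n1.+2); last by lia.
rewrite (IH1 n0.+1); last by lia.
rewrite addr0 addr0 mulr0 => /eqP.
by rewrite mulf_eq0 (negbTE an0) => /eqP.
Qed.

End Regularized.

Lemma annihilator m (A : 'M[C]_m) : exists2 P : {poly C}, P != 0 &
  forall u : 'cV[C]_m, \sum_(j < size P) P`_j *: iter j (mulmx A) u = 0.
Proof.
(* The empty core is separate: square matrices form a non-trivial ring only in positive size. *)
case: m A => [|m] A.
  by exists 1; rewrite ?oner_eq0// => u; apply: col0P; case.
exists (char_poly A) => [|u]; first exact: monic_neq0 (char_poly_monic A).
have := Cayley_Hamilton A; rewrite /horner_mx /horner_morph /= horner_coef.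
rewrite size_map_poly => /(congr1 (fun B => B *m u)); rewrite mul0mx mulmx_suml => h.
rewrite -[RHS]h; apply: eq_bigr => j _; rewrite coef_map -mulmxE.
rewrite mul_scalar_mx -scalemxAl; congr (_ *: _).
elim: {+}(j : nat) => [|k IH]; first by rewrite expr0 mul1mx.
by rewrite exprS iterS IH mulmxA.
Qed.

(** By [bq_cusp] only core indices [x] are left, and on them the action in the first argument
    reduces to the core matrix [Hc]; its characteristic polynomial kills the defect by
    Cayley-Hamilton. [Z] is this polynomial times the regularizer. *)
Theorem main_identity : exists Z : {poly C},
  [/\ Z != 0, forall x e, bmf (fun t => Z.[lamz (zt t)] * psi (zt t) x e),
    forall z, nsq z = 1 -> Z.[lamz z] != 0 -> F z \in unitmx /\ F z^-1 \in unitmx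
  & forall x y, pJ (Z * map_poly (@conjc R) Z) (cdelta x 1) y =
     cI (fun t => (Z * map_poly (@conjc R) Z).[lamz (zt t)] * ker x y (zt t))].
Proof.
have [p [G [p0 lG pG pU]]] := regularizer.
have [P P0 hP] := annihilator Hc.
have key x y : bq (Q0 p * P) x y = 0.
  have cusp0 c n P' y' : bq (Q0 p * P') (inr (c, n)) y' = 0.
    rewrite -(mul1r P'); apply: (bqMr lG pG pU) => y''.
    by rewrite mulr1; exact: (bq_cusp lG pG pU).
  case: x => [i|[c n]]; last exact: cusp0.
  rewrite (bqM lG pG pU); pose u : 'cV[C]_d := \col_k bq (Q0 p) (inl k) y.
  have hj j k : iter j Jc (fun x => bq (Q0 p) x y) (inl k) = (iter j (mulmx Hc) u) k ord0.
    elim: j k => [|j IH] k; first by rewrite mxE.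
    rewrite !iterS; set f := iter j Jc _; rewrite /= [X in _ + X]big1 ?addr0.
      by rewrite [RHS]mxE; apply: eq_bigr => k' _; rewrite -IH.
    by move=> c _; rewrite /f (iter_bq lG pG pU) cusp0 mulr0.
  have := congr1 (fun A : 'cV[C]_d => A i ord0) (hP u); rewrite mxE summxE => h.
  rewrite -[RHS]h; apply: eq_bigr => j _.
  by rewrite hj; move: (iter _ _ _) => B; rewrite mxE.
exists (p * P); split.
- by rewrite mulf_neq0.
- move=> x e; have := bmfM (bmf_horner P bmf_lamz) (bmf_psi lG pG x e).
  by congr bmf; apply/funext => t; rewrite hornerM; ring.
- by move=> z z1; rewrite hornerM mulf_eq0 negb_or => /andP[h _]; exact: pU.
move=> x y; apply/eqP; rewrite -subr_eq0 -/(bq _ x y) rmorphM /=.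
rewrite mulrACA -/(Q0 p); set P' := map_poly _ P.
by apply/eqP; exact: (bqMr lG pG pU).
Qed.

End MainIdentity.

(** * Non-negative sums along an injection *)

Section InjectiveSums.
Variables (R : realType) (I J : choiceType) (e : I -> J).
Hypothesis ei : injective e.

Lemma nsum_inj_range (g : J -> R) : (forall j, 0 <= g j) ->
  nsum (fun i => g (e i)) = nsum (fun j => if j \in range e then g j else 0).
Proof.
move=> g0; have be : set_bij setT (range e) e.
  split=> //.
  by move=> i i' _ _; exact: ei.
rewrite /nsum -(reindex_esum _ _ _ (fun j => (g j)%:E) be) [LHS]esum_mkcond.
by apply: eq_esum => j _; case: ifP.
Qed.

Lemma nsum_inj (g : J -> R) : (forall j, 0 <= g j) ->
  (nsum (fun i => g (e i)) <= nsum g)%E.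
Proof. by move=> g0; rewrite nsum_inj_range//; apply: le_nsum => j; case: ifP. Qed.

Lemma nsum_inj_supp (g : J -> R) : (forall j, 0 <= g j) ->
  (forall j, j \notin range e -> g j = 0) -> nsum g = nsum (fun i => g (e i)).
Proof.
move=> g0 gr; rewrite nsum_inj_range//; congr nsum; apply/funext => j.
by case: ifPn => // /gr.
Qed.

End InjectiveSums.

(** * Boundedness and symmetry of the Jacobi operator *)

Section JacobiBounded.
Variables (R : realType) (q d r : nat) (H : 'M[R[i]]_d) (V : 'M[R[i]]_(d, r)).
Notation C := R[i].
Notation X := (jidx d r).
Hypothesis q0 : (0 < q)%N.
Hypothesis Hh : adjmx H = H.
Notation J := (jacobi q H V).
Notation a := (sqrtq R q).
Implicit Types f g : X -> C.

Lemma one_ge0 (x : X) : 0 <= (fun=> 1) x :> R. Proof. exact: ler01. Qed.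
Notation L := (pl2 one_ge0).

Lemma sq_intP f : sq_int L f <-> (nsum (fun x => nsq (f x)) < +oo)%E.
Proof.
rewrite sq_int_l2P /rsummable nsum_norm => [|x]; last by rewrite mul1r nsq_ge0.
by under eq_fun do rewrite mul1r.
Qed.

Lemma form_nsum f : sq_int L f -> (form L f f)%:E = nsum (fun x => nsq (f x)).
Proof.
move=> sf; rewrite -(l2norm2E sf) nsum_l2; congr nsum; apply/funext => x.
by rewrite mul1r.
Qed.

Lemma nsum_dom f g : sq_int L f -> (nsum (fun x => nsq (g x)) <= nsum (fun x => nsq (f x)))%E ->
  sq_int L g /\ nrm L g <= nrm L f.
Proof.
move=> sf gf; have sg : sq_int L g by apply/sq_intP; apply: le_lt_trans gf _; apply/sq_intP.
split=> //; rewrite -(@ler_sqr R) ?nnegrE ?nrm_ge0// !nrm_sq -lee_fin.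
by rewrite !form_nsum.
Qed.

Definition shiftx (x : X) : X := match x with inl i => inl i | inr (c, n) => inr (c, n.+1) end.
Lemma shiftx_inj : injective shiftx.
Proof. by case=> [i|[c n]] [i'|[c' n']] //= [] // -> ->. Qed.

Definition upf f (x : X) : C := match x with inl _ => 0 | inr (c, n) => f (inr (c, n.+1)) end.
Definition dnf f (x : X) : C := match x with inr (c, n.+1) => f (inr (c, n)) | _ => 0 end.

Lemma upf_le f : sq_int L f -> sq_int L (upf f) /\ nrm L (upf f) <= nrm L f.
Proof.
move=> sf; apply: nsum_dom => //.
apply: le_trans (nsum_inj shiftx_inj (fun x => nsq_ge0 (f x))); apply: le_nsum => -[i|[c n]] //=.
by rewrite nsq0 nsq_ge0.
Qed.

Lemma dnf_le f : sq_int L f -> sq_int L (dnf f) /\ nrm L (dnf f) <= nrm L f.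
Proof.
move=> sf; apply: nsum_dom => //.
rewrite (nsum_inj_supp shiftx_inj (fun x => nsq_ge0 (dnf f x))).
  by apply: le_nsum => -[i|[c n]] //=; rewrite nsq0 nsq_ge0.
case=> [i|[c [|n]]] /=; rewrite ?nsq0// => /negP[]; apply: mem_set.
by exists (inr (c, n)).
Qed.

Definition cusp0_vec (c : 'I_r) : X -> C := fun x => match x with inl i => V i c | _ => 0 end.

(** Two shifts along the rays plus finitely many rank-one terms at the core, each bounded for an
    evident reason. *)
Lemma jacobi_decomp f x : J f x = a * upf f x + a * dnf f x +
  \sum_i f (inl i) * J (cdelta (inl i) 1) x + \sum_c f (inr (c, 0%N)) * cusp0_vec c x.
Proof.
have sum0 m (g : 'I_m -> C) : \sum_i g i * 0 = 0 by apply: big1 => i _; rewrite mulr0.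
have dl (g : 'I_d -> C) i0 : \sum_i g i * (if inl i == inl i0 :> X then 1 else 0) = g i0.
  rewrite (bigD1 i0)//= eqxx mulr1 big1 ?addr0// => i /negbTE ii.
  by rewrite (_ : (inl i == inl i0 :> X) = false) ?mulr0.
case: x => [i|[c [|n]]]; rewrite /cdelta /=.
- rewrite !mulr0 addr0 add0r; congr (_ + _).
    by apply: eq_bigr => i' _; rewrite dl sum0 addr0 mulrC.
  by apply: eq_bigr => c _; rewrite mulrC.
- rewrite mulr0 addr0 sum0 addr0; congr (_ + _).
  by apply: eq_bigr => i _; rewrite add0r dl mulrC.
- rewrite sum0 addr0 -mulrDr [f _ + _ in LHS]addrC -[LHS]addr0; congr (_ + _).
  by rewrite big1// => i _; rewrite !addr0 !mulr0.
Qed.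

Lemma finsupp_core (f : X -> C) : (forall c n, (0 < n)%N -> f (inr (c, n)) = 0) -> finsupp f.
Proof.
move=> f0; apply: (@seq_finsupp _ _ _ ([seq inl i | i <- enum 'I_d] ++ [seq inr (c, 0%N) | c <- enum 'I_r])).
case=> [i|[c [|n]]]; rewrite mem_cat negb_or => /andP[h1 h2]; last exact: f0.
  by case/negP: h1; rewrite map_f ?mem_enum.
by case/negP: h2; rewrite (map_f (fun c => inr (c, 0%N) : X)) ?mem_enum.
Qed.

Lemma nrmZ (W : Type) (M : pfun R W) (c : C) (f : W -> C) : sq_int M f ->
  nrm M (fun x => c * f x) = Num.sqrt (nsq c) * nrm M f.
Proof.
move=> sf; rewrite /nrm -sqrtrM ?nsq_ge0//; congr Num.sqrt.
rewrite /form -[RHS]addr0 -(pI0 M).2 -pI_lc; [|exact: rdot_intg|exact: (pI0 M).1].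
by congr pI; apply/funext => x; rewrite addr0 !rdotzz nsqM.
Qed.

Lemma nrm_sum (W : Type) (M : pfun R W) (T : finType) (F : T -> W -> C) :
  (forall t, sq_int M (F t)) -> nrm M (fun x => \sum_t F t x) <= \sum_t nrm M (F t).
Proof.
move=> sF; elim: (index_enum T) => [|t s IH].
  rewrite big_nil (_ : (fun x => _) = (fun=> 0)); last by apply/funext => x; rewrite big_nil.
  by rewrite /nrm form0l sqrtr0.
rewrite big_cons (_ : (fun x => _) = (fun x => F t x + \sum_(t <- s) F t x)); last first.
  by apply/funext => x; rewrite big_cons.
apply: le_trans (nrmD (sF t) _) _; first exact: sq_int_sum.
by rewrite lerD2l.
Qed.

Lemma sqrt_nsq_le f x : sq_int L f -> Num.sqrt (nsq (f x)) <= nrm L f.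
Proof.
move=> sf; have sd : sq_int L (cdelta x (f x)) by apply: finsupp_sq_int; exact: finsupp_cdelta.
have := le_trans (ler_norm _) (form_le sf sd).
rewrite form_cdelta mul1r rdotzz [X in _ <= _ * X -> _]/nrm form_cdelta mul1r /cdelta eqxx rdotzz.
set s := Num.sqrt _; have s0 : 0 <= s by exact: sqrtr_ge0.
have -> : nsq (f x) = s ^+ 2 by rewrite sqr_sqrtr// nsq_ge0.
have [->|sn0] := eqVneq s 0; first by rewrite nrm_ge0.
by rewrite expr2 ler_pM2r// lt_neqAle eq_sym sn0.
Qed.

Lemma jacobi_bounded : exists2 K : R, 0 <= K & forall f, sq_int L f ->
  sq_int L (J f) /\ nrm L (J f) <= K * nrm L f.
Proof.
have sc i : sq_int L (J (cdelta (inl i) 1)).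
  apply: finsupp_sq_int; apply: finsupp_core => c [//|n] _; rewrite /= /cdelta /=.
  by rewrite addr0 mulr0.
have sv c : sq_int L (cusp0_vec c) by apply: finsupp_sq_int; exact: finsupp_core.
pose K := Num.sqrt (nsq a) + Num.sqrt (nsq a) +
  \sum_i nrm L (J (cdelta (inl i) 1)) + \sum_c nrm L (cusp0_vec c).
exists K.
  by rewrite !addr_ge0 ?sqrtr_ge0 ?sumr_ge0// => *; exact: nrm_ge0.
move=> f sf; have [su nu] := upf_le sf; have [sd nd] := dnf_le sf.
have s1 : sq_int L (fun x => \sum_i f (inl i) * J (cdelta (inl i) 1) x).
  by apply: sq_int_sum => i _; exact: sq_intZ.
have s2 : sq_int L (fun x => \sum_c f (inr (c, 0%N)) * cusp0_vec c x).
  by apply: sq_int_sum => c _; exact: sq_intZ.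
have s3 : sq_int L (fun x => a * upf f x + a * dnf f x) by apply: sq_intD; exact: sq_intZ.
rewrite (_ : J f = fun x => a * upf f x + a * dnf f x +
  \sum_i f (inl i) * J (cdelta (inl i) 1) x + \sum_c f (inr (c, 0%N)) * cusp0_vec c x); last first.
  by apply/funext => x; exact: jacobi_decomp.
split; first by do 2![apply: sq_intD => //].
apply: le_trans (nrmD (sq_intD s3 s1) s2) _.
rewrite /K !mulrDl; apply: lerD.
  apply: le_trans (nrmD s3 s1) _; apply: lerD.
    by apply: le_trans (nrmD (sq_intZ _ su) (sq_intZ _ sd)) _; apply: lerD;
      rewrite nrmZ// ler_wpM2l ?sqrtr_ge0.
  apply: le_trans (nrm_sum _) _ => [i|]; first exact: sq_intZ.
  rewrite mulr_suml; apply: ler_sum => i _; rewrite nrmZ// mulrC ler_wpM2l ?nrm_ge0//.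
  exact: sqrt_nsq_le.
apply: le_trans (nrm_sum _) _ => [i|]; first exact: sq_intZ.
rewrite mulr_suml; apply: ler_sum => i _; rewrite nrmZ// mulrC ler_wpM2l ?nrm_ge0//.
exact: sqrt_nsq_le.
Qed.

Lemma jacobi_sq_int f : sq_int L f -> sq_int L (J f).
Proof. by move=> sf; have [K _ /(_ _ sf)[]] := jacobi_bounded. Qed.

(** Row and column at [x] run over the same finite list with conjugate coefficients; adjoints are
    computed from this. *)
Lemma jacobi_cdelta x c : exists s : seq (C * X),
  (forall f, J f x = \sum_(p <- s) conjc p.1 * f p.2) /\
  forall y, J (cdelta x c) y = \sum_(p <- s) cdelta p.2 (c * p.1) y.
Proof.
have [s hs] := jacobi_fin q (map_mx (@conjc R) H) (map_mx (@conjc R) V) x.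
exists s; split=> [f|y].
  rewrite -[LHS]conjcK conj_jacobi hs conj_sum; apply: eq_bigr => p _.
  by rewrite conjM conjcK.
rewrite (@eq_jacobi _ _ _ _ _ _ _ (fun y => c * cdelta x 1 y)); last first.
  by move=> y'; rewrite /cdelta; case: ifP; rewrite ?mulr1 ?mulr0.
rewrite jacobiZ -cdelta_swap// hs mulr_sumr; apply: eq_bigr => p _.
by rewrite /cdelta; case: ifP; rewrite ?mulr1 ?mulr0.
Qed.

Lemma finsupp_sum (T : eqType) (s : seq T) (F : T -> X -> C) :
  (forall t, finsupp (F t)) -> finsupp (fun x => \sum_(t <- s) F t x).
Proof.
move=> fF; elim: s => [|t s IH].
  by apply: (@seq_finsupp _ _ _ [::]) => x _; rewrite big_nil.
have [s1 _ h1] := finsupp_seq (fF t); have [s2 _ h2] := finsupp_seq IH.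
apply: (@seq_finsupp _ _ _ (s1 ++ s2)) => x; rewrite mem_cat negb_or => /andP[x1 x2].
by rewrite big_cons h1// h2// addr0.
Qed.

Lemma finsuppE f : finsupp f -> exists2 s : seq X, uniq s &
  f = fun y => \sum_(x <- s) cdelta x (f x) y.
Proof.
move=> /finsupp_seq[s us fs]; exists s => //; apply/funext => y.
have [ys|/[dup] ys /fs ->] := boolP (y \in s).
  rewrite (bigD1_seq y)//= {1}/cdelta eqxx big1 ?addr0// => x.
  by rewrite /cdelta eq_sym => /negbTE ->.
rewrite big_seq big1// => x xs; rewrite /cdelta; case: eqP => // yx.
by rewrite yx xs in ys.
Qed.

Lemma finsupp_jacobi f : finsupp f -> finsupp (J f).
Proof.
move=> /finsuppE[s _ ->]; rewrite (_ : J _ = fun y => \sum_(x <- s) J (cdelta x (f x)) y).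
  apply: finsupp_sum => x; have [u [_ h]] := jacobi_cdelta x (f x).
  have -> : J (cdelta x (f x)) = (fun y => \sum_(p <- u) cdelta p.2 (f x * p.1) y).
    by apply/funext => y; exact: h.
  by apply: finsupp_sum => p; exact: finsupp_cdelta.
by apply/funext => y; rewrite jacobi_sum.
Qed.

Lemma form_jacobi_fin f g : sq_int L f -> finsupp g -> form L (J f) g = form L f (J g).
Proof.
move=> sf /finsuppE[s _ gE]; have sd x c : sq_int L (cdelta x c).
  by apply: finsupp_sq_int; exact: finsupp_cdelta.
have sJd x c : sq_int L (J (cdelta x c)) by exact: jacobi_sq_int.
have -> : J g = fun y => \sum_(x <- s) J (cdelta x (g x)) y.
  by apply/funext => y; rewrite {1}gE jacobi_sum.
rewrite {1}gE formC [RHS]formC !form_sum//; last exact: jacobi_sq_int.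
apply: eq_bigr => x _; rewrite formC form_cdelta mul1r.
have [u [h1 h2]] := jacobi_cdelta x (g x).
have -> : J (cdelta x (g x)) = (fun y => \sum_(p <- u) cdelta p.2 (g x * p.1) y).
  by apply/funext => y; exact: h2.
rewrite form_sum// h1 rdotE mulr_suml re_sum.
apply: eq_bigr => p _; rewrite formC form_cdelta mul1r rdotE; congr re.
by rewrite !NconjE conjM; ring.
Qed.

Lemma eq_eps (x y K : R) : 0 <= K -> (forall e, 0 < e -> `|x - y| <= K * e) -> x = y.
Proof.
move=> K0 h; apply/eqP; rewrite -subr_eq0 -normr_eq0; apply/negPn/negP => n0.
have n1 : 0 < `|x - y| by rewrite lt_neqAle eq_sym n0 normr_ge0.
have K1 : 0 < K + 1 by lra.
have := h (`|x - y| / (2 * (K + 1))) (divr_gt0 n1 _); rewrite mulr_gt0// => /(_ isT).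
rewrite mulrA ler_pdivlMr ?mulr_gt0//; nra.
Qed.

(** The case of finitely supported [g] is extended by truncation, boundedness of [J] controlling
    both error terms. *)
Lemma form_jacobi f g : sq_int L f -> sq_int L g -> form L (J f) g = form L f (J g).
Proof.
move=> sf sg; have [K K0 hK] := jacobi_bounded.
apply: (@eq_eps _ _ (nrm L (J f) + nrm L f * K)).
  by rewrite addr_ge0 ?mulr_ge0 ?nrm_ge0.
move=> e e0; have [s hs] := l2_approx sg e0.
have st := finsupp_sq_int one_ge0 (finsupp_trunc s g); set g' := trunc s g in hs st.
have sgg := sq_intB sg st; have [sJf _] := hK _ sf; have [sJg _] := hK _ sg.
have [sJg' _] := hK _ st; have [sJgg nJgg] := hK _ sgg.
have -> : form L (J f) g - form L f (J g) =
    form L (J f) (fun x => g x - g' x) - form L f (J (fun x => g x - g' x)).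
  rewrite (_ : J (fun x => g x - g' x) = fun x => J g x - J g' x); last first.
    apply/funext => x; rewrite (@eq_jacobi _ _ _ _ _ _ _ (fun x => -1 * g' x + g x)) => [|y].
      by rewrite jacobi_lc mulN1r addrC.
    by rewrite mulN1r addrC.
  rewrite !formBr// (form_jacobi_fin sf (finsupp_trunc s g)); ring.
apply: le_trans (ler_normB _ _) _; rewrite mulrDl; apply: lerD.
  by apply: le_trans (form_le sJf sgg) _; rewrite ler_wpM2l ?nrm_ge0// ltW.
apply: le_trans (form_le sf sJgg) _; rewrite -mulrA ler_wpM2l ?nrm_ge0//.
by apply: le_trans nJgg _; rewrite ler_wpM2l// ltW.
Qed.

Notation pJ := (poly_jacobi q H V).

Lemma sq_int_iter j f : sq_int L f -> sq_int L (iter j J f).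
Proof. by move=> sf; elim: j => [//|j IH]; exact: jacobi_sq_int. Qed.

Lemma sq_int_pJ P f : sq_int L f -> sq_int L (pJ P f).
Proof.
by move=> sf; apply: sq_int_sum => j _; apply: sq_intZ; exact: sq_int_iter.
Qed.

Lemma pJ_bounded (P : {poly C}) : exists2 K : R, 0 <= K & forall f, sq_int L f ->
  nrm L (pJ P f) <= K * nrm L f.
Proof.
have [K K0 hK] := jacobi_bounded.
have hi j f : sq_int L f -> nrm L (iter j J f) <= K ^+ j * nrm L f.
  move=> sf; elim: j => [|j IH]; first by rewrite expr0 mul1r.
  rewrite iterS exprS -mulrA; apply: le_trans (hK _ (sq_int_iter j sf)).2 _.
  by rewrite ler_wpM2l.
exists (\sum_(j < size P) Num.sqrt (nsq P`_j) * K ^+ j).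
  by apply: sumr_ge0 => j _; rewrite mulr_ge0 ?sqrtr_ge0 ?exprn_ge0.
move=> f sf; apply: le_trans (nrm_sum _) _ => [j|].
  by apply: sq_intZ; exact: sq_int_iter.
rewrite mulr_suml; apply: ler_sum => j _; rewrite nrmZ; last exact: sq_int_iter.
by rewrite -mulrA ler_wpM2l ?sqrtr_ge0// hi.
Qed.

Lemma finsupp_pJ P f : finsupp f -> finsupp (pJ P f).
Proof.
move=> ff; apply: finsupp_sum => j.
have [s _ hs] : exists2 s : seq X, true & forall x, x \notin s -> iter j J f x = 0.
  have : finsupp (iter j J f) by elim: {+}(j : nat) => [//|k IH]; exact: finsupp_jacobi.
  by move=> /finsupp_seq[s _ h]; exists s.
by apply: (@seq_finsupp _ _ _ s) => x /hs ->; rewrite mulr0.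
Qed.

Lemma form_iter j f g : sq_int L f -> sq_int L g ->
  form L (iter j J f) g = form L f (iter j J g).
Proof.
move=> sf sg; elim: j g sg => [//|j IH] g sg.
rewrite iterS form_jacobi//; last exact: sq_int_iter.
by rewrite IH ?iterSr//; exact: jacobi_sq_int.
Qed.

Lemma form_pJ P f g : sq_int L f -> sq_int L g ->
  form L (pJ P f) g = form L f (pJ (map_poly (@conjc R) P) g).
Proof.
move=> sf sg; rewrite /poly_jacobi size_map_poly form_sum//; last first.
  by move=> j _; apply: sq_intZ; exact: sq_int_iter.
rewrite formC form_sum//; last first.
  by move=> j _; apply: sq_intZ; exact: sq_int_iter.
apply: eq_bigr => j _; rewrite (_ : (map_poly _ P)`_j = conjc P`_j); last by rewrite coef_map.
rewrite formMl NconjE [RHS]formC form_iter//; last exact: sq_intZ.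
congr form; apply/funext => x; move: (conjc P`_j) => c0.
elim: {+}(j : nat) x => [//|k IH] x.
by rewrite !iterS (@eq_jacobi _ _ _ _ _ _ _ _ IH) jacobiZ.
Qed.

End JacobiBounded.

(** * The Jacobi transform, its extension and its adjoint *)

Section Spectral.
Variables (R : realType) (q d r : nat) (H : 'M[R[i]]_d) (V : 'M[R[i]]_(d, r)).
Notation C := R[i].
Notation X := (jidx d r).
Notation mu := (@lebesgue_measure R).
Notation D := (`]0, (pi : R)[%classic : set R).
Hypothesis q0 : (0 < q)%N.
Hypothesis Hh : adjmx H = H.
Notation J := (jacobi q H V).
Notation F := (Fmx q H V).
Notation pJ := (poly_jacobi q H V).
Notation L := (pl2 (@one_ge0 R d r)).
Notation O := (pout R 'I_r).
Notation psi := (psi q H V).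
Notation lamt t := (lamz q (zt t)).
Implicit Types f g : X -> C.

Variable Z : {poly C}.
Notation Zc := (map_poly (@conjc R) Z).
Notation Q := (Z * Zc).
Hypothesis Z0 : Z != 0.
Hypothesis Zpsi : forall x e, bmf (fun t => Z.[lamt t] * psi (zt t) x e).
Hypothesis ZU : forall z, nsq z = 1 -> Z.[lamz q z] != 0 -> F z \in unitmx /\ F z^-1 \in unitmx.
Hypothesis ZQ : forall x y, pJ Q (cdelta x 1) y = cI (fun t => Q.[lamt t] * ker q H V x y (zt t)).

Notation jt := (jacobi_transform q H V).

Lemma jt_fin (s : seq X) f t c : uniq s -> (forall x, x \notin s -> f x = 0) ->
  jt f t c = \sum_(x <- s) f x * conjc (psi (zt t) x c).
Proof.
move=> us fs; set S := RHS.
have -> : S = (\sum_(x <- s) re (f x * conjc (psi (zt t) x c))) +i*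
    (\sum_(x <- s) im (f x * conjc (psi (zt t) x c))).
  by apply: complexP; rewrite /= ?re_sum ?im_sum.
rewrite /jacobi_transform /ip /csum; congr (_ +i* _).
  rewrite (rsum_fin us) => [|x /fs ->]; last by rewrite mul0r mulr0.
  by apply: eq_bigr => x _; rewrite mul1r.
rewrite (rsum_fin us) => [|x /fs ->]; last by rewrite mul0r mulr0.
by apply: eq_bigr => x _; rewrite mul1r.
Qed.

Lemma eq_jt f g t c : (forall x, f x = g x) -> jt f t c = jt g t c.
Proof. by move=> /funext ->. Qed.

Lemma jt_lc (b : C) f g t c : finsupp f -> finsupp g ->
  jt (fun x => b * f x + g x) t c = b * jt f t c + jt g t c.
Proof.
move=> /finsupp_seq[s1 _ h1] /finsupp_seq[s2 _ h2]; pose s := undup (s1 ++ s2).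
have us : uniq s := undup_uniq _.
have fs x : x \notin s -> f x = 0 by rewrite mem_undup mem_cat negb_or => /andP[/h1].
have gs x : x \notin s -> g x = 0 by rewrite mem_undup mem_cat negb_or => /andP[_ /h2].
rewrite !(jt_fin _ _ us)//; last by move=> x xs; rewrite fs// gs// mulr0 addr0.
by rewrite mulr_sumr -big_split; apply: eq_bigr => x _ /=; ring.
Qed.

Lemma jt_cdelta x b t c : jt (cdelta x b) t c = b * conjc (psi (zt t) x c).
Proof.
rewrite (@jt_fin [:: x])//; last exact: cdelta_out.
by rewrite big_seq1 /cdelta eqxx.
Qed.

Lemma jt0 t c : jt (fun=> 0) t c = 0.
Proof. by rewrite (@jt_fin [::])// big_nil. Qed.

Lemma jt_sum (T : eqType) (s : seq T) (G : T -> X -> C) t c : (forall i, finsupp (G i)) ->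
  jt (fun x => \sum_(i <- s) G i x) t c = \sum_(i <- s) jt (G i) t c.
Proof.
move=> fG; elim: s => [|i s IH].
  by rewrite big_nil (@eq_jt _ (fun=> 0)) ?jt0// => x; rewrite big_nil.
rewrite big_cons -IH -[jt (G i) t c]mul1r -jt_lc//; last exact: finsupp_sum.
by apply: eq_jt => x; rewrite big_cons mul1r.
Qed.

Lemma jt_jacobi f t c : finsupp f -> Z.[lamt t] != 0 -> jt (J f) t c = lamt t * jt f t c.
Proof.
move=> /finsuppE[s _ ->] Zt; have z1 := nsq_zt t; have [uF _] := ZU z1 Zt.
rewrite jt_sum => [|x]; last exact: finsupp_cdelta.
rewrite (_ : J _ = fun y => \sum_(x <- s) J (cdelta x (f x)) y); last first.
  by apply/funext => y; rewrite jacobi_sum.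
rewrite jt_sum => [|x]; last by apply: finsupp_jacobi => //; exact: finsupp_cdelta.
rewrite mulr_sumr; apply: eq_bigr => x _.
have [u [h1 h2]] := jacobi_cdelta q V Hh x (f x).
rewrite (_ : J _ = fun y => \sum_(p <- u) cdelta p.2 (f x * p.1) y); last exact/funext.
rewrite jt_sum => [|p]; last exact: finsupp_cdelta.
rewrite jt_cdelta mulrCA -{1}(conj_lamz q z1) -conjM -psi_eigen//.
rewrite h1 conj_sum mulr_sumr; apply: eq_bigr => p _.
by rewrite jt_cdelta conjM conjcK mulrA.
Qed.

Lemma jt_pJ P f t c : finsupp f -> Z.[lamt t] != 0 -> jt (pJ P f) t c = P.[lamt t] * jt f t c.
Proof.
move=> ff Zt; elim/poly_ind: P => [|P b IH].
  by rewrite horner0 mul0r (@eq_jt _ (fun=> 0)) ?jt0// => x; rewrite -[0 in LHS]/(0%:P) pJC mul0r.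
rewrite hornerMXaddC mulrDl mulrAC [_ * jt f t c * _]mulrC -IH -jt_jacobi//; last exact: finsupp_pJ.
rewrite [RHS]addrC -jt_lc//; last by apply: finsupp_jacobi => //; exact: finsupp_pJ.
by apply: eq_jt => x; rewrite pJD pJMX pJC addrC.
Qed.

(** Set to 0 where [Z] vanishes, a finite set of angles by [finite_Zroots], so that no default
    inverse inside [Psi] is ever seen. *)
Definition Tf f (p : R * 'I_r) : C := if Z.[lamt p.1] == 0 then 0 else jt f p.1 p.2.

Lemma Tf_lc (b : C) f g p : finsupp f -> finsupp g ->
  Tf (fun x => b * f x + g x) p = b * Tf f p + Tf g p.
Proof. by move=> ff fg; rewrite /Tf; case: ifP; rewrite ?mulr0 ?addr0// jt_lc. Qed.

Lemma Tf_pJ P f p : finsupp f -> Tf (pJ P f) p = P.[lamt p.1] * Tf f p.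
Proof. by move=> ff; rewrite /Tf; case: ifPn => Zt; rewrite ?mulr0// jt_pJ. Qed.

Lemma Q_horner t : Q.[lamt t] = (nsq Z.[lamt t])%:C.
Proof.
rewrite hornerM -{2}(conj_lamz q (nsq_zt t)) horner_map; exact: mulCJ.
Qed.

Lemma form_out_cI (u v : R * 'I_r -> C) :
  form O u v = re (\sum_c cI (fun t => u (t, c) * conjc (v (t, c)))).
Proof.
rewrite re_sum /form; apply: eq_bigr => c _; congr (Rintegral _ _ _ / _).
by apply/funext => t; rewrite rdotE.
Qed.

Lemma pJ_sum P (T : Type) (s : seq T) (G : T -> X -> C) x :
  pJ P (fun y => \sum_(t <- s) G t y) x = \sum_(t <- s) pJ P (G t) x.
Proof.
have [u e] := pJ_fin q H V P x; rewrite e; under eq_bigr do rewrite mulr_sumr.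
by rewrite exchange_big; apply: eq_bigr => t _; rewrite e.
Qed.

Lemma pJ_cdelta P x b y : pJ P (cdelta x b) y = b * pJ P (cdelta x 1) y.
Proof.
have [u e] := pJ_fin q H V P y; rewrite !e mulr_sumr; apply: eq_bigr => p _.
by rewrite /cdelta; case: ifP => _; ring.
Qed.

(** The identity [ZQ] for point masses, extended sesquilinearly. The factor [Q] is split into [Z]
    and its conjugate, one for each transform, to keep the integrands bounded. *)
Lemma plancherel_fin f g : finsupp f -> finsupp g ->
  form L (pJ Q f) g = form O (fun p => Q.[lamt p.1] * Tf f p) (Tf g).
Proof.
move=> /[dup] ff /finsupp_seq[s us fs] /[dup] fg /finsupp_seq[s' us' gs].
rewrite (form_finr _ _ us' gs) form_out_cI.
have bb x y c : bmf (fun t => (Z.[lamt t] * psi (zt t) y c) * conjc (Z.[lamt t] * psi (zt t) x c)).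
  by apply: bmfM; [|apply: bmf_conj]; exact: Zpsi.
have e c : cI (fun t => Q.[lamt t] * Tf f (t, c) * conjc (Tf g (t, c))) =
    \sum_(x <- s) \sum_(y <- s') f x * conjc (g y) *
      cI (fun t => (Z.[lamt t] * psi (zt t) y c) * conjc (Z.[lamt t] * psi (zt t) x c)).
  rewrite (eq_cI (g := fun t => \sum_(x <- s) \sum_(y <- s') f x * conjc (g y) *
      ((Z.[lamt t] * psi (zt t) y c) * conjc (Z.[lamt t] * psi (zt t) x c)))).
    rewrite cI_sum => [|x]; last by apply: bmf_sum => y; apply: bmfM; [exact: bmfC|exact: bb].
    apply: eq_bigr => x _; rewrite cI_sum => [|y]; last by apply: bmfM; [exact: bmfC|exact: bb].
    by apply: eq_bigr => y _; rewrite cIZ.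
  move=> t; rewrite /Tf; case: ifPn => [/eqP Zt|Zt].
    rewrite mulr0 mul0r big1// => x _; rewrite big1// => y _.
    by rewrite Zt !mul0r mulr0.
  rewrite (jt_fin t c us fs) (jt_fin t c us' gs) conj_sum -mulrA big_distrlr /= mulr_sumr.
  apply: eq_bigr => x _; rewrite mulr_sumr; apply: eq_bigr => y _.
  rewrite Q_horner -mulCJ NconjE !conjM conjcK; ring.
under [in RHS]eq_bigr do rewrite e.
rewrite exchange_big /=; under [in RHS]eq_bigr do rewrite exchange_big /=.
have h x y : \sum_c f x * conjc (g y) *
      cI (fun t => (Z.[lamt t] * psi (zt t) y c) * conjc (Z.[lamt t] * psi (zt t) x c)) =
    f x * conjc (g y) * pJ Q (cdelta x 1) y.
  rewrite -mulr_sumr -cI_sum// ZQ; congr (_ * _); apply: eq_cI => t.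
  rewrite /ker mulr_sumr; apply: eq_bigr => c _.
  by rewrite Q_horner -mulCJ NconjE conjM; ring.
under [in RHS]eq_bigr do under eq_bigr do rewrite h.
rewrite exchange_big /= re_sum; apply: eq_bigr => y _; rewrite mul1r rdotE; congr re.
have fE : f = fun y => \sum_(x <- s) cdelta x (f x) y.
  apply/funext => z; have [zs|/[dup] zs /fs ->] := boolP (z \in s).
    rewrite (bigD1_seq z)//= {1}/cdelta eqxx big1 ?addr0// => x.
    by rewrite /cdelta eq_sym => /negbTE ->.
  rewrite big_seq big1// => x xs; rewrite /cdelta; case: eqP => // zx.
  by rewrite zx xs in zs.
rewrite {1}fE pJ_sum mulr_suml; apply: eq_bigr => x _.
by rewrite pJ_cdelta NconjE; ring.
Qed.

Lemma bmf_Zt : bmf (fun t => Z.[lamt t]).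
Proof. by apply: bmf_horner; exact: bmf_lamz. Qed.
Lemma conj_polyK (P : {poly C}) : map_poly (@conjc R) (map_poly (@conjc R) P) = P.
Proof. by apply/polyP => i; rewrite !coef_map /= conjcK. Qed.

Lemma conj_polyZ c (P : {poly C}) :
  map_poly (@conjc R) (c *: P) = conjc c *: map_poly (@conjc R) P.
Proof. by apply/polyP => i; rewrite coef_map !coefZ coef_map /= conjM. Qed.

Lemma horner_one (x : C) : (1 : {poly C}).[x] = 1.
Proof. by rewrite hornerE. Qed.

(** [sP] is [1 - Q/B] with [B] above the bound of [|Z|^2] on the circle. Then [1 - sP^n] is a
    multiple of [Q], so [plancherel_fin] applies to it, and it tends to 1 wherever [Z] is
    non-zero. *)
Lemma cutoff : exists sP : {poly C}, exists st : R -> R, exists Rn : nat -> {poly C},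
  [/\ map_poly (@conjc R) sP = sP, forall t, sP.[lamt t] = (st t)%:C,
   forall t, 0 <= st t <= 1, forall t, Z.[lamt t] != 0 -> st t < 1
   & forall n, 1 - sP ^+ n = Q * Rn n].
Proof.
have [_ _ [B0 hB0]] := bmf_Zt; pose B := B0 + 1.
have B1 : 0 < B by have := le_trans (nsq_ge0 _) (hB0 0); rewrite /B; lra.
have hB t : nsq Z.[lamt t] <= B by apply: le_trans (hB0 t) _; rewrite lerDl.
pose sP : {poly C} := 1 - (B^-1)%:C *: Q.
exists sP, (fun t => 1 - nsq Z.[lamt t] / B), (fun n => (B^-1)%:C *: \sum_(i < n) sP ^+ i); split.
- have cc : conjc (B^-1)%:C = (B^-1)%:C by exact: conjc_real.
  by rewrite /sP rmorphB rmorph1 /= conj_polyZ cc rmorphM /= conj_polyK [Zc * Z]mulrC.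
- by move=> t; rewrite /sP hornerD hornerN hornerZ Q_horner horner_one rmorphB rmorph1 rmorphM mulrC.
- move=> t; rewrite gerBl subr_ge0 ler_pdivrMr// mul1r hB /=.
  by rewrite divr_ge0 ?nsq_ge0// ltW.
- move=> t Zt; rewrite gtrBl divr_gt0// lt_neqAle nsq_ge0 andbT eq_sym.
  by apply: contra_neq Zt => /nsq_eq0.
have e : 1 - sP = (B^-1)%:C *: Q by rewrite /sP opprB addrC subrK.
by move=> n; rewrite -opprB subrX1 -mulNr opprB e -scalerAl -scalerAr.
Qed.

(** Plancherel with the weight [1 - st^(2n)] bounds the integral by [|f|^2 - |sP^n f|^2 <= |f|^2],
    and monotone convergence removes the cut-off. *)
Lemma Tf_contraction f : finsupp f ->
  sq_int O (Tf f) /\ form O (Tf f) (Tf f) <= form L f f.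
Proof.
move=> ff; have [sP [st [Rn [sPc stE st01 st1 RnE]]]] := cutoff.
have sf : sq_int L f by exact: finsupp_sq_int.
(* The transform need not be bounded near a zero of [Z]; this multiple of it is. *)
pose w c t : C := conjc Z.[lamt t] * Tf f (t, c).
have bw c : bmf (w c).
  have [s us fs] := finsupp_seq ff.
  rewrite (_ : w c = fun t => \sum_(x <- s) f x * conjc (Z.[lamt t] * psi (zt t) x c)).
    by apply: bmf_sum => x; apply: bmfM; [exact: bmfC|apply: bmf_conj; exact: Zpsi].
  apply/funext => t; rewrite /w /Tf; case: ifPn => [/eqP ->|_].
    by rewrite mulr0 big1// => x _; rewrite mul0r conjc0 mulr0.
  by rewrite (jt_fin t c us fs) mulr_sumr; apply: eq_bigr => x _; rewrite conjM; ring.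
have rnE n p : (1 - (st p.1 ^+ n)%:C) * Tf f p = Z.[lamt p.1] * (Rn n).[lamt p.1] * w p.2 p.1.
  case: p => t c /=; rewrite /w mulrCA 2!mulrA mulrC [conjc _ * _]mulrC.
  have -> : Z.[lamt t] * conjc Z.[lamt t] = Q.[lamt t] by rewrite Q_horner -mulCJ.
  rewrite [LHS]mulrC; congr (_ * _).
  by rewrite -hornerM -RnE hornerD hornerN horner_one horner_exp stE -rmorphXn.
have mT c : measurable_fun D (fun t => re (Tf f (t, c))) /\
            measurable_fun D (fun t => im (Tf f (t, c))).
  have bn n : bmf (fun t => (1 - (st t ^+ n)%:C) * Tf f (t, c)).
    rewrite (_ : (fun t => _) = (fun t => Z.[lamt t] * (Rn n).[lamt t] * w c t)).
      by do 2![apply: bmfM => //]; apply: bmf_horner; exact: bmf_lamz.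
    by apply/funext => t; rewrite (rnE n (t, c)).
  have cv (a : R -> R) : (forall t, Z.[lamt t] = 0 -> a t = 0) ->
      forall t, (1 - st t ^+ n) * a t @[n --> \oo] --> a t.
    move=> a0 t; have [Zt|Zt] := eqVneq Z.[lamt t] 0.
      by rewrite a0//; under eq_fun do rewrite mulr0; exact: cvg_cst.
    suff : (1 - st t ^+ n) * a t @[n --> \oo] --> (1 - 0) * a t by rewrite subr0 mul1r.
    apply: cvgM; last exact: cvg_cst.
    apply: cvgB; first exact: cvg_cst.
    by apply: cvg_expr; rewrite ger0_norm ?st1//; case/andP: (st01 t).
  split.
    apply: (@measurable_fun_cvg _ _ _ D (fun n t => (1 - st t ^+ n) * re (Tf f (t, c)))).
      move=> n; have [+ _ _] := bn n; congr measurable_fun; apply/funext => t.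
      by rewrite -[1]/((1 : R)%:C) -rmorphB !reimE mul0r subr0.
    move=> t _; apply: (cv (fun t => re (Tf f (t, c)))) => t'.
    by rewrite /Tf /= => ->; rewrite eqxx.
  apply: (@measurable_fun_cvg _ _ _ D (fun n t => (1 - st t ^+ n) * im (Tf f (t, c)))).
    move=> n; have [_ + _] := bn n; congr measurable_fun; apply/funext => t.
    by rewrite -[1]/((1 : R)%:C) -rmorphB !reimE mul0r addr0.
  move=> t _; apply: (cv (fun t => im (Tf f (t, c)))) => t'.
  by rewrite /Tf /= => ->; rewrite eqxx.
have mn : omeas (fun p => nsq (Tf f p)).
  by apply: omeas_nsq => c; [exact: (mT c).1|exact: (mT c).2].
suff nA : (outnorm2 (cur (Tf f)) <= (form L f f)%:E)%E.
  have sT : sq_int O (uncur (cur (Tf f))).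
    by apply/L2outP; split=> //; apply: le_lt_trans nA (ltry _).
  have Te : uncur (cur (Tf f)) = Tf f by apply/funext => -[t c].
  by move: nA; rewrite outnorm2E// Te lee_fin; rewrite Te in sT.
(* The even exponent makes the removed part the square of the symmetric operator [sP^n], whose
   quadratic form is non-negative. *)
pose g n (p : R * 'I_r) := (1 - st p.1 ^+ (2 * n)) * nsq (Tf f p).
have st2 n t : 0 <= 1 - st t ^+ n.
  by rewrite subr_ge0 exprn_ile1//; case/andP: (st01 t).
have g0 n p : 0 <= g n p by rewrite mulr_ge0 ?nsq_ge0.
have rg n p : rdot (Q.[lamt p.1] * Tf (pJ (Rn (2 * n)%N) f) p) (Tf f p) = g n p.
  rewrite Tf_pJ// mulrA -hornerM -RnE hornerD hornerN horner_one horner_exp stE -rmorphXn.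
  rewrite -[1]/((1 : R)%:C) -rmorphB /g; move: (1 - _) => b.
  by rewrite /rdot /nsq !reimE; ring.
have og n : oint (g n).
  move=> c; have := bmf_re_int (bmfM (bmfM (bmf_horner (Rn (2 * n)%N) (@bmf_lamz R q)) (bw c)) (bmf_conj (bw c))).
  congr (mu.-integrable _ (EFin \o _)); apply/funext => t; rewrite -(rg n (t, c)) Tf_pJ//= rdotE.
  by rewrite /w Q_horner -mulCJ; congr re; rewrite !NconjE conjM conjcK; ring.
have gA n : oI (g n) <= form L f f.
  have <- : form O (fun p => Q.[lamt p.1] * Tf (pJ (Rn (2 * n)%N) f) p) (Tf f) = oI (g n).
    by rewrite /form; congr oI; apply/funext => p; exact: rg.
  rewrite -plancherel_fin//; last exact: finsupp_pJ.
  have -> : pJ Q (pJ (Rn (2 * n)%N) f) = fun x => f x - pJ (sP ^+ n) (pJ (sP ^+ n) f) x.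
    apply/funext => x; rewrite -!pJM [Rn _ * _]mulrC -RnE -exprD addnn -mul2n pJD pJC mul1r.
    by rewrite -scaleN1r pJZ mulN1r.
  have s1 : sq_int L (pJ (sP ^+ n) f) by exact: sq_int_pJ.
  have s2 : sq_int L (pJ (sP ^+ n) (pJ (sP ^+ n) f)) by exact: sq_int_pJ.
  rewrite formB// gerBl form_pJ//.
  rewrite (_ : map_poly _ _ = sP ^+ n) ?form_ge0//.
  by rewrite -[in RHS]sPc; exact: (rmorphXn (map_poly (@conjc R))).
pose h n t := (\sum_c (g n (t, c) / (2 * pi))%:E)%E.
have p0 : 0 <= (2 * pi : R)^-1 by rewrite invr_ge0 mulr_ge0// pi_ge0.
have mg n c : measurable_fun D (fun t => g n (t, c) / (2 * pi)).
  by apply: measurable_funM; [exact: (oint_meas (og n))|exact: measurable_cst].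
have hI n : (\int[mu]_(t in D) h n t = (oI (g n))%:E)%E.
  rewrite ge0_integral_sum//; last 2 first.
  - by move=> c; apply/measurable_EFinP; exact: mg.
  - by move=> c t _; rewrite lee_fin mulr_ge0.
  rewrite /oI -sumEFin; apply: eq_bigr => c _.
  rewrite [in RHS]EFinM /Rintegral fineK; last exact: (oint_fin c (og n)).
  rewrite muleC -ge0_integralZl_EFin//.
  - by apply: eq_integral => t _; rewrite -EFinM mulrC.
  - by move=> t _; rewrite lee_fin.
  - by apply/measurable_EFinP; exact: (oint_meas (og n)).
have mh n : measurable_fun D (h n).
  by apply: emeasurable_sum => c; apply/measurable_EFinP.
have hlim t : D t -> limn (h^~ t) = (\sum_c (nsq (Tf f (t, c)) / (2 * pi))%:E)%E.
  move=> _; apply: cvg_lim => //.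
  rewrite /h; under eq_fun do rewrite sumEFin; rewrite sumEFin.
  apply: cvg_EFin; first exact: nearW.
  suff gl c : g n (t, c) / (2 * pi) @[n --> \oo] --> nsq (Tf f (t, c)) / (2 * pi).
    rewrite (_ : fine \o _ = fun n => \sum_c g n (t, c) / (2 * pi)); last by apply/funext.
    elim: (index_enum 'I_r) => [|c s IH].
      by under eq_fun do rewrite big_nil; rewrite big_nil; exact: cvg_cst.
    by under eq_fun do rewrite big_cons; rewrite big_cons; apply: cvgD.
  apply: cvgM; last exact: cvg_cst.
  have [Zt|Zt] := eqVneq Z.[lamt t] 0.
    rewrite /g /Tf /= Zt eqxx nsq0; under eq_fun do rewrite mulr0; exact: cvg_cst.
  suff : (1 - st t ^+ (2 * n)) * nsq (Tf f (t, c)) @[n --> \oo] --> (1 - 0) * nsq (Tf f (t, c)).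
    by rewrite subr0 mul1r.
  apply: cvgM; last exact: cvg_cst.
  apply: cvgB; first exact: cvg_cst.
  under eq_fun do rewrite exprM; apply: cvg_expr.
  have /andP[s0 s1'] := st01 t; have s1 := st1 _ Zt.
  by rewrite ger0_norm ?exprn_ge0// expr_lt1.
have -> : outnorm2 (cur (Tf f)) = (\int[mu]_(t in D) limn (h^~ t))%E.
  apply: eq_integral => t /set_mem Dt; rewrite hlim// sumEFin.
  by congr EFin; apply: eq_bigr => c _; rewrite normc_sq.
have cvI : (\int[mu]_(t in D) h n t)%E @[n --> \oo] --> (\int[mu]_(t in D) limn (h^~ t))%E.
  apply: (@cvg_monotone_convergence _ _ R mu D (@measurable_D R) h mh).
  - by move=> n t _; apply: sume_ge0 => c _; rewrite lee_fin mulr_ge0.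
  - move=> t _ m n mle; apply: lee_sum => c _; rewrite lee_fin ler_wpM2r//.
    rewrite ler_wpM2r ?nsq_ge0// lerB// ler_wiXn2l ?leq_mul2l ?mle ?orbT//; by case/andP: (st01 t).
rewrite -(cvg_lim _ cvI)//; apply: lime_le; first by apply/cvg_ex; eexists; exact: cvI.
by apply: nearW => n; rewrite hI lee_fin.
Qed.

Notation T := Tf.
Implicit Types (u v w : R * 'I_r -> C).

Lemma Tf_sq f : finsupp f -> sq_int O (T f).
Proof. by move=> ff; have [] := Tf_contraction ff. Qed.

Lemma Tf_nrm f : finsupp f -> nrm O (T f) <= nrm L f.
Proof.
move=> ff; have [_ h] := Tf_contraction ff.
by rewrite -(@ler_sqr R) ?nnegrE ?nrm_ge0// !nrm_sq.
Qed.

Lemma finsupp0 : finsupp (fun _ : X => 0 : C).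
Proof. by apply: (@seq_finsupp _ _ _ [::]). Qed.

Lemma finsupp_lc (a : C) f g : finsupp f -> finsupp g -> finsupp (fun x => a * f x + g x).
Proof.
move=> /finsupp_seq[s1 _ h1] /finsupp_seq[s2 _ h2]; apply: (@seq_finsupp _ _ _ (s1 ++ s2)) => x.
by rewrite mem_cat negb_or => /andP[/h1 -> /h2 ->]; rewrite mulr0 addr0.
Qed.

Lemma Tf0 : T (fun=> 0) = fun=> 0.
Proof.
apply/funext => p; have := Tf_lc (-1) p finsupp0 finsupp0.
by rewrite mulr0 addr0 mulN1r addNr.
Qed.

Lemma TfB f g : finsupp f -> finsupp g ->
  T (fun x => f x - g x) = fun p => T f p - T g p.
Proof.
move=> ff fg; apply/funext => p; have := Tf_lc (-1) p fg ff.
by rewrite mulN1r addrC => <-; congr Tf; apply/funext => x; rewrite mulN1r addrC.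
Qed.

Lemma finsuppB f g : finsupp f -> finsupp g -> finsupp (fun x => f x - g x).
Proof.
move=> ff fg; have := finsupp_lc (-1) fg ff; congr finsupp.
by apply/funext => x; rewrite mulN1r addrC.
Qed.

Let fsq f : finsupp f -> sq_int L f := @finsupp_sq_int _ _ _ (@one_ge0 R d r) f.

(** Images of truncations form a Cauchy sequence by the contraction bound. The inequality against
    every finitely supported [g] fixes the limit up to norm 0. *)
Lemma Tbar_ex f : sq_int L f -> exists v, sq_int O v /\ forall g, finsupp g ->
  nrm O (fun p => v p - T g p) <= nrm L (fun x => f x - g x).
Proof.
move=> sf; have ap n : exists s : seq X, nrm L (fun x => f x - trunc s f x) < n.+1%:R^-1.
  by apply: l2_approx => //; rewrite invr_gt0 ltr0n.
pose fn n := trunc (projT1 (cid (ap n))) f.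
have fnE n : nrm L (fun x => f x - fn n x) < n.+1%:R^-1 := projT2 (cid (ap n)).
have ffn n : finsupp (fn n) by exact: finsupp_trunc.
clearbody fn.
have small e : 0 < e -> exists N, forall n, (N <= n)%N -> nrm L (fun x => f x - fn n x) <= e.
  move=> e0; have [N _ hN] := near_infty_natSinv_lt (PosNum e0).
  by exists N => n Nn; apply: ltW (lt_trans (fnE n) (hN n Nn)).
have [|e e0|v sv hv] := @pout_complete R 'I_r (fun n => T (fn n)).
- by move=> n; exact: Tf_sq.
- have [|N hN] := small (e / 2); first by rewrite divr_gt0.
  exists N => m n Nm Nn; rewrite -TfB//; apply: le_trans (Tf_nrm _) _; first exact: finsuppB.
  apply: le_trans (nrm_dist (fsq (ffn m)) sf (fsq (ffn n))) _.
  by rewrite nrmBC (splitr e) lerD// hN.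
exists v; split=> // g fg; apply/ler_addgt0Pr => e e0.
have e2 : 0 < e / 2 by rewrite divr_gt0.
have [N1 h1] := small _ e2; have [N2 h2] := hv _ e2.
pose n := maxn N1 N2; have := h1 n (leq_maxl _ _); have := h2 n (leq_maxr _ _) => A B.
apply: le_trans (nrm_dist sv (Tf_sq (ffn n)) (Tf_sq fg)) _.
rewrite nrmBC -TfB//; have := Tf_nrm (finsuppB (ffn n) fg).
have := nrm_dist (fsq (ffn n)) sf (fsq fg); rewrite nrmBC in B.
by rewrite (nrmBC L (fn n) f) in B *; lra.
Qed.

(** Selected by its characteristic inequality, because limits in [pout] are determined only up to
    null sets; statements about it are therefore in norm. *)
Definition Tbar f : R * 'I_r -> C := xget (fun=> 0) [set v | sq_int O v /\
  forall g, finsupp g -> nrm O (fun p => v p - T g p) <= nrm L (fun x => f x - g x)].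

Lemma TbarP f : sq_int L f -> sq_int O (Tbar f) /\ forall g, finsupp g ->
  nrm O (fun p => Tbar f p - T g p) <= nrm L (fun x => f x - g x).
Proof.
move=> /Tbar_ex[v hv]; rewrite /Tbar; case: xgetP => [y _ //|h].
by case: (h v hv).
Qed.

Lemma Tbar_sq f : sq_int L f -> sq_int O (Tbar f).
Proof. by move=> /TbarP[]. Qed.
Lemma fun_subr0 (W : Type) (u : W -> C) : (fun x => u x - 0) = u.
Proof. by apply/funext => x; rewrite subr0. Qed.
Lemma Tbar_nrm f : sq_int L f -> nrm O (Tbar f) <= nrm L f.
Proof. by move=> /TbarP[_ /(_ _ finsupp0)]; rewrite Tf0 !fun_subr0. Qed.

Lemma nrm_le0 (W : Type) (M : pfun R W) (K : R) (u : W -> C) : 0 <= K ->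
  (forall e, 0 < e -> nrm M u <= K * e) -> nrm M u = 0.
Proof.
move=> K0 h; apply: (eq_eps K0) => e e0; rewrite subr0 ger0_norm ?nrm_ge0//; exact: h.
Qed.

Lemma nrm_self0 (W : Type) (M : pfun R W) (u : W -> C) : nrm M (fun x => u x - u x) = 0.
Proof.
rewrite (_ : (fun x => _) = (fun=> 0)); last by apply/funext => x; rewrite subrr.
by rewrite /nrm form0l sqrtr0.
Qed.

Lemma Tbar_fin f : finsupp f -> nrm O (fun p => Tbar f p - T f p) = 0.
Proof.
move=> ff; apply/eqP; rewrite eq_le nrm_ge0 andbT.
by have [_ /(_ _ ff)] := TbarP (fsq ff); rewrite nrm_self0.
Qed.

Lemma approx f e : sq_int L f -> 0 < e -> exists2 g, finsupp g & nrm L (fun x => f x - g x) <= e.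
Proof.
move=> sf e0; have [s hs] := l2_approx sf e0; exists (trunc s f); last exact: ltW.
exact: finsupp_trunc.
Qed.

Lemma nrm_lcB (W : Type) (M : pfun R W) (a : C) (u u' v v' : W -> C) e :
  sq_int M u -> sq_int M u' -> sq_int M v -> sq_int M v' ->
  nrm M (fun x => u x - u' x) <= e -> nrm M (fun x => v x - v' x) <= e ->
  nrm M (fun x => (a * u x + v x) - (a * u' x + v' x)) <= (Num.sqrt (nsq a) + 1) * e.
Proof.
move=> su su' sv sv' h1 h2.
rewrite (_ : (fun x => _) = (fun x => a * (u x - u' x) + (v x - v' x))); last first.
  by apply/funext => x; ring.
apply: le_trans (nrmD (sq_intZ _ (sq_intB su su')) (sq_intB sv sv')) _.
rewrite nrmZ ?mulrDl ?mul1r; last exact: sq_intB.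
by rewrite lerD// ler_wpM2l// sqrtr_ge0.
Qed.

Lemma Tbar_lc (a : C) f g : sq_int L f -> sq_int L g ->
  nrm O (fun p => Tbar (fun x => a * f x + g x) p - (a * Tbar f p + Tbar g p)) = 0.
Proof.
move=> sf sg; have K0 : 0 <= 2 * (Num.sqrt (nsq a) + 1).
  by have := sqrtr_ge0 (nsq a); lra.
apply: (nrm_le0 K0) => e e0.
have [f' ff' nf] := approx sf e0; have [g' fg' ng] := approx sg e0.
have sfg := sq_int_lc a sf sg; have [sT hT] := TbarP sfg.
have [sf1 hf1] := TbarP sf; have [sg1 hg1] := TbarP sg.
have ffg := finsupp_lc a ff' fg'.
apply: le_trans (nrm_dist sT (Tf_sq ffg) (sq_int_lc a sf1 sg1)) _.
rewrite (_ : 2 * _ * e = (Num.sqrt (nsq a) + 1) * e + (Num.sqrt (nsq a) + 1) * e); last by ring.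
apply: lerD.
  by apply: le_trans (hT _ ffg) _; apply: nrm_lcB => //; exact: fsq.
rewrite nrmBC (_ : T _ = fun p => a * T f' p + T g' p); last first.
  by apply/funext => p; rewrite Tf_lc.
apply: nrm_lcB => //; try exact: Tf_sq.
  exact: le_trans (hf1 _ ff') nf.
exact: le_trans (hg1 _ fg') ng.
Qed.

Lemma form_eqO (W : Type) (M : pfun R W) (u v w : W -> C) : sq_int M u -> sq_int M v -> sq_int M w ->
  nrm M (fun x => u x - v x) = 0 -> form M u w = form M v w.
Proof.
move=> su sv sw h; apply/eqP; rewrite -subr_eq0 -formB// -normr_eq0 eq_le normr_ge0 andbT.
by apply: le_trans (form_le (sq_intB su sv) sw) _; rewrite h mul0r.
Qed.

(** The adjoint at [x]: the two real forms are the real and imaginary parts of the pairing of [u]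
    with the image of the point mass. *)
Definition Tstar u (x : X) : C :=
  form O u (T (cdelta x 1)) +i* form O u (T (cdelta x 'i)).

Let fcd x c : finsupp (cdelta x c : X -> C) := @finsupp_cdelta _ _ x c.

Lemma rdot_Tstar u x c : sq_int O u -> rdot (Tstar u x) c = form O u (T (cdelta x c)).
Proof.
move=> su; have s1 := Tf_sq (fcd x 1); have si := Tf_sq (fcd x 'i).
have -> : T (cdelta x c) =
    fun p => (re c)%:C * T (cdelta x 1) p + (im c)%:C * T (cdelta x 'i) p.
  have e (a : C) p : T (cdelta x a) p = a * T (cdelta x 1) p.
    have := Tf_lc a p (fcd x 1) finsupp0; rewrite Tf0 addr0 => <-.
    congr Tf; apply/funext => y; rewrite addr0 /cdelta; case: ifP; rewrite ?mulr1 ?mulr0//.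
  apply/funext => p; rewrite (e c) (e 'i) mulrA -mulrDl; congr (_ * _).
  by apply: complexP; rewrite !reimE; ring.
rewrite formDr ?formZr//; try exact: sq_intZ.
rewrite /rdot /Tstar; move: (form O u (T (cdelta x 1))) (form O u (T (cdelta x 'i))) => A B /=.
by rewrite mulrC [B * _]mulrC.
Qed.

Lemma Tf_cdeltaZ x (a c : C) : T (cdelta x (a * c)) = fun p => a * T (cdelta x c) p.
Proof.
apply/funext => p; have := Tf_lc a p (fcd x c) finsupp0; rewrite Tf0 addr0 => <-.
by congr Tf; apply/funext => y; rewrite addr0 /cdelta; case: ifP; rewrite ?mulr0.
Qed.

Lemma Tf_sumE g (s : seq X) : g = (fun y => \sum_(x <- s) cdelta x (g x) y) ->
  T g = fun p => \sum_(x <- s) T (cdelta x (g x)) p.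
Proof.
move=> gE; apply/funext => p; rewrite [in LHS]gE; elim: s {gE} => [|x s IH].
  rewrite big_nil -[RHS](congr1 (fun h => h p) Tf0); congr Tf.
  by apply/funext => y; rewrite big_nil.
rewrite big_cons -IH -[T (cdelta x _) p]mul1r -Tf_lc//; last first.
  by apply: finsupp_sum => ?; exact: fcd.
by congr Tf; apply/funext => y; rewrite big_cons mul1r.
Qed.

Lemma Tstar_fin u g : sq_int O u -> finsupp g -> form L (Tstar u) g = form O u (T g).
Proof.
move=> su /[dup] fg /finsuppE[s us gE].
have gs x : x \notin s -> g x = 0.
  rewrite gE => xs; rewrite big_seq big1// => y ys; rewrite /cdelta; case: eqP => // xy.
  by rewrite xy ys in xs.
rewrite (form_finr _ _ us gs) (Tf_sumE gE) formC form_sum//; last by move=> x _; exact: Tf_sq.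
by apply: eq_bigr => x _; rewrite mul1r rdot_Tstar// formC.
Qed.

(** Duality: the norm of a truncation [g] of [Tstar u] satisfies [|g|^2 <= |u| |T g| <= |u| |g|]. *)
Lemma Tstar_sq u : sq_int O u -> sq_int L (Tstar u) /\ nrm L (Tstar u) <= nrm O u.
Proof.
move=> su; have [sT nT] : sq_int L (Tstar u) /\ form L (Tstar u) (Tstar u) <= form O u u.
  apply: form_sq_int => s; set g := trunc s _; have fg : finsupp g by exact: finsupp_trunc.
  have h : form L g g <= nrm O u * nrm L g.
    rewrite -form_trunc Tstar_fin//; apply: le_trans (ler_norm _) _.
    apply: le_trans (form_le su (Tf_sq fg)) _.
    by rewrite ler_wpM2l ?nrm_ge0// Tf_nrm.
  rewrite -nrm_sq expr2 in h *; rewrite -nrm_sq expr2.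
  have [g0|g0] := eqVneq (nrm L g) 0; first by rewrite g0 mul0r mulr_ge0 ?nrm_ge0.
  have gp : 0 < nrm L g by rewrite lt_neqAle eq_sym g0 nrm_ge0.
  by rewrite ler_pM2r// in h; rewrite ler_pM ?nrm_ge0.
split=> //; by rewrite -(@ler_sqr R) ?nnegrE ?nrm_ge0// !nrm_sq.
Qed.

Lemma Tstar_Tbar u g : sq_int O u -> sq_int L g -> form L (Tstar u) g = form O u (Tbar g).
Proof.
move=> su sg; have [sT _] := Tstar_sq su; have [sb hb] := TbarP sg.
have K0 : 0 <= nrm L (Tstar u) + nrm O u by rewrite addr_ge0 ?nrm_ge0.
apply: (eq_eps K0) => e e0; have [g' fg' ng] := approx sg e0.
have sg' := fsq fg'; have sTg := Tf_sq fg'.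
have -> : form L (Tstar u) g - form O u (Tbar g) =
    form L (Tstar u) (fun x => g x - g' x) - form O u (fun p => Tbar g p - T g' p).
  by rewrite !formBr// (Tstar_fin su fg'); ring.
apply: le_trans (ler_normB _ _) _; rewrite mulrDl; apply: lerD.
  by apply: le_trans (form_le sT (sq_intB sg sg')) _; rewrite ler_wpM2l ?nrm_ge0.
apply: le_trans (form_le su (sq_intB sb sTg)) _; rewrite ler_wpM2l ?nrm_ge0//.
exact: le_trans (hb _ fg') ng.
Qed.

Lemma rdot_inj (z w : C) : (forall c, rdot z c = rdot w c) -> z = w.
Proof.
move=> h; apply: complexP; first by have := h 1; rewrite /rdot !reimE !mulr1 !mulr0 !addr0.
by have := h 'i; rewrite /rdot !reimE !mulr1 !mulr0 !add0r.
Qed.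

Lemma Tstar_lc (a : C) u v x : sq_int O u -> sq_int O v ->
  Tstar (fun p => a * u p + v p) x = a * Tstar u x + Tstar v x.
Proof.
move=> su sv; apply: rdot_inj => c; have sT := Tf_sq (fcd x c).
rewrite rdot_Tstar; last exact: sq_int_lc.
rewrite formD//; last exact: sq_intZ.
rewrite formMl NconjE -Tf_cdeltaZ -!rdot_Tstar// /rdot !reimE; ring.
Qed.

Lemma bmf_mul b u : bmf b -> sq_int O u -> sq_int O (fun p => b p.1 * u p).
Proof.
move=> [b1 b2 [B hB]] [u1 u2 u3].
have mr : omeas (fun p : R * 'I_r => re (b p.1)) by [].
have mi : omeas (fun p : R * 'I_r => im (b p.1)) by [].
have m1 := @pmeas_reM _ _ O (fun p => b p.1) u mr mi u1 u2.
have m2 := @pmeas_imM _ _ O (fun p => b p.1) u mr mi u1 u2.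
split=> //; apply: (@oint_le _ _ _ (fun p => B * nsq (u p))).
- exact: omeas_nsq.
- exact: (pintgZ B u3).
- by move=> p _; rewrite nsqM ger0_norm ?mulr_ge0 ?nsq_ge0// ler_wpM2r ?nsq_ge0.
Qed.

Lemma bmf_P (P : {poly C}) : bmf (fun t => P.[lamt t]).
Proof. by apply: bmf_horner; exact: bmf_lamz. Qed.

Notation mulQ u := (fun p => Q.[lamt p.1] * u p).

Lemma mulQ_sq u : sq_int O u -> sq_int O (mulQ u).
Proof. exact: (bmf_mul (bmf_P Q)). Qed.

Lemma form_mulQ u v : form O (mulQ u) v = form O u (mulQ v).
Proof.
rewrite /form; congr oI; apply/funext => p.
by rewrite rdotMl NconjE Q_horner conjc_real.
Qed.

Lemma plancherel f g : sq_int L f -> finsupp g ->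
  form L (pJ Q f) g = form O (mulQ (Tbar f)) (T g).
Proof.
move=> sf fg; have [sT hT] := TbarP sf; have sTg := Tf_sq fg.
have [K K0 hK] := pJ_bounded q H V Q; have sg := fsq fg.
have KK : 0 <= K * nrm L g + nrm O (mulQ (T g)).
  by rewrite addr_ge0 ?mulr_ge0 ?nrm_ge0.
apply: (eq_eps KK) => e e0; have [f' ff nf] := approx sf e0.
have sf' := fsq ff; have sTf := Tf_sq ff; have sd := sq_intB sf sf'.
have sJ := sq_int_pJ q H V Q sf; have sJ' := sq_int_pJ q H V Q sf'.
have -> : form L (pJ Q f) g - form O (mulQ (Tbar f)) (T g) =
    form L (pJ Q (fun x => f x - f' x)) g - form O (fun p => Tbar f p - T f' p) (mulQ (T g)).
  rewrite (formB sT sTf (mulQ_sq sTg)) -!form_mulQ.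
  rewrite -(plancherel_fin ff fg).
  have -> : pJ Q (fun x => f x - f' x) = fun x => pJ Q f x - pJ Q f' x.
    apply/funext => x; have [u hu] := pJ_fin q H V Q x; rewrite !hu -sumrB.
    by apply: eq_bigr => p _; rewrite mulrBr.
  by rewrite formB//; ring.
apply: le_trans (ler_normB _ _) _; rewrite mulrDl; apply: lerD.
  apply: le_trans (form_le (sq_int_pJ q H V Q sd) sg) _.
  rewrite mulrAC ler_wpM2r ?nrm_ge0//; apply: le_trans (hK _ sd) _.
  by rewrite ler_wpM2l.
apply: le_trans (form_le (sq_intB sT sTf) (mulQ_sq sTg)) _; rewrite mulrC ler_wpM2l ?nrm_ge0//.
exact: le_trans (hT _ ff) nf.
Qed.

(** Operator form of Plancherel; in particular the range of [Tstar] contains that of [Q(J)]. *)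
Lemma Tstar_Q f x : sq_int L f -> pJ Q f x = Tstar (mulQ (Tbar f)) x.
Proof.
move=> sf; apply: rdot_inj => c; rewrite rdot_Tstar; last exact: mulQ_sq (Tbar_sq sf).
rewrite -(plancherel sf (fcd x c)).
by rewrite form_cdelta mul1r.
Qed.

Lemma Q_selfconj : map_poly (@conjc R) Q = Q.
Proof. by rewrite rmorphM /= conj_polyK mulrC. Qed.

(** Carrying [Q(J)] across the form, once by Plancherel and once by symmetry, gives the identity
    [T Tstar u = u] tested against the vectors [Q T f]. *)
Lemma TTstar_orth u f : sq_int O u -> finsupp f ->
  form O (fun p => Tbar (Tstar u) p - u p) (mulQ (T f)) = 0.
Proof.
move=> su ff; have [sT _] := Tstar_sq su; have sb := Tbar_sq sT; have sTf := Tf_sq ff.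
rewrite formB//; last exact: mulQ_sq.
rewrite -form_mulQ -plancherel// form_pJ//; last exact: fsq.
rewrite Q_selfconj Tstar_fin//; last exact: finsupp_pJ.
apply/eqP; rewrite subr_eq0; apply/eqP; congr form; apply/funext => p.
by rewrite Tf_pJ.
Qed.


Lemma re_lamt t : lamt t = (2 * ar R q * cos t)%:C.
Proof. by rewrite /lamz ztDV sqrtqE -rmorphM /= mulrCA mulrA. Qed.
Lemma sin_gt0_D t : D t -> 0 < sin t.
Proof. by rewrite /= in_itv /= => h; exact: sin_gt0_pi. Qed.

Lemma finite_Zroots : finite_set [set t | D t /\ Z.[lamt t] = 0].
Proof.
have [s Zs] := closed_field_poly_normal Z.
have lc0 : lead_coef Z != 0 by rewrite lead_coef_eq0.
pose f (z : C) := acos (re z / (2 * ar R q)).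
apply: (@sub_finite_set _ _ (f @` [set` s])); last by apply: finite_image; exact: finite_seq.
move=> t [Dt /eqP]; rewrite Zs hornerZ mulf_eq0 (negbTE lc0) /= => h; exists (lamt t).
  by rewrite /= -root_prod_XsubC.
have a2 : 2 * ar R q != 0 by rewrite mulf_neq0// gt_eqF// ar_gt0.
rewrite /f re_lamt /= mulrAC divff// mul1r cosK//.
by move: Dt; rewrite /= !in_itv /= => /andP[/ltW -> /ltW ->].
Qed.

Lemma ae_Z : {ae mu, forall t, D t -> Z.[lamt t] != 0}.
Proof.
exists [set t | D t /\ Z.[lamt t] = 0]; split.
- have [s ->] : exists s : seq R, [set t | D t /\ Z.[lamt t] = 0] = [set` s].
    by apply/finite_seqP; exact: finite_Zroots.
  apply: countable_measurable => [x|]; first exact: measurable_set1.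
  by apply: finite_set_countable; exact: finite_seq.
- by apply: countable_lebesgue_measure0; apply: finite_set_countable; exact: finite_Zroots.
by move=> t /= /not_implyP[Dt /negP/negPn/eqP].
Qed.

Lemma Rintegral_sumr (I : Type) (s : seq I) (G : I -> R -> R) :
  (forall i, mu.-integrable D (EFin \o G i)) ->
  mu.-integrable D (EFin \o (fun t => \sum_(i <- s) G i t)) /\
  Rintegral mu D (fun t => \sum_(i <- s) G i t) = \sum_(i <- s) Rintegral mu D (G i).
Proof.
move=> iG; elim: s => [|i s [IH1 IH2]].
  rewrite big_nil (_ : (fun t => _) = fun=> 0); last by apply/funext => t; rewrite big_nil.
  by split; [exact: integrable0|rewrite Rintegral_cst ?mul0r//; exact: measurable_D].
rewrite big_cons -IH2 (_ : (fun t => _) = (fun t => G i t + \sum_(i <- s) G i t)); last first.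
  by apply/funext => t; rewrite big_cons.
split; last by rewrite RintegralD//; exact: measurable_D.
have := @integrableD _ _ R mu D (@measurable_D R) _ _ (iG i) IH1.
by congr (_.-integrable _ _); apply/funext.
Qed.

Lemma sq_int_component u c : sq_int O u ->
  mu.-integrable D (EFin \o (fun t => nsq (u (t, c)))).
Proof. by move=> [_ _ /(_ c)]. Qed.

(** Testing with an arbitrary polynomial in [J] applied to a point mass makes all cosine moments
    vanish; masses [1] and ['i] give the real and the imaginary part. *)
Lemma ae_zero_of_orth w : sq_int O w ->
  (forall f, finsupp f -> form O w (mulQ (T f)) = 0) ->
  forall x, {ae mu, forall t, D t -> \sum_c w (t, c) * (Q.[lamt t] * (if Z.[lamt t] == 0 then 0 else psi (zt t) x c)) = 0}.
Proof.
move=> sw worth x.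
pose hh (b : C) t : R := \sum_c rdot (w (t, c)) (Q.[lamt t] * T (cdelta x b) (t, c)).
have hint b : mu.-integrable D (EFin \o hh b).
  rewrite (_ : EFin \o hh b = fun t => (\sum_c (rdot (w (t, c)) (Q.[lamt t] * T (cdelta x b) (t, c)))%:E)%E); last first.
    by apply/funext => t; rewrite sumEFin.
  apply: integrable_sum => // c _.
  exact: (rdot_intg sw (mulQ_sq (Tf_sq (fcd x b))) c).
have h0 b : ae_eq mu D (hh b) (cst 0).
  apply: cos_moments_eq0 => // p.
  have a2 : 2 * ar R q != 0 by rewrite mulf_neq0// gt_eqF// ar_gt0.
  (* On the circle the spectral parameter is [2 sqrt q cos t], so rescaling the variable realizes
     any polynomial in the cosine. *)
  pose P : {poly C} := map_poly (@real_complex R) (p \Po ((2 * ar R q)^-1 *: 'X)).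
  have PE t : P.[lamt t] = (p.[cos t])%:C.
    by rewrite re_lamt /P horner_map /= horner_comp hornerZ hornerX mulKf.
  have := worth _ (finsupp_pJ q V Hh P (fcd x b)); rewrite /form /= /oI.
  rewrite -mulr_suml => /eqP; rewrite mulf_eq0 invr_eq0 mulf_eq0 pnatr_eq0 (gt_eqF (pi_gt0 R)) /= orbF.
  move=> /eqP h; rewrite -[RHS]h.
  rewrite -(Rintegral_sumr _ _).2 => [|c]; last first.
    exact: (rdot_intg sw (mulQ_sq (Tf_sq (finsupp_pJ q V Hh P (fcd x b)))) c).
  apply: eq_Rintegral => t _; rewrite /hh mulr_suml; apply: eq_bigr => c _.
  rewrite Tf_pJ// PE; rewrite /rdot !reimE; ring.
apply: ae_S2 (h0 1) (h0 'i) => t h1 hi Dt; have {}h1 := h1 Dt; have {}hi := hi Dt.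
have hE b : hh b t = rdot (\sum_c w (t, c) * (Q.[lamt t] *
    (if Z.[lamt t] == 0 then 0 else psi (zt t) x c))) b.
  rewrite rdotE mulr_suml re_sum; apply: eq_bigr => c _.
  rewrite rdotE; congr re; rewrite /Tf /=; case: ifP => _; first by rewrite !mulr0 rmorph0 mulr0 mul0r.
  by rewrite jt_cdelta Q_horner !NconjE !conjM conjcK conjc_real; ring.
move: h1 hi; rewrite !hE /=; set S := \sum_c _; rewrite /rdot !reimE => h1 hi.
by apply: complexP; rewrite !reimE; lra.
Qed.

(** The first two vertices of ray [c] give [z w + z^-1 S' = 0] and [z^2 w + z^-2 S' = 0], where [S']
    is the scattered amplitude; as [z^2 != 1] inside [(0, pi)], the component [w] at [c]
    vanishes. *)
Lemma orth_zero w : sq_int O w ->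
  (forall f, finsupp f -> form O w (mulQ (T f)) = 0) -> nrm O w = 0.
Proof.
move=> sw worth; have h := ae_zero_of_orth sw worth.
have s0 : sq_int O (fun=> 0) by exact: sq_int0.
have w0 : ae_eq0pi (cur w) (fun _ _ => 0).
  apply/ae0piP => c.
  have h1 : {ae mu, forall t, D t -> Z.[lamt t] != 0 /\ \sum_c' w (t, c') *
      (Q.[lamt t] * (if Z.[lamt t] == 0 then 0 else psi (zt t) (inr (c, 0%N)) c')) = 0}.
    by apply: ae_S2 ae_Z (h (inr (c, 0%N))) => t a b Dt; split; [exact: a|exact: b].
  apply: ae_S2 h1 (h (inr (c, 1%N))) => t {}h1 h2 Dt; have [Zt {}h1] := h1 Dt; have {}h2 := h2 Dt.
  have z0 := zt_neq0 t; have sint := sin_gt0_D Dt.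
  have z21 : zt t ^+ 2 - 1 != 0.
    rewrite subr_eq0; apply/eqP => z2; have : zt t = (zt t)^-1.
      by apply: (mulfI z0); rewrite divff// -expr2.
    by rewrite zt_inv => /(congr1 (@complex.Im R)) /=; lra.
  have Qt : Q.[lamt t] != 0.
    by rewrite Q_horner fmorph_eq0; apply: contra_neq Zt => /nsq_eq0.
  pose Sw := \sum_c' w (t, c') * Smx q H V (zt t) c c'.
  have key n : \sum_c' w (t, c') * (Q.[lamt t] *
      (if Z.[lamt t] == 0 then 0 else psi (zt t) (inr (c, n)) c')) =
      Q.[lamt t] * (zt t ^+ n.+1 * w (t, c) + zt t ^- n.+1 * Sw).
    rewrite (negbTE Zt) /Sw mulr_sumr.
    have -> : zt t ^+ n.+1 * w (t, c) = \sum_c' zt t ^+ n.+1 * (w (t, c') * (c == c')%:R).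
      rewrite (bigD1 c)//= eqxx mulr1 big1 ?addr0// => c' /negbTE cc.
      by rewrite eq_sym cc !mulr0.
    rewrite -big_split mulr_sumr; apply: eq_bigr => c' _.
    rewrite psi_cusp; move: (Smx q H V (zt t)) => S; by rewrite !mxE /=; ring.
  move: h1 h2; rewrite !key => /eqP; rewrite mulf_eq0 (negbTE Qt) /= => /eqP h1.
  move=> /eqP; rewrite mulf_eq0 (negbTE Qt) /= => /eqP h2.
  rewrite /cur; apply: (mulfI z21); rewrite mulr0.
  move: h1 h2; clear key; clearbody Sw; move: (w (t, c)) Sw => W S h1 h2.
  have e1 : S = - zt t ^+ 2 * W.
    have : zt t * (zt t ^+ 1 * W + zt t ^- 1 * S) = 0 by rewrite h1 mulr0.
    rewrite mulrDr !expr1 [zt t * (_^-1 * _)]mulrA divff// mul1r => /eqP.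
    by rewrite addr_eq0 => /eqP e; rewrite mulNr expr2 -mulrA e opprK.
  move: h2; rewrite e1 !exprS expr0 !mulr1 => h2; rewrite -[RHS]h2.
  by field.
have := @ae0pi_form R 'I_r (cur w) (fun _ _ => 0) (cur w).
have -> : uncur (cur w) = w by apply/funext => -[].
move=> /(_ sw s0 sw w0) e; rewrite /nrm e.
by rewrite (_ : uncur _ = fun=> 0) ?form0l ?sqrtr0//; apply/funext => -[].
Qed.

Lemma TTstar u : sq_int O u -> nrm O (fun p => Tbar (Tstar u) p - u p) = 0.
Proof.
move=> su; have [sT _] := Tstar_sq su; apply: orth_zero.
  by apply: sq_intB => //; exact: Tbar_sq.
by move=> f ff; exact: TTstar_orth.
Qed.

Lemma Tstar_isom u v : sq_int O u -> sq_int O v -> form L (Tstar u) (Tstar v) = form O u v.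
Proof.
move=> su sv; have [sT _] := Tstar_sq sv; rewrite Tstar_Tbar// formC [RHS]formC.
by apply: form_eqO; rewrite ?TTstar//; exact: Tbar_sq.
Qed.

End Spectral.

(** * Measures with a density and their images *)

Section DensityMeasure.
Variable R : realType.
Notation mu := (@lebesgue_measure R).
Variable h : R -> R.
Hypothesis h0 : forall t, 0 <= h t.
Hypothesis ih : mu.-integrable setT (EFin \o h).

(** The hypotheses on [h] are arguments so that the measure structure can be inferred from the term
    itself; [image_density] is built in the same way. *)
Definition density (h0' : forall t, 0 <= h t) (ih' : mu.-integrable setT (EFin \o h))
    (A : set (measurableTypeR R)) : \bar R := (\int[mu]_(t in A) (h t)%:E)%E.
Notation nu := (density h0 ih).

Lemma measurable_h A : measurable_fun A (fun t => (h t)%:E).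
Proof. by apply: measurable_funTS; exact: measurable_int ih. Qed.

Let density0 : nu set0 = 0%E.
Proof. by rewrite /density integral_set0. Qed.
Let density_ge0 A : (0 <= nu A)%E.
Proof. by apply: integral_ge0 => t _; rewrite lee_fin. Qed.
Let density_sigma : semi_sigma_additive nu.
Proof.
move=> F mF tF mUF; rewrite /density; apply: cvg_toP.
  apply: ereal_nondecreasing_is_cvgn => m n mn; apply: lee_sum_nneg_natr => // k _ _.
  by apply: integral_ge0 => x _; rewrite lee_fin.
rewrite ge0_integral_bigcup//; last by move=> x _; rewrite lee_fin.
exact: measurable_h.
Qed.
HB.instance Definition _ := isMeasure.Build _ _ _ nu density0 density_ge0 density_sigma.

Let density_fin : fin_num_fun nu.
Proof.
move=> A mA; rewrite ge0_fin_numE//.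
have iA : mu.-integrable A (EFin \o h) by exact: (integrableS measurableT).
have := integrable_fin_num mA iA; rewrite ge0_fin_numE//; exact: density_ge0.
Qed.
HB.instance Definition _ := Measure_isFinite.Build _ _ _ nu density_fin.

Lemma density_dominated : nu `<< mu.
Proof.
apply/null_content_dominatesP => A mA muA0.
by apply: null_set_integral => //; exact: measurable_h.
Qed.

(** The density agrees almost everywhere with the Radon-Nikodym derivative, for which the change of
    variables is known. *)
Lemma integral_density (g : R -> R) : measurable_fun setT g -> (exists M, forall t, `|g t| <= M) ->
  nu.-integrable setT (EFin \o g) /\
  (\int[nu]_t (g t)%:E = \int[mu]_t (g t * h t)%:E)%E.
Proof.
move=> mg [M gM].
have ig : nu.-integrable setT (EFin \o g).
  apply: measurable_bounded_integrable => //; first by rewrite ltey_eq density_fin.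
  exists M; split; first exact: num_real.
  by move=> N MN t _; apply: le_trans (gM t) (ltW MN).
split=> //; rewrite -(Radon_Nikodym_change_of_variables density_dominated measurableT ig).
have iR := @Radon_Nikodym_integrable _ _ R (charge_of_finite_measure nu) mu density_dominated.
apply: ae_eq_integral => //.
- by apply: emeasurable_funM; [apply/measurable_EFinP|exact: measurable_int iR].
- rewrite (_ : (fun t => _) = (fun t => (g t)%:E * (h t)%:E)%E); last by apply/funext.
  by apply: emeasurable_funM; [apply/measurable_EFinP|exact: measurable_h].
suff hR : ae_eq mu setT (Radon_Nikodym (charge_of_finite_measure nu) mu) (EFin \o h).
  by apply: (@filterS _ _ (ae_filter_ringOfSetsType mu)) hR => t hR _; rewrite hR.
apply: integral_ae_eq; [exact: measurableT|exact: iR|exact: measurable_h|move=> E _ mE].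
have e := @Radon_Nikodym_integral _ _ R (charge_of_finite_measure nu) mu E density_dominated mE.
by rewrite -e.
Qed.

Variables (phi : R -> R).
Hypothesis mphi : measurable_fun (setT : set (measurableTypeR R)) (phi : measurableTypeR R -> measurableTypeR R).

Definition image_density (mphi' : measurable_fun (setT : set (measurableTypeR R))
    (phi : measurableTypeR R -> measurableTypeR R)) (A : set (measurableTypeR R)) : \bar R :=
  nu (phi @^-1` A).
Notation imd := (image_density mphi).
Let P := @measure_function_pushforward__canonical__measure_function_Measure _ _ _ _ _
  nu (phi : measurableTypeR R -> measurableTypeR R) mphi.
Let im0 : imd set0 = 0%E. Proof. exact: (measure0 P). Qed.
Let im_ge0 A : (0 <= imd A)%E. Proof. exact: density_ge0. Qed.
Let im_sigma : semi_sigma_additive imd. Proof. exact: (@measure_semi_sigma_additive _ _ _ P). Qed.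
HB.instance Definition _ := isMeasure.Build _ _ _ imd im0 im_ge0 im_sigma.
Let im_fin : fin_num_fun imd.
Proof. by move=> A mA; apply: density_fin; rewrite -[X in measurable X]setTI; exact: mphi. Qed.
HB.instance Definition _ := Measure_isFinite.Build _ _ _ imd im_fin.

Lemma integral_image_density (g : R -> R) : measurable_fun setT g ->
  (exists M, forall t, `|g (phi t)| <= M) ->
  (\int[imd]_t (g t)%:E = \int[mu]_t (g (phi t) * h t)%:E)%E.
Proof.
move=> mg bg; have mgp : measurable_fun setT (g \o phi) by exact: measurableT_comp.
have [ig <-] := integral_density mgp bg.
have := @integral_pushforward _ _ _ _ R (phi : measurableTypeR R -> measurableTypeR R) mphi
  nu setT (EFin \o g).
rewrite preimage_setT => -> //.
by apply/measurable_EFinP.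
Qed.

End DensityMeasure.

(** * The substitution [x = s cos t] and null sets *)

Section CosineNull.
Variable R : realType.
Notation mu := (@lebesgue_measure R).
Notation D := (`]0, (pi : R)[%classic : set R).

Definition sin0pi (t : R) : R := if (0 < t < pi) then sin t else 0.
Lemma sin0pi_ge0 t : 0 <= sin0pi t.
Proof. by rewrite /sin0pi; case: ifP => // h; apply/ltW/sin_gt0_pi. Qed.
Lemma sin0pi_patch : EFin \o sin0pi = (EFin \o (@sin R)) \_ D.
Proof.
apply/funext => t; rewrite /sin0pi /patch /=.
have -> : (t \in D) = (0 < t < pi) by apply/idP/idP => [/set_mem|h]; rewrite ?inE /= ?in_itv//; apply: mem_set; rewrite /= in_itv.
by case: ifP.
Qed.
Lemma sin0pi_int : mu.-integrable setT (EFin \o sin0pi).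
Proof.
rewrite sin0pi_patch; apply/integrable_restrict => //; rewrite setTI.
apply: measurable_bounded_integrable => //; first exact: finite_D.
  exact: measurable_sin.
exists 1; split; first exact: num_real.
by move=> N N1 t _; apply: le_trans (ltW N1); rewrite ler_norml sin_geN1 sin_le1.
Qed.

Lemma int_sin (x : R) : 0 <= x <= pi -> (\int[mu]_(t in `]0%R, x[) (sin t)%:E = (1 - cos x)%:E)%E.
Proof.
move=> /andP[]; rewrite le_eqVlt => /orP[/eqP <- _|x0 xp].
  by rewrite set_itvoo0 integral_set0 cos0 subrr.
rewrite -(@integral_itv_bndoo R 0 x (fun t => (sin t)%:E) true false); last first.
  by apply/measurable_EFinP; exact: measurable_sin.
have dF (t : R) : is_derive t 1 (fun t : R => - cos t : R) (sin t).
  by have := is_deriveN (is_derive_cos t); rewrite opprK.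
have cF (t : R) : {for t, continuous (fun t : R => - cos t : R)}.
  by apply: differentiable_continuous; apply/derivable1_diffP; case: (dF t).
rewrite (@continuous_FTC2 R _ (fun t : R => - cos t : R) 0 x x0).
- by rewrite cos0 -EFinB; congr EFin; ring.
- by apply: continuous_in_subspaceT => t _; exact: continuous_sin.
- split.
  + by move=> t _; case: (dF t).
  + by apply: cvg_at_right_filter; exact: cF.
  + by apply: cvg_at_left_filter; exact: cF.
by move=> t _; rewrite derive1E derive_val.
Qed.

Variable s : R.
Hypothesis s0 : 0 < s.

Definition scos (t : R) : R := s * cos t.
Definition ssin (t : R) : R := s * sin0pi t.
Lemma ssin_ge0 t : 0 <= ssin t. Proof. by rewrite mulr_ge0 ?sin0pi_ge0// ltW. Qed.
Lemma ssin_int : mu.-integrable setT (EFin \o ssin).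
Proof.
rewrite (_ : EFin \o ssin = fun t => s%:E * (EFin \o sin0pi) t)%E; last first.
  by apply/funext => t; rewrite /ssin /= EFinM.
by apply: integrableZl => //; exact: sin0pi_int.
Qed.

Lemma mscos : measurable_fun (setT : set (measurableTypeR R)) (scos : measurableTypeR R -> measurableTypeR R).
Proof. by apply: measurable_funM => //; exact: measurable_cos. Qed.
Lemma cos_lt1 t : D t -> -1 < cos t < 1.
Proof. by rewrite /= in_itv /= => /sin_gt0_pi st; have := cos2Dsin2 t; nra. Qed.

(** The image of [s sin t dt] on [(0, pi)] under [s cos t] is Lebesgue measure on [(-s, s)]: the two
    agree on the rays [(x, +oo)], hence on all Borel sets. As the sine is positive on [(0, pi)], a
    set that is null for [s sin t dt] is null. *)
Lemma scos_null (A : set R) : measurable A -> mu A = 0%E ->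
  mu (D `&` scos @^-1` A) = 0%E.
Proof.
move=> mA A0; pose mf : {finite_measure set (measurableTypeR R) -> \bar R} := image_density ssin_ge0 ssin_int mscos.
pose m1 : {measure set (measurableTypeR R) -> \bar R} := mf.
pose m2 : {measure set (measurableTypeR R) -> \bar R} := mrestr mu (measurable_itv `](- s), s[).
have m1E (B : set R) : measurable B -> m1 B = (s%:E * \int[mu]_(t in D `&` scos @^-1` B) (sin t)%:E)%E.
  move=> mB.
  have mp : measurable (scos @^-1` B) by rewrite -[X in measurable X]setTI; exact: mscos.
  have -> : m1 B = (\int[mu]_(x in scos @^-1` B) (s%:E * (sin0pi x)%:E))%E by [].
  rewrite integralZl//; last by apply: integrableS sin0pi_int.
  congr (_ * _)%E.
  rewrite setIC integral_mkcondr; apply: eq_integral => t _; exact: (congr1 (fun f => f t) sin0pi_patch).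
have inS (t x : R) : (x < s * cos t) = (x / s < cos t) by rewrite ltr_pdivrMr// mulrC.
have rays x : m1 `]x, +oo[%classic = m2 `]x, +oo[%classic.
  rewrite m1E; last exact: measurable_itv.
  have [x1|x1] := leP s x.
    rewrite (_ : D `&` _ = set0); last first.
      apply/seteqP; split=> // t [/cos_lt1 /andP[_ ct]] /=.
      rewrite in_itv /= andbT /scos => h; have h2 : s * cos t <= s by rewrite ger_pMr// ltW.
      by have := lt_le_trans h h2; rewrite ltNge x1.
    rewrite integral_set0 mule0 /m2 /= /mrestr (_ : _ `&` _ = set0) ?measure0//.
    apply/seteqP; split=> // t [] /=; rewrite !in_itv /= andbT => xt /andP[_ t1].
    by have := lt_trans xt t1; rewrite ltNge x1.
  have [x2|x2] := leP x (- s).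
    rewrite (_ : D `&` _ = D); last first.
      apply/seteqP; split=> [t []//|t Dt]; split=> //=; rewrite in_itv /= andbT /scos.
      apply: le_lt_trans x2 _; rewrite -[- s]mulrN1 ltr_pM2l//; by case/andP: (cos_lt1 Dt).
    rewrite int_sin ?pi_ge0 ?lexx// cospi /m2 /= /mrestr.
    rewrite (_ : _ `&` _ = `](- s), s[%classic); last first.
      apply/seteqP; split=> [t []//|t]; rewrite /= !in_itv /= andbT => /andP[t1 t2].
      by split; [exact: le_lt_trans x2 t1|rewrite t1].
    have ss : - s < s by rewrite -subr_gt0 opprK addr_gt0.
    have -> : (s%:E * (1 - -1)%:E)%E = (s - - s)%:E by rewrite -EFinM; congr EFin; ring.
    by rewrite lebesgue_measure_itv /= lte_fin ss EFinB.
  have y2 : -1 < x / s by rewrite ltr_pdivlMr// mulN1r.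
  have y1 : x / s < 1 by rewrite ltr_pdivrMr// mul1r.
  have xb : -1 <= x / s <= 1 by rewrite !ltW.
  have ya := acosK xb; have yb : 0 < acos (x / s) < pi by rewrite acos_gt0 ?acos_ltpi ?y1 ?y2 ?ltW.
  have Dy : D (acos (x / s)) by rewrite /= in_itv.
  rewrite (_ : D `&` _ = `]0, (acos (x / s))[%classic); last first.
    apply/seteqP; split=> [t [Dt]|t] /=.
      rewrite !in_itv /= andbT /scos inS -{1}ya (cos_cD Dt Dy) => ->; rewrite andbT.
      by move: Dt; rewrite /= in_itv => /andP[].
    rewrite !in_itv /= andbT => /andP[t0 ty].
    have Dt : D t by rewrite /= in_itv /= t0; apply: lt_trans ty _; case/andP: yb.
    by move: (Dt); rewrite /= in_itv /= => ->; rewrite /scos inS -{1}ya (cos_cD Dt Dy).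
  rewrite int_sin; last by case/andP: yb => /ltW -> /ltW ->.
  rewrite ya /m2 /= /mrestr (_ : _ `&` _ = `]x, s[%classic); last first.
    apply/seteqP; split=> [t []|t]; rewrite /= !in_itv /= andbT.
      by move=> -> /andP[_ ->].
    by move=> /andP[xt t1]; rewrite xt t1 (lt_trans x2 xt).
  rewrite lebesgue_measure_itv /= lte_fin x1 -EFinB -EFinM; congr EFin.
  by rewrite mulrBr mulr1 mulrCA divff ?mulr1// gt_eqF.
have m12 : m1 A = m2 A.
  refine (@measure_unique _ R (measurableTypeR R) (@RGenOInfty.G R)
    (fun n => `](- n%:R), +oo[%classic) _ _ _ _ m1 m2 _ _ A mA) => //.
  - exact: RGenOInfty.measurableE.
  - move=> _ _ [x ->] [y ->]; exists (Num.max x y); apply/seteqP; split=> t /=;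
      rewrite !in_itv /= !andbT gt_max; first by move=> [-> ->].
    by move=> /andP[].
  - by move=> n; exists (- n%:R).
  - apply/seteqP; split=> // t _; exists (Num.truncn `|t|).+1 => //=.
    rewrite in_itv /= andbT ltrNl; apply: le_lt_trans (_ : `|t| < _).
      by rewrite -normrN ler_norm.
    by rewrite truncnS_gt.
  - by move=> _ [x ->].
  - by move=> n; rewrite ltey_eq (fin_num_measure mf)//; exact: measurable_itv.
have mS : measurable (D `&` scos @^-1` A).
  apply: measurableI; first exact: measurable_itv.
  rewrite -[X in measurable X]setTI; exact: mscos.
have m2A : m2 A = 0%E.
  apply/eqP; rewrite eq_le measure_ge0 andbT -A0.
  exact: (measureIl mu mA (measurable_itv `](- s), s[)).
have h : (\int[mu]_(t in D `&` scos @^-1` A) (sin t)%:E = 0)%E.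
  move: m2A; rewrite -m12 m1E// => /eqP; rewrite mule_eq0 eqe (gt_eqF s0) /= => /eqP.
  by [].
have mf' : measurable_fun (D `&` scos @^-1` A) (EFin \o (@sin R)).
  by apply/measurable_EFinP; exact: measurable_sin.
have := (ae_eq_integral_abs mu mS mf').1; rewrite (_ : (\int[mu]_(x in _) `|_ x|)%E = 0%E); last first.
  rewrite -[RHS]h; apply: eq_integral => t /set_mem[Dt _] /=.
  by rewrite ger0_norm// ltW// sin_gt0_pi//; move: Dt; rewrite /= in_itv.
move=> /(_ erefl) [N [mN N0 hN]]; apply/eqP; rewrite eq_le measure_ge0 andbT -N0.
apply: (le_measure mu (mem_set mS) (mem_set mN)).
move=> t St; apply: hN => /= hs.
have := hs St; case=> s1; have : 0 < sin t by apply: sin_gt0_pi; case: St; rewrite /= in_itv.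
by rewrite s1 ltxx.
Qed.

End CosineNull.

(** * Uniqueness of the unitary extension *)

Section Uniqueness.
Variables (R : realType) (X : choiceType) (w : X -> R) (I : finType).
Hypothesis wp : forall x, 0 < w x.
Notation C := R[i].
Let w0 x : 0 <= w x := ltW (wp x).
Notation L := (pl2 w0).
Notation O := (pout R I).

Variables (D : set (X -> C)) (T0 : (X -> C) -> R -> I -> C).
Hypothesis Dl2 : forall f, D f -> l2 w f.
Hypothesis Dlc : forall (a : C) f g, D f -> D g -> D (fun x => a * f x + g x).

Let Dsq f : D f -> sq_int L f. Proof. by move=> /Dl2 /(l2P w0). Qed.

Lemma D_sub f g : D f -> D g -> D (fun x => f x - g x).
Proof.
by move=> Df Dg; rewrite (_ : (fun x => _) = fun x => -1 * g x + f x); [exact: Dlc|apply/funext => x; rewrite mulN1r addrC].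
Qed.

Lemma nrm0_ae (u v : R -> I -> C) : sq_int O (uncur u) -> sq_int O (uncur v) ->
  nrm O (fun x => uncur u x - uncur v x) = 0 -> ae_eq0pi u v.
Proof. by move=> su sv h; apply: ae0pi_eq0 => //; rewrite -nrm_sq h expr0n. Qed.

Lemma ae_nrm0 (u v : R -> I -> C) : sq_int O (uncur u) -> sq_int O (uncur v) ->
  ae_eq0pi u v -> nrm O (fun x => uncur u x - uncur v x) = 0.
Proof.
move=> su sv h; have e1 := ae0pi_form su sv su h; have e2 := ae0pi_form su sv sv h.
have e3 := formC O (uncur v) (uncur u).
rewrite /nrm form_sub2// e1 e3 e2 (_ : _ - _ + _ = 0) ?sqrtr0//; ring.
Qed.

Section Onto.
Variable U : (X -> C) -> R -> I -> C.
Hypothesis UU : unitary_onto_L2 w D U.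

Lemma U_sq f : D f -> sq_int O (uncur (U f)).
Proof. by case: UU => h _ _ _ /h /L2outP. Qed.

Lemma U_nrm f : D f -> nrm O (uncur (U f)) = nrm L f.
Proof.
move=> Df; have sU := U_sq Df; case: UU => _ _ h _; have := h _ Df.
rewrite outnorm2E// (l2norm2E (Dsq Df)) => /(congr1 fine) e; congr Num.sqrt; exact: e.
Qed.

Lemma U_dist f g : D f -> D g ->
  nrm O (fun x => uncur (U f) x - uncur (U g) x) = nrm L (fun x => f x - g x).
Proof.
move=> Df Dg; have Dd := Dlc (-1) Dg Df; rewrite -(U_nrm (D_sub Df Dg)).
have sf := U_sq Df; have sg := U_sq Dg; have sd := U_sq (D_sub Df Dg).
case: UU => _ /(_ (-1) _ _ Dg Df) h _ _.
have e : (fun x => f x - g x) = (fun x => -1 * g x + f x).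
  by apply/funext => x; rewrite mulN1r addrC.
rewrite -e in h.
have h2 : ae_eq0pi (U (fun x => f x - g x)) (fun t c => U f t c - U g t c).
  by apply: ae_S h => t h Dt; rewrite h//; apply/funext => c; rewrite mulN1r addrC.
have sB : sq_int O (uncur (fun t c => U f t c - U g t c)) by exact: sq_intB.
rewrite /nrm; congr Num.sqrt.
rewrite (ae0pi_form sd sB sd h2) formC (ae0pi_form sd sB sB h2) //.
Qed.

End Onto.

Lemma proj_dist f g p : D f -> sq_int L g -> is_projection w D g p ->
  nrm L (fun x => f x - p x) <= nrm L (fun x => f x - g x).
Proof.
move=> Df sg [Dp h]; have Dd := D_sub Df Dp; have sd := Dsq Dd.
have sf := Dsq Df; have sp := Dsq Dp.
have fg : form L (fun x => g x - p x) (fun x => f x - p x) = 0.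
  have := h _ Dd; rewrite (ipE w0) => /(congr1 (@complex.Re R)); exact.
have [e|n0] := eqVneq (nrm L (fun x => f x - p x)) 0; first by rewrite e nrm_ge0.
have np : 0 < nrm L (fun x => f x - p x) by rewrite lt_neqAle eq_sym n0 nrm_ge0.
rewrite -(ler_pM2r np) -expr2 nrm_sq.
have -> : form L (fun x => f x - p x) (fun x => f x - p x) =
    form L (fun x => f x - g x) (fun x => f x - p x).
  by move: fg; rewrite (formB sg sp sd) (formB sf sp sd) (formB sf sg sd); lra.
apply: le_trans (ler_norm _) _; apply: form_le => //; exact: sq_intB.
Qed.

Lemma proj_unique f p p' : is_projection w D f p -> is_projection w D f p' -> sq_int L f -> p = p'.
Proof.
move=> [Dp hp] [Dp' hp'] sf; have Dd := D_sub Dp Dp'; have sd := Dsq Dd.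
have sp := Dsq Dp; have sp' := Dsq Dp'.
have : form L (fun x => p x - p' x) (fun x => p x - p' x) = 0.
  have h1 : form L (fun x => f x - p x) (fun x => p x - p' x) = 0.
    by have := hp _ Dd; rewrite (ipE w0) => /(congr1 (@complex.Re R)).
  have h2 : form L (fun x => f x - p' x) (fun x => p x - p' x) = 0.
    by have := hp' _ Dd; rewrite (ipE w0) => /(congr1 (@complex.Re R)).
  by move: h1 h2; rewrite (formB sf sp sd) (formB sf sp' sd) (formB sp sp' sd); lra.
move=> /(form_eq0 wp sd) h; apply/funext => x; apply/eqP; rewrite -subr_eq0; apply/eqP; exact: h.
Qed.

(** Both maps are isometric on [D] and agree on the projections of finitely supported functions.
    Such projections approximate any [f] in [D]: by [proj_dist] the projection of [g] is no farther
    from [f] than [g] is. *)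
Lemma unitary_extension_unique U U' : unitary_extension w D T0 U ->
  unitary_extension w D T0 U' -> forall f, D f -> ae_eq0pi (U' f) (U f).
Proof.
move=> [UU hU] [UU' hU'] f Df; have sU := U_sq UU Df; have sU' := U_sq UU' Df.
apply: nrm0_ae => //; apply: (@eq_eps _ _ _ 2) => // e e0.
rewrite subr0 ger0_norm ?nrm_ge0//.
have [s /ltW hs] := l2_approx (Dsq Df) e0; set g := trunc s f in hs.
have fg : finsupp g by exact: finsupp_trunc.
have sg := finsupp_sq_int w0 fg.
have [p pp ae1] := hU _ fg; have [p' pp' ae2] := hU' _ fg.
have pE := proj_unique pp pp' sg; rewrite -{p'}pE in pp' ae2.
have Dp := pp.1; have sp := U_sq UU Dp; have sp' := U_sq UU' Dp.
have e1 : nrm O (fun x => uncur (U' p) x - uncur (U p) x) = 0.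
  by apply: ae_nrm0 => //; apply: ae0pi_trans ae2 (ae0pi_sym ae1).
have dd := le_trans (proj_dist Df sg pp) hs.
apply: le_trans (nrm_dist sU' sp' sU) _; rewrite (U_dist UU' Df Dp) mulr_natl mulr2n lerD//.
apply: le_trans (nrm_dist sp' sp sU) _; rewrite e1 add0r (U_dist UU Dp Df).
by rewrite nrmBC.
Qed.

End Uniqueness.

(** * The absolutely continuous subspace as the range of the adjoint *)

Section AcSubspace.
Variables (R : realType) (q d r : nat) (H : 'M[R[i]]_d) (V : 'M[R[i]]_(d, r)).
Notation C := R[i].
Notation X := (jidx d r).
Notation mu := (@lebesgue_measure R).
Notation D := (`]0, (pi : R)[%classic : set R).
Hypothesis q0 : (0 < q)%N.
Hypothesis Hh : adjmx H = H.
Notation J := (jacobi q H V).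
Notation F := (Fmx q H V).
Notation pJ := (poly_jacobi q H V).
Notation L := (pl2 (@one_ge0 R d r)).
Notation O := (pout R 'I_r).
Notation psi := (psi q H V).
Notation lamt t := (lamz q (zt t)).
Implicit Types (f g : X -> C) (u v w : R * 'I_r -> C).

Variable Z : {poly C}.
Notation Zc := (map_poly (@conjc R) Z).
Notation Q := (Z * Zc).
Hypothesis Z0 : Z != 0.
Hypothesis Zpsi : forall x e, bmf (fun t => Z.[lamt t] * psi (zt t) x e).
Hypothesis ZU : forall z, nsq z = 1 -> Z.[lamz q z] != 0 -> F z \in unitmx /\ F z^-1 \in unitmx.
Hypothesis ZQ : forall x y, pJ Q (cdelta x 1) y = cI (fun t => Q.[lamt t] * ker q H V x y (zt t)).
Notation T := (Tf q H V Z).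

Notation Tb := (Tbar q H V Z).
Notation Ts := (Tstar q H V Z).
Notation RC := (map_poly (@real_complex R)).

Lemma selfconj_real (P : {poly C}) : map_poly (@conjc R) P = P -> exists p : {poly R}, P = RC p.
Proof.
move=> cP; exists (\poly_(i < size P) re P`_i); apply/polyP => i.
rewrite coef_map /= coef_poly; case: ltnP => [_|h]; last by rewrite nth_default.
have := congr1 (fun p : {poly C} => p`_i) cP; rewrite coef_map /= => e.
by apply: complexP => //; have := congr1 (@complex.Im R) e; rewrite im_conj /=; lra.
Qed.

Lemma measurable_poly (p : {poly R}) :
  measurable_fun (setT : set (measurableTypeR R)) (fun x : measurableTypeR R => p.[x] : measurableTypeR R).
Proof.
rewrite (_ : (fun x => _) = fun x => \sum_(i < size p) p`_i * x ^+ i); last first.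
  by apply/funext => x; rewrite horner_coef.
apply: measurable_sum => i; apply: measurable_funM => //; exact: exprn_measurable.
Qed.

Lemma poly_bound (p : {poly R}) (M : R) : exists B, forall x, `|x| <= M -> `|p.[x]| <= B.
Proof.
exists (\sum_(i < size p) `|p`_i| * M ^+ i) => x xM; rewrite horner_coef.
apply: le_trans (ler_norm_sum _ _ _) _; apply: ler_sum => i _; rewrite normrM ler_wpM2l//.
by rewrite normrX lerXn2r// nnegrE ?(le_trans _ xM).
Qed.

Lemma pJ_1B P f x : pJ (1 - P) f x = f x - pJ P f x.
Proof. by rewrite pJD -[1 : {poly C}]/(1%:P) pJC mul1r -scaleN1r pJZ mulN1r. Qed.

Section Moments.
Variables (f : X -> C) (nu : {finite_measure set (measurableTypeR R) -> \bar R}) (M : R).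
Hypothesis sf : sq_int L f.
Hypothesis nuM : nu (~` `[- M, M]) = 0%E.
Hypothesis mom : forall n, form L (iter n J f) f = Rintegral nu setT (fun x => x ^+ n).
Notation I := (`[- M, M]%classic : set (measurableTypeR R)).

Let mI : measurable I. Proof. exact: measurable_itv. Qed.

Lemma I_norm x : I x -> `|x| <= M.
Proof. by rewrite /= in_itv /= ler_norml. Qed.

Lemma poly_intI (p : {poly R}) : nu.-integrable I (fun x => (p.[x])%:E).
Proof.
apply: measurable_bounded_integrable => //.
- by rewrite -ge0_fin_numE ?measure_ge0// fin_num_measure.
- by apply: measurable_funTS; exact: measurable_poly.
have [B hB] := poly_bound p M; exists B; split; first exact: num_real.
by move=> N BN x xI; apply: le_trans (hB _ (I_norm xI)) (ltW BN).
Qed.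

Lemma poly_int (p : {poly R}) : nu.-integrable setT (fun x => (p.[x])%:E).
Proof.
apply/(negligible_integrable (N := ~` I)) => //; first exact: measurableC.
- by apply/measurable_EFinP; exact: measurable_poly.
- by rewrite setTD setCK; exact: poly_intI.
Qed.

Lemma poly_integral (p : {poly R}) :
  Rintegral nu setT (fun x => p.[x]) = Rintegral nu I (fun x => p.[x]).
Proof.
rewrite /Rintegral (@negligible_integral _ _ _ nu _ (~` I))//; first by rewrite setTD setCK.
- exact: measurableC.
- exact: poly_int.
Qed.

Lemma mom_sum n (a : nat -> R) :
  form L (fun x => \sum_(j < n) (a j)%:C * iter j J f x) f =
  Rintegral nu setT (fun x => \sum_(j < n) a j * x ^+ j).
Proof.
elim: n => [|n IH].
  have -> : (fun x : X => \sum_(j < 0) (a j)%:C * iter j J f x) = fun=> 0.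
    by apply/funext => x; rewrite big_ord0.
  have -> : (fun x : R => \sum_(j < 0) a j * x ^+ j) = fun=> 0.
    by apply/funext => x; rewrite big_ord0.
  by rewrite form0l Rintegral_cst ?mul0r.
rewrite (_ : (fun x => _) = fun x => \sum_(j < n) (a j)%:C * iter j J f x + (a n)%:C * iter n J f x); last first.
  by apply/funext => x; rewrite big_ord_recr.
have sj j : sq_int L (iter j J f) by exact: sq_int_iter.
rewrite formD//; [|by apply: sq_int_sum => j _; apply: sq_intZ|by apply: sq_intZ].
rewrite IH formZ// mom; under [in RHS]eq_fun do rewrite big_ord_recr /=.
have e1 : (fun x : R => \sum_(j < n) a j * x ^+ j) = fun x => (\poly_(j < n) a j).[x].
  by apply/funext => x; rewrite horner_poly.
have e2 : (fun x : R => x ^+ n) = fun x => ('X^n : {poly R}).[x].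
  by apply/funext => x; rewrite hornerXn.
have e3 : (fun x : R => a n * x ^+ n) = fun x => (a n *: 'X^n : {poly R}).[x].
  by apply/funext => x; rewrite hornerZ hornerXn.
have i1 : nu.-integrable setT (EFin \o (fun x : R => \sum_(j < n) a j * x ^+ j)) by rewrite e1; exact: poly_int.
have i2 : nu.-integrable setT (EFin \o (fun x : R => a n * x ^+ n)) by rewrite e3; exact: poly_int.
have i3 : nu.-integrable setT (EFin \o (fun x : R => x ^+ n)) by rewrite e2; exact: poly_int.
by rewrite (RintegralD measurableT i1 i2) (RintegralZl _ measurableT i3).
Qed.

Lemma mom_poly (p : {poly R}) : form L (pJ (RC p) f) f = Rintegral nu setT (fun x => p.[x]).
Proof.
have -> : pJ (RC p) f = fun x => \sum_(j < size p) (p`_j)%:C * iter j J f x.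
  apply/funext => x; rewrite (pJ_wide _ _ _ (n := size p)) ?size_map_poly//.
  by apply: eq_bigr => j _; rewrite coef_map.
rewrite mom_sum; congr Rintegral; apply/funext => x; by rewrite horner_coef.
Qed.

Lemma Q_real (x : R) : Q.[x%:C] = (nsq Z.[x%:C])%:C.
Proof.
rewrite hornerM -mulCJ; congr (_ * _).
by rewrite -[x%:C in LHS](conjc_real x) horner_map.
Qed.

(** The analogue of [cutoff] on an interval carrying the spectral measure, which at this point is
    not known to lie in the range of [2 sqrt q cos t]. *)
Lemma cutoff_on : exists s : {poly R}, exists Rn : nat -> {poly C},
  [/\ forall x, I x -> 0 <= s.[x] <= 1, forall x, I x -> Z.[x%:C] != 0 -> s.[x] < 1
   & forall n, 1 - RC s ^+ n = Q * Rn n].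
Proof.
have [p pE] := selfconj_real (Q_selfconj Z).
have pQ x : p.[x] = nsq Z.[x%:C].
  have := Q_real x; rewrite pE horner_map /= => e.
  exact: (congr1 (@complex.Re R) e).
have [B0 hB0] := poly_bound p M; pose B := `|B0| + 1.
have B1 : 0 < B by rewrite ltr_wpDl.
have hB x : I x -> p.[x] <= B.
  move=> /I_norm xM; have := hB0 x xM; have := ler_norm B0; have := ler_norm p.[x]; rewrite /B; lra.
exists (1 - B^-1 *: p), (fun n => (B^-1)%:C *: \sum_(i < n) RC (1 - B^-1 *: p) ^+ i); split.
- move=> x Ix; rewrite hornerD hornerN hornerZ hornerE mulrC.
  rewrite gerBl subr_ge0 ler_pdivrMr// mul1r hB//=.
  by rewrite divr_ge0 ?pQ ?nsq_ge0// ltW.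
- move=> x Ix Zx; rewrite hornerD hornerN hornerZ hornerE mulrC.
  rewrite gtrBl divr_gt0// pQ lt_neqAle nsq_ge0 andbT eq_sym.
  by apply: contra_neq Zx => /nsq_eq0.
set sP := RC _; have e : 1 - sP = (B^-1)%:C *: Q.
  by rewrite /sP rmorphB rmorph1 /= map_polyZ -pE opprB addrC subrK.
by move=> n; rewrite -opprB subrX1 -mulNr opprB e -scalerAl -scalerAr.
Qed.

Hypothesis nuac : nu `<< mu.

Lemma finite_Zreal : finite_set [set x : R | Z.[x%:C] = 0].
Proof.
have [s Zs] := closed_field_poly_normal Z.
have lc0 : lead_coef Z != 0 by rewrite lead_coef_eq0.
apply: (@sub_finite_set _ _ (@complex.Re R @` [set` s])); last by apply: finite_image; exact: finite_seq.
move=> x /eqP; rewrite Zs hornerZ mulf_eq0 (negbTE lc0) /= => h; exists x%:C => //=.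
by rewrite -root_prod_XsubC.
Qed.

Lemma nu_Zreal : measurable ([set x : R | Z.[x%:C] = 0] : set (measurableTypeR R)) /\
  nu [set x : R | Z.[x%:C] = 0] = 0%E.
Proof.
have cZ := finite_set_countable finite_Zreal.
have mZ : measurable ([set x : R | Z.[x%:C] = 0] : set (measurableTypeR R)).
  by apply: countable_measurable => [x|//]; exact: measurable_set1.
split=> //; move/null_content_dominatesP: nuac; apply=> //.
exact: countable_lebesgue_measure0.
Qed.

(** Absolute continuity is used here: the finitely many real zeros of [Z], where [s] may equal 1,
    carry no mass, and elsewhere the powers tend to 0. *)
Lemma power_integral (s : {poly R}) : (forall x, I x -> 0 <= s.[x] <= 1) ->
  (forall x, I x -> Z.[x%:C] != 0 -> s.[x] < 1) ->
  Rintegral nu I (fun x => (s ^+ n).[x]) @[n --> \oo] --> 0.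
Proof.
move=> s01 s1; have [mZ nZ] := nu_Zreal.
have mf n : measurable_fun I (fun x => ((s ^+ n).[x])%:E) := measurable_int nu (poly_intI (s ^+ n)).
have cv : {ae nu, forall x, I x -> ((s ^+ n).[x])%:E @[n --> \oo] --> cst 0%E x}.
  exists [set x : R | Z.[x%:C] = 0]; split=> // x /= /not_implyP[Ix h].
  apply: contrapT => /eqP Zx; apply: h.
  suff : (s ^+ n).[x] @[n --> \oo] --> (0 : R) by move=> hs; apply: cvg_EFin => //; exact: nearW.
  under eq_fun do rewrite horner_exp.
  by apply: cvg_expr; rewrite ger0_norm ?s1//; case/andP: (s01 _ Ix).
have i1 : nu.-integrable I (cst 1%E).
  apply: measurable_bounded_integrable => //.
  - by rewrite -ge0_fin_numE ?measure_ge0// fin_num_measure.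
  - exists 1; split; first exact: num_real.
    by move=> N N1 x _; rewrite normr1 ltW.
have bd : {ae nu, forall x n, I x -> (`|((s ^+ n).[x])%:E| <= cst 1 x)%E}.
  apply: aeW => x n Ix /=; rewrite lee_fin horner_exp normrX; case/andP: (s01 _ Ix) => a b.
  by rewrite ger0_norm// exprn_ile1.
have [_ _] := dominated_convergence mI mf (measurable_cst _) cv i1 bd.
rewrite integral0 => h; rewrite -[0]/(fine 0%E); exact: fine_cvg.
Qed.

(** [f - s^N(J) f] is [Q(J)] of a vector, hence in the range of [Tstar], and the squared norm of
    [s^N(J) f] is the integral of [s^(2N)] against the spectral measure. *)
Lemma near_range e : 0 < e -> exists2 u, sq_int O u & nrm L (fun x => f x - Ts u x) <= e.
Proof.
move=> e0; have [s [Rn [s01 s1 RnE]]] := cutoff_on.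
have /cvgrPdist_lt/(_ (e ^+ 2)) := power_integral s01 s1.
move=> /(_ (exprn_gt0 2 e0)) [N _ hN].
(* The exponent is doubled because the squared norm pairs two factors [s^N(J)]. *)
have := hN (N + N)%N (leq_addr _ _); rewrite sub0r normrN => {}hN.
have sR := sq_int_pJ q H V (Rn N) sf.
have scC : map_poly (@conjc R) (RC s ^+ N) = RC s ^+ N.
  rewrite rmorphXn /=; congr (_ ^+ _); apply/polyP => i.
  by rewrite coef_map coef_map /=; exact: conjc_real.
set u := fun p : R * 'I_r => Q.[lamt p.1] * Tb (pJ (Rn N) f) p.
have sTR := Tbar_sq q0 Hh Zpsi ZU ZQ sR.
exists u; first exact: mulQ_sq sTR.
have fE : (fun x => f x - Ts u x) = pJ (RC s ^+ N) f.
  by apply/funext => x; rewrite -(Tstar_Q q0 Hh Zpsi ZU ZQ _ sR) -pJM [Rn N * _]mulrC -RnE pJ_1B opprB addrC subrK.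
rewrite fE -(@ler_sqr R) ?nnegrE ?nrm_ge0 ?(ltW e0)// nrm_sq.
have -> : form L (pJ (RC s ^+ N) f) (pJ (RC s ^+ N) f) = form L (pJ (RC s ^+ N * RC s ^+ N) f) f.
  move: scC; move: (RC s ^+ N) => S SC; have sS := sq_int_pJ q H V S sf.
  have e2 : pJ S (pJ S f) = pJ (S * S) f by apply/funext => x; rewrite pJM.
  have h := form_pJ q V Hh S sS sf.
  rewrite SC in h.
  rewrite e2 in h.
  exact: esym h.
have -> : RC s ^+ N * RC s ^+ N = RC (s ^+ (N + N)) by rewrite exprD rmorphM rmorphXn.
rewrite mom_poly poly_integral.
by apply: le_trans (ler_norm _) _; exact: ltW.
Qed.
End Moments.

Lemma Tbar_dist f g : sq_int L f -> sq_int L g ->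
  nrm O (fun p => Tb f p - Tb g p) <= nrm L (fun x => f x - g x).
Proof.
move=> sf sg; have sd := sq_int_lc (-1) sg sf.
have e : (fun x => f x - g x) = (fun x => -1 * g x + f x).
  by apply/funext => x; rewrite mulN1r addrC.
have sTf := Tbar_sq q0 Hh Zpsi ZU ZQ sf; have sTg := Tbar_sq q0 Hh Zpsi ZU ZQ sg.
have sTd := Tbar_sq q0 Hh Zpsi ZU ZQ sd.
have h := Tbar_lc q0 Hh Zpsi ZU ZQ (-1) sg sf.
have e2 : (fun p => Tb f p - Tb g p) = (fun p => (-1 * Tb g p + Tb f p) - 0).
  by apply/funext => p; rewrite mulN1r addrC subr0.
rewrite e e2; apply: le_trans (nrm_dist (sq_int_lc (-1) sTg sTf) sTd (sq_int0 _)) _.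
rewrite nrmBC h add0r fun_subr0; exact: (Tbar_nrm q0 Hh Zpsi ZU ZQ).
Qed.

Lemma Tstar_dist u v : sq_int O u -> sq_int O v ->
  nrm L (fun x => Ts u x - Ts v x) <= nrm O (fun p => u p - v p).
Proof.
move=> su sv; have sd := sq_int_lc (-1) sv su.
have -> : (fun x => Ts u x - Ts v x) = Ts (fun p => -1 * v p + u p).
  by apply/funext => x; rewrite (Tstar_lc q0 Hh Zpsi ZU ZQ)// mulN1r addrC.
have -> : (fun p => u p - v p) = (fun p => -1 * v p + u p).
  by apply/funext => x; rewrite mulN1r addrC.
by have [] := Tstar_sq q0 Hh Zpsi ZU ZQ sd.
Qed.

(** [Tstar] after [Tbar] is continuous and fixes the range of [Tstar], and [f] is a limit of
    elements of that range. *)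
Lemma ac_range f : ac_subspace (fun=> 1) J f ->
  nrm L (fun x => f x - Ts (Tb f) x) = 0.
Proof.
move=> [/(l2P (@one_ge0 R d r)) sf [nu [[M nuM] mom] nuac]].
have mom' n : form L (iter n J f) f = Rintegral nu setT (fun x => x ^+ n).
  by have := congr1 (@complex.Re R) (mom n); rewrite (ipE (@one_ge0 R d r)).
have sTf := Tbar_sq q0 Hh Zpsi ZU ZQ sf.
apply: (@eq_eps _ _ _ 2) => // e e0; have [u su hu] := near_range sf nuM mom' nuac e0.
have [sT _] := Tstar_sq q0 Hh Zpsi ZU ZQ su; have [sTT _] := Tstar_sq q0 Hh Zpsi ZU ZQ sTf.
rewrite subr0 ger0_norm ?nrm_ge0// mulr_natl mulr2n.
apply: le_trans (nrm_dist sf sT sTT) (lerD hu _).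
apply: le_trans (Tstar_dist su sTf) _.
have sTs := Tbar_sq q0 Hh Zpsi ZU ZQ sT.
apply: le_trans (nrm_dist su sTs sTf) _.
rewrite nrmBC (TTstar q0 Hh Z0 Zpsi ZU ZQ su) add0r.
by apply: le_trans (Tbar_dist sT sf) _; rewrite nrmBC.
Qed.

Lemma Tf_J f p : finsupp f -> T (J f) p = lamt p.1 * T f p.
Proof. by move=> ff; rewrite /Tf; case: ifPn => [_|h]; rewrite ?mulr0// (jt_jacobi q0 Hh ZU). Qed.
Lemma bmf_lamt : bmf (fun t : R => lamt t).
Proof. exact: bmf_lamz. Qed.

Lemma J_Tstar u x : sq_int O u -> J (Ts u) x = Ts (fun p => lamt p.1 * u p) x.
Proof.
move=> su; have [sT _] := Tstar_sq q0 Hh Zpsi ZU ZQ su; apply: rdot_inj => c.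
have fc : finsupp (cdelta x c : X -> C) by exact: finsupp_cdelta.
have sc := finsupp_sq_int (@one_ge0 R d r) fc.
rewrite (rdot_Tstar q0 Hh Zpsi ZU ZQ); last exact: bmf_mul bmf_lamt su.
have -> : form O (fun p => lamt p.1 * u p) (T (cdelta x c)) = form O u (fun p => lamt p.1 * T (cdelta x c) p).
  rewrite /form; congr oI; apply/funext => p; rewrite rdotMl re_lamt; congr (rdot _ (_ * _)).
  exact: conjc_real.
have := form_cdelta (@one_ge0 R d r) (J (Ts u)) x c; rewrite mul1r => <-.
rewrite (form_jacobi q V Hh)//.
rewrite (Tstar_fin q0 Hh Zpsi ZU ZQ)//; last exact: finsupp_jacobi.
congr form; apply/funext => p; by rewrite Tf_J.
Qed.

Lemma bmf_exp n : bmf (fun t : R => lamt t ^+ n).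
Proof.
elim: n => [|n IH]; first by rewrite (_ : (fun t => _) = fun=> 1)//; exact: bmfC.
rewrite (_ : (fun t => _) = fun t => lamt t * lamt t ^+ n); first exact: bmfM bmf_lamt IH.
by apply/funext => t; rewrite exprS.
Qed.

Lemma iter_Tstar n u : sq_int O u -> iter n J (Ts u) = Ts (fun p => lamt p.1 ^+ n * u p).
Proof.
move=> su; elim: n => [|n IH] /=.
  by congr Tstar; apply/funext => p; rewrite mul1r.
rewrite IH; apply/funext => x; rewrite J_Tstar; last exact: bmf_mul (bmf_exp n) su.
by congr Tstar; apply/funext => p; rewrite exprS mulrA.
Qed.

Lemma Tstar0 : Ts (fun=> 0) = fun=> 0.
Proof.
apply/funext => x; have := Tstar_lc q0 Hh Zpsi ZU ZQ (-1) x (sq_int0 _) (sq_int0 _).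
by rewrite mulr0 addr0 mulN1r addNr.
Qed.

Section Range.
Variables (u : R * 'I_r -> C).
Hypothesis su : sq_int O u.

Definition sdens (t : R) : R := \sum_c nsq (u (t, c)) / (2 * pi).
Definition sdensD (t : R) : R := if 0 < t < pi then sdens t else 0.

Lemma sdens_ge0 t : 0 <= sdens t.
Proof. by apply: sumr_ge0 => c _; rewrite divr_ge0 ?nsq_ge0// mulr_ge0// pi_ge0. Qed.
Lemma sdensD_ge0 t : 0 <= sdensD t.
Proof. by rewrite /sdensD; case: ifP => // _; exact: sdens_ge0. Qed.

Lemma sdensD_patch : EFin \o sdensD = (EFin \o sdens) \_ D.
Proof.
apply/funext => t; rewrite /sdensD /patch /=.
have -> : (t \in D) = (0 < t < pi) by apply/idP/idP => [/set_mem|h]; rewrite ?inE /= ?in_itv//; apply: mem_set; rewrite /= in_itv.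
by case: ifP.
Qed.

Lemma nsq_int c : mu.-integrable D (EFin \o (fun t => nsq (u (t, c)) / (2 * pi))).
Proof.
rewrite (_ : EFin \o _ = fun t => ((2 * pi)^-1)%:E * (EFin \o (fun t => nsq (u (t, c)))) t)%E.
  by apply: integrableZl; [exact: measurable_D|exact: sq_int_component su].
by apply/funext => t; rewrite /= -EFinM mulrC.
Qed.

Lemma sdensD_int : mu.-integrable setT (EFin \o sdensD).
Proof.
rewrite sdensD_patch; apply/integrable_restrict => //; rewrite setTI; exact: (Rintegral_sumr _ nsq_int).1.
Qed.

Lemma ar2 : 0 < 2 * ar R q. Proof. by rewrite mulr_gt0// ar_gt0. Qed.

(** The spectral measure of [Ts u]: the image of [|u|^2 dtheta / (2 pi)] under [theta] to
    [2 sqrt q cos theta]. *)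
Definition nuT : {finite_measure set (measurableTypeR R) -> \bar R} :=
  image_density sdensD_ge0 sdensD_int (@mscos R (2 * ar R q)).

Lemma scos_bound t : `|scos (2 * ar R q) t| <= 2 * ar R q.
Proof.
rewrite /scos normrM (ger0_norm (ltW ar2)) -[leRHS]mulr1 (ler_wpM2l (ltW ar2))//.
by rewrite ler_norml cos_geN1 cos_le1.
Qed.

Lemma nuT_moment n : Rintegral nuT setT (fun x => x ^+ n) = form O (fun p => lamt p.1 ^+ n * u p) u.
Proof.
rewrite /Rintegral integral_image_density; first last.
- exists ((2 * ar R q) ^+ n) => t; rewrite normrX lerXn2r ?nnegrE ?(ltW ar2)//; exact: scos_bound.
- exact: exprn_measurable.
have -> : (fun t => (scos (2 * ar R q) t ^+ n * sdensD t)%:E) =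
    (EFin \o (fun t => \sum_c (scos (2 * ar R q) t ^+ n * nsq (u (t, c)) / (2 * pi)))) \_ D.
  apply/funext => t; rewrite EFinM -[(sdensD t)%:E]/((EFin \o sdensD) t) sdensD_patch /patch.
  case: ifP => _; last by rewrite mule0.
  by rewrite /= -EFinM /sdens mulr_sumr; congr EFin; apply: eq_bigr => c _; rewrite mulrA.
rewrite -integral_mkcond.
have ic c : mu.-integrable D (EFin \o (fun t => scos (2 * ar R q) t ^+ n * nsq (u (t, c)) / (2 * pi))).
  have := rdot_intg (bmf_mul (bmf_exp n) su) su; move=> /(_ c) h.
  rewrite (_ : EFin \o _ = fun t => ((2 * pi)^-1)%:E * (rdot (lamt t ^+ n * u (t, c)) (u (t, c)))%:E)%E.
    by apply: integrableZl => //; exact: measurable_D.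
  apply/funext => t; rewrite /= -EFinM re_lamt -rmorphXn /scos; congr EFin.
  by rewrite /rdot /nsq !reimE; ring.
rewrite -[fine _]/(Rintegral mu D (fun t => \sum_c scos (2 * ar R q) t ^+ n * nsq (u (t, c)) / (2 * pi))).
rewrite (Rintegral_sumr _ ic).2 /form /= /oI; apply: eq_bigr => c _.
have := rdot_intg (bmf_mul (bmf_exp n) su) su; move=> /(_ c) h.
rewrite -RintegralZr; [|exact: measurable_D|exact: h].
apply: eq_Rintegral => t _; rewrite re_lamt -rmorphXn /scos; congr (_ / _).
by rewrite /rdot /nsq !reimE; ring.
Qed.

(** [Tstar] is isometric and intertwines [J] with multiplication by a real function, so the moments
    are those of [nuT]; their imaginary parts vanish because that function is real. Absolute
    continuity is [scos_null]. *)
Lemma range_ac : ac_subspace (fun=> 1) J (Ts u).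
Proof.
have [sT _] := Tstar_sq q0 Hh Zpsi ZU ZQ su.
split; first by apply/(l2P (@one_ge0 R d r)).
exists nuT; first split.
- exists (2 * ar R q); rewrite /nuT /= /image_density /density.
  rewrite (_ : _ @^-1` _ = set0) ?integral_set0//.
  apply/seteqP; split=> // t /=; apply; rewrite in_itv /= -ler_norml; exact: scos_bound.
- move=> n; rewrite (ipE (@one_ge0 R d r)) iter_Tstar// nuT_moment.
  have sn := bmf_mul (bmf_exp n) su.
  rewrite (Tstar_isom q0 Hh Z0 Zpsi ZU ZQ sn su).
  suff -> : form L (Ts (fun p => lamt p.1 ^+ n * u p)) (fun x => 'i * Ts u x) = 0 by [].
  have -> : (fun x => 'i * Ts u x) = Ts (fun p => 'i * u p + 0).
    by apply/funext => x; rewrite (Tstar_lc q0 Hh Zpsi ZU ZQ _ _ su (sq_int0 _)) Tstar0 addr0.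
  rewrite (Tstar_isom q0 Hh Z0 Zpsi ZU ZQ sn); last exact: sq_int_lc su (sq_int0 _).
  rewrite -[RHS](form0l O u) /form; congr oI; apply/funext => p.
  by rewrite re_lamt -rmorphXn /rdot !reimE; ring.
apply/null_content_dominatesP => A mA A0.
have mp : measurable (scos (2 * ar R q) @^-1` A) by rewrite -[X in measurable X]setTI; exact: mscos.
have -> : nuT A = (\int[mu]_(x in scos (2 * ar R q) @^-1` A) (EFin \o sdensD) x)%E by [].
rewrite sdensD_patch -integral_mkcondr setIC.
apply: null_set_integral => //.
- by apply: measurableI => //; exact: measurable_D.
- by have := (Rintegral_sumr (index_enum _) nsq_int).1 => h; apply: measurable_funS (measurable_int _ h); [exact: measurable_D|exact: subIsetl].
- by apply: scos_null => //; exact: ar2.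
Qed.

End Range.

Notation ac := (ac_subspace (fun=> 1) J).
Notation one0 := (@one_ge0 R d r).

Lemma acP f : ac f <-> exists2 u, sq_int O u & f = Ts u.
Proof.
split=> [acf|[u su ->]]; last exact: range_ac.
have sf : sq_int L f by have [/(l2P one0)] := acf.
exists (Tb f); first exact: (Tbar_sq q0 Hh Zpsi ZU ZQ sf).
have sT := Tbar_sq q0 Hh Zpsi ZU ZQ sf; have [sTT _] := Tstar_sq q0 Hh Zpsi ZU ZQ sT.
have h := ac_range acf.
have f0 : form L (fun x => f x - Ts (Tb f) x) (fun x => f x - Ts (Tb f) x) = 0.
  by rewrite -nrm_sq h expr0n.
have := @form_eq0 _ _ _ one0 _ (fun=> ltr01) (sq_intB sf sTT) f0 => {}h.
by apply/funext => x; apply/eqP; rewrite -subr_eq0; apply/eqP; exact: h.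
Qed.

Lemma ac_lc (a : C) f g : ac f -> ac g -> ac (fun x => a * f x + g x).
Proof.
move=> /acP[u su ->] /acP[v sv ->]; apply/acP; exists (fun p => a * u p + v p).
  exact: sq_int_lc.
by apply/funext => x; rewrite (Tstar_lc q0 Hh Zpsi ZU ZQ).
Qed.

Definition Fac f : R -> 'I_r -> C := cur (Tb f).

Lemma uncurK (u : R * 'I_r -> C) : uncur (cur u) = u.
Proof. by apply/funext => -[]. Qed.

Lemma ae_of_nrm (u v : R * 'I_r -> C) : sq_int O u -> sq_int O v ->
  nrm O (fun p => u p - v p) = 0 -> ae_eq0pi (cur u) (cur v).
Proof. by move=> su sv h; apply: nrm0_ae; rewrite ?uncurK. Qed.

Lemma Fac_Tstar u : sq_int O u -> ae_eq0pi (Fac (Ts u)) (cur u).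
Proof.
move=> su; have [sT _] := Tstar_sq q0 Hh Zpsi ZU ZQ su.
by apply: ae_of_nrm => //; [exact: (Tbar_sq q0 Hh Zpsi ZU ZQ sT)|exact: (TTstar q0 Hh Z0 Zpsi ZU ZQ su)].
Qed.

Lemma iTstar u : sq_int O u -> (fun x => 'i * Ts u x) = Ts (fun p => 'i * u p + 0).
Proof.
move=> su; apply/funext => x.
by rewrite (Tstar_lc q0 Hh Zpsi ZU ZQ _ _ su (sq_int0 _)) Tstar0 addr0.
Qed.

(** On the range of the isometry [Tstar] the map [Tbar] is its inverse, and the projection of [f] to
    that range is [Ts (Tb f)]. On finitely supported [f] the transform differs from [Tf] only at the
    angles where [Z] vanishes. *)
Lemma Fac_unitary : unitary_extension (fun=> 1) ac (jacobi_transform q H V) Fac.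
Proof.
have sqac f : ac f -> sq_int L f by case=> /(l2P one0).
have sTb f : sq_int L f -> sq_int O (Tb f) := fun h => Tbar_sq q0 Hh Zpsi ZU ZQ h.
split; first split.
- by move=> f /sqac sf; apply/L2outP; rewrite uncurK; exact: sTb.
- move=> a f g acf acg; have sf := sqac _ acf; have sg := sqac _ acg.
  apply: (@ae_of_nrm (Tb (fun x => a * f x + g x)) (fun p => a * Tb f p + Tb g p)); [exact: (sTb _ (sq_int_lc a sf sg))|exact: (sq_int_lc a (sTb _ sf) (sTb _ sg))|].
  exact: (Tbar_lc q0 Hh Zpsi ZU ZQ a sf sg).
- move=> f acf; have sf := sqac _ acf; have sT := sTb _ sf.
  rewrite outnorm2E ?uncurK// (l2norm2E sf).
  have /acP[u su fE] := acf.
  have [sTT _] := Tstar_sq q0 Hh Zpsi ZU ZQ su.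
  have e : form L f f = form O u u by rewrite fE (Tstar_isom q0 Hh Z0 Zpsi ZU ZQ su su).
  have h := Fac_Tstar su; rewrite -fE in h.
  have su' : sq_int O (uncur (cur u)) by rewrite uncurK.
  have sT' : sq_int O (uncur (Fac f)) by rewrite uncurK.
  have := ae0pi_form sT' su' sT' h; rewrite !uncurK => ->.
  by rewrite formC; have := ae0pi_form sT' su' su' h; rewrite !uncurK e => ->.
- move=> u /L2outP su; exists (Ts (uncur u)); first by apply/acP; exists (uncur u).
  have := Fac_Tstar su; by rewrite /cur /uncur.
move=> f ff; have sf := finsupp_sq_int one0 ff; have sT := sTb _ sf.
exists (Ts (Tb f)).
  split; first by apply/acP; exists (Tb f).
  have [sTT _] := Tstar_sq q0 Hh Zpsi ZU ZQ sT.
  move=> _ /acP[v sv ->]; have [sTv _] := Tstar_sq q0 Hh Zpsi ZU ZQ sv.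
  have key w : sq_int O w -> form L (fun x => f x - Ts (Tb f) x) (Ts w) = 0.
    move=> sw; have [sTw _] := Tstar_sq q0 Hh Zpsi ZU ZQ sw.
    rewrite formB// (Tstar_isom q0 Hh Z0 Zpsi ZU ZQ sT sw) formC (Tstar_Tbar q0 Hh Zpsi ZU ZQ sw sf).
    by rewrite formC subrr.
  rewrite (ipE one0) iTstar// key// key//; exact: sq_int_lc sv (sq_int0 _).
apply: ae0pi_trans (Fac_Tstar sT) _.
have sTf := Tf_sq q0 Hh Zpsi ZU ZQ ff.
apply: ae0pi_trans (ae_of_nrm sT sTf (Tbar_fin q0 Hh Zpsi ZU ZQ ff)) _.
apply: ae_S (ae_Z q0 Z0) => t Zt Dt; apply/funext => c.
by rewrite /cur /Tf (negbTE (Zt Dt)).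
Qed.

Lemma Fac_mul f : ac f -> ac (J f) /\
  ae_eq0pi (Fac (J f)) (fun t c => (2 * Num.sqrt q%:R * cos t)%:C * Fac f t c).
Proof.
move=> /acP[u su ->]; have sl := bmf_mul bmf_lamt su.
have JE : J (Ts u) = Ts (fun p => lamt p.1 * u p).
  by apply/funext => x; rewrite J_Tstar.
rewrite JE; split; first by apply/acP; exists (fun p => lamt p.1 * u p).
apply: ae0pi_trans (Fac_Tstar sl) _.
apply: ae_S (Fac_Tstar su) => t h Dt; apply/funext => c; rewrite (h Dt) /cur.
by rewrite re_lamt.
Qed.

End AcSubspace.

(** * The spectral transform of one Jacobi operator *)

Section JacobiSpectral.
Variables (R : realType) (q d r : nat) (H : 'M[R[i]]_d) (V : 'M[R[i]]_(d, r)).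
Notation C := R[i].
Hypothesis q0 : (0 < q)%N.
Hypothesis Hh : adjmx H = H.
Notation J := (jacobi q H V).
Notation ac := (ac_subspace (fun=> 1) J).

Theorem jacobi_spectral : (forall (a : C) f g, ac f -> ac g -> ac (fun x => a * f x + g x)) /\
  exists F : (jidx d r -> C) -> R -> 'I_r -> C,
    unitary_extension (fun=> 1) ac (jacobi_transform q H V) F /\
    forall f, ac f -> ac (J f) /\
      ae_eq0pi (F (J f)) (fun t c => (2 * Num.sqrt q%:R * cos t)%:C * F f t c).
Proof.
have [Z [Z0 Zpsi ZU ZQ]] := main_identity V q0 Hh.
split; first exact: (ac_lc q0 Hh Z0 Zpsi ZU ZQ).
exists (Fac q H V Z); split; first exact: Fac_unitary.
by move=> f; apply: Fac_mul.
Qed.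

(* For almost every angle [Psi] is given by an honest inverse. *)
Lemma Fmx_unit_finite : exists s : seq R, forall t, 0 < t < pi -> t \notin s ->
  Fmx q H V (zt t) \in unitmx.
Proof.
have [Z [Z0 Zpsi ZU ZQ]] := main_identity V q0 Hh.
have [s sE] : exists s : seq R, [set t | `]0, (pi : R)[%classic t /\ Z.[lamz q (zt t)] = 0] = [set` s].
  by apply/finite_seqP; exact: finite_Zroots.
exists s => t t0 ts; apply: (ZU _ _ _).1; first exact: nsq_zt.
apply/eqP => h; move/negP: ts; apply; have : [set` s] t by rewrite -sE /= in_itv.
by [].
Qed.

End JacobiSpectral.

(** * Discrete valuations *)

Section Valuation.
Variables (F : fieldType) (v : valuation F).
Implicit Types (x y : F) (n m : int).

Lemma val1 : v 1 = 0.
Proof. by apply: (addrI (v 1)); rewrite -val_M ?oner_neq0// mulr1 addr0. Qed.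
Lemma valV x : x != 0 -> v x^-1 = - v x.
Proof. by move=> x0; have := val_M v x0 (invr_neq0 x0); rewrite divff// val1; lia. Qed.

Lemma valN x : v (- x) = v x.
Proof.
have n1 : -1 != 0 :> F by rewrite oppr_eq0 oner_neq0.
have h1 : v (-1) = 0 by have := val_M v n1 n1; rewrite mulrNN mulr1 val1; lia.
have [->|x0] := eqVneq x 0; first by rewrite oppr0.
by rewrite -mulN1r val_M// h1 add0r.
Qed.

Lemma valX x (n : nat) : x != 0 -> v (x ^+ n) = v x * n%:Z.
Proof.
move=> x0; elim: n => [|n IH]; first by rewrite expr0 val1 mulr0.
by rewrite exprS val_M ?expf_neq0// IH; lia.
Qed.

Lemma vgeE n x : x != 0 -> val_ge v n x <-> n <= v x.
Proof. by move=> x0; split=> [[/eqP|//]|]; [rewrite (negbTE x0)|right]. Qed.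
Lemma vgeW n m x : n <= m -> val_ge v m x -> val_ge v n x.
Proof. by move=> nm [->|h]; [left|right; apply: le_trans h]. Qed.
Lemma vgeN n x : val_ge v n x -> val_ge v n (- x).
Proof. by move=> [->|h]; [left; rewrite oppr0|right; rewrite valN]. Qed.

Lemma vgeD n x y : val_ge v n x -> val_ge v n y -> val_ge v n (x + y).
Proof.
have [->|x0] := eqVneq x 0; first by rewrite add0r.
have [->|y0] := eqVneq y 0; first by rewrite addr0.
have [->|xy0] := eqVneq (x + y) 0; first by left.
move=> /vgeE - /(_ x0) hx /vgeE - /(_ y0) hy; right.
by apply: le_trans (val_D v x0 y0 xy0); rewrite le_min hx.
Qed.

Lemma vgeB n x y : val_ge v n x -> val_ge v n y -> val_ge v n (x - y).
Proof. by move=> hx hy; apply: vgeD => //; exact: vgeN. Qed.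

Lemma vgeM n m x y : val_ge v n x -> val_ge v m y -> val_ge v (n + m) (x * y).
Proof.
move=> [->|hx]; first by rewrite mul0r; left.
have [->|x0] := eqVneq x 0; first by rewrite mul0r; left.
move=> [->|hy]; first by rewrite mulr0; left.
have [->|y0] := eqVneq y 0; first by rewrite mulr0; left.
by right; rewrite val_M// lerD.
Qed.

Lemma vge1 : val_ge v 0 1. Proof. by right; rewrite val1. Qed.

(** Since [a] equals its power of exponent [#|E|], the integer [v (f a)] is unchanged by
    multiplication with [#|E| > 1]. *)
Lemma val_finite (E : finFieldType) (f : {rmorphism E -> F}) (a : E) : v (f a) = 0.
Proof.
have [->|a0] := eqVneq a 0; first by rewrite rmorph0 val_0.
have f0 : f a != 0 by rewrite fmorph_eq0.
have := finfield.expf_card a => /(congr1 (fun z => v (f z))); rewrite rmorphXn valX//.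
by have := card_finNzRing_gt1 E; move: #|E| (v (f a)) => n w; nia.
Qed.

(* The least valuation of the two coordinates; the guards bypass the dummy value at 0. *)
Definition minv x y : int :=
  if x == 0 then v y else if y == 0 then v x else Num.min (v x) (v y).

Lemma minvP x y n : (x != 0) || (y != 0) ->
  n <= minv x y <-> val_ge v n x /\ val_ge v n y.
Proof.
rewrite /minv; have [->|x0] /= := eqVneq x 0.
  by move=> y0; rewrite -(vgeE n y0); split=> [h|[]//]; split=> //; left.
have [->|y0] := eqVneq y 0 => _.
  by rewrite -(vgeE n x0); split=> [h|[]//]; split=> //; left.
rewrite le_min; split=> [/andP[a b]|[/vgeE - /(_ x0) -> /vgeE - /(_ y0) ->]//].
by split; right.
Qed.

Lemma minv0 y : minv 0 y = v y. Proof. by rewrite /minv eqxx. Qed.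

Lemma minvZ c x y : c != 0 -> (x != 0) || (y != 0) -> minv (c * x) (c * y) = v c + minv x y.
Proof.
move=> c0; rewrite /minv !mulf_eq0 (negbTE c0) /=.
case: (eqVneq x 0) => [_ y0|x0 _]; first by rewrite val_M.
by case: (eqVneq y 0) => [_|y0]; rewrite !val_M//; lia.
Qed.

End Valuation.

(** * Two by two matrices and their projective classes *)

Section Matrices.
Variable F : fieldType.
Implicit Types (a b c d : F) (A B : 'M[F]_2).

Definition mx2 a b c d : 'M[F]_2 :=
  \matrix_(i, j) (if i == 0 then (if j == 0 then a else b) else (if j == 0 then c else d)).


Lemma ord2P (i : 'I_2) : i = 0 \/ i = 1.
Proof. by case: i => -[|[|//]] hi; [left|right]; apply: val_inj. Qed.

Lemma mx2E a b c d : (mx2 a b c d 0 0 = a) * (mx2 a b c d 0 1 = b) *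
  (mx2 a b c d 1 0 = c) * (mx2 a b c d 1 1 = d).
Proof. by rewrite !mxE. Qed.

Lemma mx2_eta A : A = mx2 (A 0 0) (A 0 1) (A 1 0) (A 1 1).
Proof.
by apply/matrixP => i j; case: (ord2P i) => ->; case: (ord2P j) => ->; rewrite !mxE.
Qed.

Lemma mx2_ext A B : A 0 0 = B 0 0 -> A 0 1 = B 0 1 -> A 1 0 = B 1 0 -> A 1 1 = B 1 1 -> A = B.
Proof. by move=> h1 h2 h3 h4; rewrite (mx2_eta A) (mx2_eta B) h1 h2 h3 h4. Qed.
Lemma sum2 (V : nmodType) (f : 'I_2 -> V) : \sum_i f i = f 0 + f 1.
Proof. by rewrite !big_ord_recl big_ord0 addr0; congr (f _ + f _); apply: val_inj. Qed.

Lemma det2 A : \det A = A 0 0 * A 1 1 - A 0 1 * A 1 0.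
Proof.
rewrite (expand_det_row _ 0) sum2 /cofactor !det_mx11 !mxE /=.
rewrite (_ : fintype.lift 0 0 = 1); last exact: val_inj.
rewrite (_ : fintype.lift 1 0 = 0); last exact: val_inj.
by rewrite /= addn0 expr0 add0n expr1 mulN1r mul1r mulrN.
Qed.

Lemma mx2M a b c d a' b' c' d' :
  mx2 a b c d *m mx2 a' b' c' d' = mx2 (a * a' + b * c') (a * b' + b * d') (c * a' + d * c') (c * b' + d * d').
Proof. by apply: mx2_ext; rewrite !mxE sum2 !mxE. Qed.

Lemma mx2Z e a b c d : e *: mx2 a b c d = mx2 (e * a) (e * b) (e * c) (e * d).
Proof. by apply: mx2_ext; rewrite !mxE. Qed.
Lemma unit2E A : (A \in unitmx) = (\det A != 0).
Proof. by rewrite unitmxE unitfE. Qed.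

Lemma row2_neq0 A : \det A != 0 -> (A 1 0 != 0) || (A 1 1 != 0).
Proof.
by apply: contraNT; rewrite negb_or !negbK det2 => /andP[/eqP -> /eqP ->]; rewrite !mulr0 subrr.
Qed.

Implicit Types x y : PGL2 F.

Lemma val_insubd A : \det A != 0 -> val (insubd (gl_one F) A) = A.
Proof. by rewrite -unit2E => h; rewrite insubdK. Qed.
Lemma det_mxrep x : \det (mxrep x) != 0.
Proof. by rewrite -unit2E; exact: valP. Qed.

Lemma pgl_ofK x : pgl_of (mxrep x) = x.
Proof.
rewrite -[RHS]pgl_reprK /pgl_of; congr pgl_class; apply: val_inj.
by rewrite val_insubd// det_mxrep.
Qed.

Lemma pgl_ofP x : exists2 A, \det A != 0 & x = pgl_of A.
Proof. by exists (mxrep x); rewrite ?det_mxrep ?pgl_ofK. Qed.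

Lemma mxrep_pgl_of A : \det A != 0 -> exists2 c, c != 0 & A = c *: mxrep (pgl_of A).
Proof.
move=> A0; have [c c0 e] := pgl_reprE (insubd (gl_one F) A); exists c => //.
by rewrite -{1}(val_insubd A0).
Qed.

Lemma pgl_of_eq A B : \det A != 0 -> \det B != 0 ->
  pgl_of A = pgl_of B <-> exists2 c, c != 0 & B = c *: A.
Proof.
move=> A0 B0; rewrite /pgl_of -pgl_eqP; split=> -[c c0 e]; exists c => //.
  by rewrite -(val_insubd B0) e val_insubd.
by rewrite !val_insubd.
Qed.

Lemma pgl_ofZ c A : c != 0 -> \det A != 0 -> pgl_of (c *: A) = pgl_of A.
Proof.
move=> c0 A0; apply/esym/pgl_of_eq => //; last by exists c.
by rewrite detZ mulf_neq0// expf_neq0.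
Qed.

Lemma pgl_ofM A B : \det A != 0 -> \det B != 0 -> (pgl_of A * pgl_of B)%g = pgl_of (A *m B).
Proof.
move=> A0 B0; rewrite [LHS]pgl_classM; congr pgl_class; apply: val_inj => /=.
by rewrite !val_insubd// det_mulmx mulf_neq0.
Qed.

Lemma pgl_of1 : pgl_of 1%:M = 1%g :> PGL2 F.
Proof.
congr pgl_class; apply: val_inj; rewrite val_insubd//=.
by rewrite det1 oner_neq0.
Qed.

Definition adj2 A := mx2 (A 1 1) (- A 0 1) (- A 1 0) (A 0 0).

Lemma det_adj2 A : \det (adj2 A) = \det A.
Proof. by rewrite !det2 !mx2E; ring. Qed.
Lemma adj2M A : adj2 A *m A = (\det A)%:M.
Proof. by apply: mx2_ext; rewrite !mxE sum2 !mx2E /= ?mulr1n ?mulr0n ?det2; ring. Qed.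

Lemma pgl_ofV A : \det A != 0 -> (pgl_of A)^-1%g = pgl_of (adj2 A).
Proof.
move=> A0; apply: (mulIg (pgl_of A)); rewrite mulVg pgl_ofM ?det_adj2// adj2M -pgl_of1.
by rewrite -[(\det A)%:M]scalemx1 pgl_ofZ// det1 oner_neq0.
Qed.

End Matrices.

Section PglMap.
Variables (E F : fieldType) (f : {rmorphism E -> F}).

Lemma det_map2 (A : 'M[E]_2) : \det (map_mx f A) = f (\det A).
Proof. by rewrite det_map_mx. Qed.

Lemma pgl_map_of (A : 'M[E]_2) : \det A != 0 -> pgl_map f (pgl_of A) = pgl_of (map_mx f A).
Proof.
move=> A0; have [c c0 e] := mxrep_pgl_of A0; rewrite /pgl_map.
have d0 : \det (map_mx f (mxrep (pgl_of A))) != 0 by rewrite det_map2 fmorph_eq0 det_mxrep.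
apply/pgl_of_eq => //; first by rewrite det_map2 fmorph_eq0.
exists (f c); first by rewrite fmorph_eq0.
by rewrite -map_mxZ -e.
Qed.

Lemma pgl_mapM (x y : PGL2 E) : pgl_map f (x * y)%g = (pgl_map f x * pgl_map f y)%g.
Proof.
have [A A0 ->] := pgl_ofP x; have [B B0 ->] := pgl_ofP y.
rewrite pgl_ofM// !pgl_map_of//; last by rewrite det_mulmx mulf_neq0.
by rewrite map_mxM pgl_ofM// det_map2 fmorph_eq0.
Qed.

Lemma pgl_map1 : pgl_map f 1%g = 1%g.
Proof. by rewrite -pgl_of1 pgl_map_of ?map_mx1 ?pgl_of1// det1 oner_neq0. Qed.
Lemma pgl_mapV (x : PGL2 E) : pgl_map f x^-1%g = (pgl_map f x)^-1%g.
Proof. by apply: (mulIg (pgl_map f x)); rewrite -pgl_mapM !mulVg pgl_map1. Qed.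

End PglMap.

(** * The integral subgroup and the height of a class *)

Section IntegralSubgroup.
Variables (F : fieldType) (v : valuation F).

Definition intM (A : 'M[F]_2) := forall i j, val_ge v 0 (A i j).

Lemma intM_mx2 a b c d : val_ge v 0 a -> val_ge v 0 b -> val_ge v 0 c -> val_ge v 0 d -> intM (mx2 a b c d).
Proof. by move=> *; move=> i j; case: (ord2P i) => ->; case: (ord2P j) => ->; rewrite mxE. Qed.

Lemma intM_mul A B : intM A -> intM B -> intM (A *m B).
Proof.
by move=> hA hB i j; rewrite mxE sum2; apply: vgeD; rewrite -[0 : int]addr0; apply: vgeM.
Qed.

Lemma intM1 : intM 1%:M.
Proof. by move=> i j; rewrite mxE; case: eqP => _; [exact: vge1|left]. Qed.
Lemma intM_adj A : intM A -> intM (adj2 A).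
Proof. by move=> h; apply: intM_mx2; rewrite ?vgeN//; apply: vgeN. Qed.

Lemma pgl_intP (A : 'M[F]_2) : \det A != 0 ->
  pgl_int v (pgl_of A) <-> exists2 c, c != 0 & intM (c *: A) /\ v (\det (c *: A)) = 0.
Proof.
move=> A0; split=> [[B [e h1 h2]]|[c c0 [h1 h2]]].
  have B0 : \det (val B) != 0 by rewrite -unit2E (valP B).
  have eB : pgl_of A = pgl_of (val B).
    rewrite e /pgl_of; congr pgl_class; apply: val_inj; by rewrite val_insubd.
  by have [c c0 eBA] := (pgl_of_eq A0 B0).1 eB; exists c => //; rewrite -eBA.
have cA0 : \det (c *: A) != 0 by rewrite detZ mulf_neq0// expf_neq0.
exists (insubd (gl_one F) (c *: A)); rewrite -[pgl_class _]/(pgl_of (c *: A)) pgl_ofZ//.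
by rewrite val_insubd.
Qed.

Lemma pgl_int_of (A : 'M[F]_2) : \det A != 0 -> intM A -> v (\det A) = 0 -> pgl_int v (pgl_of A).
Proof. by move=> A0 h1 h2; apply/pgl_intP => //; exists 1; rewrite ?oner_neq0 ?scale1r. Qed.

Lemma pgl_int_rep x : pgl_int v x -> exists A, [/\ \det A != 0, x = pgl_of A, intM A & v (\det A) = 0].
Proof.
have [A A0 ->] := pgl_ofP x; move=> /(pgl_intP A0)[c c0 [h1 h2]]; exists (c *: A).
by rewrite pgl_ofZ// detZ mulf_neq0// ?expf_neq0// -detZ.
Qed.

Lemma pgl_int_subgroup : is_subgroup (pgl_int v).
Proof.
split.
- by rewrite -pgl_of1; apply: pgl_int_of; rewrite ?det1 ?oner_neq0 ?val1//; exact: intM1.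
- move=> _ _ /pgl_int_rep[A [A0 -> hA vA]] /pgl_int_rep[B [B0 -> hB vB]].
  rewrite pgl_ofM//; apply: pgl_int_of; rewrite ?det_mulmx ?mulf_neq0//; first exact: intM_mul.
  by rewrite val_M// vA vB.
move=> _ /pgl_int_rep[A [A0 -> hA vA]]; rewrite pgl_ofV//.
by apply: pgl_int_of; rewrite ?det_adj2//; exact: intM_adj.
Qed.

(** The Busemann height of the vertex of [A] for the end of the first basis vector, equal to
    [v(d) - v(a)] on upper triangular matrices. The factor 2 against the determinant makes it
    invariant under scalars. *)
Definition bhM (A : 'M[F]_2) : int := 2 * minv v (A 1 0) (A 1 1) - v (\det A).

Lemma bhM_Z c A : c != 0 -> \det A != 0 -> bhM (c *: A) = bhM A.
Proof.
move=> c0 A0; rewrite /bhM !mxE minvZ ?row2_neq0// detZ val_M ?expf_neq0// valX//; ring.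
Qed.

Lemma minv_int A B : \det A != 0 -> \det B != 0 -> intM B ->
  minv v (A 1 0) (A 1 1) <= minv v ((A *m B) 1 0) ((A *m B) 1 1).
Proof.
move=> A0 B0 hB; have [h1 h2] := (minvP v _ (row2_neq0 A0)).1 (lexx (minv v (A 1 0) (A 1 1))).
apply/minvP; first by apply: row2_neq0; rewrite det_mulmx mulf_neq0.
by rewrite !mxE !sum2; split; apply: vgeD; rewrite -[minv _ _ _]addr0; apply: vgeM.
Qed.

(** One inequality is [minv_int] for [B], the other is the same for the adjugate of [B], an inverse
    up to a unit. *)
Lemma bhM_K A B : \det A != 0 -> \det B != 0 -> intM B -> v (\det B) = 0 -> bhM (A *m B) = bhM A.
Proof.
move=> A0 B0 hB vB; rewrite /bhM det_mulmx val_M// vB addr0; congr (2 * _ - _).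
have AB0 : \det (A *m B) != 0 by rewrite det_mulmx mulf_neq0.
apply/eqP; rewrite eq_le minv_int// andbT.
have aB0 : \det (adj2 B) != 0 by rewrite det_adj2.
have := minv_int AB0 aB0 (intM_adj hB); rewrite -mulmxA.
have -> : B *m adj2 B = (\det B)%:M by apply: mx2_ext; rewrite !mxE sum2 !mx2E /= ?mulr1n ?mulr0n ?det2; ring.
rewrite mul_mx_scalar [(\det B *: A) 1 0]mxE [(\det B *: A) 1 1]mxE minvZ ?row2_neq0// vB.
by rewrite add0r.
Qed.

Definition bh (x : PGL2 F) : int := bhM (mxrep x).

Lemma bh_of A : \det A != 0 -> bh (pgl_of A) = bhM A.
Proof.
by move=> A0; have [c c0 e] := mxrep_pgl_of A0; rewrite {2}e bhM_Z// det_mxrep.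
Qed.

Lemma bh_K x k : pgl_int v k -> bh (x * k)%g = bh x.
Proof.
have [A A0 ->] := pgl_ofP x; move=> /pgl_int_rep[B [B0 -> hB vB]].
by rewrite pgl_ofM// !bh_of// ?det_mulmx ?mulf_neq0// bhM_K.
Qed.

(* Column reduction: every class in PGL2(F)/PGL2(O) has an upper triangular representative. *)
Lemma iwasawa x : exists a b d k, [/\ a != 0, d != 0, pgl_int v k & (x * k)%g = pgl_of (mx2 a b 0 d)].
Proof.
(* Pivot on [d] when it has the smaller valuation in the bottom row; in the other case the columns
   are exchanged first. *)
have key (a b c d : F) : a * d - b * c != 0 -> d != 0 -> val_ge v (v d) c ->
    exists a' b' d' k, [/\ a' != 0, d' != 0, pgl_int v k & (pgl_of (mx2 a b c d) * k)%g = pgl_of (mx2 a' b' 0 d')].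
  move=> D0 d0 cd; have K0 : \det (mx2 1 0 (- (c / d)) 1) = 1 :> F by rewrite det2 !mx2E; ring.
  exists (a - b * (c / d)), b, d, (pgl_of (mx2 1 0 (- (c / d)) 1)); split=> //.
  - apply: contra_neq D0 => h; have : (a - b * (c / d)) * d = 0 by rewrite h mul0r.
    by rewrite mulrBl -mulrA divfK.
  - apply: pgl_int_of; rewrite ?K0 ?oner_neq0 ?val1//.
    apply: intM_mx2; [exact: vge1|by left| |exact: vge1].
    by apply: vgeN; rewrite -[0 : int](subrr (v d)); apply: vgeM => //; right; rewrite valV.
  rewrite pgl_ofM; rewrite ?K0 ?oner_neq0// ?det2 ?mx2E// mx2M; congr pgl_of.
  by apply: mx2_ext; rewrite !mx2E; field.
have [A A0 ->] := pgl_ofP x; rewrite (mx2_eta A).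
move: A0; rewrite det2; move: (A 0 0) (A 0 1) (A 1 0) (A 1 1) => a b c d D0.
have [/andP[d0 /orP hdc]|h] := boolP ((d != 0) && ((c == 0) || (v d <= v c))).
  by apply: key => //; case: hdc => [/eqP ->|]; [left|right].
have c0 : c != 0.
  apply: contraNneq h => c0; rewrite c0 eqxx /= andbT; apply: contra_neq D0 => ->.
  by rewrite c0 !mulr0 subrr.
have dc : val_ge v (v c) d.
  move: h; rewrite negb_and negbK negb_or c0 /= -ltNge => /orP[/eqP ->|/ltW]; [by left|by right].
have D0' : b * c - a * d != 0 by rewrite -oppr_eq0 opprB.
have [a' [b' [d' [k [h1 h2 hk e]]]]] := key b a d c D0' c0 dc.
have W0 : \det (mx2 0 1 1 0) = -1 :> F by rewrite det2 !mx2E; ring.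
have W1 : -1 != 0 :> F by rewrite oppr_eq0 oner_neq0.
exists a', b', d', (pgl_of (mx2 0 1 1 0) * k)%g; split=> //.
  apply: (subgroup_M pgl_int_subgroup) => //; apply: pgl_int_of; rewrite ?W0//; last by rewrite valN val1.
  by apply: intM_mx2; [left|exact: vge1|exact: vge1|left].
rewrite mulgA pgl_ofM; rewrite ?W0// ?det2 ?mx2E// mx2M.
by rewrite !mulr0 !mulr1 !add0r !addr0.
Qed.

End IntegralSubgroup.

Section Orb.
Variables (G X : Type) (a : G -> X -> X) (H : set G).

Lemma oprojE x y : oproj a H x = oproj a H y <-> orb a H x = orb a H y.
Proof.
split=> [|h]; first by move=> /(congr1 (@proj1_sig _ _)).
by rewrite /oproj; apply: eq_exist.
Qed.

Lemma orepK O : oproj a H (orep O) = O.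
Proof.
rewrite /orep; case: (cid _) => x /= e; rewrite /oproj.
by case: O e => P p /= e; apply: eq_exist; rewrite e.
Qed.

End Orb.

Section FractionIdentities.
Variable F : fieldType.
Implicit Types a b d e p : F.

Lemma frac_cancel1 p b d e : d != 0 -> e != 0 -> p / (d * e) * (b * e) = p * (b / d).
Proof. by move=> d0 e0; field; rewrite d0 e0. Qed.
Lemma frac_cancel2 p d e : p != 0 -> d * e != 0 -> p / (d * e) * (p^-1 * (d * e)) = 1.
Proof. by rewrite mulf_eq0 negb_or => p0 /andP[d0 e0]; field; rewrite p0 d0 e0. Qed.
Lemma frac_cancel3 p a d e : p != 0 -> d * e != 0 ->
  (p / (d * e)) ^+ 2 * (p^-1 * (a * (d * e))) = p * (a / (d * e)).
Proof. by rewrite mulf_eq0 negb_or => p0 /andP[d0 e0]; field; rewrite p0 d0 e0. Qed.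
End FractionIdentities.

(** * The tree, its neighbours and its Busemann functions *)

Section TreeSection.
Variables (Fq : finFieldType) (k : fieldType) (iota : {rmorphism Fq -> k}).
Variables (oo : valuation k) (Kc : forall v : valuation k, completion v).
Hypothesis hoo : degree_one iota oo.
Variable (varpi : koo oo Kc).
Hypothesis hvarpi : varpi != 0 /\ voo oo Kc varpi = 1.
Notation Lf := (koo oo Kc).
Notation vv := (voo oo Kc).
Notation G := (Goo oo Kc).
Notation K := (@Koo k oo Kc).
Notation T := (tree oo Kc).
Notation ce := (compl_emb (Kc oo)).
Implicit Types (B g u : G) (x y z : T) (C : int).

Let w0 : varpi != 0. Proof. by case: hvarpi. Qed.
Let w1 : vv varpi = 1. Proof. by case: hvarpi. Qed.
Let KG : is_subgroup K := pgl_int_subgroup vv.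
Let K1 : K 1%g := subgroup_1 KG.
Let KM u v : K u -> K v -> K (u * v)%g. Proof. exact: (subgroup_M KG). Qed.
Let KV u : K u -> K u^-1%g. Proof. exact: (subgroup_V KG). Qed.

(** Density of [k] in its completion reduces to an integral element of [k], for which the degree of
    the place provides the constant. *)
Lemma residue (t : Lf) : val_ge vv 0 t -> exists b : Fq, val_ge vv 1 (t - ce (iota b)).
Proof.
move=> ht; have [x hx] := compl_dense t 1.
have ix : val_ge vv 0 (ce x).
  by rewrite -[ce x](subKr t); apply: vgeB => //; apply: vgeW hx.
have ix' : val_ge oo 0 x.
  have [->|x0] := eqVneq x 0; first by left.
  by right; rewrite -(compl_ext (Kc oo)); apply/(vgeE vv) => //; rewrite fmorph_eq0.
have [b hb] := hoo ix'; exists b.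
rewrite -(subrKA (ce x)) -rmorphB; apply: vgeD => //.
have [->|xb0] := eqVneq (x - iota b) 0; first by rewrite rmorph0; left.
by right; rewrite [vv _](compl_ext (Kc oo)); apply/(vgeE oo).
Qed.

Lemma vtxE g g' : vtx g = vtx g' <-> K (g^-1 * g')%g.
Proof.
rewrite [vtx g = _]oprojE; split=> [h|h].
  have : orb (fun u g : G => g * u)%g K g' g' by exists 1%g => //; rewrite mulg1.
  by rewrite -h => -[u Ku <-]; rewrite mulgA mulVg mul1g.
apply/seteqP; split=> _ [u Ku <-].
  by exists ((g^-1 * g')^-1 * u)%g; [exact: KM (KV h) Ku|rewrite invgM invgK !mulgA mulgV mul1g].
by exists ((g^-1 * g') * u)%g; [exact: KM|rewrite !mulgA mulgV mul1g].
Qed.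

Lemma vtx_mulr g u : K u -> vtx (g * u)%g = vtx g.
Proof. by move=> Ku; apply/vtxE; rewrite invgM -mulgA mulVg mulg1; exact: KV. Qed.

Lemma liftK x : vtx (lift x) = x. Proof. exact: orepK. Qed.

Lemma lift_vtx g : exists2 u, K u & lift (vtx g) = (g * u)%g.
Proof.
exists (g^-1 * lift (vtx g))%g; last by rewrite mulgA mulgV mul1g.
by apply/vtxE; rewrite liftK.
Qed.

Lemma act_vtx g g' : act g (vtx g') = vtx (g * g')%g.
Proof. by rewrite /act; have [u Ku ->] := lift_vtx g'; rewrite mulgA (vtx_mulr _ Ku). Qed.
Lemma actM g g' x : act (g * g')%g x = act g (act g' x).
Proof. by rewrite -(liftK x) !act_vtx mulgA. Qed.
Lemma act1 x : act 1%g x = x.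
Proof. by rewrite -{1}(liftK x) act_vtx mul1g liftK. Qed.

Definition hB B x : int := bh vv (B^-1 * lift x)%g.

Lemma hB_vtx B g : hB B (vtx g) = bh vv (B^-1 * g)%g.
Proof. by rewrite /hB; have [u Ku ->] := lift_vtx g; rewrite mulgA bh_K. Qed.
Lemma hB_act B g x : hB B (act g x) = hB (g^-1 * B)%g x.
Proof. by rewrite -(liftK x) act_vtx !hB_vtx invgM invgK mulgA. Qed.

(** Representatives of the [q + 1] cosets in [K diag(varpi, 1) K], one for each point of the
    projective line over the residue field. *)
Definition nbm (o : option Fq) : 'M[Lf]_2 :=
  if o is Some b then mx2 varpi (ce (iota b)) 0 1 else mx2 1 0 0 varpi.

Lemma det_nbm o : \det (nbm o) = varpi.
Proof. by case: o => [b|]; rewrite det2 !mx2E; ring. Qed.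

Lemma det_nbm0 o : \det (nbm o) != 0. Proof. by rewrite det_nbm. Qed.

Lemma diag2E a : diag2 a = mx2 a 0 0 1 :> 'M[Lf]_2.
Proof. by apply: mx2_ext; rewrite !mxE. Qed.
Lemma det_diag2 (a : Lf) : \det (diag2 a) = a.
Proof. by rewrite diag2E det2 !mx2E; ring. Qed.

Let W : 'M[Lf]_2 := mx2 0 1 1 0.
Let detW : \det W = -1. Proof. by rewrite det2 !mx2E; ring. Qed.
Let W0 : \det W != 0. Proof. by rewrite detW oppr_eq0 oner_neq0. Qed.
Let KW : K (pgl_of W).
Proof.
apply: pgl_int_of => //; last by rewrite detW valN val1.
by apply: intM_mx2; [left|exact: vge1|exact: vge1|left].
Qed.

Lemma ce_int b : val_ge vv 0 (ce (iota b)).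
Proof. by right; rewrite (val_finite vv (ce \o iota)). Qed.

Lemma nb_dc o : exists u1 u2, [/\ K u1, K u2 & pgl_of (nbm o) = (u1 * pgl_of (diag2 varpi) * u2)%g].
Proof.
case: o => [b|].
  have d1 : \det (mx2 1 (ce (iota b)) 0 1) = 1 by rewrite det2 !mx2E; ring.
  exists (pgl_of (mx2 1 (ce (iota b)) 0 1)), 1%g; split=> //.
    apply: pgl_int_of; rewrite ?d1 ?oner_neq0 ?val1//.
    by apply: intM_mx2; [exact: vge1|exact: ce_int|left|exact: vge1].
  rewrite mulg1 pgl_ofM ?d1 ?oner_neq0 ?det_diag2// diag2E mx2M; congr pgl_of.
  by apply: mx2_ext; rewrite !mx2E; ring.
exists (pgl_of W), (pgl_of W); split=> //.
rewrite pgl_ofM ?det_diag2// pgl_ofM ?det_mulmx ?det_diag2 ?mulf_neq0//; congr pgl_of.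
by rewrite diag2E !mx2M; apply: mx2_ext; rewrite !mx2E; ring.
Qed.

(** The lower right entry [s] decides: if it is a unit, the residue of [q / s] selects the coset
    [Some b]; otherwise the coset is [None]. *)
Lemma dc_nb u1 : K u1 -> exists o u2, K u2 /\ (u1 * pgl_of (diag2 varpi))%g = (pgl_of (nbm o) * u2)%g.
Proof.
move=> /pgl_int_rep[A [A0 -> hA vA]].
suff [] : exists t (M : 'M[Lf]_2), [/\ intM vv M, vv (\det M) = 0 & A *m diag2 varpi = nbm t *m M].
  move=> t [M [hM vM e]]; have D0 : \det (A *m diag2 varpi) != 0 by rewrite det_mulmx det_diag2 mulf_neq0.
  have M0 : \det M != 0 by move: D0; rewrite e det_mulmx mulf_eq0 negb_or => /andP[].
  exists t, (pgl_of M); split; first exact: pgl_int_of.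
  by rewrite !pgl_ofM ?det_diag2 ?det_nbm0// e.
have dM o M : A *m diag2 varpi = nbm o *m M -> vv (\det M) = 0.
  move=> /(congr1 determinant); rewrite !det_mulmx det_diag2 det_nbm mulrC => /(mulfI w0) <-.
  exact: vA.
move: A0 dM; rewrite (mx2_eta A) diag2E det2 !mx2E.
have := (hA 0 0, hA 0 1, hA 1 0, hA 1 1).
move: (A 0 0) (A 0 1) (A 1 0) (A 1 1) => p q r s [[[hp hq] hr] hs] D0 dM.
have [s0|s0] := boolP ((s != 0) && (vv s == 0)).
  case/andP: s0 => s0 /eqP vs.
  have ht : val_ge vv 0 (q / s) by rewrite -[0 : int](addr0 0); apply: vgeM => //; right; rewrite valV// vs.
  have [b hb] := residue ht.
  have e : mx2 p q r s *m mx2 varpi 0 0 1 =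
      nbm (Some b) *m mx2 (p - ce (iota b) * r) ((q - s * ce (iota b)) / varpi) (r * varpi) s.
    by rewrite /nbm !mx2M; apply: mx2_ext; rewrite !mx2E; field.
  exists (Some b), (mx2 (p - ce (iota b) * r) ((q - s * ce (iota b)) / varpi) (r * varpi) s).
  split=> //; last exact: dM e.
  apply: intM_mx2 => //.
  - by apply: vgeB => //; rewrite -[0 : int](addr0 0); apply: vgeM => //; exact: ce_int.
  - have -> : (q - s * ce (iota b)) / varpi = s * ((q / s - ce (iota b)) * varpi^-1) by field; rewrite ?w0 ?s0.
    rewrite -[0 : int](addr0 0); apply: vgeM => //; rewrite -[0 : int](subrr 1); apply: vgeM => //.
    by right; rewrite valV// w1.
  - by rewrite -[0 : int](addr0 0); apply: vgeM => //; right; rewrite w1.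
have hs1 : val_ge vv 1 s.
  case: hs s0 => [->|hs]; first by left.
  by rewrite negb_and negbK => /orP[/eqP ->|vs0]; [left|right; lia].
have e : mx2 p q r s *m mx2 varpi 0 0 1 = nbm None *m mx2 (p * varpi) q r (s / varpi).
  by rewrite /nbm !mx2M; apply: mx2_ext; rewrite !mx2E; field.
exists None, (mx2 (p * varpi) q r (s / varpi)); split=> //; last exact: dM e.
apply: intM_mx2 => //.
  by rewrite -[0 : int](addr0 0); apply: vgeM => //; right; rewrite w1.
by rewrite -[0 : int](subrr 1); apply: vgeM => //; right; rewrite valV// w1.
Qed.

Notation adj := (adj varpi).

Lemma adj_vtx g y : adj (vtx g) y <-> exists o, y = vtx (g * pgl_of (nbm o))%g.
Proof.
have [u Ku eu] := lift_vtx g; split=> [[u1 [u2 [K1' K2 e]]]|[t ->]].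
  have [t [u3 [K3 e3]]] := dc_nb (KM Ku K1'); exists t.
  have -> : y = vtx (g * (u * u1 * pgl_of (diag2 varpi)) * u2)%g.
    by rewrite -(liftK y) -[lift y]mul1g -(mulgV (lift (vtx g))) -mulgA e eu !mulgA.
  by rewrite (vtx_mulr _ K2) e3 mulgA (vtx_mulr _ K3).
have [u1 [u2 [K1' K2 e]]] := nb_dc t; have [u3 K3 e3] := lift_vtx (g * pgl_of (nbm t))%g.
exists (u^-1 * u1)%g, (u2 * u3)%g; split; [exact: KM (KV Ku) K1'|exact: KM|].
by rewrite e3 eu invgM e !mulgA -(mulgA _ g^-1%g) mulVg mulg1.
Qed.

Lemma adj_sym x y : adj x y -> adj y x.
Proof.
move=> [u1 [u2 [h1 h2 e]]]; have [v1 [v2 [h3 h4 e']]] := nb_dc None.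
exists (u2^-1 * v1)%g, (v2 * u1^-1)%g; split; [exact: KM (KV h2) h3|exact: KM h4 (KV h1)|].
have -> : ((lift y)^-1 * lift x)%g = ((lift x)^-1 * lift y)^-1%g by rewrite invgM invgK.
rewrite e !invgM; have -> : (pgl_of (diag2 varpi))^-1%g = pgl_of (nbm None).
  rewrite pgl_ofV ?det_diag2// diag2E /adj2; congr pgl_of.
  by apply: mx2_ext; rewrite !mx2E ?oppr0.
by rewrite e' !mulgA.
Qed.

Lemma adj_act g x y : adj (act g x) (act g y) <-> adj x y.
Proof.
have h g' x' y' : adj x' y' -> adj (act g' x') (act g' y').
  rewrite -(liftK x') -(liftK y') => /adj_vtx[t ->]; rewrite !act_vtx mulgA.
  by apply/adj_vtx; exists t.
split=> [/(h g^-1%g)|]; last exact: h.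
by rewrite -!actM mulVg !act1.
Qed.

Lemma bhM_tri a b d : a != 0 -> d != 0 -> bhM vv (mx2 a b 0 d) = vv d - vv a.
Proof. by move=> a0 d0; rewrite /bhM det2 !mx2E minv0 mulr0 subr0 val_M//; lia. Qed.
Lemma det_tri a b d : \det (mx2 a b 0 d) = a * d :> Lf.
Proof. by rewrite det2 !mx2E mulr0 subr0. Qed.

(* Exactly one neighbour lies closer to the end of [B], the others farther away. *)
Lemma local_rule B x : exists nbr : option Fq -> T,
  [/\ injective nbr, forall y, adj x y <-> exists o, y = nbr o,
      hB B (nbr None) = hB B x + 1 & forall b, hB B (nbr (Some b)) = hB B x - 1].
Proof.
have [a [b [d [u [a0 d0 Ku e]]]]] := iwasawa vv (B^-1 * lift x)%g.
have xE : x = vtx (lift x * u)%g by rewrite vtx_mulr// liftK.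
have D0 : \det (mx2 a b 0 d) != 0 by rewrite det_tri mulf_neq0.
have hx : hB B x = vv d - vv a by rewrite {1}xE hB_vtx mulgA e bh_of// bhM_tri.
have hN : hB B (vtx (lift x * u * pgl_of (nbm None))%g) = hB B x + 1.
  rewrite hB_vtx !mulgA e pgl_ofM ?det_nbm0// bh_of ?det_mulmx ?mulf_neq0 ?det_nbm0//.
  rewrite /nbm mx2M !mulr0 !mul0r ?addr0 ?add0r ?mulr1 bhM_tri ?mulf_neq0// val_M// w1 hx; lia.
have hS c : hB B (vtx (lift x * u * pgl_of (nbm (Some c)))%g) = hB B x - 1.
  rewrite hB_vtx !mulgA e pgl_ofM ?det_nbm0// bh_of ?det_mulmx ?mulf_neq0 ?det_nbm0//.
  rewrite /nbm mx2M !mulr0 !mul0r ?addr0 ?add0r ?mulr1 bhM_tri ?mulf_neq0// val_M// w1 hx; lia.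
exists (fun o => vtx (lift x * u * pgl_of (nbm o))%g); split=> //.
- case=> [c|] [c'|] // h; [|by have := hS c; rewrite h hN; lia|by have := hS c'; rewrite -h hN; lia].
  congr Some; apply/eqP; apply: contraT => cc.
  have {}h : vtx (lift x * u * pgl_of (nbm (Some c)))%g = vtx (lift x * u * pgl_of (nbm (Some c')))%g := h.
  move: h => /vtxE; rewrite invgM mulgA -(mulgA _ (_ * _)^-1%g) mulVg mulg1.
  rewrite pgl_ofV ?det_nbm0// pgl_ofM ?det_adj2 ?det_nbm0// => /pgl_intP h.
  have /h : \det (adj2 (nbm (Some c)) *m nbm (Some c')) != 0.
    by rewrite det_mulmx det_adj2 mulf_neq0 ?det_nbm0.
  move=> [e0 e00 [h1 h2]].
  (* The determinant condition forces the scalar to have valuation [-1], while the entry [0 1] is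
     that scalar times a difference of constants, a unit if they are distinct; so it could not be
     integral. *)
  move: h2; rewrite detZ det_mulmx det_adj2 !det_nbm val_M ?expf_neq0 ?mulf_neq0// valX// val_M// w1 => h2.
  have := h1 0 1; rewrite !mxE sum2 /nbm /adj2 !mx2E => -[/eqP|].
    rewrite mulf_eq0 (negbTE e00) mul1r mulr1 addr_eq0 opprK => /eqP.
    by move=> /(fmorph_inj ce) /(fmorph_inj iota) /eqP; rewrite eq_sym (negbTE cc).
  have bc0 : ce (iota (c' - c)) != 0 by rewrite !fmorph_eq0 subr_eq0 eq_sym.
  rewrite mul1r mulr1 -!rmorphB /= val_M//.
  by rewrite (val_finite vv (ce \o iota)); lia.
- by move=> y; rewrite {1}xE; exact: adj_vtx.
Qed.

Lemma adj_hB B x y : adj x y -> hB B y = hB B x + 1 \/ hB B y = hB B x - 1.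
Proof.
by have [nbr [_ hn hN hS]] := local_rule B x; move=> /hn[[b|] ->]; [right|left].
Qed.

Lemma walk_hB B x y n : walk varpi x y n -> `|hB B y - hB B x| <= n%:Z.
Proof.
elim=> [z|z1 z2 z3 m az _ IH]; first by rewrite subrr normr0.
by have [e|e] := adj_hB B az; move: IH; rewrite e; lia.
Qed.

Lemma walk_rcons x y z n : walk varpi x y n -> adj y z -> walk varpi x z n.+1.
Proof.
elim=> [w|w1' w2 w3 m aw _ IH] az; first by apply: walkS az (walk0 _ _).
by apply: walkS aw (IH az).
Qed.

Notation ray B m := (vtx (B * pgl_of (diag2 (varpi ^- m)))%g).

Lemma hB_ray B (m : nat) : hB B (ray B m) = m%:Z.
Proof.
rewrite hB_vtx mulgA mulVg mul1g bh_of ?det_diag2 ?invr_eq0 ?expf_neq0//.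
by rewrite diag2E bhM_tri ?invr_eq0 ?expf_neq0 ?oner_neq0// val1 valV ?expf_neq0// valX// w1; lia.
Qed.

(** In upper triangular coordinates the ascending step multiplies the second column by [varpi]. Once
    the off-diagonal entry is divisible enough, the ascending path has merged with the ray. *)
Lemma walk_ray B x : exists N : nat, forall m : nat, (N <= m)%N ->
  exists2 i : nat, i%:Z = m%:Z - hB B x & walk varpi x (ray B m) i.
Proof.
have [a [b [d [u [a0 d0 Ku e]]]]] := iwasawa vv (B^-1 * lift x)%g.
have gE : (lift x * u)%g = (B * pgl_of (mx2 a b 0 d))%g by rewrite -e !mulgA mulgV mul1g.
have xE : x = vtx (B * pgl_of (mx2 a b 0 d))%g by rewrite -gE vtx_mulr// liftK.
have D0 : \det (mx2 a b 0 d) != 0 by rewrite det_tri mulf_neq0.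
have hx : hB B x = vv d - vv a by rewrite {1}xE hB_vtx mulgA mulVg mul1g bh_of// bhM_tri.
pose xi i := vtx (B * pgl_of (mx2 a (b * varpi ^+ i) 0 (d * varpi ^+ i)))%g.
have Di i : \det (mx2 a (b * varpi ^+ i) 0 (d * varpi ^+ i)) != 0.
  by rewrite det_tri !mulf_neq0 ?expf_neq0.
have wi i : walk varpi x (xi i) i.
  elim: i => [|i IH]; first by rewrite /xi expr0 !mulr1 -xE; exact: walk0.
  apply: walk_rcons IH _; apply/adj_vtx; exists None; rewrite /xi -mulgA pgl_ofM ?det_nbm0//.
  rewrite /nbm mx2M !mulr0 !mul0r !addr0 !add0r mulr1 !exprSr !mulrA.
  by [].
exists (absz (hB B x) + absz (vv (b / d)%R))%N => m Nm.
exists (absz (m%:Z - hB B x)); first lia.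
set i := absz _; suff -> : ray B m = xi i by exact: wi.
have iE : i%:Z = m%:Z - hB B x by rewrite /i; lia.
apply/vtxE; rewrite invgM mulgA -(mulgA _ B^-1%g) mulVg mulg1.
have dr0 : \det (diag2 (varpi ^- m)) != 0 :> Lf by rewrite det_diag2 invr_eq0 expf_neq0.
rewrite pgl_ofV// pgl_ofM ?det_adj2//; apply/pgl_intP; first by rewrite det_mulmx det_adj2 mulf_neq0.
have pm0 : varpi ^+ m != 0 by rewrite expf_neq0.
have pi0 : varpi ^+ i != 0 by rewrite expf_neq0.
have de0 : d * varpi ^+ i != 0 by rewrite mulf_neq0.
have vm : vv (varpi ^+ m) = m%:Z by rewrite valX// w1 mul1r.
have vi : vv (varpi ^+ i) = i%:Z by rewrite valX// w1 mul1r.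
have vde : vv (d * varpi ^+ i) = vv d + i%:Z by rewrite val_M// vi.
move: pm0 pi0 de0 vm vi vde; move: (varpi ^+ m) (varpi ^+ i) => p e' pm0 pi0 de0 vm vi vde.
have c0 : p / (d * e') != 0 by rewrite mulf_neq0// invr_eq0.
have vc : vv (p / (d * e')) = m%:Z - (vv d + i%:Z) by rewrite val_M ?invr_eq0// valV// vm vde.
(* The scalar that makes the lower right entry of the quotient equal to 1. *)
exists (p / (d * e')) => //; split.
  rewrite diag2E /adj2 !mx2E mx2M mx2Z; apply: intM_mx2; rewrite oppr0 ?mul1r !mul0r ?mulr0 ?addr0 ?add0r.
  - by right; rewrite val_M// vc iE hx; lia.
  - rewrite (frac_cancel1 _ _ d0 pi0).
    have [->|b0] := eqVneq b 0; first by rewrite mul0r mulr0; left.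
    right; rewrite val_M ?mulf_neq0 ?invr_eq0// vm; clear -Nm; move: (hB B x) (vv (b / d)) Nm => s1 s2 Nm; lia.
  - by rewrite mulr0; left.
  by rewrite frac_cancel2//; exact: vge1.
by rewrite detZ det_mulmx det_adj2 det_diag2 det_tri frac_cancel3// val_M ?mulf_neq0 ?invr_eq0// val_M ?invr_eq0// valV// vm vde iE hx; lia.
Qed.

(** The distance to a far ray vertex is known exactly: [walk_ray] provides a walk of length
    [m - hB], and by [walk_hB] none is shorter. *)
Lemma busemann_hB (xi : 'cV[k]_2) (h : T -> int) (B : GL2 Lf) :
  busemann varpi xi h ->
  (exists a : Lf, col ord0 (val B) = a *: map_mx ce xi) ->
  exists C, forall x, h x = C + hB (pgl_class B) x.
Proof.
move=> hh /hh[C hC]; exists C => x; have [N1 h1] := hC x; have [N2 h2] := walk_ray (pgl_class B) x.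
pose m := maxn N1 N2; have [n [wn mn] ->] := h1 m (leq_maxl _ _).
have [i iE wi] := h2 m (leq_maxr _ _).
have := mn _ wi; have := walk_hB (pgl_class B) wn; rewrite hB_ray; lia.
Qed.

(** From height [n] a descending path leaves the horoball after [n] steps, and there the other
    height is at most 0. As heights change by 1 at each step, neither height can exceed the
    other. *)
Lemma horoball_height B B' (C C' : int) : (forall x, 1 <= C + hB B x <-> 1 <= C' + hB B' x) ->
  forall x, 1 <= C + hB B x -> C + hB B x = C' + hB B' x.
Proof.
have key B1 B2 (C1 C2 : int) : (forall x, 1 <= C1 + hB B1 x <-> 1 <= C2 + hB B2 x) ->
    forall (n : nat) x, C1 + hB B1 x = n%:Z -> C2 + hB B2 x <= n%:Z.
  move=> h; elim=> [|n IH] x hx.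
    by rewrite leNgt; apply/negP => h2; have := (h x).2; rewrite hx; lia.
  have [nbr [_ hn hN hS]] := local_rule B1 x.
  have axy : adj x (nbr (Some 0)) by apply/hn; exists (Some 0).
  have := IH (nbr (Some 0)); rewrite hS => /(_ _) hy.
  by have [e|e] := adj_hB B2 axy; have := hy ltac:(lia); rewrite e; lia.
move=> h x hx; have h1 := key _ _ _ _ h (absz (C + hB B x)) x.
have h2 := key _ _ _ _ (fun x => iff_sym (h x)) (absz (C' + hB B' x)) x.
by have := (h x).1 hx; have := h1 ltac:(lia); have := h2; move=> h3 h4 h5; have := h3 ltac:(lia); lia.
Qed.

Definition upt (F : fieldType) (u : PGL2 F) : Prop := mxrep u 1 0 = 0.

Lemma upt_of (F : fieldType) (A : 'M[F]_2) : \det A != 0 -> upt (pgl_of A) <-> A 1 0 = 0.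
Proof.
move=> A0; have [c c0 e] := mxrep_pgl_of A0; rewrite {2}e mxE /upt; split=> [->|/eqP].
  by rewrite mulr0.
by rewrite mulf_eq0 (negbTE c0) => /eqP.
Qed.

(* Along the ray of [B] the height [hB B'] tends to -oo unless both frames have the same end. *)
Lemma horoball_end B B' (C C' : int) : (forall x, 1 <= C + hB B x <-> 1 <= C' + hB B' x) ->
  upt (B^-1 * B')%g.
Proof.
move=> h; have [A A0 AE] := pgl_ofP (B^-1 * B')%g; rewrite AE upt_of//.
apply/eqP; apply: contraT => c0.
(* So large that the height for [B] is positive at this ray vertex, while a non-zero lower left
   entry would push the height for [B'] below 1. *)
pose n : nat := (absz C + absz C' + 2 * absz (vv (A 1 0)%R) + absz (vv (\det A)) + absz (vv (A 0 0)%R) + 2)%N.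
have n1 : 1 <= C + hB B (ray B n) by rewrite hB_ray /n; lia.
have := (h _).1 n1; rewrite hB_vtx mulgA.
have -> : (B'^-1 * B)%g = (pgl_of A)^-1%g by rewrite -AE invgM invgK.
have dr0 : \det (diag2 (varpi ^- n)) != 0 :> Lf by rewrite det_diag2 invr_eq0 expf_neq0.
have wn0 : varpi ^- n != 0 by rewrite invr_eq0 expf_neq0.
rewrite pgl_ofV// pgl_ofM ?det_adj2// bh_of ?det_mulmx ?det_adj2 ?mulf_neq0//.
rewrite /bhM det_mulmx det_adj2 det_diag2 val_M// diag2E /adj2 mx2M !mx2E !mulr0 !mulr1 addr0 add0r.
have x0 : - A 1 0 * varpi ^- n != 0 by rewrite mulf_neq0// oppr_eq0.
have := (@minvP _ vv (- A 1 0 * varpi ^- n) (A 0 0) (minv vv (- A 1 0 * varpi ^- n) (A 0 0))) .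
rewrite x0 => /(_ isT) [/(_ (lexx _)) [/(vgeE vv _ x0) hm _] _].
move: hm; rewrite val_M ?oppr_eq0// valN valV ?expf_neq0// valX// w1 => hm.
by move: hm; set mv := minv _ _ _; move=> hm h1; move: hm h1 n1; rewrite /n; lia.
Qed.

(* Two frames with the same end have heights differing by a constant. *)
Lemma upt_height B B' : upt (B^-1 * B')%g -> exists C0 : int, forall x, hB B' x = C0 + hB B x.
Proof.
have [A A0 AE] := pgl_ofP (B^-1 * B')%g; rewrite AE upt_of// => c0.
have AE' : A = mx2 (A 0 0) (A 0 1) 0 (A 1 1) by rewrite {1}(mx2_eta A) c0.
move: A0 AE; rewrite AE'; move: (A 0 0) (A 0 1) (A 1 1) => a b d A0 AE {A AE' c0}.
have /andP[a0 d0] : (a != 0) && (d != 0) by move: A0; rewrite det_tri mulf_eq0 negb_or.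
exists (vv a - vv d) => x; rewrite /hB.
have -> : (B'^-1 * lift x)%g = ((pgl_of (mx2 a b 0 d))^-1 * (B^-1 * lift x))%g.
  by rewrite -AE invgM invgK !mulgA -(mulgA _ B) mulgV mulg1.
have [M M0 ->] := pgl_ofP (B^-1 * lift x)%g.
rewrite pgl_ofV// pgl_ofM ?det_adj2// !bh_of ?det_mulmx ?det_adj2 ?mulf_neq0//.
rewrite /bhM det_mulmx det_adj2 det_tri {1 2}(mx2_eta M) /adj2 !mx2E mx2M !mx2E oppr0 !mul0r !add0r.
by rewrite minvZ ?row2_neq0// val_M ?mulf_neq0// val_M//; ring.
Qed.

Lemma height_surj B (n : int) : exists x, hB B x = n.
Proof.
case: n => [n|n]; first by exists (ray B n); exact: hB_ray.
exists (vtx (B * pgl_of (diag2 (varpi ^+ n.+1)))%g).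
rewrite hB_vtx mulgA mulVg mul1g bh_of ?det_diag2 ?expf_neq0//.
by rewrite diag2E bhM_tri ?expf_neq0 ?oner_neq0// val1 valX// w1; lia.
Qed.

Lemma finite_walk x n : finite_set [set y | walk varpi x y n].
Proof.
elim: n x => [|n IH] x.
  apply: (@sub_finite_set _ _ [set x]); last exact: finite_set1.
  by move=> y h; inversion h.
have [nbr [_ hn _ _]] := local_rule 1%g x.
apply: (@sub_finite_set _ _ (\bigcup_(t in [set: option Fq]) [set y | walk varpi (nbr t) y n])).
  move=> y h; inversion h as [|x' z y' n' az wz]; subst.
  by have [t tE] := (hn z).1 az; exists t => //=; rewrite -tE.
by apply: bigcup_finite => [|t _]; [exact: finite_finset|exact: IH].
Qed.

Lemma climb B (C : int) x : exists2 y, 1 <= C + hB B y & exists2 n : nat, walk varpi x y n & n%:Z <= Num.max 0 (1 - (C + hB B x)).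
Proof.
have key (n : nat) x' : 1 - (C + hB B x') = n%:Z -> exists2 y, 1 <= C + hB B y & walk varpi x' y n.
  elim: n x' => [|n IH] x' e; first by exists x'; [lia|exact: walk0].
  have [nbr [_ hn hN _]] := local_rule B x'.
  have [y hy wy] := IH (nbr None) ltac:(rewrite hN; lia); exists y => //.
  by apply: walkS wy; apply/hn; exists None.
have [h|h] := leP 1 (C + hB B x); first by exists x => //; exists 0%N; [exact: walk0|lia].
have [|y hy wy] := key (absz (1 - (C + hB B x))%R) x; first lia.
by exists y => //; exists (absz (1 - (C + hB B x))%R) => //; lia.
Qed.

End TreeSection.

(** * Absolutely summable complex families *)

Section ComplexSums.
Variable R : realType.
Notation C := R[i].
Notation nc := (@Normc.normc R).
Implicit Types (I J : choiceType) (z w : C).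

Lemma ncM z w : nc (z * w) = nc z * nc w. Proof. exact: Normc.normcM. Qed.
Lemma ncD z w : nc (z + w) <= nc z + nc w.
Proof. by rewrite -lecR rmorphD; exact: (@ler_normD _ R[i]). Qed.
Lemma ncN z : nc (- z) = nc z.
Proof. by rewrite -mulN1r ncM /Normc.normc /= sqrrN expr1n oppr0 expr0n addr0 sqrtr1 mul1r. Qed.
Lemma ncB z w : nc (z - w) <= nc z + nc w. Proof. by rewrite -(ncN w) ncD. Qed.
Lemma nc_ge0 z : 0 <= nc z. Proof. by case: z => a b; exact: sqrtr_ge0. Qed.
Lemma nc0 : nc 0 = 0. Proof. exact: Normc.normc0. Qed.
Lemma nc1 : nc 1 = 1. Proof. exact: Normc.normc1. Qed.
Lemma nc_eq0 z : nc z = 0 -> z = 0. Proof. exact: Normc.eq0_normc. Qed.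
Lemma nc_gt0 z : z != 0 -> 0 < nc z.
Proof. by move=> z0; rewrite lt_neqAle nc_ge0 andbT eq_sym; apply: contra_neq z0 => /nc_eq0. Qed.
Lemma ncV z : nc z^-1 = (nc z)^-1. Proof. exact: Normc.normcV. Qed.
Lemma ncX z n : nc (z ^+ n) = nc z ^+ n.
Proof. by elim: n => [|n IH]; rewrite ?expr0 ?nc1// !exprS ncM IH. Qed.
Lemma ncR (x : R) : nc x%:C = `|x|.
Proof. by rewrite /Normc.normc /= expr0n addr0 sqrtr_sqr. Qed.
Lemma nc_sqr z : nc z ^+ 2 = nsq z. Proof. exact: normc_sq. Qed.
Lemma nc_sum (T : Type) (s : seq T) (f : T -> C) : nc (\sum_(i <- s) f i) <= \sum_(i <- s) nc (f i).
Proof.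
by elim/big_rec2: _ => [|i a b _ h]; [rewrite nc0|apply: le_trans (ncD _ _) _; rewrite lerD2l].
Qed.
Lemma re_le z : `|re z| <= nc z.
Proof. by case: z => a b; rewrite -sqrtr_sqr ler_wsqrtr// lerDl sqr_ge0. Qed.
Lemma im_le z : `|im z| <= nc z.
Proof. by case: z => a b; rewrite -sqrtr_sqr ler_wsqrtr// lerDr sqr_ge0. Qed.
Lemma nc_le z : nc z <= `|re z| + `|im z|.
Proof.
rewrite -(@ler_sqr R) ?nnegrE ?nc_ge0 ?addr_ge0// nc_sqr /nsq sqrrD !real_normK ?num_real//.
by rewrite lerD2r lerDl mulrn_wge0// mulr_ge0.
Qed.

Lemma nsum_bound I (f : I -> R) (B : R) : (forall i, 0 <= f i) ->
  (forall s : seq I, uniq s -> \sum_(i <- s) f i <= B) -> rsummable f /\ rsum f <= B.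
Proof.
move=> f0 h; have nM : (nsum f <= B%:E)%E.
  apply: ge_ereal_sup => _ [Y [finY _] <-].
  by rewrite fsbig_finite//= sumEFin lee_fin; apply: h; exact: fset_uniq.
have sf : rsummable f by rewrite /rsummable nsum_norm//; exact: le_lt_trans nM (ltry _).
by split=> //; rewrite -lee_fin rsum_nsum.
Qed.

Definition csummable I (f : I -> C) : Prop := rsummable (fun i => nc (f i)).

Lemma csummable_re I (f : I -> C) : csummable f -> rsummable (fun i => re (f i)).
Proof. by move=> sf; apply: rsummable_le sf _ => i; exact: re_le. Qed.
Lemma csummable_im I (f : I -> C) : csummable f -> rsummable (fun i => im (f i)).
Proof. by move=> sf; apply: rsummable_le sf _ => i; exact: im_le. Qed.
Lemma csummable_le I (f : I -> C) (g : I -> R) : rsummable g -> (forall i, nc (f i) <= g i) -> csummable f.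
Proof. by move=> sg h; apply: rsummable_le sg _ => i; rewrite ger0_norm ?nc_ge0. Qed.
Lemma csummableZ I c (f : I -> C) : csummable f -> csummable (fun i => c * f i).
Proof. by move=> sf; apply: csummable_le (rsummableZ (nc c) sf) _ => i; rewrite ncM. Qed.

Lemma csumD I (f g : I -> C) : csummable f -> csummable g ->
  csum (fun i => f i + g i) = csum f + csum g.
Proof.
move=> sf sg; apply: complexP; rewrite reimE /=.
  by rewrite -(rsumD (csummable_re sf) (csummable_re sg)); congr rsum; apply/funext => i; rewrite reD.
by rewrite -(rsumD (csummable_im sf) (csummable_im sg)); congr rsum; apply/funext => i; rewrite imD.
Qed.

Lemma csumZ I c (f : I -> C) : csummable f -> csum (fun i => c * f i) = c * csum f.
Proof.
move=> sf; have sr := csummable_re sf; have si := csummable_im sf.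
apply: complexP.
  transitivity (re c * rsum (fun i => re (f i)) - im c * rsum (fun i => im (f i))); last by rewrite reM.
  rewrite -(rsumZ _ sr) -(rsumZ _ si) -rsumB; try exact: rsummableZ.
  by congr rsum; apply/funext => i; rewrite reM.
transitivity (re c * rsum (fun i => im (f i)) + im c * rsum (fun i => re (f i))); last by rewrite imM.
rewrite -(rsumZ _ sr) -(rsumZ _ si) -rsumD; try exact: rsummableZ.
by congr rsum; apply/funext => i; rewrite imM.
Qed.

Lemma csum_fin I (f : I -> C) (s : seq I) : uniq s -> (forall i, i \notin s -> f i = 0) ->
  csummable f /\ csum f = \sum_(i <- s) f i.
Proof.
move=> us fs; split; first by apply: (@rsummable_fin _ _ _ s) => i /fs ->; rewrite nc0.
by apply: complexP; rewrite /= ?re_sum ?im_sum (@rsum_fin _ _ _ s)// => i /fs ->.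
Qed.

Lemma csum_sum I (T : finType) (f : T -> I -> C) : (forall t, csummable (f t)) ->
  csum (fun i => \sum_t f t i) = \sum_t csum (f t).
Proof.
move=> sf; apply: complexP; rewrite ?re_sum ?im_sum /=.
  rewrite -(rsum_sum (fun t => csummable_re (sf t))).2; congr rsum; apply/funext => i; exact: re_sum.
rewrite -(rsum_sum (fun t => csummable_im (sf t))).2; congr rsum; apply/funext => i; exact: im_sum.
Qed.

Lemma csum_pair I J (f : I * J -> C) : csummable f ->
  csum f = csum (fun i => csum (fun j => f (i, j))).
Proof.
move=> sf; apply: complexP => /=.
  exact: (rsum_pair (csummable_re sf)).2.
exact: (rsum_pair (csummable_im sf)).2.
Qed.

(** No summability is assumed: the positive and negative sums agree even when infinite, so both
    sides take the same default value. *)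
Lemma rsum_inj I J (e : I -> J) (g : J -> R) : injective e ->
  (forall j, j \notin range e -> g j = 0) -> rsum g = rsum (fun i => g (e i)).
Proof.
move=> ei gr; have h (F : R -> R) : F 0 = 0 -> (forall x, 0 <= F x) ->
    (\esum_(i in setT) (F (g i))%:E = \esum_(i in setT) (F (g (e i)))%:E)%E.
  by move=> F0 Fp; apply: (nsum_inj_supp ei (g := fun j => F (g j))) => // j /gr ->.
rewrite /rsum (h (fun x => Num.max x 0)) ?maxxx//; last by move=> x; rewrite le_max lexx orbT.
by rewrite (h (fun x => Num.max (- x) 0)) ?oppr0 ?maxxx//; move=> x; rewrite le_max lexx orbT.
Qed.

Lemma csum_inj I J (e : I -> J) (g : J -> C) : injective e ->
  (forall j, j \notin range e -> g j = 0) -> csum g = csum (fun i => g (e i)).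
Proof. by move=> ei gr; apply: complexP => /=; apply: rsum_inj => // j /gr ->. Qed.

(** Real and imaginary parts are bounded separately, whence the factor 2; only finiteness of the
    constant matters later. *)
Lemma nc_csum I (f : I -> C) (B : R) : csummable f -> rsum (fun i => nc (f i)) <= B -> nc (csum f) <= B + B.
Proof.
move=> sf hB; apply: le_trans (nc_le _) (lerD _ _) => /=.
  apply: le_trans (ler_norm_rsum (csummable_re sf)) (le_trans _ hB).
  by apply: ler_rsum => //; [exact: rsummable_norm (csummable_re sf)|move=> i; exact: re_le].
apply: le_trans (ler_norm_rsum (csummable_im sf)) (le_trans _ hB).
by apply: ler_rsum => //; [exact: rsummable_norm (csummable_im sf)|move=> i; exact: im_le].
Qed.

Lemma csummable_mul I J (a : I -> C) (b : J -> C) : csummable a -> csummable b ->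
  csummable (fun p : I * J => a p.1 * b p.2).
Proof.
move=> sa sb; rewrite /csummable /rsummable nsum_norm => [|p]; last exact: nc_ge0.
rewrite nsum_pair => [|p]; last exact: nc_ge0.
have -> : (fun i => nsum (fun j => nc (a (i, j).1 * b (i, j).2))) = fun i => (nc (a i) * rsum (fun j => nc (b j)))%:E.
  apply/funext => i; rewrite (_ : (fun j => _) = fun j => nc (a i) * nc (b j)).
    rewrite nsumZ ?nc_ge0//; last by move=> j; exact: nc_ge0.
    by rewrite EFinM rsum_nsum// => j; exact: nc_ge0.
  by apply/funext => j; rewrite ncM.
have := rsummableZ (rsum (fun j => nc (b j))) sa; rewrite /rsummable nsum_norm.
  by congr (_ < _)%E; apply: eq_esum => i _; rewrite mulrC.
by move=> i; rewrite mulr_ge0 ?nc_ge0// rsum_ge0// => j; exact: nc_ge0.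
Qed.

(** Both sides sum one summable family over pairs: the injection [(i, j)] to [(i + j, i)] lists the
    products by diagonals. *)
Lemma cauchy_product (a b : nat -> C) : csummable a -> csummable b ->
  csum (fun n => \sum_(i < n.+1) a i * b (n - i)%N) = csum a * csum b.
Proof.
move=> sa sb; pose F (p : nat * nat) := if (p.2 <= p.1)%N then a p.2 * b (p.1 - p.2)%N else 0.
pose e (p : nat * nat) := ((p.1 + p.2)%N, p.1).
have ei : injective e by move=> [i j] [i' j'] [] h1 h2; congr pair => //; lia.
have Fe p : F (e p) = a p.1 * b p.2 by rewrite /F /e /= leq_addr addKn.
have Fr p : p \notin range e -> F p = 0.
  rewrite /F; case: ifP => // h /negP []; apply/mem_set; exists (p.2, p.1 - p.2)%N => //.
  by case: p h => n i /= h; rewrite /e /= subnKC.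
have sF : csummable F.
  have := csummable_mul sa sb; rewrite /csummable /rsummable !nsum_norm; try by move=> ?; exact: nc_ge0.
  rewrite [X in _ -> (X < _)%E](nsum_inj_supp ei); first by under [X in _ -> (nsum X < _)%E]eq_fun do rewrite Fe.
    by move=> p; exact: nc_ge0.
  by move=> p /Fr ->; rewrite nc0.
have := csum_pair sF; rewrite (csum_inj ei Fr) (_ : (fun p => F (e p)) = fun p => a p.1 * b p.2); last exact/funext.
rewrite (csum_pair (csummable_mul sa sb)) (_ : (fun i => csum (fun j => _)) = fun i => csum b * a i); last first.
  by apply/funext => i; rewrite /= csumZ// mulrC.
rewrite csumZ// mulrC => ->; congr csum; apply/funext => n.
rewrite (@csum_fin _ _ (iota 0 n.+1) (iota_uniq _ _) _).2; last first.
  by move=> i; rewrite mem_iota /= add0n ltnS /F => /negbTE ->.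
rewrite -(big_mkord xpredT (fun i => a i * b (n - i)%N)) /index_iota subn0 big_seq [RHS]big_seq.
by apply: eq_bigr => i; rewrite mem_iota /= add0n ltnS /F => ->.
Qed.

Lemma nsum_bound_nat (f : nat -> R) (B : R) : (forall i, 0 <= f i) ->
  (forall N, \sum_(i < N) f i <= B) -> rsummable f /\ rsum f <= B.
Proof.
move=> f0 h; apply: nsum_bound => // s us.
have [N hN] : exists N, forall i, i \in s -> (i < N)%N.
  exists (\max_(i <- s) i).+1 => i si; rewrite ltnS; exact: leq_bigmax_seq.
have -> : \sum_(i <- s) f i = \sum_(i < N | (i : nat) \in s) f i.
  rewrite -(big_mkord (fun i => i \in s) f) -big_filter.
  apply/perm_big/uniq_perm => //; first by rewrite filter_uniq// iota_uniq.
  move=> i; rewrite mem_filter mem_index_iota /=; case: (boolP (i \in s)) => // /hN ->.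
  by [].
apply: le_trans (h N); rewrite big_mkcond; apply: ler_sum => i _; by case: ifP.
Qed.

Lemma geom_half : rsummable (fun n => (2^-1 : R) ^+ n) /\ rsum (fun n => (2^-1 : R) ^+ n) <= 2.
Proof.
apply: nsum_bound_nat => [n|N]; first by rewrite exprn_ge0.
have -> : \sum_(i < N) (2^-1 : R) ^+ i = 2 - 2 * 2^-1 ^+ N.
  elim: N => [|N IH]; first by rewrite big_ord0 expr0; lra.
  by rewrite big_ord_recr /= IH exprS; field.
by rewrite gerBl mulr_ge0.
Qed.

End ComplexSums.

(** * Power series and the identity theorem for meromorphic functions *)

Section PowerSeries.
Variable R : realType.
Notation C := R[i].
Notation nc := (@Normc.normc R).
Implicit Types (a b d p : nat -> C) (z w s : C) (F G : C -> C).

(** A geometric bound stands for a positive radius of convergence; it is stable under the operations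
    needed and gives estimates for [K |w| <= 1/2]. *)
Definition gbd a (K : R) := exists2 B : R, 0 <= B & forall n, nc (a n) <= B * K ^+ n.

Lemma gbdW a (K K' : R) : 0 <= K <= K' -> gbd a K -> gbd a K'.
Proof.
move=> /andP[K0 KK] [B B0 h]; exists B => // n; apply: le_trans (h n) _.
by rewrite ler_wpM2l// lerXn2r// ?nnegrE ?(le_trans K0).
Qed.

Lemma ps_bound a (K B : R) w : 0 <= B -> 0 <= K -> (forall n, nc (a n) <= B * K ^+ n) -> K * nc w <= 2^-1 ->
  csummable (fun n => a n * w ^+ n) /\ nc (pseries a w) <= 4 * B.
Proof.
move=> B0 K0 h hw; have [s2 r2] := geom_half R.
have le n : nc (a n * w ^+ n) <= B * 2^-1 ^+ n.
  rewrite ncM ncX; apply: le_trans (ler_wpM2r (exprn_ge0 _ (nc_ge0 _)) (h n)) _.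
  by rewrite -mulrA -exprMn ler_wpM2l// lerXn2r// nnegrE ?mulr_ge0 ?nc_ge0.
have sB := rsummableZ B s2; have sa := csummable_le sB le; split=> //.
have : rsum (fun n => nc (a n * w ^+ n)) <= 2 * B.
  by apply: le_trans (ler_rsum sa sB le) _; rewrite rsumZ// mulrC ler_wpM2r.
by move=> /(nc_csum sa) hh; apply: le_trans hh _; lra.
Qed.

Lemma ps_sum a (K : R) w : 0 <= K -> gbd a K -> K * nc w <= 2^-1 -> csummable (fun n => a n * w ^+ n).
Proof. by move=> K0 [B B0 h] hw; have [] := ps_bound B0 K0 h hw. Qed.

Lemma ps_cvg a w : csummable (fun n => a n * w ^+ n) <-> cvg_pseries a w.
Proof.
rewrite /csummable /rsummable nsum_norm => [|n]; last exact: nc_ge0.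
rewrite /cvg_pseries /summable /nsum; have -> : \esum_(i in setT) (nc (a i * w ^+ i))%:E =
   \esum_(x in setT) `|(nc (a x * w ^+ x))%:E|%E; last by [].
by apply: eq_esum => i _; rewrite gee0_abs// lee_fin nc_ge0.
Qed.

Lemma ps_shift a w : csummable (fun n => a n * w ^+ n) -> csummable (fun n => a n.+1 * w ^+ n) ->
  pseries a w = a 0%N + w * pseries (fun n => a n.+1) w.
Proof.
move=> sa sa1; pose f n := a n * w ^+ n; pose f0 n := if n == 0%N then f n else 0.
pose f1 n := if n == 0%N then 0 else f n.
have [s0 e0] : csummable f0 /\ csum f0 = \sum_(i <- [:: 0%N]) f0 i.
  by apply: csum_fin => // i; rewrite inE /f0 => /negbTE ->.
have s1 : csummable f1.
  by apply: csummable_le sa _ => n; rewrite /f1; case: eqP => // _; rewrite nc0 nc_ge0.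
have e1 : csum f1 = csum (fun n => f1 n.+1).
  apply: (csum_inj (e := S)) => [i j []//|j]; rewrite /f1; case: j => // j /negP[].
  by apply/mem_set; exists j.
rewrite /pseries -/f (_ : f = fun n => f0 n + f1 n); last first.
  by apply/funext => n; rewrite /f0 /f1; case: eqP; rewrite ?addr0 ?add0r.
rewrite csumD// e0 big_seq1 /f0 /f eqxx expr0 mulr1 e1 -csumZ//; congr (_ + csum _).
by apply/funext => n; rewrite /f1 /f /= exprS mulrCA.
Qed.

Lemma gbdS a (K : R) : 0 <= K -> gbd a K -> gbd (fun n => a n.+1) K.
Proof.
by move=> K0 [B B0 h]; exists (B * K) => [|n]; [rewrite mulr_ge0|rewrite -mulrA -exprS].
Qed.

(** Isolated zeros: after removing [w^m] the constant term dominates the tail near 0. *)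
Lemma ps_nonzero a (K : R) m : 0 < K -> gbd a K -> (forall i, (i < m)%N -> a i = 0) -> a m != 0 ->
  exists2 rho : R, 0 < rho & forall w, 0 < nc w < rho -> pseries a w != 0.
Proof.
move=> K0; elim: m a => [|m IH] a ga a0 am.
  have [B B0 h] := gbdS (ltW K0) ga; have na := nc_gt0 am.
  pose rho := Num.min ((2 * K)^-1) (nc (a 0%N) / (4 * B + 1)).
  have B4 : 0 < 4 * B + 1 by rewrite ltr_wpDl// mulr_ge0.
  exists rho; first by rewrite lt_min invr_gt0 mulr_gt0//= divr_gt0.
  move=> w /andP[w0]; rewrite lt_min => /andP[w1 w2].
  have wK : K * nc w <= 2^-1.
    by apply: ltW; rewrite -(@ltr_pM2l _ K)// invfM mulrA mulrAC divff ?mul1r ?gt_eqF// in w1.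
  rewrite (ps_shift (ps_sum (ltW K0) ga wK) (ps_sum (ltW K0) (gbdS (ltW K0) ga) wK)).
  apply: contraNneq am => e.
  have [_ hb] := ps_bound B0 (ltW K0) h wK; set t := pseries _ w in e hb.
  have e2 : a 0%N = - (w * t) by apply/eqP; rewrite -addr_eq0; apply/eqP.
  have : nc (a 0%N) <= nc w * (4 * B) by rewrite e2 ncN ncM ler_wpM2l// nc_ge0.
  move: w2; rewrite ltr_pdivlMr// => w2 w3; have := nc_ge0 w; move: na => _ w4; exfalso.
  by move: w0 w2 w3; lra.
have [|rho rho0 hr] := IH (fun n => a n.+1) (gbdS (ltW K0) ga) _ am.
  by move=> i im; apply: a0.
exists (Num.min rho ((2 * K)^-1)); first by rewrite lt_min rho0 invr_gt0 mulr_gt0.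
move=> w /andP[w0]; rewrite lt_min => /andP[w1 w2].
have wK : K * nc w <= 2^-1.
  by apply: ltW; rewrite -(@ltr_pM2l _ K)// invfM mulrA mulrAC divff ?mul1r ?gt_eqF// in w2.
rewrite (ps_shift (ps_sum (ltW K0) ga wK) (ps_sum (ltW K0) (gbdS (ltW K0) ga) wK)) a0// add0r.
by rewrite mulf_neq0 ?hr ?w0//; apply: contraTneq w0 => ->; rewrite nc0 ltxx.
Qed.

(* [m] is the order of the pole, so the value is the constant term or the convention at a pole. *)
Definition germ F z m a := [/\ exists2 K, 0 < K & gbd a K,
  exists2 r, 0 < r & forall s, 0 < nc (s - z) < r -> (s - z) ^+ m * F s = pseries a (s - z),
  m = 0%N \/ a 0%N != 0 & F z = if m == 0%N then a 0%N else 0].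

Lemma ps_at0 a : pseries a 0 = a 0%N.
Proof.
rewrite /pseries (@csum_fin _ _ _ [:: 0%N] _ _).2//.
  by rewrite big_seq1 expr0 mulr1.
by move=> i; rewrite inE => i0; rewrite expr0n (negbTE i0) mulr0.
Qed.

(** At distance [r / 2] each term is bounded by the sum of the moduli, which gives the rate
    [2 / r]. *)
Lemma cvg_gbd a (r : R) z : 0 < r -> (forall s, 0 < nc (s - z) < r -> cvg_pseries a (s - z)) ->
  exists2 K, 0 < K & gbd a K.
Proof.
move=> r0 h; exists (2 / r); first by rewrite divr_gt0.
have e : (z + (r / 2)%:C) - z = (r / 2)%:C by rewrite addrC addKr.
have nr : nc (r / 2)%:C = r / 2 by rewrite ncR ger0_norm// divr_ge0// ltW.
have := h (z + (r / 2)%:C); rewrite e nr divr_gt0//= ltr_pdivrMr// => /(_ _) /ps_cvg sa.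
have {}sa := sa ltac:(by lra).
have sn i : 0 <= nc (a i * (r / 2)%:C ^+ i) by exact: nc_ge0.
exists (rsum (fun n => nc (a n * (r / 2)%:C ^+ n))); first exact: rsum_ge0.
move=> n; have -> : 2 / r = (r / 2)^-1 by rewrite invfM invrK mulrC.
rewrite exprVn ler_pdivlMr ?exprn_gt0 ?divr_gt0// -{1}nr -ncX -ncM.
have d n' : n' \notin [:: n] -> (if n' == n then nc (a n * (r / 2)%:C ^+ n) else 0) = 0 :> R.
  by rewrite inE => /negbTE ->.
have := @rsum_fin _ _ (fun n' => if n' == n then nc (a n * (r / 2)%:C ^+ n) else 0) [:: n] isT d.
rewrite big_seq1 eqxx => <-; apply: ler_rsum => //; first exact: rsummable_fin d.
by move=> i; case: eqP => [->|].
Qed.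

Lemma mero_germ F z : meromorphic F -> exists m a, germ F z m a.
Proof.
move=> /(_ z) [[a [r [r0 h]]]|[Fz [m [a [r [m0 a0 r0 h]]]]]].
  exists 0%N, a; split; [|exists r => // s /andP[_ s2]|by left|].
  - by apply: (cvg_gbd (r := r) (z := z)) => // s /andP[_ /h[]].
  - by rewrite expr0 mul1r; have [] := h _ s2.
  have := h z; rewrite subrr nc0 => /(_ r0) [_ ->]; exact: ps_at0.
exists m, a; split=> //; [|exists r => // s /h[]//|by right|by rewrite gtn_eqF].
by apply: (cvg_gbd (r := r) (z := z)) => // s /h[].
Qed.

Lemma germ_mero F : (forall z, exists m a, germ F z m a) -> meromorphic F.
Proof.
move=> h z; have [m [a [[K K0 ga] [r r0 hr] am Fz]]] := h z.
pose r' := Num.min r ((2 * K)^-1).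
have r'0 : 0 < r' by rewrite lt_min r0 invr_gt0 mulr_gt0.
have cv s : nc (s - z) < r' -> cvg_pseries a (s - z).
  rewrite lt_min => /andP[_ w2]; apply/ps_cvg; apply: (ps_sum (ltW K0) ga).
  by apply: ltW; rewrite -(@ltr_pM2l _ K)// invfM mulrA mulrAC divff ?mul1r ?gt_eqF// in w2.
have lt s : nc (s - z) < r' -> nc (s - z) < r by rewrite lt_min => /andP[].
have [m0|m0] := posnP m.
  left; exists a, r'; split=> // s sr; split; first exact: cv.
  rewrite m0 eqxx in Fz; have [->|sz] := eqVneq s z; first by rewrite subrr ps_at0.
  have := hr s; rewrite m0 expr0 mul1r; apply; rewrite lt//= nc_gt0// ?subr_eq0.
  by [].
right; rewrite gtn_eqF// in Fz; split=> //; exists m, a, r'; split=> //.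
  by case: am => // m1; rewrite m1 in m0.
by move=> s /andP[s1 s2]; split; [exact: cv|apply: hr; rewrite s1 lt].
Qed.

Definition shift k a n := if (n < k)%N then 0 else a (n - k)%N.

Lemma gbd_shift k a (K : R) : 1 <= K -> gbd a K -> gbd (shift k a) K.
Proof.
move=> K1 [B B0 h]; exists B => // n; rewrite /shift; case: ltnP => kn.
  by rewrite nc0 mulr_ge0// exprn_ge0// (le_trans ler01).
apply: le_trans (h _) _; rewrite ler_wpM2l//; apply: ler_weXn2l => //; exact: leq_subr.
Qed.

Lemma ps_shiftk k a (K : R) w : 1 <= K -> gbd a K -> K * nc w <= 2^-1 ->
  pseries (shift k a) w = w ^+ k * pseries a w.
Proof.
move=> K1 ga hw; have K0 := le_trans ler01 K1; elim: k => [|k IH].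
  have -> : shift 0 a = a by apply/funext => n; rewrite /shift subn0.
  by rewrite expr0 mul1r.
have g1 := gbd_shift k.+1 K1 ga; have s1 := ps_sum K0 g1 hw.
have s2 := ps_sum K0 (gbdS K0 g1) hw.
rewrite (ps_shift s1 s2) {1}/shift /= add0r exprS -mulrA -IH.
by have -> : (fun n => shift k.+1 a n.+1) = shift k a by apply/funext.
Qed.

Lemma ps_sub a b (K : R) w : 0 <= K -> gbd a K -> gbd b K -> K * nc w <= 2^-1 ->
  pseries (fun n => a n - b n) w = pseries a w - pseries b w.
Proof.
move=> K0 ga gb hw; have sa := ps_sum K0 ga hw; have sb := ps_sum K0 gb hw.
rewrite -[- pseries b w]mulN1r -csumZ// -csumD//; last exact: csummableZ.
by congr csum; apply/funext => n; rewrite mulrBl mulN1r.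
Qed.

Lemma gbd_sub a b (K : R) : gbd a K -> gbd b K -> gbd (fun n => a n - b n) K.
Proof.
move=> [B B0 h] [B' B0' h']; exists (B + B'); first exact: addr_ge0.
by move=> n; apply: le_trans (ncB _ _) _; rewrite mulrDl lerD.
Qed.

Definition near_eq F G z := exists2 r : R, 0 < r & forall s, nc (s - z) < r -> F s = G s.

(** Clearing both poles gives a power series [D] that vanishes on small discs arbitrarily near [z],
    so all its coefficients are 0. The conditions in [germ] then force equal pole orders, and the
    prescribed value at a pole gives equality at [z] itself. *)
Lemma identity_local F G z : meromorphic F -> meromorphic G ->
  (forall e : R, 0 < e -> exists2 y, near_eq F G y & nc (y - z) < e) -> near_eq F G z.
Proof.
move=> /mero_germ - /(_ z) [m [a [[K1 K10 ga] [r1 r10 h1] am Fz]]].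
move=> /mero_germ - /(_ z) [k [b [[K2 K20 gb] [r2 r20 h2] bk Gz]]] hE.
pose K := K1 + K2 + 1.
have K1' : 1 <= K by rewrite lerDr addr_ge0// ltW.
have K0 : 0 < K by exact: lt_le_trans K1'.
have {}ga : gbd a K by apply: gbdW ga; rewrite /K; lra.
have {}gb : gbd b K by apply: gbdW gb; rewrite /K; lra.
pose D n := shift k a n - shift m b n.
have gD : gbd D K := gbd_sub (gbd_shift k K1' ga) (gbd_shift m K1' gb).
pose r := Num.min (Num.min r1 r2) ((2 * K)^-1).
have r0 : 0 < r by rewrite !lt_min r10 r20 invr_gt0 mulr_gt0.
have De s : 0 < nc (s - z) < r -> pseries D (s - z) = (s - z) ^+ (k + m) * (F s - G s).
  move=> /andP[s0]; rewrite !lt_min => /andP[/andP[w1 w2] w3].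
  have wK : K * nc (s - z) <= 2^-1.
    by apply: ltW; rewrite -(@ltr_pM2l _ K)// invfM mulrA mulrAC divff ?mul1r ?gt_eqF// in w3.
  rewrite (ps_sub (ltW K0) (gbd_shift k K1' ga) (gbd_shift m K1' gb) wK).
  rewrite (ps_shiftk k K1' ga wK) (ps_shiftk m K1' gb wK) -h1 ?s0// -h2 ?s0//.
  by rewrite exprD; move: (_ ^+ k) (_ ^+ m) => A B; ring.
have D0 n : D n = 0.
  apply/eqP; apply: contraT => Dn.
  have [l [l0 lm]] : exists l, D l != 0 /\ forall i, (i < l)%N -> D i = 0.
    have ex : exists n, D n != 0 by exists n.
    exists (ex_minn ex); case: ex_minnP => l l0 lm; split=> // i il.
    by apply/eqP; apply: contraTT il => /lm; rewrite -leqNgt.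
  have [rho rho0 hrho] := ps_nonzero K0 gD lm l0.
  have [|y [e e0 he] yz] := hE (Num.min r rho / 2); first by rewrite divr_gt0// lt_min r0.
  pose mr := Num.min r rho; have mr0 : 0 < mr by rewrite lt_min r0.
  have [s [sy s1 s2]] : exists s, [/\ nc (s - y) < e, 0 < nc (s - z) & nc (s - z) < mr].
    have [yz0|yz0] := eqVneq y z; last first.
      exists y; rewrite subrr nc0; split=> //; first by apply: nc_gt0; rewrite subr_eq0.
      by apply: lt_trans yz _; rewrite -/mr ltr_pdivrMr// ltr_pMr ?ltr1n//.
    pose t := Num.min e mr / 2; have t0 : 0 < t by rewrite divr_gt0// lt_min e0.
    have tt : t < Num.min e mr by rewrite /t ltr_pdivrMr// ltr_pMr ?ltr1n// lt_min e0.
    move: tt; rewrite lt_min => /andP[te tm].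
    have es : z + t%:C - z = t%:C by rewrite addrC addKr.
    by exists (z + t%:C); rewrite yz0 es ncR gtr0_norm.
  have s2r : nc (s - z) < r by apply: lt_le_trans s2 _; rewrite ge_min lexx.
  have := hrho (s - z); rewrite s1 De ?s1// (he _ sy) subrr mulr0 eqxx.
  by move=> /(_ _); apply; apply: lt_le_trans s2 _; rewrite ge_min lexx orbT.
have FG s : 0 < nc (s - z) < r -> F s = G s.
  move=> sz; have := De s sz; rewrite /pseries (@csum_fin _ _ _ [::] _ _).2//; last by move=> i _; rewrite D0 mul0r.
  rewrite big_nil => /esym/eqP; rewrite mulf_eq0 expf_eq0 subr_eq0 => /orP[/andP[_ /eqP e]|/eqP/subr0_eq//].
  by move: sz; rewrite e subrr nc0 ltxx.
exists r => // s sr; have [->|sz] := eqVneq s z; last first.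
  by apply: FG; rewrite sr nc_gt0// subr_eq0.
have sh n : shift k a n = shift m b n by apply/eqP; rewrite -subr_eq0; apply/eqP; exact: D0.
rewrite Fz Gz; have [mk|km|mk] := ltngtP m k.
- case: bk => [k0|b0]; first by rewrite k0 in mk.
  by have := sh m; rewrite /shift mk ltnn subnn => /esym/eqP; rewrite (negbTE b0).
- case: am => [m0|a0]; first by rewrite m0 in km.
  by have := sh k; rewrite /shift km ltnn subnn => /eqP; rewrite (negbTE a0).
by rewrite mk; case: ifP => // _; have := sh k; rewrite /shift mk ltnn subnn => ->.
Qed.

(** Connectedness of the segment from 2 to [z]: the parameters up to which [F] and [G] agree locally
    form an interval, closed by [identity_local] and open because agreement holds on discs. *)
Theorem mero_identity F G : meromorphic F -> meromorphic G ->
  (forall s, 1 < re s -> F s = G s) -> F = G.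
Proof.
move=> mF mG FG; apply/funext => z; pose g (t : R) : C := 2%:R + t%:C * (z - 2%:R).
have g0 : near_eq F G (g 0).
  exists 1 => // s hs; apply: FG; have := le_lt_trans (re_le _) hs.
  by rewrite /g rmorph0 mul0r addr0 reD reN ltr_norml /= => /andP[]; lra.
pose S := [set t : R | 0 <= t <= 1 /\ forall u, 0 <= u <= t -> near_eq F G (g u)].
have S0 : S 0 by split; [rewrite lexx ler01|move=> u u0; rewrite (_ : u = 0)//; lra].
have bS : has_ubound S by exists 1 => t [/andP[]].
have hS : has_sup S by split => //; exists 0.
pose T := sup S; have T0 : 0 <= T by apply: sup_upper_bound.
have T1 : T <= 1 by apply: sup_le_ub; [exists 0|move=> t [/andP[]]].
have below u : 0 <= u < T -> near_eq F G (g u).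
  move=> /andP[u0 uT]; have Tu : 0 < T - u by rewrite subr_gt0.
  have [t St ut] := sup_adherent Tu hS.
  move: ut; rewrite -/T subKr => ut; apply: St.2; rewrite u0; exact: ltW.
pose L := nc (z - 2%:R) + 1; have L0 : 0 < L by rewrite ltr_wpDl// nc_ge0.
have gl u v : nc (g u - g v) <= `|u - v| * L.
  have -> : g u - g v = (u - v)%:C * (z - 2%:R) by rewrite /g rmorphB; ring.
  by rewrite ncM ncR ler_wpM2l// lerDl ler01.
have nT : near_eq F G (g T).
  have [T00|Tn0] := eqVneq T 0; first by rewrite T00.
  (* The path [g] is Lipschitz with constant [L], so this parameter lies below [T] and its image is
     within [e] of [g T]. *)
  apply: identity_local => // e e0; pose u := Num.max 0 (T - e / (2 * L)).
  have Tp : 0 < T by rewrite lt_neqAle eq_sym Tn0.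
  have eL : 0 < e / (2 * L) by rewrite divr_gt0// mulr_gt0.
  have u1 : 0 <= u < T by rewrite le_max lexx /= gt_max Tp gtrBl.
  exists (g u); first exact: below.
  apply: le_lt_trans (gl _ _) _; have uT : `|u - T| <= e / (2 * L).
    have : T - e / (2 * L) <= u by rewrite le_max lexx orbT.
    by rewrite distrC ger0_norm; move: u1; lra.
  apply: le_lt_trans (ler_wpM2r (ltW L0) uT) _.
  by rewrite invfM mulrA divfK ?gt_eqF//; lra.
have upto u : 0 <= u <= T -> near_eq F G (g u).
  move=> /andP[u0]; rewrite le_eqVlt => /orP[/eqP ->//|uT]; by apply: below; rewrite u0.
have [r r0 hr] := nT.
suff TE : T = 1.
  move: hr; rewrite TE => hr; apply: hr.
  have -> : g 1 = z by rewrite /g rmorph1; ring.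
  by rewrite subrr nc0.
apply/eqP; rewrite eq_le T1 /= leNgt; apply/negP => T1'.
pose t := Num.min 1 (T + r / (2 * L)).
have rL : 0 < r / (2 * L) by rewrite divr_gt0// mulr_gt0.
have Tt : T < t by rewrite lt_min T1' ltrDl.
suff St : S t by have := sup_upper_bound hS St; rewrite leNgt -/T Tt.
split; first by rewrite (le_trans T0 (ltW Tt)) ge_min lexx.
move=> u /andP[u0 ut]; have [uT|uT] := leP u T; first by apply: upto; rewrite u0.
exists (r / 2); first exact: divr_gt0.
move=> s hs; apply: hr; have -> : s - g T = (s - g u) + (g u - g T) by rewrite addrA subrK.
apply: le_lt_trans (ncD _ _) _; have : nc (g u - g T) <= r / 2; last by move: hs; lra.
apply: le_trans (gl _ _) _.
have tr : t <= T + r / (2 * L) by rewrite ge_min lexx orbT.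
have h2 : `|u - T| <= r / (2 * L) by rewrite ger0_norm; move: uT ut tr; lra.
apply: le_trans (ler_wpM2r (ltW L0) h2) _.
by rewrite invfM mulrA divfK ?gt_eqF.
Qed.

Lemma mero_continuationE F (f : C -> C) : meromorphic F ->
  (forall s, 1 < re s -> F s = f s) -> mero_continuation f = F.
Proof.
move=> mF Ff; rewrite /mero_continuation; case: xgetP => [G -> [mG Gf]|/(_ F)[]//].
by apply: mero_identity => // s hs; rewrite Gf// Ff.
Qed.

End PowerSeries.

(** * The complex exponential as a power series *)

Section Exponential.
Variable R : realType.
Notation C := R[i].
Notation nc := (@Normc.normc R).
Implicit Types (a b d p : nat -> C) (z w s : C).

Lemma cexpD z w : cexp (z + w) = cexp z * cexp w.
Proof. by case: z w => [a b] [c e]; apply: complexP; rewrite /= expRD cosD sinD; ring. Qed.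
Lemma cexp0 : cexp (0 : C) = 1.
Proof. by rewrite /cexp /= expR0 cos0 sin0; apply: complexP; rewrite /=; ring. Qed.
Lemma nc_cexp z : nc (cexp z) = expR (re z).
Proof.
rewrite /cexp ncM ncR ger0_norm ?expR_ge0// (_ : nc (_ +i* _) = 1) ?mulr1//.
by rewrite /Normc.normc /= cos2Dsin2 sqrtr1.
Qed.
Lemma cexp_neq0 z : cexp z != 0.
Proof. by apply/eqP => e; have := nc_cexp z; rewrite e nc0 => h; have := expR_gt0 (re z); rewrite -h ltxx. Qed.
Lemma cexpX z n : cexp z ^+ n = cexp (n%:R * z).
Proof.
elim: n => [|n IH]; first by rewrite mul0r cexp0.
by rewrite exprS IH -cexpD; congr cexp; rewrite mulrSr mulrDl mul1r addrC.
Qed.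

Definition ec (w : C) n : C := w ^+ n / n`!%:R.

Lemma fact_neq0 n : n`!%:R != 0 :> C. Proof. by rewrite pnatr_eq0 -lt0n fact_gt0. Qed.

Lemma nc_nat n : nc n%:R = n%:R.
Proof. by rewrite -(rmorph_nat (@real_complex R)) ncR normr_nat. Qed.
Lemma nc_ec w n : nc (ec w n) = exp_coeff (nc w) n.
Proof. by rewrite /ec ncM ncX ncV nc_nat. Qed.

Lemma exp_rsum (x : R) : 0 <= x -> rsummable (exp_coeff x).
Proof.
move=> x0; have f0 i : 0 <= exp_coeff x i by rewrite /exp_coeff /= divr_ge0// exprn_ge0.
apply: (@nsum_bound_nat _ _ (expR x) f0 _).1 => N; rewrite -(big_mkord xpredT (exp_coeff x)).
apply: (nondecreasing_cvgn_le _ (is_cvg_series_exp_coeff x) N) => m n mn.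
by apply: nondecreasing_series.
Qed.

Lemma ec_summable w : csummable (ec w).
Proof. by apply: csummable_le (exp_rsum (nc_ge0 w)) _ => n; rewrite nc_ec. Qed.
Lemma rsum_lim (f : nat -> R) l : rsummable f -> (series f @ \oo --> l) -> rsum f = l.
Proof. by move=> sf fl; have := rsum_cvg_series sf => h; apply: (cvg_unique _ h fl). Qed.

Lemma ec_expR (x : R) : csum (ec x%:C) = (expR x)%:C.
Proof.
have s := ec_summable x%:C.
have e n : ec x%:C n = (exp_coeff x n)%:C.
  by rewrite /ec -rmorphXn -(rmorph_nat (@real_complex R)) -fmorphV -rmorphM.
apply: complexP => /=.
  apply: rsum_lim; first exact: csummable_re s.
  rewrite (_ : (fun n => _) = exp_coeff x); last by apply/funext => n; rewrite e.
  exact: is_cvg_series_exp_coeff.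
by rewrite -[RHS](rsum0 R nat); congr rsum; apply/funext => n; rewrite e.
Qed.

Lemma iX n : ('i : C) ^+ n = (((~~ odd n)%:R * (-1) ^+ n./2) +i* ((odd n)%:R * (-1) ^+ n.-1./2)).
Proof.
rewrite -{1}(odd_double_half n) exprD -mul2n exprM sqr_i.
have e : ((-1) ^+ n./2 : C) = ((-1) ^+ n./2)%:C by rewrite rmorphXn rmorphN rmorph1.
rewrite e; case: (boolP (odd n)) => on /=.
  have -> : (n.-1./2 = n./2)%N by move: on; rewrite -{1 2}(odd_double_half n) => on; move: on; lia.
  by rewrite expr1; apply: complexP; rewrite /=; ring.
by rewrite expr0 mul1r; apply: complexP; rewrite /=; ring.
Qed.

Lemma ec_cossin (y : R) : csum (ec (y%:C * 'i)) = cos y +i* sin y.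
Proof.
have s := ec_summable (y%:C * 'i).
have e n : ec (y%:C * 'i) n = cos_coeff y n +i* sin_coeff y n.
  rewrite /ec exprMn iX -rmorphXn -(rmorph_nat (@real_complex R)) -fmorphV.
  by rewrite /cos_coeff /sin_coeff /= -?exprnP; apply: complexP; rewrite /=; ring.
apply: complexP => /=.
  apply: rsum_lim; first exact: csummable_re s.
  rewrite (_ : (fun n => _) = cos_coeff y); last by apply/funext => n; rewrite e.
  by rewrite unlock; exact: is_cvg_series_cos_coeff.
apply: rsum_lim; first exact: csummable_im s.
rewrite (_ : (fun n => _) = sin_coeff y); last by apply/funext => n; rewrite e.
by rewrite unlock; exact: is_cvg_series_sin_coeff.
Qed.

(** As [cexp] is defined by modulus and argument, the real and the imaginary exponent are expanded
    separately and combined by the Cauchy product and the binomial formula. *)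
Lemma cexp_series w : csum (ec w) = cexp w.
Proof.
have -> : cexp w = csum (ec (re w)%:C) * csum (ec ((im w)%:C * 'i)).
  by rewrite ec_expR ec_cossin.
rewrite -cauchy_product; try exact: ec_summable.
congr csum; apply/funext => n; rewrite {1}/ec {1}(_ : w = (re w)%:C + (im w)%:C * 'i); last first.
  by apply: complexP; rewrite !reimE; ring.
rewrite addrC exprDn mulr_suml; apply: eq_bigr => -[i /= hi] _; rewrite ltnS in hi; rewrite /ec.
have := bin_fact hi => /(congr1 (fun m => m%:R : C)); rewrite !natrM => h.
rewrite -mulr_natl.
have -> : ('C(n, i))%:R = n`!%:R / (i`!%:R * (n - i)`!%:R) :> C.
  by rewrite -h mulfK ?mulf_neq0 ?fact_neq0.
by have f1 := fact_neq0 i; have f2 := fact_neq0 (n - i); have f3 := fact_neq0 n; field; rewrite f1 f2 f3.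
Qed.

Variable l : R.

(* The Taylor coefficients at [w = 0] of [N (z0 * exp (l w))]. *)
Definition epoly (N : {poly C}) (z0 : C) n : C := \sum_(k < size N) N`_k * z0 ^+ k * ec (k%:R * l%:C) n.

Lemma ec_mul (c w : C) n : ec c n * w ^+ n = ec (c * w) n.
Proof. by rewrite /ec exprMn mulrAC. Qed.

Lemma epolyE N z0 w : pseries (epoly N z0) w = N.[z0 * cexp (w * l%:C)].
Proof.
have s k : csummable (fun n => ec (k%:R * l%:C) n * w ^+ n).
  by rewrite (_ : (fun n => _) = ec (k%:R * l%:C * w)); [exact: ec_summable|apply/funext => n; exact: ec_mul].
rewrite /pseries (_ : (fun n => _) =
    fun n => \sum_(k < size N) N`_k * z0 ^+ k * (ec (k%:R * l%:C) n * w ^+ n)); last first.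
  by apply/funext => n; rewrite /epoly mulr_suml; apply: eq_bigr => k _; rewrite -!mulrA.
rewrite csum_sum => [|k]; last exact: csummableZ.
rewrite horner_coef; apply: eq_bigr => k _; rewrite csumZ//.
rewrite (_ : (fun n => _) = ec (k%:R * l%:C * w)); last by apply/funext => n; exact: ec_mul.
rewrite (cexp_series (k%:R * l%:C * w)) exprMn cexpX (_ : k%:R * (w * l%:C) = k%:R * l%:C * w) ?mulrA//.
by rewrite [RHS]mulrAC.
Qed.

Lemma epoly_gbd N z0 : exists2 K : R, 1 <= K & gbd (epoly N z0) K.
Proof.
pose K := 1 + (size N)%:R * `|l|; exists K; first by rewrite lerDl mulr_ge0.
have K1 : 1 <= K by rewrite lerDl mulr_ge0.
exists (\sum_(k < size N) nc (N`_k * z0 ^+ k)); first by apply: sumr_ge0 => k _; exact: nc_ge0.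
move=> n; apply: le_trans (nc_sum _ _) _; rewrite mulr_suml; apply: ler_sum => k _.
rewrite ncM ler_wpM2l ?nc_ge0// nc_ec /exp_coeff /= ncM nc_nat ncR.
rewrite ler_pdivrMr ?ltr0n ?fact_gt0//; apply: le_trans (_ : K ^+ n <= _).
  rewrite lerXn2r ?nnegrE ?mulr_ge0// ?(le_trans ler01)//.
  by rewrite /K; apply: le_trans (ler_wpM2r (normr_ge0 l) (_ : k%:R <= (size N)%:R)) _; rewrite ?ler_nat ?(ltnW (ltn_ord k))// lerDr.
by rewrite ler_peMr ?exprn_ge0 ?(le_trans ler01)// ler1n fact_gt0.
Qed.

End Exponential.

(** * Quotients of power series *)

Section Quotient.
Variable R : realType.
Notation C := R[i].
Notation nc := (@Normc.normc R).
Variables (p d : nat -> C).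
Hypothesis d0 : d 0%N != 0.

(** Long division: the list carries all earlier coefficients, on which the next one depends. *)
Fixpoint qs n : seq C :=
  if n is m.+1 then rcons (qs m) ((p m - \sum_(i < m) (qs m)`_i * d (m - i)%N) / d 0%N) else [::].
Definition quo n : C := (qs n.+1)`_n.

Lemma size_qs n : size (qs n) = n. Proof. by elim: n => //= n IH; rewrite size_rcons IH. Qed.
Lemma qsE n i : (i < n)%N -> (qs n)`_i = quo i.
Proof.
elim: n => // n IH; rewrite ltnS leq_eqVlt => /orP[/eqP -> //|ln].
by rewrite /= nth_rcons size_qs ln IH.
Qed.

Lemma quoE n : \sum_(i < n.+1) quo i * d (n - i)%N = p n.
Proof.
rewrite big_ord_recr /= subnn.
have -> : quo n = (p n - \sum_(i < n) quo i * d (n - i)%N) / d 0%N.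
  rewrite {1}/quo /= nth_rcons size_qs ltnn eqxx; congr ((_ - _) / _).
  by apply: eq_bigr => i _; rewrite qsE.
by rewrite divfK// addrC subrK.
Qed.

(** Strong induction with rate [K * M]. The choice of [M] makes the geometric sum of the earlier
    terms small enough for the constant [2 Bp / |d 0|] to reproduce itself. *)
Lemma quo_gbd (K : R) : 1 <= K -> gbd p K -> gbd d K -> exists2 L : R, 1 <= L & gbd quo L.
Proof.
move=> K1 [Bp Bp0 hp] [Bd Bd0 hd]; have n0 := nc_gt0 d0; pose dl := nc (d 0%N).
pose M := 2 + 2 * Bd / dl; have K0 : 0 <= K by exact: le_trans K1.
have Bdl : 0 <= Bd / dl by rewrite divr_ge0// ltW.
have M2 : 2 <= M by rewrite /M -mulrA lerDl mulr_ge0.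
have MM n : 1 <= M ^+ n by rewrite exprn_ege1//; lra.
exists (K * M); first by rewrite mulr_ege1//; lra.
exists (2 * Bp / dl); first by rewrite divr_ge0 ?mulr_ge0// ltW.
move=> n; elim/ltn_ind: n => n IH.
have -> : quo n = (p n - \sum_(i < n) quo i * d (n - i)%N) / d 0%N.
  by rewrite -(quoE n) big_ord_recr /= subnn addrC addrK mulfK.
rewrite ncM ncV ler_pdivrMr//.
set A := 2 * Bp / dl; have A0 : 0 <= A by rewrite divr_ge0 ?mulr_ge0// ltW.
have geo : \sum_(i < n) M ^+ i <= M ^+ n / (M - 1).
  rewrite ler_pdivlMr; last by lra.
  have := subrX1 M n; rewrite mulrC => <-; lra.
have S : nc (\sum_(i < n) quo i * d (n - i)%N) <= A * Bd * K ^+ n * (M ^+ n / (M - 1)).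
  apply: le_trans (nc_sum _ _) _.
  apply: le_trans (_ : \sum_(i < n) A * Bd * K ^+ n * M ^+ i <= _); last first.
    have ABK : 0 <= A * Bd * K ^+ n by rewrite mulr_ge0 ?exprn_ge0// mulr_ge0.
    by rewrite -mulr_sumr ler_wpM2l.
  apply: ler_sum => i _; rewrite ncM.
  apply: le_trans (ler_pM (nc_ge0 _) (nc_ge0 _) (IH i (ltn_ord i)) (hd _)) _.
  have Ki : K ^+ n = K ^+ i * K ^+ (n - i) by rewrite -exprD subnKC// ltnW.
  by rewrite -/A exprMn Ki le_eqVlt; apply/orP; left; apply/eqP; ring.
apply: le_trans (ncB _ _) _; apply: le_trans (lerD (hp n) S) _.
have e1 : A * nc (d 0%N) = 2 * Bp by rewrite /A /dl divfK// gt_eqF.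
have e2 : Bd = (M - 2) / 2 * nc (d 0%N).
  by rewrite /M /dl; field; rewrite gt_eqF.
have Kn : 0 <= K ^+ n by exact: exprn_ge0.
rewrite exprMn.
have -> : A * (K ^+ n * M ^+ n) * nc (d 0%N) = 2 * Bp * K ^+ n * M ^+ n by rewrite -e1; ring.
have -> : A * Bd * K ^+ n * (M ^+ n / (M - 1)) = Bp * K ^+ n * M ^+ n * ((M - 2) / (M - 1)).
  have -> : A * Bd = Bp * (M - 2) by rewrite e2 mulrCA e1; field.
  by ring.
have f1 : (M - 2) / (M - 1) <= 1 by rewrite ler_pdivrMr; lra.
have BK : 0 <= Bp * K ^+ n by rewrite mulr_ge0.
have := MM n; have BKM : 0 <= Bp * K ^+ n * M ^+ n by rewrite mulr_ge0// exprn_ge0//; lra.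
move=> m1; have h1 := ler_wpM2l BKM f1; have h2 := ler_wpM2l BK m1; lra.
Qed.

Lemma quo_series (K : R) w : 0 <= K -> gbd d K -> gbd quo K -> K * nc w <= 2^-1 ->
  pseries quo w * pseries d w = pseries p w.
Proof.
move=> K0 gd gq hw; rewrite /pseries -cauchy_product; [|exact: (ps_sum K0 gq hw)|exact: (ps_sum K0 gd hw)].
congr csum; apply/funext => n; rewrite -quoE mulr_suml; apply: eq_bigr => -[i /= hi] _; rewrite ltnS in hi.
have -> : w ^+ n = w ^+ i * w ^+ (n - i) by rewrite -exprD subnKC.
by ring.
Qed.

End Quotient.

(** * Meromorphy of rational functions of an exponential *)

Section RationalContinuation.
Variable R : realType.
Notation C := R[i].
Notation nc := (@Normc.normc R).
Variables (l : R) (N D : {poly C}).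
Hypothesis l0 : 0 < l.
Hypothesis D0 : D != 0.
Hypothesis ND : coprimep N D.
Notation ze s := (cexp ((s - 2^-1) * l%:C)).

Lemma cexp_real_inj (z0 : C) (t t' : R) : z0 != 0 -> z0 * cexp (t%:C * l%:C) = z0 * cexp (t'%:C * l%:C) -> t = t'.
Proof.
move=> z00 /(mulfI z00) /(congr1 nc); rewrite !nc_cexp -!rmorphM /= => /expR_inj /(mulIf _).
by apply; rewrite gt_eqF.
Qed.

(** If all Taylor coefficients vanished, [D] would vanish at the distinct points [z0 exp(i l)] for
    every natural number [i], too many for a non-zero polynomial. *)
Lemma epoly_neq0 z0 : z0 != 0 -> exists n, epoly l D z0 n != 0.
Proof.
move=> z00; apply: contrapT => nex; have h n : epoly l D z0 n = 0.
  by apply/eqP; apply: contraT => hn; exfalso; apply: nex; exists n.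
have root0 (t : R) : root D (z0 * cexp (t%:C * l%:C)).
  rewrite /root -epolyE /pseries (@csum_fin _ _ _ [::] _ _).2//; first by rewrite big_nil.
  by move=> i _; rewrite h mul0r.
pose s := [seq z0 * cexp ((i%:R : R)%:C * l%:C) | i <- iota 0 (size D)].
have us : uniq s.
  rewrite map_inj_uniq ?iota_uniq// => i j /(cexp_real_inj z00) /eqP.
  by rewrite eqr_nat => /eqP.
have al : all (root D) s by apply/allP => _ /mapP[i _ ->]; exact: root0.
by have := max_poly_roots D0 al us; rewrite size_map size_iota ltnn.
Qed.

(** Coprimality makes each zero of the denominator a genuine pole, and there the value 0 of a
    division by zero is also the one required by [pole_at]. *)
Lemma rational_meromorphic : meromorphic (fun s => N.[ze s] / D.[ze s]).
Proof.
apply: germ_mero => s0; pose z0 := ze s0; have z00 : z0 != 0 := cexp_neq0 _.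
have zE s : ze s = z0 * cexp ((s - s0) * l%:C) by rewrite /z0 -cexpD; congr cexp; ring.
have [n0 hn0] := epoly_neq0 z00.
have ex : exists n, epoly l D z0 n != 0 by exists n0.
pose m := ex_minn ex; have [dm mm] : epoly l D z0 m != 0 /\ forall i, (i < m)%N -> epoly l D z0 i = 0.
  rewrite /m; case: ex_minnP => m' h1 h2; split=> // i im.
  by apply/eqP; apply: contraTT im => /h2; rewrite -leqNgt.
pose d n := epoly l D z0 (n + m)%N; have d0 : d 0%N != 0 by rewrite /d add0n.
have dE : epoly l D z0 = shift m d.
  by apply/funext => n; rewrite /shift; case: ltnP => h; [exact: mm|rewrite /d subnK].
have [K1 K11 g1] := epoly_gbd l N z0; have [K2 K21 g2] := epoly_gbd l D z0.
have gd : gbd d K2.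
  case: g2 => B B0 h; exists (B * K2 ^+ m); first by rewrite mulr_ge0// exprn_ge0// (le_trans ler01).
  by move=> n; apply: le_trans (h _) _; rewrite exprD mulrA mulrAC.
pose p := epoly l N z0; pose K := Num.max K1 K2.
have KK : 1 <= K by rewrite le_max K11.
have gp : gbd p K by apply: gbdW g1; rewrite (le_trans ler01 K11) le_max lexx.
have {}gd : gbd d K by apply: gbdW gd; rewrite (le_trans ler01 K21) le_max lexx orbT.
have [L L1 gq] := quo_gbd d0 KK gp gd; pose M := Num.max K L.
have M1 : 1 <= M by rewrite le_max KK.
have M0 : 0 < M by exact: lt_le_trans M1.
have {}gp : gbd p M by apply: gbdW gp; rewrite (le_trans ler01 KK) le_max lexx.
have {}gd : gbd d M by apply: gbdW gd; rewrite (le_trans ler01 KK) le_max lexx.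
have {}gq : gbd (quo p d) M by apply: gbdW gq; rewrite (le_trans ler01 L1) le_max lexx orbT.
have [rho rho0 hrho] := ps_nonzero M0 gd (fun i (h : (i < 0)%N) => False_ind _ (notF h)) d0.
have quo0 : quo p d 0%N = p 0%N / d 0%N.
  by have := quoE p d0 0%N; rewrite big_ord1 subnn => <-; rewrite mulfK.
have p0E : p 0%N = N.[z0] by rewrite -ps_at0 epolyE mul0r cexp0 mulr1.
have D0E : epoly l D z0 0%N = D.[z0] by rewrite -ps_at0 epolyE mul0r cexp0 mulr1.
exists m, (quo p d); split; first by exists M.
- exists (Num.min rho (2 * M)^-1); first by rewrite lt_min rho0 invr_gt0 mulr_gt0.
  move=> s /andP[s0']; rewrite lt_min => /andP[w1 w2].
  have wM : M * nc (s - s0) <= 2^-1.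
    by apply: ltW; rewrite -(@ltr_pM2l _ M)// invfM mulrA mulrAC divff ?mul1r ?gt_eqF// in w2.
  have dn : pseries d (s - s0) != 0 by apply: hrho; rewrite s0'.
  apply: (mulIf dn); rewrite (quo_series d0 (ltW M0) gd gq wM) epolyE -zE.
  have e2 : D.[ze s] = (s - s0) ^+ m * pseries d (s - s0).
    by rewrite -(ps_shiftk m M1 gd wM) -dE epolyE -zE.
  have sm : (s - s0) ^+ m != 0.
    by rewrite expf_neq0//; apply: contraTneq s0' => ->; rewrite nc0 ltxx.
  by rewrite e2; move: (pseries d _) dn ((s - s0) ^+ m) sm => X X0 Y Y0; field; rewrite X0 Y0.
- have [m0|m0] := posnP m; [by left|right].
  rewrite quo0 mulf_neq0 ?invr_eq0// p0E; apply: contraTneq ND => N0.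
  have Dz : root D z0 by rewrite /root -D0E mm.
  have Nz : root N z0 by rewrite /root N0.
  apply/negP => /coprimep_root /(_ Nz); by rewrite -rootE Dz.
have [m0|m0] := eqVneq m 0%N.
  by rewrite quo0 p0E /d m0 addn0 D0E.
have -> : D.[ze s0] = 0 by rewrite -/z0 -D0E mm// lt0n.
by rewrite invr0 mulr0.
Qed.

End RationalContinuation.

(** * Diagonal embeddings and the rational parabolic subgroup *)

Section Diagonal.
Variables (k : fieldType) (oo : valuation k) (Kc : forall v : valuation k, completion v).
Notation emb := (emb oo Kc).
Notation diagf := (diagf oo Kc).

Lemma embM a b : emb (a * b)%g = (emb a * emb b)%g. Proof. exact: pgl_mapM. Qed.
Lemma emb1 : emb 1%g = 1%g. Proof. exact: pgl_map1. Qed.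
Lemma embV a : emb a^-1%g = (emb a)^-1%g. Proof. exact: pgl_mapV. Qed.

Lemma diagfM a b : diagf (a * b)%g = (diagf a * diagf b)%g.
Proof. by apply: functional_extensionality_dep => v; exact: pgl_mapM. Qed.
Lemma diagf1 : diagf 1%g = 1%g.
Proof. by apply: functional_extensionality_dep => v; exact: pgl_map1. Qed.
Lemma diagfV a : diagf a^-1%g = (diagf a)^-1%g.
Proof. by apply: functional_extensionality_dep => v; exact: pgl_mapV. Qed.

Variable Kf : set (Gprod oo Kc).
Hypothesis hKf : is_subgroup Kf.

Lemma Gamma_subgroup g : is_subgroup (Gamma Kf g).
Proof.
split; rewrite /Gamma /=.
- by rewrite diagf1 mulg1 mulVg; exact: (subgroup_1 hKf).
- move=> x y hx hy; rewrite diagfM.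
  have -> : (g^-1 * (diagf x * diagf y) * g = (g^-1 * diagf x * g) * (g^-1 * diagf y * g))%g.
    by rewrite !mulgA -(mulgA _ g) mulgV mulg1.
  exact: (subgroup_M hKf hx hy).
- move=> x /(subgroup_V hKf); rewrite !invgM invgK diagfV mulgA; exact.
Qed.

Lemma upt_emb (a : PGL2 k) : upt (emb a) <-> upt a.
Proof.
have [A A0 ->] := pgl_ofP a; rewrite /emb pgl_map_of// !upt_of//; last by rewrite det_map2 fmorph_eq0.
by rewrite mxE; split=> [/eqP|->]; rewrite ?rmorph0// fmorph_eq0 => /eqP.
Qed.

Variable xi : 'cV[k]_2.
Hypothesis hxi : xi != 0.

(** An invertible matrix with first column [xi]: it carries the standard end to that of [xi], so
    [parabolic xi] becomes the upper triangular group after conjugation. *)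
Definition frame_mx : 'M[k]_2 :=
  if xi 0 0 != 0 then mx2 (xi 0 0) 0 (xi 1 0) 1 else mx2 (xi 0 0) 1 (xi 1 0) 0.

Lemma det_frame : \det frame_mx != 0.
Proof.
rewrite /frame_mx; case: ifPn => h; rewrite det2 !mx2E; first by rewrite mulr1 mul0r subr0.
rewrite mulr0 mul1r sub0r oppr_eq0; apply: contraNneq hxi => h1; apply/eqP/matrixP => i j.
by rewrite (ord1 j) mxE; case: (ord2P i) => ->; [apply/eqP; rewrite negbK in h|].
Qed.

Lemma frame_col i : frame_mx i 0 = xi i 0.
Proof. by rewrite /frame_mx; case: ifP => _; case: (ord2P i) => ->; rewrite mx2E. Qed.

Definition frame : PGL2 k := pgl_of frame_mx.

Lemma parabolic_of (A : 'M[k]_2) : \det A != 0 ->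
  parabolic xi (pgl_of A) <-> exists a, A *m xi = a *: xi.
Proof.
move=> A0; have [c c0 e] := mxrep_pgl_of A0; rewrite {2}e /parabolic /=; split=> -[a ea].
  by exists (c * a); rewrite -scalemxAl ea scalerA.
by exists (c^-1 * a); rewrite -scalerA -ea -scalemxAl scalerA mulVf// scale1r.
Qed.

Lemma parabolic_frame p : parabolic xi p <-> upt (frame^-1 * p * frame)%g.
Proof.
have [A A0 ->] := pgl_ofP p; rewrite parabolic_of// /frame.
have B0 := det_frame; rewrite pgl_ofV// !pgl_ofM ?det_mulmx ?det_adj2 ?mulf_neq0//.
rewrite upt_of ?det_mulmx ?det_adj2 ?mulf_neq0//.
have e (M : 'M[k]_2) i : (M *m frame_mx) i 0 = (M *m xi) i 0.
  by rewrite !mxE; apply: eq_bigr => l _; rewrite frame_col.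
rewrite e -mulmxA; set w := A *m xi; rewrite [(_ *m w) 1 0]mxE sum2 /adj2 !mx2E !frame_col.
split=> [[a ->]|]; first by rewrite !mxE; ring.
move=> /eqP h; have h' : xi 0 0 * w 1 0 = xi 1 0 * w 0 0.
  by apply/eqP; rewrite -subr_eq0 addrC -mulNr.
have ex a : w 0 0 = a * xi 0 0 -> w 1 0 = a * xi 1 0 -> exists a, w = a *: xi.
  move=> h0 h1; exists a; apply/matrixP => i j; rewrite (ord1 j) [RHS]mxE.
  by case: (ord2P i) => ->.
have [x0|x0] := eqVneq (xi 0 0) 0.
  have x1 : xi 1 0 != 0.
    apply: contraNneq hxi => x1; apply/eqP/matrixP => i j; rewrite (ord1 j) mxE.
    by case: (ord2P i) => ->.
  apply: (ex (w 1 0 / xi 1 0)); last by rewrite divfK.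
  by move/eqP: h'; rewrite x0 mul0r eq_sym mulf_eq0 (negbTE x1) mulr0 => /eqP.
apply: (ex (w 0 0 / xi 0 0)); first by rewrite divfK.
by apply: (mulfI x0); rewrite h'; field.
Qed.

Lemma upt_subgroup : is_subgroup (@upt k).
Proof.
have d1 : \det (1%:M : 'M[k]_2) != 0 by rewrite det1 oner_neq0.
split.
- by rewrite -pgl_of1 upt_of// mxE.
- move=> x y; have [A A0 ->] := pgl_ofP x; have [B B0 ->] := pgl_ofP y.
  rewrite pgl_ofM// !upt_of ?det_mulmx ?mulf_neq0// => h1 h2.
  by rewrite mxE sum2 h1 h2 mul0r mulr0 addr0.
- move=> x; have [A A0 ->] := pgl_ofP x; rewrite pgl_ofV// !upt_of ?det_adj2// => h.
  by rewrite /adj2 mx2E h oppr0.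
Qed.

Lemma parabolic_subgroup : is_subgroup (parabolic xi).
Proof.
split; first by apply/parabolic_frame; rewrite mulg1 mulVg; exact: (subgroup_1 upt_subgroup).
- move=> x y /parabolic_frame hx /parabolic_frame hy; apply/parabolic_frame.
  have -> : (frame^-1 * (x * y) * frame = (frame^-1 * x * frame) * (frame^-1 * y * frame))%g.
    by rewrite !mulgA -(mulgA _ frame) mulgV mulg1.
  exact: (subgroup_M upt_subgroup hx hy).
move=> x /parabolic_frame /(subgroup_V upt_subgroup); rewrite !invgM invgK mulgA => h.
exact/parabolic_frame.
Qed.

End Diagonal.

(** * Horoballs, stabilizers and the quotient graph *)

Section Cusps.
Variables (Fq : finFieldType) (k : fieldType) (iota : {rmorphism Fq -> k}).
Variables (oo : valuation k) (Kc : forall v : valuation k, completion v).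
Hypothesis hoo : degree_one iota oo.
Variable (varpi : koo oo Kc).
Hypothesis hvarpi : varpi != 0 /\ voo oo Kc varpi = 1.
Variable Kf : set (Gprod oo Kc).
Hypothesis hKf : is_subgroup Kf.
Variable xi : 'cV[k]_2.
Hypothesis hxi : xi != 0.
Variables (g : Gprod oo Kc) (r : nat) (gam : 'I_r -> PGL2 k).
Hypothesis hgam : forall a : PGL2 k, exists! c : 'I_r,
  exists b p, [/\ Gamma Kf g b, parabolic xi p & a = (b * gam c * p)%g].
Variable hgt : 'I_r -> tree oo Kc -> int.
Hypothesis hhgt : forall c, busemann varpi (mxrep (gam c) *m xi) (hgt c).
Hypothesis hdisj : forall c c' a a', Gamma Kf g a -> Gamma Kf g a' ->
    [set actk a x | x in horoball (hgt c)]
      `&` [set actk a' x | x in horoball (hgt c')] !=set0 ->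
    [set actk a x | x in horoball (hgt c)]
      = [set actk a' x | x in horoball (hgt c')].
Hypothesis hstab : forall c a,
    (Gamma Kf g a /\
       [set actk a x | x in horoball (hgt c)] = horoball (hgt c))
    <-> cusp_group Kf g xi (gam c) a.
Notation T := (tree oo Kc).
Notation Gam := (Gamma Kf g).
Notation P := (parabolic xi).
Notation fr := (frame xi).
Notation emb := (emb oo Kc).
Implicit Types (a b p : PGL2 k) (x y : T) (c : 'I_r).

Definition hk (b : PGL2 k) (x : T) : int := hB (emb b) x.

Let GS : is_subgroup Gam := Gamma_subgroup hKf g.
Let PS : is_subgroup P := parabolic_subgroup hxi.

Lemma actkM a b x : actk (a * b)%g x = actk a (actk b x).
Proof. by rewrite /actk embM actM. Qed.
Lemma actk1 x : actk 1%g x = x. Proof. by rewrite /actk emb1 act1. Qed.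
Lemma actkV a x : actk a (actk a^-1%g x) = x. Proof. by rewrite -actkM mulgV actk1. Qed.
Lemma actVk a x : actk a^-1%g (actk a x) = x. Proof. by rewrite -actkM mulVg actk1. Qed.

Lemma hk_act b a x : hk b (actk a x) = hk (a^-1 * b)%g x.
Proof. by rewrite /hk /actk hB_act embM embV. Qed.

(** The heights are given only as Busemann functions; here they become explicit up to a constant,
    compatibly with translation by any [b]. *)
Lemma hgt_hk c : exists C : int, forall b x, hgt c (actk b^-1%g x) = C + hk (b * gam c * fr)%g x.
Proof.
pose M : 'M[koo oo Kc]_2 := map_mx (compl_emb (Kc oo)) (mxrep (gam c) *m frame_mx xi).
have d0 : \det (mxrep (gam c) *m frame_mx xi) != 0.
  by rewrite det_mulmx mulf_neq0 ?det_mxrep ?det_frame.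
have M0 : \det M != 0 by rewrite det_map2 fmorph_eq0.
have [|C hC] := busemann_hB hoo hvarpi (B := (insubd (gl_one (koo oo Kc)) M : GL2 (koo oo Kc))) (@hhgt c).
  exists 1; rewrite scale1r val_insubd//; apply/matrixP => i j.
  rewrite (ord1 j) 3!mxE [RHS]mxE [(_ *m xi) i 0]mxE; congr (compl_emb _ _); apply: eq_bigr => l _.
  by rewrite -(frame_col xi l); congr (_ * frame_mx xi l _); apply: val_inj.
exists C => b x; rewrite hC; congr (C + _).
have -> : pgl_class (insubd (gl_one _) M) = emb (gam c * fr)%g.
  rewrite -[LHS]/(pgl_of M) /M -pgl_map_of// -pgl_ofM ?det_mxrep ?det_frame//.
  by rewrite pgl_ofK.
by rewrite -/(hk (gam c * fr)%g _) hk_act invgK mulgA.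
Qed.

Lemma horoball_act c b : [set actk b x | x in horoball (hgt c)] = [set x | 1 <= hgt c (actk b^-1%g x)].
Proof.
apply/seteqP; split=> [_ [x hx <-]|x hx] /=; first by rewrite actVk.
by exists (actk b^-1%g x) => //; rewrite actkV.
Qed.

(** Translates that meet coincide by [hdisj], and equal horoballs have the same end by
    [horoball_end]. *)
Lemma same_end c c' b b' x : Gam b -> Gam b' -> 1 <= hgt c (actk b^-1%g x) ->
  1 <= hgt c' (actk b'^-1%g x) -> exists2 p, P p & (b * gam c * p = b' * gam c')%g.
Proof.
move=> hb hb' h h'; have := @hdisj c c' b b' hb hb'; rewrite !horoball_act => /(_ _) e.
have {}e := e ltac:(by exists x).
have [C hC] := hgt_hk c; have [C' hC'] := hgt_hk c'.
have := @horoball_end k oo Kc varpi hvarpi (emb (b * gam c * fr)%g) (emb (b' * gam c' * fr)%g) C C'.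
move=> /(_ _) hu.
have {}hu := hu ltac:(by move=> y; rewrite -!/(hk _ y) -hC -hC'; have /seteqP[e1 e2] := e; split; [apply: e1|apply: e2]).
exists ((b * gam c)^-1 * (b' * gam c'))%g; last by rewrite mulgA mulgV mul1g.
apply/(parabolic_frame hxi)/(upt_emb oo Kc); move: hu; rewrite -embV -embM !invgM !mulgA.
exact.
Qed.

(** Equal ends make the two heights differ by a constant. Since [b'^-1 b] lies in the cusp group it
    preserves the horoball, and [horoball_height] forces the constant to be 0. *)
Lemma same_height c c' b b' p : Gam b -> Gam b' -> P p -> (b * gam c * p = b' * gam c')%g ->
  c = c' /\ forall x, hgt c (actk b^-1%g x) = hgt c' (actk b'^-1%g x).
Proof.
move=> hb hb' hp e.
have cc : c = c'.
  have [c0 [_ hc0]] := hgam (b' * gam c')%g.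
  rewrite -(hc0 c'); last by exists b', 1%g; split=> //; [exact: (subgroup_1 PS)|rewrite mulg1].
  by apply/esym; apply: hc0; exists b, p.
split=> //; rewrite -{}cc in e *.
have cg : cusp_group Kf g xi (gam c) (b'^-1 * b)%g.
  split; first exact: (subgroup_M GS (subgroup_V GS hb') hb).
  exists p^-1%g; first exact: (subgroup_V PS hp).
  have -> : (b'^-1 * b = b'^-1 * (b * gam c * p) * p^-1 * (gam c)^-1)%g.
    by rewrite !mulgA -(mulgA _ p) mulgV mulg1 -(mulgA _ (gam c)) mulgV mulg1.
  by rewrite e !mulgA mulVg mul1g.
have [_] := (hstab c (b'^-1 * b)%g).2 cg; rewrite horoball_act => hor.
have [C hC] := hgt_hk c.
have hu : upt ((emb (b * gam c * fr)%g)^-1 * emb (b' * gam c * fr)%g)%g.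
  rewrite -embV -embM; apply/upt_emb; rewrite -e !invgM !mulgA -(mulgA _ b^-1%g) mulVg mulg1.
  rewrite -(mulgA _ (gam c)^-1%g) mulVg mulg1; exact/(parabolic_frame hxi).
have [C0 hC0] := upt_height hu.
have [x0 hx0] := height_surj hvarpi (emb (b * gam c * fr)%g) (1 - C).
have h1 : 1 <= hgt c (actk b^-1%g x0) by rewrite hC /hk hx0; lia.
have horE x : 1 <= C + hB (emb (b * gam c * fr)%g) x <-> 1 <= C + hB (emb (b' * gam c * fr)%g) x.
  rewrite -!/(hk _ x) -!hC; have /seteqP[e1 e2] := hor.
  have e3 : actk (b'^-1 * b)^-1%g (actk b'^-1%g x) = actk b^-1%g x.
    by rewrite -actkM invgM invgK -mulgA mulgV mulg1.
  by split=> h; [apply: e1; rewrite /= e3|rewrite -e3; apply: e2].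
have e0 := horoball_height hoo hvarpi horE (x := x0).
move=> x; rewrite !hC /hk hC0; have := e0 _; rewrite hC0 => e4.
have := e4 ltac:(by rewrite -/(hk _ x0) -hC); lia.
Qed.

Notation PGo := (PG xi).

Lemma PG_coset a : exists2 p, P p & orep (oproj (fun p a : PGL2 k => p * a)%g P a) = (p * a)%g.
Proof.
have := orepK (oproj (fun p a : PGL2 k => p * a)%g P a) => /oprojE.
set o := orep _ => e.
have : orb (fun p a : PGL2 k => p * a)%g P o o by exists 1%g; [exact: (subgroup_1 PS)|rewrite mul1g].
by rewrite e => -[p hp <-]; exists p.
Qed.

Lemma PG_eq a a' p : P p -> a' = (p * a)%g ->
  oproj (fun p a : PGL2 k => p * a)%g P a = oproj (fun p a : PGL2 k => p * a)%g P a'.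
Proof.
move=> hp ->; apply/oprojE; apply/seteqP; split=> _ [p' hp' <-].
  exists (p' * p^-1)%g; first exact: (subgroup_M PS hp' (subgroup_V PS hp)).
  by rewrite !mulgA -(mulgA _ p^-1%g) mulVg mulg1.
by exists (p' * p)%g; [exact: (subgroup_M PS hp' hp)|rewrite !mulgA].
Qed.

Notation pg := (oproj (fun p a : PGL2 k => p * a)%g P : PGL2 k -> PGo).

Lemma PG_dec (O : PGo) : exists cb : 'I_r * PGL2 k, Gam cb.2 /\
  exists2 p, P p & ((orep O)^-1 = cb.2 * gam cb.1 * p)%g.
Proof.
by have [c [[b [p [hb hp e]]] _]] := hgam (orep O)^-1%g; exists (c, b); split=> //; exists p.
Qed.

(** The coset of [delta] labels the horoball at the end [delta^-1 xi]: [ct] is its cusp, and [bt]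
    carries the chosen horoball of that cusp to it. *)
Definition ct (O : PGo) : 'I_r := (projT1 (cid (PG_dec O))).1.
Definition bt (O : PGo) : PGL2 k := (projT1 (cid (PG_dec O))).2.

Lemma btP O : Gam (bt O) /\ exists2 p, P p & ((orep O)^-1 = bt O * gam (ct O) * p)%g.
Proof. by rewrite /bt /ct; case: (cid _). Qed.

Definition hO (O : PGo) (x : T) : int := hgt (ct O) (actk (bt O)^-1%g x).

(** By [same_height] the cusp and the height depend only on the coset, not on the decomposition
    selected in [bt]. *)
Lemma hO_eq a b c p : Gam b -> P p -> (a^-1 = b * gam c * p)%g ->
  ct (pg a) = c /\ forall x, hO (pg a) x = hgt c (actk b^-1%g x).
Proof.
move=> hb hp e; have [hbt [p1 hp1 e1]] := btP (pg a); have [p2 hp2 e2] := PG_coset a.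
have hp3 : P (p1 * p2 * p^-1)%g.
  exact: (subgroup_M PS (subgroup_M PS hp1 hp2) (subgroup_V PS hp)).
have := @same_height (ct (pg a)) c (bt (pg a)) b (p1 * p2 * p^-1)%g hbt hb hp3; apply.
rewrite !mulgA -e1 e2 invgM -(mulgA _ p2^-1%g) mulVg mulg1 e.
by rewrite -(mulgA _ p) mulgV mulg1.
Qed.

Lemma hO_disj O O' x : 1 <= hO O x -> 1 <= hO O' x -> O = O'.
Proof.
move=> h h'; have [hb [p hp e]] := btP O; have [hb' [p' hp' e']] := btP O'.
have [p0 hp0 e0] := same_end hb hb' h h'.
rewrite -(orepK O) -(orepK O'); apply: (@PG_eq _ _ (p'^-1 * p0^-1 * p)%g).
  exact: (subgroup_M PS (subgroup_M PS (subgroup_V PS hp') (subgroup_V PS hp0)) hp).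
rewrite -[orep O']invgK e' -e0 -[orep O in RHS]invgK e !invgM !mulgA.
by rewrite -(mulgA _ p) mulgV mulg1.
Qed.

Lemma hO_local O : exists C B, forall x, hO O x = C + hB B x.
Proof.
have [C hC] := hgt_hk (ct O); exists C, (emb (bt O * gam (ct O) * fr)%g) => x.
exact: hC.
Qed.

(** Right translation of cosets, through which [Gamma] permutes the horoballs; invariance of the
    Eisenstein sum is a reindexing by it. *)
Definition racth (a : PGL2 k) (O : PGo) : PGo := pg (orep O * a)%g.

Lemma racth_spec a O : Gam a -> ct (racth a O) = ct O /\ forall x, hO (racth a O) x = hO O (actk a x).
Proof.
move=> ha; have [hb [p hp e]] := btP O.
have hab : Gam (a^-1 * bt O)%g by exact: (subgroup_M GS (subgroup_V GS ha) hb).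
have [|h1 h2] := @hO_eq (orep O * a)%g (a^-1 * bt O)%g (ct O) p hab hp.
  by rewrite invgM e !mulgA.
by split=> // x; rewrite h2 /hO -actkM invgM invgK.
Qed.

Lemma racthK a O : racth a^-1%g (racth a O) = O.
Proof.
rewrite /racth; have [p hp ->] := PG_coset (orep O * a)%g.
rewrite -[RHS]orepK; apply/esym; apply: (@PG_eq _ _ p) => //.
by rewrite -!mulgA mulgV mulg1.
Qed.

Lemma racthVK a O : racth a (racth a^-1%g O) = O.
Proof. by have := racthK a^-1%g O; rewrite invgK. Qed.

(** Climbing reaches such a horoball within [N + 1] steps; only finitely many vertices are that
    close, and disjointness leaves one horoball at each. *)
Lemma finite_high x (N : nat) : finite_set [set O | - N%:Z <= hO O x].
Proof.
pose near := \bigcup_(n in [set n | (n < N.+2)%N]) [set y | walk varpi x y n].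
have fn : finite_set near.
  apply: bigcup_finite => [|n _]; last exact: (finite_walk hoo hvarpi).
  exact: finite_II.
have [ex0|nO] := pselect (exists O : PGo, True); last first.
  by apply: (@sub_finite_set _ _ set0) => // O _; apply: nO; exists O.
have O1 := projT1 (cid ex0).
apply: (@sub_finite_set _ _ ((fun y => xget O1 [set O | 1 <= hO O y]) @` near)); last exact: finite_image.
move=> O /= hx; have [C [B hCB]] := hO_local O.
have [y hy [n wn hn]] := climb hoo hvarpi B C x.
exists y; first by exists n => //=; move: hn; rewrite -hCB; lia.
case: xgetP => [Q -> h'|/(_ O)]; last by rewrite /= hCB.
by apply/esym; apply: (@hO_disj O _ y) => //; rewrite hCB.
Qed.

Definition sw : PGL2 k := pgl_of (mx2 0 1 1 0).
Definition sh : PGL2 k := pgl_of (mx2 1 0 1 1).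

Lemma det_sw : \det (mx2 0 1 1 0) != 0 :> k.
Proof. by rewrite det2 !mx2E mulr0 mulr1 sub0r oppr_eq0 oner_neq0. Qed.
Lemma det_sh : \det (mx2 1 0 1 1) != 0 :> k.
Proof. by rewrite det2 !mx2E mulr1 mul0r subr0 oner_neq0. Qed.

Lemma upt_conj (M A : 'M[k]_2) : \det M != 0 -> \det A != 0 ->
  upt (pgl_of M * pgl_of A * (pgl_of M)^-1)%g -> (M *m A *m adj2 M) 1 0 = 0.
Proof.
move=> M0 A0; have MA : \det (M *m A) != 0 by rewrite det_mulmx mulf_neq0.
have aM : \det (adj2 M) != 0 by rewrite det_adj2.
rewrite pgl_ofV// pgl_ofM// pgl_ofM// upt_of//.
by rewrite det_mulmx mulf_neq0.
Qed.

(* An element fixing the three ends 0, oo and -1 of the frame is trivial. *)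
Lemma fix_three a : upt (fr^-1 * a * fr)%g -> upt (sw * (fr^-1 * a * fr) * sw^-1)%g ->
  upt (sh * (fr^-1 * a * fr) * sh^-1)%g -> a = 1%g.
Proof.
have [A A0 AE] := pgl_ofP (fr^-1 * a * fr)%g; rewrite AE upt_of// => h10.
move=> /(upt_conj det_sw A0); rewrite {1}(mx2_eta A) /adj2 !mx2M !mx2E h10 => h01.
have {}h01 : A 0 1 = 0 by apply/eqP; rewrite -oppr_eq0; apply/eqP; rewrite -[RHS]h01; ring.
move=> /(upt_conj det_sh A0); rewrite {1}(mx2_eta A) /adj2 !mx2M !mx2E h10 h01 => h11.
have {}h11 : A 0 0 = A 1 1 by apply/eqP; rewrite -subr_eq0; apply/eqP; rewrite -[RHS]h11; ring.
have AS : A = A 1 1 *: 1%:M.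
  by apply: mx2_ext; rewrite !mxE /= ?mulr1n ?mulr0n ?mulr1 ?mulr0.
have A11 : A 1 1 != 0 by apply: contraNneq A0 => e; rewrite AS e scale0r det2 !mxE mul0r subrr.
have e1 : pgl_of A = 1%g by rewrite AS pgl_ofZ ?pgl_of1// det1 oner_neq0.
have -> : a = (fr * (fr^-1 * a * fr) * fr^-1)%g.
  by rewrite !mulgA mulgV mul1g -mulgA mulgV mulg1.
by rewrite AE e1 mulg1 mulgV.
Qed.

Lemma racth_pg a d : racth a (pg d) = pg (d * a)%g.
Proof.
rewrite /racth; have [p hp ->] := PG_coset d; apply/esym; apply: (@PG_eq _ _ p) => //.
by rewrite mulgA.
Qed.

Lemma pg_inj d d' : pg d = pg d' -> P (d' * d^-1)%g.
Proof.
move=> /oprojE e; have : orb (fun p a : PGL2 k => p * a)%g P d d by exists 1%g; [exact: (subgroup_1 PS)|rewrite mul1g].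
rewrite e => -[p hp e']; rewrite -[d]e' invgM mulgA mulgV mul1g; exact: (subgroup_V PS hp).
Qed.

Lemma racth_fix a a' u : racth a (pg (fr * u * fr^-1)%g) = racth a' (pg (fr * u * fr^-1)%g) ->
  upt (u * (fr^-1 * (a' * a^-1) * fr) * u^-1)%g.
Proof.
rewrite !racth_pg => /pg_inj /(parabolic_frame hxi); congr upt.
rewrite !invgM !invgK !mulgA mulVg mul1g.
by rewrite -(mulgA _ fr^-1%g fr) mulVg mulg1.
Qed.

(** A stabilizer element preserves heights at [x], so it sends three fixed cosets into the finite
    set of high ones; by [fix_three] the three images determine it. *)
Lemma stab_finite x : finite_set (stab Kf g x).
Proof.
pose E u := pg (fr * u * fr^-1)%g.
pose N := (absz (hO (E 1%g) x) + absz (hO (E sw) x) + absz (hO (E sh) x))%N.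
pose S := [set Q | - N%:Z <= hO Q x]; have fS : finite_set S by exact: finite_high.
have SE u : u = 1%g \/ u = sw \/ u = sh -> S (E u).
  by rewrite /S /N /=; case=> [->|[->|->]]; lia.
pose f a : PGo * PGo * PGo := (racth a (E 1%g), racth a (E sw), racth a (E sh)).
have fi : {in stab Kf g x &, injective f}.
  move=> a a' _ _ e; have e0 := congr1 (fun t => t.1.1) e; have e1 := congr1 (fun t => t.1.2) e.
  have e2 := congr1 snd e; apply/esym/eqP; rewrite -(inj_eq (mulIg a^-1%g)) mulgV; apply/eqP.
  apply: fix_three; [|exact: racth_fix e1|exact: racth_fix e2].
  by have := racth_fix e0; rewrite invg1 mulg1 mul1g.
rewrite -(eq_finite_set (inj_card_eq fi)).
apply: (@sub_finite_set _ _ (S `*` S `*` S)); last by do 2?[apply: finite_setX => //].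
have key a u : stab Kf g x a -> S (E u) -> S (racth a (E u)).
  by move=> [ha hax] h; rewrite /S /=; have [_ ->] := racth_spec (E u) ha; rewrite hax.
by move=> _ [a sa <-]; split; [split|]; apply: key => //; apply: SE; tauto.
Qed.

Lemma yprojP x y : yproj Kf g x = yproj Kf g y <-> exists2 a, Gam a & y = actk a x.
Proof.
split=> [/oprojE e|[a ha ->]].
  have : orb (@actk k oo Kc) Gam y y by exists 1%g; [exact: (subgroup_1 GS)|rewrite actk1].
  by rewrite -e => -[a ha <-]; exists a.
apply/oprojE/seteqP; split=> _ [b hb <-].
  exists (b * a^-1)%g; first exact: (subgroup_M GS hb (subgroup_V GS ha)).
  by rewrite -actkM -mulgA mulVg mulg1.
by exists (b * a)%g; [exact: (subgroup_M GS hb ha)|rewrite actkM].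
Qed.

Lemma orep_yproj x : exists2 a, Gam a & orep (yproj Kf g x) = actk a x.
Proof. by apply/yprojP; rewrite [RHS]orepK. Qed.

Variable R : realType.
Notation C := R[i].
Notation Yg := (Y Kf g).
Notation lam := (@lam k oo Kc Kf R g).

Lemma stab1 x : stab Kf g x 1%g.
Proof. by split; [exact: (subgroup_1 GS)|rewrite actk1]. Qed.

Definition snum x : R := \sum_(a \in stab Kf g x) (1 : R).

Lemma fsum1 (I : choiceType) (A : set I) : finite_set A -> \sum_(a \in A) (1 : R) = (#|` fset_set A|)%:R.
Proof. by move=> fA; rewrite fsbig_finite// big_const_seq count_predT iter_addr_0 -mulr_natr mul1r. Qed.
Lemma snumE x : snum x = (#|` fset_set (stab Kf g x)|)%:R.
Proof. by rewrite /snum fsum1//; exact: stab_finite. Qed.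

Lemma snum_gt0 x : 0 < snum x.
Proof.
rewrite snumE ltr0n cardfs_gt0; apply/fset0Pn; exists 1%g.
by rewrite in_fset_set; [apply/mem_set; exact: stab1|exact: stab_finite].
Qed.

Lemma lamE (y : Yg) : lam y = (snum (orep y))^-1. Proof. by rewrite snumE. Qed.
Lemma lam_gt0 (y : Yg) : 0 < lam y. Proof. by rewrite lamE invr_gt0 snum_gt0. Qed.
Lemma sqrt_lam_gt0 (y : Yg) : 0 < Num.sqrt (lam y). Proof. by rewrite sqrtr_gt0 lam_gt0. Qed.

Lemma actk_adj a x y : adj varpi (actk a x) (actk a y) <-> adj varpi x y.
Proof. exact: (adj_act hoo hvarpi (emb a) x y). Qed.

Definition edges x x' : set (PGL2 k) := [set a | Gam a /\ adj varpi x (actk a x')].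
Definition ynum x (y : Yg) : R := \sum_(z \in [set z | adj varpi x z /\ yproj Kf g z = y]) (1 : R).

Lemma finite_adj x : finite_set [set z | adj varpi x z].
Proof.
apply: sub_finite_set (finite_walk hoo hvarpi x 1) => z h.
by apply: walkS h _; exact: walk0.
Qed.

(** Above each neighbour of [x] lying over [y] there is one coset of the stabilizer of the lift of
    [y]. Inverting group elements then gives [ynum_sym], the symmetry of the adjacency operator for
    the weights. *)
Lemma edges_count x (y : Yg) : \sum_(a \in edges x (orep y)) (1 : R) = ynum x y * snum (orep y).
Proof.
set A := [set z | adj varpi x z /\ yproj Kf g z = y]; set B := stab Kf g (orep y).
have fA : finite_set A by apply: sub_finite_set (finite_adj x) => z [].
have fB : finite_set B by exact: stab_finite.
have ex z : exists a, A z -> Gam a /\ z = actk a (orep y).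
  have [[_ hz]|nA] := pselect (A z); last by exists 1%g.
  have [a ha e] := orep_yproj z; exists a^-1%g => _; split; first exact: (subgroup_V GS ha).
  by rewrite -hz e actVk.
pose sec z := projT1 (cid (ex z)).
have secP z : A z -> Gam (sec z) /\ z = actk (sec z) (orep y) by rewrite /sec; case: cid.
have bij : set_bij (A `*` B) (edges x (orep y)) (fun p : T * PGL2 k => (sec p.1 * p.2)%g).
  split.
  - move=> [z s] [/= Az [sG sf]]; have [h1 h2] := secP z Az.
    by split; [exact: (subgroup_M GS h1 sG)|rewrite actkM sf -h2; case: Az].
  - move=> [z s] [z' s'] /set_mem [/= Az [sG sf]] /set_mem [/= Az' [sG' sf']] e.
    have zz : z = z'.
      have [_ ->] := secP z Az; have [_ ->] := secP z' Az'.
      by rewrite -{1}sf -actkM e actkM sf'.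
    by move: e; rewrite -zz => /mulgI ->.
  move=> a [aG ax]; have Aa : A (actk a (orep y)).
    by split=> //; rewrite -[RHS]orepK; apply/esym/yprojP; exists a.
  have [h1 h2] := secP _ Aa; exists (actk a (orep y), (sec (actk a (orep y)))^-1 * a)%g => /=.
    split=> //; split; first exact: (subgroup_M GS (subgroup_V GS h1) aG).
    by rewrite actkM {2}h2 actVk.
  by rewrite mulgA mulgV mul1g.
rewrite (reindex_fsbig _ _ _ _ bij) fsbig_finite; last exact: finite_setX.
rewrite /ynum /snum -!/A -!/B fsbig_finite// [X in _ * X]fsbig_finite// mulr_suml.
rewrite fset_setX// big_imfset2 /=; last by move=> [? ?] [? ?] _ _ /= [-> ->].
apply: eq_bigr => z _; rewrite mul1r; apply: eq_bigl => b.
by [].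
Qed.

Lemma ynum_sym (y y' : Yg) : lam y * ynum (orep y) y' = lam y' * ynum (orep y') y.
Proof.
have e1 := edges_count (orep y) y'; have e2 := edges_count (orep y') y.
have inv x x' a : edges x x' a -> edges x' x a^-1%g.
  move=> [ha hx]; split; first exact: (subgroup_V GS ha).
  by have := (actk_adj a^-1%g x (actk a x')).2 hx; rewrite actVk => h; exact: (adj_sym iota hvarpi h).
have e3 : \sum_(a \in edges (orep y) (orep y')) (1 : R) = \sum_(a \in edges (orep y') (orep y)) (1 : R).
  apply: (@reindex_fsbig _ _ _ _ _ (fun a : PGL2 k => a^-1)%g _ _ (fun=> 1 : R)); split.
  - by move=> a /inv.
  - by move=> a b _ _ /invg_inj.
  by move=> a /inv h; exists a^-1%g => //; rewrite invgK.
have s0 := gt_eqF (snum_gt0 (orep y)); have s0' := gt_eqF (snum_gt0 (orep y')).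
rewrite !lamE; move: e1; rewrite e3 e2.
move: (snum _) (snum _) (ynum _ _) (ynum _ _) s0 s0' => A B N1 N2 A0 B0 h.
by rewrite mulrC [RHS]mulrC; apply/eqP; rewrite eqr_div ?A0 ?B0// h.
Qed.

Lemma Adj_fin (f : Yg -> C) (y : Yg) : Adj varpi f y = \sum_(z <- fset_set [set z | adj varpi (orep y) z]) f (yproj Kf g z).
Proof. by rewrite /Adj fsbig_finite//; exact: finite_adj. Qed.

Lemma Adj_delta (y y' : Yg) : Adj varpi (fun z => (z == y')%:R) y = (ynum (orep y) y')%:C.
Proof.
have fA : finite_set [set z | adj varpi (orep y) z /\ yproj Kf g z = y'].
  by apply: sub_finite_set (finite_adj (orep y)) => z [].
rewrite /ynum fsbig_finite// rmorph_sum /= -fsbig_finite// rmorph1.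
rewrite /Adj; apply/esym; rewrite (_ : \big[_/_]_(x \in _) _ = \sum_(z \in [set z | adj varpi (orep y) z /\ yproj Kf g z = y']) ((yproj Kf g z == y')%:R : C)); last first.
  by apply: eq_fsbigr => z /set_mem[/= _ ->]; rewrite eqxx.
by apply: fsbig_widen => [z []//|z [/= az nz]]; case: eqP => // e; case: nz.
Qed.

Variables (q d : nat) (cusp : 'I_r -> nat -> Yg) (core : 'I_d -> Yg) (wid : 'I_r -> R).
Hypothesis q0 : (0 < q)%N.
Hypothesis hcusp : forall c n x, (1 <= n)%N -> hgt c x = n%:Z -> yproj Kf g x = cusp c n.
Hypothesis hcore_inj : injective core.
Hypothesis hcore : forall y : Yg, (exists i, core i = y) <-> ~ (exists c n, (1 <= n)%N /\ y = cusp c n).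
Hypothesis hwid : forall c n, (1 <= n)%N -> lam (cusp c n) = wid c * q.+1%:R * (q%:R ^- n).
Variables (H : 'M[C]_d) (V : 'M[C]_(d, r)).
Definition lab (x : jidx d r) : Yg := match x with inl i => core i | inr (c, m) => cusp c m.+1 end.
Definition stab_conj (f : Yg -> C) (x : jidx d r) : C := (Num.sqrt (lam (lab x)))%:C * f (lab x).
Notation U := stab_conj.
Notation J := (jacobi q H V).
Notation A := (Adj varpi).
Hypothesis hJ : forall f : Yg -> C, U (A f) = J (U f).

Lemma wid_gt0 c : 0 < wid c.
Proof.
have := lam_gt0 (cusp c 1); rewrite hwid// pmulr_lgt0 ?invr_gt0 ?exprn_gt0 ?ltr0n//.
by rewrite pmulr_lgt0// ltr0n.
Qed.

Lemma hgt_surj c (n : int) : exists x, hgt c x = n.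
Proof.
have [C0 hC] := hgt_hk c; have [x hx] := height_surj hvarpi (emb (1 * gam c * fr)%g) (n - C0).
by exists x; rewrite -(actk1 x) -invg1 hC /hk hx; ring.
Qed.

Lemma lab_inj : injective lab.
Proof.
have nc i c n : core i = cusp c n.+1 -> False.
  by move=> e; have [h _] := hcore (core i); apply: (h _); [exists i|exists c, n.+1].
move=> [i|[c n]] [i'|[c' n']] /=; first by move/hcore_inj ->.
- by move/nc.
- by move/esym/nc.
have [x hx] := hgt_surj c n.+1; have [x' hx'] := hgt_surj c' n'.+1.
rewrite -(hcusp _ hx)// -(hcusp _ hx')// => /yprojP[a ha e].
have h1 := subgroup_1 GS; have ha' := subgroup_V GS ha.
have [||p hp e2] := @same_end c c' 1%g a^-1%g x h1 ha'.
- by rewrite invg1 actk1 hx.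
- by rewrite invgK -e hx'.
have [cc hh] := same_height h1 ha' hp e2.
have := hh x; rewrite invg1 invgK actk1 -e hx hx' cc => -[->].
by [].
Qed.

Lemma lab_surj (y : Yg) : exists x : jidx d r, lab x = y.
Proof.
have [[c [[|n] [n0 ->]]]|h] := pselect (exists c n, (1 <= n)%N /\ y = cusp c n); [by []|by exists (inr (c, n))|].
by have [i <-] := (hcore y).2 h; exists (inl i).
Qed.

Lemma lab_bij : set_bij setT setT lab.
Proof.
by split=> // [x x' _ _|y _]; [exact: lab_inj|have [x <-] := lab_surj y; exists x].
Qed.

Lemma conjUE f (x : jidx d r) : U f x = (Num.sqrt (lam (lab x)))%:C * f (lab x). Proof. by []. Qed.

Lemma conjU_inj f f' : U f = U f' -> f = f'.
Proof.
move=> e; apply/funext => y; have [x <-] := lab_surj y; have := congr1 (fun u => u x) e.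
by rewrite !conjUE => /mulfI; apply; rewrite fmorph_eq0 gt_eqF// sqrt_lam_gt0.
Qed.

Lemma conjU_onto (u : jidx d r -> C) : exists f, U f = u.
Proof.
have ex (y : Yg) : exists x : jidx d r, lab x = y by exact: lab_surj.
pose inv (y : Yg) := projT1 (cid (ex y)); have invP (y : Yg) : lab (inv y) = y by rewrite /inv; case: cid.
exists (fun y : Yg => ((Num.sqrt (lam y))^-1)%:C * u (inv y)); apply/funext => x.
rewrite conjUE mulrA -rmorphM mulfV ?mul1r; last by rewrite gt_eqF// sqrt_lam_gt0.
by congr u; apply: lab_inj; rewrite invP.
Qed.

Lemma conjU_norm f : l2norm2 (fun=> 1) (U f) = l2norm2 (fun y : Yg => lam y) f.
Proof.
rewrite !nsum_l2 -(nsum_reindex _ lab_bij) /nsum; congr esum; apply/funext => x /=.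
by rewrite conjUE nsqM nsq_RC sqr_sqrtr ?mul1r// ltW// lam_gt0.
Qed.

Lemma conjU_ip f f' : ip (fun=> 1) (U f) (U f') = ip (fun y : Yg => lam y) f f'.
Proof.
pose F (y : Yg) : C := (lam y)%:C * (f y * (f' y)^*).
have cr (a : R) (w : C) : (a%:C * w)^* = a%:C * w^* by case: w => w w'; apply: complexP; rewrite /=; ring.
have e (x : jidx d r) : (1 : R)%:C * (U f x * (U f' x)^*) = F (lab x).
  rewrite !conjUE /F rmorph1 mul1r [X in _ * X = _](_ : _ = (Num.sqrt (lam (lab x)))%:C * (f' (lab x))^*); last exact: cr.
  rewrite -[in RHS](sqr_sqrtr (ltW (lam_gt0 (lab x)))).
  by rewrite rmorphXn; ring.
rewrite /ip /csum -(rsum_reindex (fun y : Yg => re (F y)) lab_bij).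
rewrite -(rsum_reindex (fun y : Yg => im (F y)) lab_bij).
by congr (_ +i* _); congr rsum; apply/funext => x; rewrite e.
Qed.

Lemma conjU_iter n f : iter n J (U f) = U (iter n A f).
Proof. by elim: n => //= n ->; rewrite hJ. Qed.

Lemma conjU_ac f : ac_subspace (fun=> 1) J (U f) <-> ac_subspace (fun y : Yg => lam y) A f.
Proof.
rewrite /ac_subspace /= /l2 conjU_norm /spectral_measure.
by split=> -[h1 [mu [h2 h3] h4]]; split=> //; exists mu => //; split=> // n;
  have := h3 n; rewrite ?conjU_iter conjU_ip.
Qed.

(** Applying [hJ] to indicator functions reads off the entries of [H]; their symmetry is [ynum_sym]
    divided by the square roots of the two weights. *)
Lemma H_hermitian : adjmx H = H.
Proof.
have key i i' : (Num.sqrt (lam (core i)) * ynum (orep (core i)) (core i'))%:C =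
    H i i' * (Num.sqrt (lam (core i')))%:C.
  have := congr1 (fun u => u (inl i)) (hJ (fun z => (z == core i')%:R)).
  rewrite {1}conjUE [lab (inl i)]/= Adj_delta -rmorphM => ->; rewrite [LHS]/=.
  have cd (i1 : 'I_d) : U (fun z => (z == core i')%:R) (inl i1) = (Num.sqrt (lam (core i1)))%:C * (i1 == i')%:R.
    by rewrite conjUE /= (inj_eq hcore_inj).
  rewrite (bigD1 i')//= big1 ?addr0.
    rewrite big1 ?addr0 => [|c _]; first by rewrite cd eqxx mulr1.
    rewrite conjUE (_ : (lab _ == core i') = false) ?mulr0//.
    by apply/eqP => e; have := @lab_inj (inr (c, 0%N)) (inl i') e.
  by move=> i1 /negbTE i1n; rewrite cd i1n !mulr0.
apply/matrixP => i i'; rewrite mxE.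
have sI i0 : (Num.sqrt (lam (core i0)))%:C != 0 :> C by rewrite fmorph_eq0 gt_eqF// sqrt_lam_gt0.
apply: (mulIf (sI i)); apply: (mulIf (sI i')); rewrite -[in LHS](conjc_real (Num.sqrt (lam (core i)))).
rewrite -conjM -key conjc_real mulrAC -key -!rmorphM; congr (_%:C).
have := ynum_sym (core i) (core i'); have l0 i0 := ltW (lam_gt0 (core i0)).
rewrite -{1}(sqr_sqrtr (l0 i)) -{1}(sqr_sqrtr (l0 i')).
move: (Num.sqrt _) (Num.sqrt _) (ynum _ _) (ynum _ _) => a b n1 n2 h; rewrite -?expr2 in h *.
by rewrite -mulrA mulrC; move: h; rewrite !expr2 => h; lra.
Qed.
Hypothesis hq : q = #|Fq|.

Lemma q_gt1 : (1 < q)%N. Proof. by rewrite hq finalg.card_finRing_gt1. Qed.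

Definition nb x : option Fq -> T := projT1 (cid (local_rule hoo hvarpi 1%g x)).

Lemma nbP x : injective (nb x) /\ forall z, adj varpi x z <-> exists e, z = nb x e.
Proof. by rewrite /nb; case: cid => f []. Qed.

Lemma hO_nb D x : exists2 e, hO D (nb x e) = hO D x + 1 & forall e', e' != e -> hO D (nb x e') = hO D x - 1.
Proof.
have [C0 [B hB]] := hO_local D; have [f [fi fa f1 f2]] := local_rule hoo hvarpi B x.
have [ni na] := nbP x; have [e he] := (na (f None)).1 ((fa _).2 (ex_intro _ None erefl)).
exists e => [|e' ee]; first by rewrite !hB -he f1; ring.
have [[b|] hb] := (fa (nb x e')).1 ((na _).2 (ex_intro _ e' erefl)); first by rewrite !hB hb f2; ring.
by move/eqP: ee; case; apply: ni; rewrite hb.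
Qed.

Lemma sum_atmost1 (I : eqType) (s : seq I) (p : pred I) (F : I -> R) B : uniq s -> 0 <= B ->
  (forall i, p i -> F i <= B) -> (forall i j, p i -> p j -> i = j) -> \sum_(i <- s | p i) F i <= B.
Proof.
move=> us B0 FB p1; rewrite -big_filter; have := filter_uniq p us; have := filter_all p s.
case: (seq.filter p s) => [|i [|j t]] /=; rewrite ?big_nil ?big_seq1//; first by case/andP => /FB.
by move=> /and3P[pi pj _]; rewrite (p1 _ _ pi pj) inE eqxx.
Qed.

Lemma sum_cover (I : eqType) (K : finType) (s : seq I) (p : pred I) (B : pred K) (u : K -> pred I) (F G : I -> R) :
  (forall i, 0 <= G i) -> (forall i, i \in s -> p i -> F i <= G i /\ exists2 e, B e & u e i) ->
  \sum_(i <- s | p i) F i <= \sum_(e | B e) \sum_(i <- s | u e i) G i.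
Proof.
move=> G0 h; rewrite (eq_bigr (fun e => \sum_(i <- s) (if u e i then G i else 0))) => [|e _]; last by rewrite big_mkcond.
rewrite exchange_big big_mkcond big_seq [leRHS]big_seq; apply: ler_sum => i si /=.
have t0 (b : bool) : 0 <= (if b then G i else 0) by case: b.
case: ifP => pi; last by apply: sumr_ge0.
have [FG [e Be ue]] := h i si pi; rewrite (bigD1 e)//= ue; apply: le_trans FG _.
by rewrite lerDl; apply: sumr_ge0.
Qed.

(** * Convergence of the Eisenstein series *)

Section Weights.
Variable sg : R.
Hypothesis sg1 : 1 < sg.
Definition wt (n : int) : R := expR (sg * n%:~R * ln q%:R).
Definition qsg : R := expR (sg * ln (q%:R : R)).
Definition rho : R := q%:R / qsg.
Notation Q := qsg.
Lemma qsg_gt0 : 0 < Q. Proof. exact: expR_gt0. Qed.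

Lemma wt_gt0 n : 0 < wt n. Proof. exact: expR_gt0. Qed.
Lemma wt0 : wt 0 = 1. Proof. by rewrite /wt mulr0 mul0r expR0. Qed.
Lemma wtD1 n : wt (n + 1) = wt n * Q.
Proof. by rewrite /wt /qsg -expRD intrD; congr expR; ring. Qed.
Lemma lnq_gt0 : 0 < ln (q%:R : R). Proof. by rewrite ln_gt0// ltr1n q_gt1. Qed.
Lemma rho_lt1 : rho < 1.
Proof.
have qp : 0 < (q%:R : R) by rewrite ltr0n (ltn_trans _ q_gt1).
rewrite ltr_pdivrMr ?qsg_gt0// mul1r /qsg -[X in X < _](lnK (x := q%:R)) ?posrE// ltr_expR.
by rewrite -[X in X < _]mul1r ltr_pM2r ?lnq_gt0.
Qed.
Lemma rho_ge0 : 0 <= rho. Proof. by rewrite divr_ge0// ltW// qsg_gt0. Qed.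

Definition up M x y D := (hO D y == hO D x + 1) && (- M%:Z < hO D x <= 0).

(** Only horoballs whose height rises along the edge are counted. Height 0 at [x] means height 1 at
    [y], where disjointness leaves at most one. For the others the height rises again along one of
    the [q] edges leaving [y] other than the way back, at the cost of a factor [q^-sg]; hence the
    ratio [rho]. *)
Lemma edge_bound M (s : seq PGo) x y : uniq s -> adj varpi x y ->
  \sum_(D <- s | up M x y D) wt (hO D x) <= \sum_(i < M) rho ^+ i.
Proof.
move=> us; elim: M x y => [|M IH] x y xy.
  by rewrite big_ord0 big_pred0// /up => D; lia.
rewrite (bigID (fun D => hO D x == 0)) /= big_ord_recl expr0 lerD//.
  apply: sum_atmost1 => // [D /andP[_ /eqP ->]|D D']; first by rewrite wt0.
  by rewrite /up => /andP[h1 h2] /andP[h3 h4]; apply: (@hO_disj D D' y); lia.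
have [ni na] := nbP y; have [e0 e0E] := (na x).1 (adj_sym iota hvarpi xy).
apply: le_trans (sum_cover (G := fun D => wt (hO D y) / Q) (B := fun e => e != e0) (u := fun e => up M y (nb y e)) _ _) _.
- by move=> D; apply: divr_ge0; apply: ltW; [exact: wt_gt0|exact: qsg_gt0].
- move=> D _; rewrite /up => h; have hy : hO D y = hO D x + 1 by lia.
  split; first by rewrite hy wtD1 mulfK// gt_eqF ?qsg_gt0.
  have [e he he'] := hO_nb D y; exists e; last by rewrite he eqxx /=; lia.
  by apply: contraTneq h => ee; rewrite e0E -ee he; lia.
apply: le_trans (_ : \sum_(e | e != e0) (\sum_(i < M) rho ^+ i) / Q <= _).
  apply: ler_sum => e _; rewrite -mulr_suml ler_wpM2r ?invr_ge0 ?(ltW qsg_gt0)//; apply: IH.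
  by apply/na; exists e.
rewrite sumr_const (_ : #|_| = q); last first.
  by have := cardC1 e0; rewrite card_option /= hq => <-; apply: eq_card => e; rewrite !inE.
rewrite -mulr_natl mulrCA -/rho mulr_suml; apply: ler_sum => i _.
by rewrite lift0 exprSr.
Qed.

Lemma low_bound (s : seq PGo) x : uniq s -> \sum_(D <- s | hO D x <= 0) wt (hO D x) <= q.+1%:R / (1 - rho).
Proof.
(* A depth exceeding all those that occur in the finite list; the final bound does not depend on
   it. *)
move=> us; pose M := (1 + \sum_(D <- s) absz (hO D x))%N.
have hM D : D \in s -> - M%:Z < hO D x.
  by move=> Ds; rewrite /M (big_rem D)//=; lia.
have r1 := rho_lt1; have geo : \sum_(i < M) rho ^+ i <= (1 - rho)^-1.
  rewrite -[leRHS]mul1r ler_pdivlMr ?subr_gt0//.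
  have := subrX1 rho M; have := exprn_ge0 M rho_ge0; move: (\sum_(i < M) _) (rho ^+ M) => X Y Y0 h.
  by rewrite -(opprB rho) mulrN mulrC -h; lra.
apply: le_trans (sum_cover (G := fun D => wt (hO D x)) (B := xpredT) (u := fun e => up M x (nb x e)) _ _) _.
- by move=> D; rewrite ltW ?wt_gt0.
- move=> D Ds h; split=> //; have [e he _] := hO_nb D x; exists e => //.
  by rewrite /up he eqxx hM.
apply: le_trans (_ : \sum_(e : option Fq) (1 - rho)^-1 <= _).
  apply: ler_sum => e _; apply: le_trans geo; apply: edge_bound => //.
  by have [_ na] := nbP x; apply/na; exists e.
by rewrite sumr_const card_option /= -hq mulr_natl.
Qed.

Lemma low_summable x : rsummable (fun D => if hO D x <= 0 then wt (hO D x) else 0) /\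
  rsum (fun D => if hO D x <= 0 then wt (hO D x) else 0) <= q.+1%:R / (1 - rho).
Proof.
apply: nsum_bound => [D|s us]; first by case: ifP => // _; rewrite ltW ?wt_gt0.
by rewrite -big_mkcond; exact: low_bound.
Qed.

(** By disjointness at most one horoball contains [x]. *)
Lemma high_summable x : rsummable (fun D => if hO D x <= 0 then 0 else wt (hO D x)).
Proof.
have [[D0 h0]|no] := pselect (exists D, 1 <= hO D x).
  apply: (@rsummable_fin _ _ _ [:: D0]) => D; rewrite inE; case: ifP => // h /eqP[].
  by apply: (@hO_disj D D0 x) => //; lia.
apply: (@rsummable_fin _ _ _ [::]) => D _; case: ifP => // h; case: no; exists D; lia.
Qed.

Lemma wt_summable x : rsummable (fun D => wt (hO D x)).
Proof.
have := rsummableD (low_summable x).1 (high_summable x); congr rsummable; apply/funext => D.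
by case: ifP; rewrite ?addr0 ?add0r.
Qed.
End Weights.

Lemma pow_bounded (w X B : R) : 1 < w -> 0 <= X -> (forall n, w ^+ n.+1 * X <= B) -> X = 0.
Proof.
move=> w1 X0 h; apply/eqP; rewrite eq_le X0 andbT leNgt; apply/negP => Xp.
have bern n : 1 + n%:R * (w - 1) <= w ^+ n.
  elim: n => [|n IH]; first by rewrite mul0r addr0 expr0.
  rewrite exprS mulrSr; have n0 : 0 <= (n%:R : R) by [].
  have sq : 0 <= n%:R * (w - 1) ^+ 2 by rewrite mulr_ge0 ?sqr_ge0.
  by have := ler_wpM2l (ltW (lt_trans ltr01 w1)) IH; rewrite expr2 in sq; lra.
have [n hn] : exists n : nat, B / (X * (w - 1)) < n%:R.
  by exists (Num.truncn (B / (X * (w - 1)))).+1; exact: truncnS_gt.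
move: hn; rewrite ltr_pdivrMr ?mulr_gt0 ?subr_gt0// => hn.
have := h n; have := bern n.+1; rewrite mulrSr => b1 b2.
by have := ler_wpM2r X0 b1; nra.
Qed.

Lemma Adj_nb (f : Yg -> C) (y : Yg) : A f y = \sum_e f (yproj Kf g (nb (orep y) e)).
Proof.
have [ni na] := nbP (orep y); rewrite Adj_fin -(big_map (nb (orep y)) xpredT (fun z => f (yproj Kf g z))).
apply: perm_big; apply: uniq_perm; rewrite ?fset_uniq ?map_inj_uniq ?index_enum_uniq// => z.
rewrite in_fset_set; last exact: finite_adj.
apply/idP/idP => [/set_mem /= /na[e ->]|/mapP[e _ ->]]; first by rewrite map_f ?mem_index_enum.
by apply/mem_set/na; exists e.
Qed.

(** For the supremum norm the adjacency operator is bounded by the degree [q + 1]. *)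
Lemma bounded_eigen (f : Yg -> C) (m : C) (B : R) : (forall y : Yg, Normc.normc (f y) <= B) ->
  (forall y : Yg, A f y = m * f y) -> q.+1%:R < Normc.normc m -> forall y : Yg, f y = 0.
Proof.
move=> fB Af mq y; set S := [set Normc.normc (f z) | z in setT].
have hS : has_sup S by split; [exists (Normc.normc (f y)), y|exists B => _ [z _ <-]].
have le z : Normc.normc (f z) <= sup S by apply: ub_le_sup; [exact: hS.2|exists z].
have m0 : 0 < Normc.normc m by apply: le_lt_trans mq.
have S0 : sup S <= q.+1%:R / Normc.normc m * sup S.
  apply: ge_sup => [|_ [z _ <-]]; first exact: hS.1.
  rewrite mulrAC ler_pdivlMr// mulrC -ncM -Af Adj_nb.
  apply: le_trans (nc_sum _ _) (le_trans (ler_sum _ (fun e _ => le _)) _).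
  by rewrite sumr_const card_option /= -hq mulr_natl.
apply: nc_eq0; apply/eqP; rewrite eq_le nc_ge0 andbT; apply: le_trans (le y) _.
have k1 : q.+1%:R / Normc.normc m < 1 by rewrite ltr_pdivrMr// mul1r.
by move: S0 k1; move: (_ / _) (sup S) => k2 t h1 h2; rewrite leNgt; apply/negP => h3; nra.
Qed.

Definition wq c : R := Num.sqrt (wid c * q.+1%:R).
Lemma wq_gt0 c : 0 < wq c. Proof. by rewrite sqrtr_gt0 mulr_gt0 ?wid_gt0// ltr0n. Qed.
Lemma sqrt_lam_cusp c n : Num.sqrt (lam (cusp c n.+1)) = wq c * (Num.sqrt q%:R ^+ n.+1)^-1.
Proof.
rewrite hwid// sqrtrM ?mulr_ge0 ?(ltW (wid_gt0 c))//; congr (_ * _).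
have -> : (q%:R : R) ^- n.+1 = (Num.sqrt q%:R ^- n.+1) ^+ 2 by rewrite exprVn -exprM mulnC exprM sqr_sqrtr.
by rewrite sqrtr_sqr ger0_norm// invr_ge0 exprn_ge0// sqrtr_ge0.
Qed.

(** * The Eisenstein series in its half plane of convergence *)

Section EisensteinSeries.
Variable s : C.
Hypothesis s1 : 1 < re s.
Notation sg := (re s).
Notation wz := (wt sg).
Notation LB := (q.+1%:R / (1 - rho sg)).
Notation nc := (@Normc.normc R).

Definition qp (n : int) : C := qpow q (s * n%:~R).

Lemma intC (n : int) : n%:~R = (n%:~R : R)%:C :> C. Proof. by rewrite (rmorph_int (@real_complex R)). Qed.

Lemma nc_qp n : nc (qp n) = wz n.
Proof. by rewrite /qp /qpow nc_cexp /wt intC; congr expR; case: s => a b /=; ring. Qed.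
Lemma qpD n m : qp (n + m) = qp n * qp m.
Proof. by rewrite /qp /qpow -cexpD intrD; congr cexp; ring. Qed.
Lemma qp_neq0 n : qp n != 0. Proof. exact: cexp_neq0. Qed.
Lemma qpB1 n : qp (n - 1) = qp n / qp 1.
Proof. by apply: (mulIf (qp_neq0 1)); rewrite -qpD subrK divfK// qp_neq0. Qed.

Definition zeta : C := cexp ((s - 2^-1) * (ln q%:R)%:C).
Notation aq := (sqrtq R q).

Lemma aqE : aq = cexp (2^-1 * (ln q%:R)%:C).
Proof.
have e : cexp (2^-1 * (ln q%:R)%:C) = (expR (2^-1 * ln (q%:R : R)))%:C.
  rewrite (_ : 2^-1 * (ln q%:R)%:C = (2^-1 * ln (q%:R : R))%:C); last first.
    by rewrite rmorphM fmorphV (rmorph_nat (@real_complex R)).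
  by rewrite /cexp /= cos0 sin0; apply: complexP; rewrite /=; ring.
rewrite e /sqrtq; congr (_%:C).
have {1}-> : (q%:R : R) = expR (2^-1 * ln (q%:R : R)) ^+ 2.
  by rewrite -expRM_natl mulrA divff// mul1r lnK// posrE ltr0n.
by rewrite sqrtr_sqr ger0_norm// expR_ge0.
Qed.

Lemma qp1 : qp 1 = zeta * aq.
Proof. by rewrite aqE -cexpD /qp /qpow; congr cexp; rewrite mulr1z; field. Qed.
Lemma qp_nat n : qp n%:Z = (zeta * aq) ^+ n.
Proof. by rewrite -qp1; elim: n => [|n IH]; [rewrite /qp mulr0 /qpow mul0r cexp0|rewrite intS addrC qpD IH exprSr]. Qed.

Lemma nc_zeta : Num.sqrt (q%:R : R) < nc zeta.
Proof.
have h : nc (zeta * aq) = nc zeta * Num.sqrt (q%:R : R) by rewrite ncM ncR ger0_norm ?sqrtr_ge0.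
have sq0 : 0 < Num.sqrt (q%:R : R) by rewrite sqrtr_gt0 ltr0n.
rewrite -(ltr_pM2r sq0) -h -qp1 nc_qp -expr2 sqr_sqrtr//.
have := rho_lt1 s1; rewrite /rho ltr_pdivrMr ?mul1r ?qsg_gt0// => h2.
by apply: lt_le_trans h2 _; rewrite /qsg /wt mulr1z mulr1.
Qed.

Lemma nc_zeta1 : 1 < nc zeta.
Proof.
apply: le_lt_trans nc_zeta; rewrite -[leLHS]sqrtr1 ler_sqrt// ler1n //.
Qed.

Definition Es c x : C := csum (fun D => if ct D == c then qp (hO D x) else 0).
Lemma Es_sum c x : csummable (fun D => if ct D == c then qp (hO D x) else 0).
Proof.
apply: csummable_le (wt_summable s1 x) _ => D; case: ifP => _; rewrite ?nc_qp// nc0.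
by rewrite ltW ?wt_gt0.
Qed.

Lemma Es_inv c a x : Gam a -> Es c (actk a x) = Es c x.
Proof.
move=> ha; rewrite /Es [RHS](@csum_inj _ _ _ (racth a)).
- by congr csum; apply/funext => D; have [-> ->] := racth_spec D ha.
- exact: can_inj (racthK a).
- by move=> D /negP; case; apply/mem_set; exists (racth a^-1%g D) => //; exact: racthVK.
Qed.

Definition fE c (y : Yg) : C := Es c (orep y).
Lemma fE_yproj c x : fE c (yproj Kf g x) = Es c x.
Proof. by rewrite /fE; have [a ha ->] := orep_yproj x; exact: Es_inv. Qed.

(** Each term is already an eigenfunction on the tree: one neighbour is higher and [q] are lower,
    which gives [q^s + q^(1-s)]. *)
Lemma fE_eigen c (y : Yg) : A (fE c) y = aq * (zeta + zeta^-1) * fE c y.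
Proof.
rewrite Adj_nb (eq_bigr (fun e => Es c (nb (orep y) e))); last by move=> e _; rewrite fE_yproj.
rewrite /Es -csum_sum; last by move=> e; exact: Es_sum.
rewrite /fE /Es -csumZ; last exact: Es_sum.
have a0 : aq != 0 := a_neq0 R q0; have z0 : zeta != 0 := cexp_neq0 _.
have a2 : aq * aq = q%:R.
  by rewrite -rmorphM -expr2 sqr_sqrtr// (rmorph_nat (@real_complex R)).
congr csum; apply/funext => D; case: ifP => _; last by rewrite big1 ?mulr0.
have [e he he'] := hO_nb D (orep y); rewrite (bigD1 e)//= he.
rewrite (eq_bigr (fun=> qp (hO D (orep y) - 1))); last by move=> e' /he' ->.
rewrite sumr_const (_ : #|_| = q); last first.
  by have := cardC1 e; rewrite card_option /= hq => <-; apply: eq_card => e'; rewrite !inE.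
rewrite -mulr_natl -a2 qpD qpB1 qp1; move: (qp _) => X; field; by rewrite a0 z0.
Qed.

(** At height [n >= 1] exactly one horoball contains [x]. All others have height at most 0 there,
    and [low_summable] bounds their total uniformly in [x]; the decay appears only after
    multiplication by the square root of the weight. *)
Lemma Es_cusp c c' (n : nat) x : (1 <= n)%N -> hgt c' x = n%:Z ->
  exists2 t, Es c x = (c' == c)%:R * qp n + t & nc t <= LB + LB.
Proof.
move=> n1 hx; pose D0 : PGo := pg (gam c')^-1%g.
have [ct0 hO0] : ct D0 = c' /\ forall z, hO D0 z = hgt c' (actk 1^-1%g z).
  apply: (@hO_eq (gam c')^-1%g 1%g c' 1%g (subgroup_1 GS) (subgroup_1 PS)).
  by rewrite invgK mul1g mulg1.
have hD0 : hO D0 x = n by rewrite hO0 invg1 actk1.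
pose F D := if ct D == c then qp (hO D x) else 0.
pose F1 D := if D == D0 then (c' == c)%:R * qp n else 0; pose F2 D := if hO D x <= 0 then F D else 0.
have FE : F = (fun D => F1 D + F2 D).
  apply/funext => D; rewrite /F1 /F2; case: eqP => [->|ne].
    rewrite /F ct0 hD0 (_ : (n%:Z <= 0) = false) ?addr0; last by lia.
    by case: eqP; rewrite ?mul1r ?mul0r.
  rewrite add0r; case: ifP => // h; case: ne; apply: (@hO_disj D D0 x); lia.
have [s1' e1] := @csum_fin _ _ F1 [:: D0] isT ltac:(by move=> D; rewrite inE /F1 => /negbTE ->).
have [l1 l2] := low_summable s1 x.
have le D : nc (F2 D) <= (if hO D x <= 0 then wz (hO D x) else 0).
  rewrite /F2 /F; case: ifP => _; last by rewrite nc0.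
  by case: ifP => _; rewrite ?nc_qp// nc0 ltW ?wt_gt0.
have s2 : csummable F2 by exact: csummable_le l1 le.
exists (csum F2); last first.
  by apply: nc_csum => //; apply: le_trans l2; apply: ler_rsum.
by rewrite /Es -/F FE csumD// e1 big_seq1 /F1 eqxx.
Qed.

(** A kernel vector extends by powers of [zeta^-1] along the rays to an eigenfunction. As
    [|zeta| > sqrt q], it is bounded even after division by the square roots of the weights; as
    [zeta] is then real, its eigenvalue exceeds [q + 1] in modulus, against [bounded_eigen]. *)
Lemma Fmx_zeta_unit : Fmx q H V zeta \in unitmx.
Proof.
rewrite unitmxE unitfE; apply/negP => /eqP d0.
have /det0P[v v0 hv] : \det (Fmx q H V zeta)^T == 0 by rewrite det_tr d0.
pose u := v^T; have u0 : u != 0 by apply: contra_neq v0 => /(congr1 trmx); rewrite trmxK trmx0.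
have Fu : Fmx q H V zeta *m u = 0 by apply: trmx_inj; rewrite trmx_mul trmxK trmx0.
move: u u0 Fu => {hv v v0} u u0 Fu.
have z1 := nc_zeta1; have z0 : zeta != 0 := cexp_neq0 _; have a0 : aq != 0 := a_neq0 R q0.
have im0 : im zeta = 0.
  by apply: (Fmx_kernel_real q0 H_hermitian _ u0 Fu); rewrite -nc_sqr expr_gt1 ?(ltW z1) ?nc_ge0.
pose b := aq^-1 *: (adjmx V *m u).
have bu c : b c ord0 = aq^-1 * (adjmx V *m u) c ord0 by rewrite mxE.
pose e (x : jidx d r) : C := match x with inl i => u i ord0 | inr (c, n) => zeta ^- n.+1 * b c ord0 end.
have Je (x : jidx d r) : J e x = aq * (zeta + zeta^-1) * e x.
  case: x => [i|[c [|n]]] /=.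
  - have := congr1 (fun M : 'cV[C]_d => M i ord0) Fu; rewrite /Fmx mulmxDl mulmxBl -scalemxAl mul_scalar_mx !mxE.
    move=> h; apply/eqP; rewrite -subr_eq0; apply/eqP; rewrite -[RHS]h addrAC; congr (_ - _ + _).
    have -> : \sum_j (V *m adjmx V) i j * u j ord0 = (V *m (adjmx V *m u)) i ord0 by rewrite mulmxA [RHS]mxE.
    rewrite mxE mulr_sumr; apply: eq_bigr => c _; rewrite bu expr1.
    by field; rewrite z0 a0.
  - have -> : \sum_i adjmx V c i * u i ord0 = aq * b c ord0.
      by rewrite bu mulVKf// [RHS]mxE.
    by rewrite !exprS expr0; field; rewrite z0.
  - by rewrite !exprS; move: (b c ord0) => X; field; rewrite z0 expf_neq0.
have [f fe] := conjU_onto e.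
have Af (y : Yg) : A f y = aq * (zeta + zeta^-1) * f y.
  suff -> : A f = (fun y : Yg => aq * (zeta + zeta^-1) * f y) by [].
  apply: conjU_inj; rewrite hJ fe; apply/funext => x; rewrite Je -fe !conjUE; ring.
have sq0 : 0 < Num.sqrt (q%:R : R) by rewrite sqrtr_gt0 ltr0n.
have muq : q.+1%:R < nc (aq * (zeta + zeta^-1)).
  have -> : zeta = (re zeta)%:C by apply: complexP.
  have := nc_zeta; have -> : nc zeta = `|re zeta| by rewrite -ncR; congr nc; apply: complexP.
  set x := re zeta => hx; have w0 : 0 < `|x| by exact: lt_trans hx.
  rewrite -fmorphV -rmorphD -rmorphM ncR.
  have x0 : x != 0 by rewrite -normr_gt0.
  have -> : `|Num.sqrt q%:R * (x + x^-1)| = Num.sqrt q%:R * (`|x| + `|x|^-1).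
    rewrite normrM ger0_norm ?sqrtr_ge0//; congr (_ * _).
    have -> : x + x^-1 = x^-1 * (x ^+ 2 + 1) by field.
    rewrite normrM normfV [X in _ * X]ger0_norm ?addr_ge0 ?sqr_ge0// -(real_normK (num_real x)).
    by field; rewrite gt_eqF.
  have q2 : (q%:R : R) = Num.sqrt q%:R ^+ 2 by rewrite sqr_sqrtr.
  rewrite mulrSr [X in X + 1]q2; move: hx sq0; move: `|x| w0 => w w0; set t := Num.sqrt _ => tw t0.
  have t1 : w^-1 < t.
    have t1 : 1 < t by rewrite -[X in X < _]sqrtr1 ltr_sqrt ?ltr1n ?q_gt1// ltr0n.
    by apply: lt_trans (t1); rewrite invf_lt1//; exact: lt_trans t1 tw.
  (* Both factors are positive because [|zeta| > sqrt q > |zeta|^-1]. *)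
  rewrite -subr_gt0; have -> : t * (w + w^-1) - (t ^+ 2 + 1) = (w - t) * (t - w^-1).
    by field; rewrite gt_eqF.
  by rewrite mulr_gt0 ?subr_gt0.
pose B := \sum_i nc (f (core i)) + \sum_c nc (b c ord0) / wq c.
have p1 : 0 <= \sum_c nc (b c ord0) / wq c by apply: sumr_ge0 => c _; rewrite divr_ge0 ?nc_ge0 ?ltW ?wq_gt0.
have p2 : 0 <= \sum_i nc (f (core i)) by apply: sumr_ge0 => i _; exact: nc_ge0.
have fB (y : Yg) : nc (f y) <= B.
  have [[i|[c n]] <-] := lab_surj y; rewrite /B /=.
    rewrite (bigD1 i)//= -addrA lerDl addr_ge0//; apply: sumr_ge0 => i' _; exact: nc_ge0.
  rewrite (bigD1 c)//= addrCA -[leLHS]addr0 lerD//; last first.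
    by rewrite addr_ge0//; apply: sumr_ge0 => c' _; rewrite divr_ge0 ?nc_ge0 ?ltW ?wq_gt0.
  rewrite ler_pdivlMr ?wq_gt0//.
  have := congr1 (fun v => nc (v (inr (c, n)))) fe; rewrite conjUE /= sqrt_lam_cusp !ncM ncR ncV ncX.
  have t0 := exprn_gt0 n.+1 sq0; have w0 := exprn_gt0 n.+1 (lt_trans ltr01 z1).
  rewrite ger0_norm ?divr_ge0 ?(ltW (wq_gt0 c)) ?(ltW t0)// => h.
  have -> : nc (f (cusp c n.+1)) * wq c = Num.sqrt q%:R ^+ n.+1 / nc zeta ^+ n.+1 * nc (b c ord0).
    by rewrite -mulrA -h; field; rewrite gt_eqF.
  rewrite -[leRHS]mul1r ler_wpM2r ?nc_ge0// ler_pdivrMr// mul1r lerXn2r ?nnegrE ?sqrtr_ge0 ?nc_ge0//.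
  exact: ltW nc_zeta.
have f0 := bounded_eigen fB Af muq.
have ui i : u i ord0 = 0.
  by have := congr1 (fun w => w (inl i)) fe; rewrite conjUE f0 mulr0 => /esym.
by move/eqP: u0; apply; apply: col0P => i; rewrite [RHS]mxE; exact: ui.
Qed.

Lemma PsiZ_scale (c : C) al (x : jidx d r) : PsiZ q H V zeta (c *: al) x = c * PsiZ q H V zeta al x.
Proof.
case: x => [i|[c' n]] /=; rewrite -!scalemxAr.
  by rewrite scalerA mulrC -scalerA [LHS]mxE.
by rewrite !mxE; ring.
Qed.

(** Only the incoming amplitude [al] has to be identified: on every ray its difference from the
    expected one, times the growing [|zeta|^n], stays bounded, hence is zero by [pow_bounded]. *)
Lemma fE_PsiZ c (x : jidx d r) : U (fE c) x = (wq c)%:C * PsiZ q H V zeta (delta_mx c ord0) x.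
Proof.
have z1 := nc_zeta1; have z0 : zeta != 0 := cexp_neq0 _; have a0 : aq != 0 := a_neq0 R q0.
have z2 : zeta ^+ 2 != 1.
  by apply/eqP => /(congr1 nc); rewrite ncX nc1; have := expr_gt1 (n := 2) isT (nc_ge0 zeta); rewrite z1; lra.
have Je (x' : jidx d r) : J (U (fE c)) x' = aq * (zeta + zeta^-1) * U (fE c) x'.
  by rewrite -hJ !conjUE fE_eigen; ring.
have [al [alE [b bE]]] := eigen_is_PsiZ q0 z0 z2 Fmx_zeta_unit Je.
suff ae : al = (wq c)%:C *: delta_mx c ord0 by rewrite alE ae PsiZ_scale.
apply: col0P => c'; rewrite !mxE eqxx andbT; apply/eqP; rewrite -subr_eq0; apply/eqP/nc_eq0.
suff hb n : nc zeta ^+ n.+1 * nc (al c' ord0 - (wq c)%:C * (c' == c)%:R) <= nc (b c' ord0) + wq c' * (LB + LB).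
  exact: pow_bounded z1 (nc_ge0 _) hb.
have [x0 hx0] := hgt_surj c' n.+1.
have [t tE tB] := @Es_cusp c c' n.+1 x0 isT hx0.
have := bE c' n; rewrite conjUE [lab _]/= sqrt_lam_cusp -(hcusp _ hx0)// fE_yproj tE qp_nat => h.
have e1 : zeta ^+ n.+1 * (al c' ord0 - (wq c)%:C * (c' == c)%:R) =
    (wq c' * (Num.sqrt q%:R ^+ n.+1)^-1)%:C * t - zeta ^- n.+1 * b c' ord0.
  have e2 : (wq c)%:C * (c' == c)%:R = (wq c')%:C * (c' == c)%:R :> C by case: eqP => [->|_]; rewrite ?mulr0.
  rewrite mulrBr e2; apply/eqP; rewrite subr_eq addrAC -subr_eq opprK -h.
  rewrite rmorphM fmorphV rmorphXn /= exprMn -/aq; apply/eqP.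
  by move: (t) ((c' == c)%:R) => X Y; field; rewrite expf_neq0.
rewrite -ncX -ncM e1; apply: le_trans (ncB _ _) _; rewrite addrC lerD//.
  rewrite ncM ncV ncX -[leRHS]mul1r ler_wpM2r ?nc_ge0// invf_le1 ?exprn_ege1 ?exprn_gt0 ?(ltW z1)//.
  exact: lt_trans z1.
have t1 : 1 <= Num.sqrt (q%:R : R) by rewrite -[leLHS]sqrtr1 ler_sqrt// ler1n.
have tn : 1 <= Num.sqrt (q%:R : R) ^+ n.+1 by exact: exprn_ege1.
have wq0 := ltW (wq_gt0 c').
have p0 : 0 <= wq c' / Num.sqrt (q%:R : R) ^+ n.+1 by rewrite divr_ge0// (le_trans ler01).
have p1 : wq c' / Num.sqrt (q%:R : R) ^+ n.+1 <= wq c'.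
  by rewrite ler_pdivrMr ?(lt_le_trans ltr01)// ler_peMr.
by rewrite ncM ncR ger0_norm//; exact: (ler_pM p0 (nc_ge0 _) p1 tB).
Qed.
End EisensteinSeries.

(** * Rationality in [zeta] and continuation to the critical line *)

Notation Fz := (Fmx q H V).

(* A function is rational when it is a quotient of polynomials at each nonzero
   [z] where [Fz z] is invertible. *)
Definition rational (f : C -> C) : Prop := exists N D : {poly C}, D != 0 /\
  forall z, z != 0 -> Fz z \in unitmx -> D.[z] != 0 /\ f z = N.[z] / D.[z].

Lemma rational_poly (N : {poly C}) : rational (fun z => N.[z]).
Proof. by exists N, 1; split=> [|z _ _]; rewrite ?oner_neq0// hornerC oner_neq0 divr1. Qed.
Lemma rational_cst (w : C) : rational (fun=> w).
Proof. by have := rational_poly w%:P; congr rational; apply/funext => z; rewrite hornerC. Qed.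
Lemma rational_X n : rational (fun z => z ^+ n).
Proof. by have := rational_poly 'X^n; congr rational; apply/funext => z; rewrite hornerXn. Qed.

Lemma rational_XV n : rational (fun z => z ^- n).
Proof.
by exists 1, 'X^n; split=> [|z z0 _]; rewrite ?monic_neq0 ?monicXn// hornerXn hornerC expf_neq0// mul1r.
Qed.

Lemma rationalD f f' : rational f -> rational f' -> rational (fun z => f z + f' z).
Proof.
move=> [N [D [D0 h]]] [N' [D' [D0' h']]]; exists (N * D' + N' * D), (D * D').
split=> [|z z0 uz]; first by rewrite mulf_neq0.
have [d0 ->] := h z z0 uz; have [d0' ->] := h' z z0 uz.
by rewrite !hornerE mulf_neq0//; split=> //; field; rewrite d0 d0'.
Qed.

Lemma rationalM f f' : rational f -> rational f' -> rational (fun z => f z * f' z).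
Proof.
move=> [N [D [D0 h]]] [N' [D' [D0' h']]]; exists (N * N'), (D * D').
split=> [|z z0 uz]; first by rewrite mulf_neq0.
have [d0 ->] := h z z0 uz; have [d0' ->] := h' z z0 uz.
by rewrite !hornerM mulf_neq0// mulf_div.
Qed.

Lemma rational_sum (I : Type) (l : seq I) (p : pred I) (f : I -> C -> C) : (forall i, rational (f i)) ->
  rational (fun z => \sum_(i <- l | p i) f i z).
Proof.
move=> h; elim: l => [|i l IH].
  by rewrite (_ : (fun z => _) = fun=> 0); [exact: rational_cst|apply/funext => z; rewrite big_nil].
have [pi|pi] := boolP (p i).
  rewrite (_ : (fun z => _) = fun z => f i z + \sum_(i <- l | p i) f i z); first exact: rationalD.
  by apply/funext => z; rewrite big_cons pi.
by rewrite (_ : (fun z => _) = fun z => \sum_(i <- l | p i) f i z)//; apply/funext => z; rewrite big_cons (negbTE pi).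
Qed.

(* [z * Fz z], up to the factor [sqrt q], as a matrix of polynomials. *)
Definition Fpoly : 'M[{poly C}]_d := \matrix_(i, j) ((sqrtq R q * H i j)%:P * 'X
  - ((i == j)%:R * sqrtq R q ^+ 2)%:P * ('X^2 + 1) + ((V *m adjmx V) i j)%:P).

Lemma FpolyE z : z != 0 -> map_mx (horner_eval z) Fpoly = (sqrtq R q * z) *: Fz z.
Proof.
move=> z0; have a0 := a_neq0 R q0; apply/matrixP => i j; rewrite /Fmx !mxE /horner_eval.
rewrite !(hornerD, hornerN, hornerM, hornerC, hornerX, hornerXn) -mulr_natl.
by move: (\sum_l _) => Y; field; rewrite a0 z0.
Qed.

(** Cramer's rule for [Fpoly]; its determinant is a non-zero polynomial because [Fmx_zeta_unit]
    applies at [s = 2]. *)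
Lemma rational_invF i j : rational (fun z => invmx (Fz z) i j).
Proof.
have a0 := a_neq0 R q0.
have e z : z != 0 -> Fz z \in unitmx -> map_mx (horner_eval z) Fpoly \in unitmx.
  by move=> z0 uz; rewrite FpolyE// unitmxZ// unitfE mulf_neq0.
exists (sqrtq R q *: ('X * (\adj Fpoly) i j)), (\det Fpoly); split=> [|z z0 uz].
  pose s2 : C := 2; have s21 : 1 < re s2 by rewrite /s2 -(rmorph_nat (@real_complex R)) /= ltr1n.
  have := e _ (cexp_neq0 _) (Fmx_zeta_unit s21).
  by rewrite unitmxE det_map_mx unitfE; apply: contraNneq => ->; rewrite /= /horner_eval horner0.
have uP := e z z0 uz; have dP : (\det Fpoly).[z] != 0 by move: uP; rewrite unitmxE det_map_mx unitfE.
split=> //; have -> : invmx (Fz z) = (sqrtq R q * z) *: invmx (map_mx (horner_eval z) Fpoly).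
  by rewrite FpolyE// invmxZ ?scalerA ?mulfV ?scale1r ?mulf_neq0// -FpolyE.
rewrite /invmx uP det_map_mx -map_mx_adj !mxE hornerZ hornerM hornerX /= /horner_eval.
by rewrite mulrCA mulrC !mulrA.
Qed.

Lemma rational_mulmx m n m' (X : C -> 'M[C]_(m, n)) (Z : C -> 'M[C]_(n, m')) i j :
  (forall i j, rational (fun z => X z i j)) -> (forall i j, rational (fun z => Z z i j)) ->
  rational (fun z => (X z *m Z z) i j).
Proof.
move=> hX hZ; rewrite (_ : (fun z => _) = fun z => \sum_l X z i l * Z z l j); last by apply/funext => z; rewrite mxE.
by apply: rational_sum => l; exact: rationalM.
Qed.

Lemma PsiZ_rational c (x : jidx d r) : rational (fun z => PsiZ q H V z (delta_mx c ord0) x).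
Proof.
have rB : rational (fun z : C => z^-1 - z).
  rewrite (_ : (fun z => _) = fun z : C => z ^- 1 + -1 * z ^+ 1); last by apply/funext => z; rewrite mulN1r.
  by apply: rationalD; [exact: rational_XV|apply: rationalM; [exact: rational_cst|exact: rational_X]].
have cst m n (M : 'M[C]_(m, n)) i j : rational (fun z => M i j) by exact: rational_cst.
have rI := rational_invF.
case: x => [i|[c' n]] /=.
  rewrite (_ : (fun z => _) = fun z => (z^-1 - z) * (invmx (Fz z) *m V *m delta_mx c ord0 : 'cV_d) i ord0); last first.
    by apply/funext => z; rewrite mxE.
  by apply: rationalM => //; apply: rational_mulmx => // i' j'; apply: rational_mulmx.
apply: rationalD; first by apply: rationalM; [exact: rational_X|exact: rational_cst].
apply: rationalM; first exact: rational_XV.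
apply: (rational_mulmx (Z := fun=> delta_mx c ord0)) => // a b; rewrite /Smx.
rewrite (_ : (fun z => _) = fun z => - (1%:M : 'M[C]_r) a b +
   ((z^-1 - z) * (sqrtq R q)^-1) * (adjmx V *m invmx (Fz z) *m V) a b); last first.
  by apply/funext => z; rewrite !mxE.
apply: rationalD; first exact: rational_cst.
apply: rationalM; first by apply: rationalM => //; exact: rational_cst.
by apply: rational_mulmx => // i' j'; apply: rational_mulmx.
Qed.

(** Lowest terms are what [rational_meromorphic] needs; the cancelled factor is non-zero wherever
    the original denominator is. *)
Lemma rational_coprime f : rational f -> exists N D : {poly C}, [/\ D != 0, coprimep N D &
  forall z, z != 0 -> Fz z \in unitmx -> f z = N.[z] / D.[z]].
Proof.
move=> [N [D [D0 h]]]; pose G := gcdp N D.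
have eN : N = N %/ G * G by rewrite divpK// dvdp_gcdl.
have eD : D = D %/ G * G by rewrite divpK// dvdp_gcdr.
exists (N %/ G), (D %/ G); split.
- by apply: contraNneq D0 => e; rewrite eD e mul0r.
- by apply: coprimep_div_gcd; rewrite D0 orbT.
move=> z z0 uz; have [d0 ->] := h z z0 uz; move: d0.
have eD' : D.[z] = (D %/ G).[z] * G.[z] by rewrite -hornerM -eD.
have eN' : N.[z] = (N %/ G).[z] * G.[z] by rewrite -hornerM -eN.
rewrite eD' eN' mulf_eq0 negb_or => /andP[n1 n2].
by field; rewrite n1 n2.
Qed.

Lemma s_thetaE t : cexp ((s_theta q t - 2^-1) * (ln (q%:R : R))%:C) = cos t +i* sin t.
Proof.
have l0 := lnq_gt0; have -> : (s_theta q t - 2^-1) * (ln (q%:R : R))%:C = 0 +i* t.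
  rewrite /s_theta -(rmorph_nat (@real_complex R)) -fmorphV.
  by apply: complexP; rewrite /=; field; rewrite gt_eqF.
by rewrite /cexp /= expR0; apply: complexP; rewrite /=; ring.
Qed.

Lemma continuation_Psi (f : C -> C) (k0 : R) c (x : jidx d r) t : k0 != 0 ->
  (forall s, 1 < re s -> f s = k0%:C * PsiZ q H V (zeta s) (delta_mx c ord0) x) ->
  Fz (cos t +i* sin t) \in unitmx ->
  mero_continuation f (s_theta q t) = k0%:C * Psi q H V t (delta_mx c ord0) x.
Proof.
move=> k00 fE ut; have [N [D [D0 ND h]]] := rational_coprime (PsiZ_rational c x).
have kC : k0%:C != 0 :> C by rewrite fmorph_eq0.
have ND' : coprimep (k0%:C *: N) D by rewrite coprimepZl.
rewrite (mero_continuationE (rational_meromorphic lnq_gt0 D0 ND')); last first.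
  by move=> s s1; rewrite fE// h ?cexp_neq0 ?Fmx_zeta_unit// hornerZ mulrA.
rewrite s_thetaE hornerZ PsiE h// ?mulrA//.
by rewrite -s_thetaE cexp_neq0.
Qed.

Lemma fE_continuation c (x : jidx d r) t : Fz (cos t +i* sin t) \in unitmx ->
  mero_continuation (fun s => fE s c (lab x)) (s_theta q t) =
  (wq c / Num.sqrt (lam (lab x)))%:C * Psi q H V t (delta_mx c ord0) x.
Proof.
move=> ut; have l0 := sqrt_lam_gt0 (lab x).
apply: continuation_Psi => [|s s1|//]; first by rewrite gt_eqF// divr_gt0 ?wq_gt0.
by rewrite rmorphM mulrAC -fE_PsiZ// conjUE mulrC mulrA -rmorphM mulVf ?mul1r// gt_eqF.
Qed.

(** Left translation by the lift sends the cosets of the double coset bijectively to the neighbours,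
    and automorphy absorbs the choices of representatives. *)
Lemma Too_Adj (F : Goo oo Kc -> Gprod oo Kc -> C) (y : Yg) : automorphic Kf F -> Gf g ->
  Too varpi F (lift (orep y)) g = A (fun z => F (lift (orep z)) g) y.
Proof.
move=> aF gG; set x0 := orep y; have d1 := diagf1 oo Kc; have e1 := emb1 oo Kc.
have inv a x : Gam a -> F (lift (actk a x)) g = F (lift x) g.
  move=> ha; have [u Ku ->] := lift_vtx (emb a * lift x)%g.
  have := aF a u ((g^-1 * diagf oo Kc a * g)^-1)%g (lift x) g Ku (subgroup_V hKf ha) gG.
  by move=> <-; congr F; rewrite !invgM invgK !mulgA mulgK mulgV mul1g.
have invK (m u : Goo oo Kc) : Koo u -> F (m * u)%g g = F m g.
  move=> Ku; have := aF 1%g u 1%g m g Ku (subgroup_1 hKf) gG.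
  by rewrite d1 e1 !mul1g mulg1.
rewrite /Too /Adj; have bij : set_bij [set vtx u | u in double_coset varpi] [set z | adj varpi x0 z]
    (fun z : T => vtx (lift x0 * lift z)%g).
  have [K1 KM KV] := pgl_int_subgroup (voo oo Kc).
  split.
  - move=> _ [u du <-] /=; have [v Kv e] := lift_vtx u; have [w Kw ew] := lift_vtx (lift x0 * lift (vtx u))%g.
    rewrite /adj ew e; case: du => u1 [u2 [K1' K2 ->]]; exists u1, (u2 * v * w)%g; split=> //.
      exact: KM (KM _ _ K2 Kv) Kw.
    by rewrite !mulgA mulVg mul1g.
  - move=> z z' _ _ /vtxE; rewrite invgM !mulgA -(mulgA _ _^-1%g) mulVg mulg1 => h.
    by rewrite -(liftK z) -(liftK z'); apply/vtxE.
  move=> z az; exists (vtx ((lift x0)^-1 * lift z)%g); first by exists ((lift x0)^-1 * lift z)%g.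
  have [u Ku ->] := lift_vtx ((lift x0)^-1 * lift z)%g.
  by rewrite !mulgA mulgV mul1g (vtx_mulr _ Ku) liftK.
rewrite [RHS](reindex_fsbig _ _ _ _ bij); apply: eq_fsbigr => z _.
have [a ha ->] := orep_yproj (vtx (lift x0 * lift z)%g); rewrite inv//.
by have [u Ku ->] := lift_vtx (lift x0 * lift z)%g; exact/esym/invK.
Qed.

Variables (hP : T -> int) (kap : 'I_r -> int).
Hypothesis hkap : forall c x, hgt c x = hP (actk (gam c)^-1%g x) + kap c.
Notation diagf := (diagf oo Kc).

(** A term of the adelic sum survives exactly when its coset belongs to the cusp [c], and its
    exponent is then the height [hO]. *)
Lemma Eis_sumE c s (y : Yg) :
  Eis_sum Kf q xi hP ((diagf (gam c))^-1 * g)%g (kap c) s (lift (orep y)) g = fE s c y.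
Proof.
rewrite /Eis_sum /fE /Es; congr csum; apply/funext => D; rewrite /phi.
set S := [set p | _]; set x := orep y.
have SP p : S p -> ct D = c /\ hO D x = hP (vtx ((emb p)^-1 * (emb (orep D) * lift x))%g) + kap c.
  (* The finite-adelic equation says that [b] lies in [Gamma]; then
     [(orep D)^-1 = b^-1 * gam c * p^-1] is a decomposition to which [hO_eq] applies. *)
  move=> [hp [w Kw e]]; pose b := (gam c * p^-1 * orep D)%g.
  have hb : Gam b.
    have e2 : (diagf b * g = g * w)%g.
      rewrite /b !diagfM diagfV -[LHS]mulgA e !mulgA.
      by rewrite -(mulgA _ _ (diagf p)) mulVg mulg1 mulgV mul1g.
    by rewrite /Gamma /= -mulgA e2 mulgA mulVg mul1g.
  have hb' := subgroup_V GS hb; have hp' := subgroup_V PS hp.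
  have [|h1 h2] := @hO_eq (orep D) b^-1%g c p^-1%g hb' hp'.
    by rewrite /b !invgM invgK !mulgA -(mulgA _ (gam c)^-1%g) mulVg mulg1 -(mulgA _ p) mulgV mulg1.
  rewrite -[D in ct D]orepK -[D in hO D]orepK h1 h2; split=> //; rewrite hkap invgK -actkM; congr (hP _ + _).
  rewrite /actk /act; congr vtx; rewrite !mulgA mulVg mul1g.
  by rewrite embM embV.
case: asboolP => [S0|nS].
  have Sp : S (xget 1%g S) by have [p hp] := S0; exact: xgetI hp.
  by have [-> ->] := SP _ Sp; rewrite eqxx.
case: eqP => // e; case: nS; have [hb [p hp e']] := btP D; exists p^-1%g; split; first exact: (subgroup_V PS hp).
exists (g^-1 * diagf (bt D)^-1%g * g)%g; first exact: (subgroup_V GS hb).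
have -> : orep D = (p^-1 * (gam c)^-1 * (bt D)^-1)%g by rewrite -[LHS]invgK e' e !invgM mulgA.
by rewrite !diagfM !diagfV !mulgA -(mulgA _ g) mulgV mulg1.
Qed.

Lemma Eis_sum_other c (s : C) go g' : (forall a w, Kf w -> g' = (diagf a * g * w)%g -> False) ->
  Eis_sum Kf q xi hP ((diagf (gam c))^-1 * g)%g (kap c) s go g' = 0.
Proof.
move=> no; rewrite /Eis_sum (_ : (fun D => _) = fun=> 0).
  by rewrite (@csum_fin _ _ _ [::] _ _).2 ?big_nil.
apply/funext => D; rewrite /phi; case: asboolP => // -[p [_ [w Kw e]]].
case: (no ((orep D)^-1 * p * (gam c)^-1)%g w Kw).
by rewrite -[LHS]mul1g -(mulVg (diagf (orep D))) -mulgA e !diagfM !diagfV !mulgA.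
Qed.

Lemma stab_conj_lin (a : C) (f f' : Yg -> C) :
  U (fun y : Yg => a * f y + f' y) = fun x : jidx d r => a * U f x + U f' x.
Proof. by apply/funext => x; rewrite !conjUE; ring. Qed.

Lemma stab_conj_finsupp (f : Yg -> C) : finsupp f -> finsupp (U f).
Proof.
move=> ff; apply: (@sub_finite_set _ _ (lab @^-1` [set y | f y != 0])).
  by move=> x /=; apply: contra_neq => f0; rewrite conjUE f0 mulr0.
by apply: finite_preimage => // x x' _ _; exact: lab_inj.
Qed.

Lemma Eis_transform_jacobi (f Ev : Yg -> C) c t : finsupp f -> Fz (cos t +i* sin t) \in unitmx ->
  (forall y : Yg, Ev y = mero_continuation (fun s => fE s c y) (s_theta q t)) ->
  ((Num.sqrt q.+1%:R)^-1 * (Num.sqrt (wid c))^-1)%:C * ip (fun y : Yg => lam y) f Ev =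
  jacobi_transform q H V (U f) t c.
Proof.
move=> ff ut EvE; rewrite /jacobi_transform /ip -csumZ; last first.
  have [l ul lf] := finsupp_seq ff; apply: (@csum_fin _ _ _ l ul _).1 => y /lf ->.
  by rewrite mul0r mulr0.
rewrite (csum_inj lab_inj) => [|y /negP ny]; last first.
  by case: ny; apply/mem_set; have [x <-] := lab_surj y; exists x.
congr csum; apply/funext => x; rewrite EvE fE_continuation// conjUE.
have l0 := sqrt_lam_gt0 (lab x); have w0 : 0 < Num.sqrt (wid c) by rewrite sqrtr_gt0 wid_gt0.
have q1 : 0 < Num.sqrt (q.+1%:R : R) by rewrite sqrtr_gt0 ltr0n.
have eq : lam (lab x) = Num.sqrt (lam (lab x)) ^+ 2 by rewrite sqr_sqrtr// ltW// lam_gt0.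
have ew : wq c = Num.sqrt (wid c) * Num.sqrt q.+1%:R by rewrite /wq sqrtrM// ltW// wid_gt0.
rewrite [in (lam _)%:C]eq ew; move: (Psi _ _ _ _ _ _) (f _) l0 w0 q1 => Z Y.
move: (Num.sqrt (lam (lab x))) (Num.sqrt (wid c)) (Num.sqrt (q.+1%:R : R)) => a b e a0 b0 e0.
rewrite [X in _ * (_ * (_ * X))](_ : _ = (b * e / a)%:C * Z^*); last first.
  by case: Z => z z'; apply: complexP; rewrite /=; ring.
(* The normalization: with [a^2] the weight of the vertex, [b^2] the cusp width and [e^2 = q + 1],
   all factors collapse to [a], the factor of the stabilizer conjugation. *)
have h : (e^-1 * b^-1 * a ^+ 2 * (b * e / a))%:C = a%:C :> C.
  by congr (_%:C); field; rewrite !gt_eqF.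
by rewrite rmorph1 mul1r -h !rmorphM; ring.
Qed.

End Cusps.

(** * Transport of a unitary extension along an isometric bijection *)

Section Transfer.
Variables (R : realType) (X Z : choiceType) (w : X -> R) (v : Z -> R) (I : finType).
Notation C := R[i].
Variable T : (X -> C) -> Z -> C.
Variables (D : set (X -> C)) (E : set (Z -> C)).
Hypothesis TD : forall f, D f <-> E (T f).
Hypothesis Tlin : forall a f g, T (fun x => a * f x + g x) = fun z => a * T f z + T g z.
Hypothesis Tnorm : forall f, l2norm2 v (T f) = l2norm2 w f.
Hypothesis Tip : forall f g, ip v (T f) (T g) = ip w f g.
Hypothesis Tonto : forall u, exists f, T f = u.
Hypothesis Tfin : forall f, finsupp f -> finsupp (T f).

Lemma unitary_transfer T0 (U : (Z -> C) -> R -> I -> C) : unitary_extension v E T0 U ->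
  unitary_extension w D (fun f => T0 (T f)) (fun f => U (T f)).
Proof.
move=> [[U1 U2 U3 U4] UT]; split; first split.
- by move=> f /TD; exact: U1.
- by move=> a f g /TD Df /TD Dg; rewrite Tlin; exact: U2.
- by move=> f /TD Df; rewrite -Tnorm; exact: U3.
- move=> u /U4[f Ef uf]; have [f' f'E] := Tonto f; exists f'; rewrite ?f'E//.
  by apply/TD; rewrite f'E.
move=> f /Tfin /UT[p [Ep hp] pe]; have [p' p'E] := Tonto p; exists p'; rewrite ?p'E//.
split=> [|d /TD Ed]; first by apply/TD; rewrite p'E.
have e : T (fun x => f x - p' x) = fun z => T f z - p z.
  have := Tlin (-1) p' f; rewrite p'E.
  rewrite (_ : (fun x => -1 * p' x + f x) = fun x => f x - p' x); last by apply/funext => x; ring.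
  by move=> ->; apply/funext => z; ring.
by rewrite -Tip e; exact: hp.
Qed.

End Transfer.

(** * Finite orthogonal direct sums *)

Section DirectSum.
Variables (R : realType) (n : nat) (Y : 'I_n -> choiceType) (w : forall j, Y j -> R) (r : 'I_n -> nat).
Arguments w {j}.
Hypothesis wp : forall j (y : Y j), 0 < w y.
Notation C := R[i].
Notation X := {j : 'I_n & Y j}.
Notation I := {j : 'I_n & 'I_(r j)}.
Definition wsum (x : X) : R := w (projT2 x).
Definition fibre (f : X -> C) (j : 'I_n) (y : Y j) : C := f (existT _ j y).
Variable D : forall j, set (Y j -> C).
Definition Dsum : set (X -> C) := [set f | forall j, D (fibre f (j := j))].
Variables (U T : forall j, (Y j -> C) -> R -> 'I_(r j) -> C).
Definition Usum (f : X -> C) (t : R) (c : I) : C := let: existT j i := c in U (fibre f (j := j)) t i.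
Hypothesis UT : forall j, unitary_extension (w (j := j)) (D (j := j)) (T (j := j)) (U (j := j)).

Lemma wsum_gt0 x : 0 < wsum x. Proof. exact: wp. Qed.

Lemma nsum_sigma (F : X -> R) : (forall x, 0 <= F x) ->
  nsum F = (\sum_j nsum (fun y : Y j => F (existT _ j y)))%E.
Proof.
move=> F0; pose G j x := if tag x == j then F x else 0.
have FE : F = fun x => \sum_j G j x.
  by apply/funext => x; rewrite -big_mkcond /= (big_pred1 (tag x)).
have G0 j x : 0 <= G j x by rewrite /G; case: ifP.
rewrite [X in nsum X = _]FE.
have -> (l : seq 'I_n) : nsum (fun x => \sum_(j <- l) G j x) = (\sum_(j <- l) nsum (G j))%E.
  elim: l => [|j l IH]; first by rewrite big_nil; apply: esum1 => x _; rewrite big_nil.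
  rewrite big_cons -IH -nsumD//; last by move=> x; exact: sumr_ge0.
  by congr nsum; apply/funext => x; rewrite big_cons.
apply: eq_bigr => j _.
have inj : injective (existT (fun j => Y j : Type) j) by move=> y y' /eqP; rewrite eq_Tagged => /eqP.
rewrite (nsum_inj_supp inj) => [|x|[j' y] /negP ny]; first by congr nsum; apply/funext => y; rewrite /G /= eqxx.
  exact: G0.
by rewrite /G /=; case: eqP => //= e; case: ny; apply/mem_set; subst j'; exists y.
Qed.

Lemma csum_sigma (F : X -> C) : (forall j, csummable (fun y : Y j => F (existT _ j y))) ->
  csum F = \sum_j csum (fun y : Y j => F (existT _ j y)).
Proof.
move=> sF; have sX : csummable F.
  have e (G : forall j, Y j -> R) : (forall j, (nsum (fun y : Y j => `|Normc.normc (F (existT _ j y))|%R) < +oo)%E) ->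
     (\sum_j nsum (fun y : Y j => `|Normc.normc (F (existT _ j y))|%R) < +oo)%E.
    by move=> h; apply/lte_sum_pinfty => j _; exact: h.
  by rewrite /csummable /rsummable nsum_sigma//; apply: e => //.
have FE : F = fun x => \sum_j (if tag x == j then F x else 0).
  by apply/funext => x; rewrite -big_mkcond /= (big_pred1 (tag x)).
rewrite {1}FE csum_sum => [|j]; last first.
  by apply: csummable_le sX _ => x; case: ifP => // _; rewrite nc0 nc_ge0.
apply: eq_bigr => j _.
have inj : injective (existT (fun j => Y j : Type) j) by move=> y y' /eqP; rewrite eq_Tagged => /eqP.
rewrite (csum_inj inj) => [|[j' y] /negP ny]; first by congr csum; apply/funext => y; rewrite /= eqxx.
by rewrite /=; case: eqP => //= e; case: ny; apply/mem_set; subst j'; exists y.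
Qed.

Lemma l2norm2_fibres f : l2norm2 wsum f = (\sum_j l2norm2 (w (j := j)) (fibre f (j := j)))%E.
Proof.
rewrite nsum_l2 nsum_sigma => [|x]; last by rewrite mulr_ge0 ?nsq_ge0 ?ltW ?wsum_gt0.
by apply: eq_bigr => j _; rewrite nsum_l2.
Qed.

Lemma ip_summable j (f g : Y j -> C) : l2 (w (j := j)) f -> l2 (w (j := j)) g ->
  csummable (fun y => (w y)%:C * (f y * (g y)^*)).
Proof.
have w0 y : 0 <= w (j := j) y by rewrite ltW.
move=> /(l2P w0) /sq_int_l2P lf /(l2P w0) /sq_int_l2P lg.
apply: csummable_le (rsummableD lf lg) _ => y.
rewrite !ncM ncR ger0_norm// -mulrDr ler_wpM2l// -!nc_sqr.
have -> : Normc.normc (g y)^* = Normc.normc (g y) by case: (g y) => a b; rewrite /Normc.normc /= sqrrN.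
have := nc_ge0 (f y); have := nc_ge0 (g y); move: (Normc.normc _) (Normc.normc _) => a b a0 b0.
by have := sqr_ge0 (a - b); nra.
Qed.

Lemma ip_fibres f g : (forall j, l2 (w (j := j)) (fibre f (j := j))) -> (forall j, l2 (w (j := j)) (fibre g (j := j))) ->
  ip wsum f g = \sum_j ip (w (j := j)) (fibre f (j := j)) (fibre g (j := j)).
Proof. by move=> lf lg; apply: csum_sigma => j; exact: ip_summable. Qed.

Lemma finsupp_fibre f j : finsupp f -> finsupp (fibre f (j := j)).
Proof.
move=> ff; rewrite /finsupp (_ : [set x | _] = existT (fun j => Y j : Type) j @^-1` [set x | f x != 0])//.
by apply: finite_preimage => // y y' _ _ /eqP; rewrite eq_Tagged => /eqP.
Qed.

Lemma D_l2 j (f : Y j -> C) : D f -> l2 (w (j := j)) f.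
Proof. by case: (UT j) => -[h1 _ h3 _] _ Df; rewrite /l2 -h3//; case: (h1 f Df). Qed.

Lemma outnorm2_fibres (u : R -> I -> C) : (forall c, measurable_fun `]0, (pi : R)[ (fun t => re (u t c)) /\
    measurable_fun `]0, (pi : R)[ (fun t => im (u t c))) ->
  outnorm2 u = (\sum_j outnorm2 (fun t (i : 'I_(r j)) => u t (existT _ j i)))%E.
Proof.
move=> mu; rewrite outnorm2_sum; last by apply: omeas_nsq => c; [exact: (mu c).1|exact: (mu c).2].
rewrite (eq_bigr (fun p : I => \int[lebesgue_measure]_(t in (`]0%R, pi : R[%classic : set R))
       (nsq (u t (existT _ (tag p) (tagged p))) / (2 * pi))%:E)%E) => [|[j i] _ //].
rewrite -(@sig_big_dep _ _ _ 'I_n (fun j => 'I_(r j)) xpredT (fun=> xpredT) (fun j i => \int[lebesgue_measure]_(t in (`]0%R, pi : R[%classic : set R))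
       (nsq (u t (existT _ j i)) / (2 * pi))%:E)%E).
apply: eq_bigr => j _; rewrite outnorm2_sum//.
by apply: omeas_nsq => i; [exact: (mu (existT _ j i)).1|exact: (mu (existT _ j i)).2].
Qed.

Lemma ae_fibres (u v : R -> I -> C) :
  (forall j, ae_eq0pi (fun t (i : 'I_(r j)) => u t (existT _ j i)) (fun t i => v t (existT _ j i))) -> ae_eq0pi u v.
Proof. by move=> h; apply/ae0piP => -[j i]; have /ae0piP := h j; apply. Qed.

Lemma fibre_measurable (u : R -> I -> C) : (forall j, L2out (fun t (i : 'I_(r j)) => u t (existT _ j i))) ->
  forall c, measurable_fun `]0, (pi : R)[ (fun t => re (u t c)) /\
    measurable_fun `]0, (pi : R)[ (fun t => im (u t c)).
Proof. by move=> h [j i]; case: (h j) => m _; exact: m i. Qed.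

(** Norms, pairings and null sets decompose over the finitely many fibres, so preimages and
    projections are assembled componentwise. The pairing splits only for square-summable arguments,
    which [D_l2] extracts from unitarity itself. *)
Lemma unitary_sum T0 : (forall f, finsupp f -> ae_eq0pi (fun t c => let: existT j i := c in T (fibre f (j := j)) t i) (T0 f)) ->
  unitary_extension wsum Dsum T0 Usum.
Proof.
move=> hT0; have L f j : Dsum f -> L2out (fun t (i : 'I_(r j)) => Usum f t (existT _ j i)).
  by move=> /(_ j) Df; case: (UT j) => -[h _ _ _] _; exact: h.
have N f : Dsum f -> outnorm2 (Usum f) = l2norm2 wsum f.
  move=> Df; rewrite outnorm2_fibres; last by apply: fibre_measurable => j; exact: L.
  rewrite l2norm2_fibres; apply: eq_bigr => j _; case: (UT j) => -[_ _ h _] _; exact: h.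
split; first split=> //.
- move=> f Df; split; first by apply: fibre_measurable => j; exact: L.
  by rewrite N// l2norm2_fibres; apply/lte_sum_pinfty => j _; exact: D_l2.
- move=> a f g Df Dg; apply: ae_fibres => j; case: (UT j) => -[_ h _ _] _.
  exact: (h a _ _ (Df j) (Dg j)).
- move=> u [mu nu].
  have Lu j : L2out (fun t (i : 'I_(r j)) => u t (existT _ j i)).
    split=> [i|]; first exact: mu.
    apply: le_lt_trans nu; rewrite outnorm2_fibres// (bigD1 j)//= leeDl// sume_ge0// => j' _.
    by rewrite /outnorm2; apply: integral_ge0 => t _; rewrite lee_fin; apply: sumr_ge0 => i _; apply: divr_ge0; [exact: sqr_ge0|rewrite mulr_ge0// pi_ge0].
  have ex j : exists f, D f /\ ae_eq0pi (U (j := j) f) (fun t i => u t (existT _ j i)).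
    by case: (UT j) => -[_ _ _ h] _; have [f Df fe] := h _ (Lu j); exists f.
  pose F (x : X) : C := projT1 (cid (ex (projT1 x))) (projT2 x).
  have FP j : D (fibre F (j := j)) /\ ae_eq0pi (U (fibre F (j := j))) (fun t i => u t (existT _ j i)) := projT2 (cid (ex j)).
  by exists F => [j|]; [exact: (FP j).1|apply: ae_fibres => j; exact: (FP j).2].
move=> f ff.
have ex j : exists p, is_projection (w (j := j)) (D (j := j)) (fibre f (j := j)) p /\ ae_eq0pi (U p) (T (fibre f (j := j))).
  by case: (UT j) => _ h; have [p h1 h2] := h _ (finsupp_fibre j ff); exists p.
pose p (x : X) : C := projT1 (cid (ex (projT1 x))) (projT2 x).
have pP j : is_projection (w (j := j)) (D (j := j)) (fibre f (j := j)) (fibre p (j := j)) /\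
    ae_eq0pi (U (fibre p (j := j))) (T (fibre f (j := j))) := projT2 (cid (ex j)).
have Dp : Dsum p by move=> j; have [[]] := pP j.
exists p; last first.
  apply: ae0pi_trans (hT0 _ ff); by apply: ae_fibres => j; exact: (pP j).2.
split=> // d Dd; rewrite ip_fibres.
- by apply: big1 => j _; have [[_ h] _] := pP j; exact: h _ (Dd j).
- move=> j; have w0 y : 0 <= w (j := j) y by rewrite ltW.
  by apply/(l2P w0); apply: sq_intB; [apply: finsupp_sq_int; exact: (finsupp_fibre j ff)|apply/l2P; apply: D_l2; exact: Dp].
- by move=> j; exact: D_l2.
Qed.

Lemma Dsum_l2 f : Dsum f -> l2 wsum f.
Proof. by move=> Df; rewrite /l2 l2norm2_fibres; apply/lte_sum_pinfty => j _; exact: D_l2. Qed.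

End DirectSum.

Lemma ae_notin (R : realType) (l : seq R) : {ae @lebesgue_measure R, forall t, t \notin l}.
Proof.
have cl : countable [set` l] by apply: finite_set_countable; exact: finite_seq.
exists [set` l]; split.
- by apply: countable_measurable => [x|//]; exact: measurable_set1.
- exact: countable_lebesgue_measure0.
by move=> t /= /negP; rewrite negbK.
Qed.

Lemma mero_continuation0 (R : realType) (s : R[i]) : mero_continuation (fun=> 0) s = 0.
Proof.
have m := @rational_meromorphic R 1 0 1 ltr01 (oner_neq0 _) (coprimep1 _).
by rewrite (mero_continuationE m) => [|z _]; rewrite horner0 mul0r.
Qed.

(** * Cusps in adelic terms *)

Section AdelicCusps.
Variables (k : fieldType) (oo : valuation k) (Kc : forall v : valuation k, completion v).
Variable Kf : set (Gprod oo Kc).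
Hypothesis hKf : is_subgroup Kf.
Variables (h : nat) (g : 'I_h -> Gprod oo Kc).
Hypothesis hgG : forall j, Gf (g j).
Hypothesis hg : forall x, Gf x -> exists! j : 'I_h,
  exists (a : PGL2 k) (w : Gprod oo Kc), Kf w /\ x = (diagf oo Kc a * g j * w)%g.
Variable xi : 'cV[k]_2.
Hypothesis hxi : xi != 0.
Notation diagf := (diagf oo Kc).

Lemma class_unique j j' a w : Kf w -> g j' = (diagf a * g j * w)%g -> j = j'.
Proof.
move=> Kw e; have [j0 [_ u]] := hg (hgG j').
rewrite -(u j); last by exists a, w.
by apply: u; exists 1%g, 1%g; split; [exact: (subgroup_1 hKf)|rewrite diagf1 mul1g mulg1].
Qed.

Lemma adelic_cusp_eq j j' (a a' : PGL2 k) :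
  (exists p w, [/\ parabolic xi p, Kf w &
     ((diagf a')^-1 * g j' = diagf p * ((diagf a)^-1 * g j) * w)%g])
  <-> (j = j' /\ exists b p, [/\ Gamma Kf (g j) b, parabolic xi p & a' = (b * a * p)%g]).
Proof.
have PS := parabolic_subgroup hxi; split.
  move=> [p [w [hp Kw e]]]; pose b := (a' * p * a^-1)%g.
  have e2 : g j' = (diagf b * g j * w)%g.
    rewrite -[LHS]mul1g -(mulgV (diagf a')) -mulgA e /b !diagfM diagfV !mulgA.
    by [].
  have jj := class_unique Kw e2; split=> //; rewrite -{}jj in e2.
  exists b, p^-1%g; split; last by rewrite /b -!mulgA mulKg mulgV mulg1.
    rewrite /Gamma /= -mulgA; have -> : ((g j)^-1 * (diagf b * g j) = w^-1)%g.
      have -> : (diagf b * g j = g j * w^-1)%g by rewrite {2}e2 -mulgA mulgV mulg1.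
      by rewrite mulgA mulVg mul1g.
    exact: (subgroup_V hKf).
  exact: (subgroup_V PS).
move=> [<- [b [p [hb hp ->]]]]; exists p^-1%g, ((g j)^-1 * diagf b^-1%g * g j)%g; split.
- exact: (subgroup_V PS).
- exact: (subgroup_V (Gamma_subgroup hKf (g j)) hb).
rewrite !diagfM !diagfV !invgM !mulgA; congr (_ * _)%g.
by rewrite -!(mulgA _ (g j)) mulgV mulg1.
Qed.

Lemma adelic_cusp_surj x : Gf x -> exists j (a : PGL2 k) p w, [/\ parabolic xi p, Kf w &
  x = (diagf p * ((diagf a)^-1 * g j) * w)%g].
Proof.
move=> /hg[j [[a [w [Kw ->]]] _]]; exists j, a^-1%g, 1%g, w; split=> //.
  exact: (subgroup_1 (parabolic_subgroup hxi)).
by rewrite diagf1 mul1g diagfV invgK.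
Qed.

End AdelicCusps.

(** * The adelic Eisenstein transform *)

Theorem corollary2p30
  (R : realType)
  (Fq : finFieldType) (k : fieldType) (iota : {rmorphism Fq -> k})
  (hk : global_function_field iota)
  (oo : valuation k) (hoo : degree_one iota oo)
  (Kc : forall v : valuation k, completion v)
  (varpi : koo oo Kc) (hvarpi : varpi != 0 /\ voo oo Kc varpi = 1)
  (Kf : set (Gprod oo Kc)) (hKf : is_subgroup Kf) (hKfG : Kf `<=` @Gf k oo Kc)
  (hKfo : open Kf) (hKfc : compact Kf)
  (h : nat) (g : 'I_h -> Gprod oo Kc) (hgG : forall j, Gf (g j))
  (hg : forall x, Gf x -> exists! j : 'I_h,
    exists (a : PGL2 k) (w : Gprod oo Kc), Kf w /\ x = (diagf oo Kc a * g j * w)%g)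
  (xi : 'cV[k]_2) (hxi : xi != 0)
  (hP : tree oo Kc -> int) (hhP : busemann varpi xi hP)
  (hhPp : forall p al x, parabolic xi p -> root_char xi p al ->
    hP (actk p x) - hP x = - oo al)
  (r : 'I_h -> nat) (gam : forall j : 'I_h, 'I_(r j) -> PGL2 k)
  (hgam : forall (j : 'I_h) (a : PGL2 k), exists! c : 'I_(r j),
    exists b p, [/\ Gamma Kf (g j) b, parabolic xi p & a = (b * gam j c * p)%g])
  (hgt : forall j : 'I_h, 'I_(r j) -> tree oo Kc -> int)
  (hhgt : forall j c, busemann varpi (mxrep (gam j c) *m xi) (hgt j c))
  (kap : forall j : 'I_h, 'I_(r j) -> int)
  (hkap : forall j c x, hgt j c x = hP (actk (gam j c)^-1%g x) + kap j c)
  (hdisj : forall j c c' a a', Gamma Kf (g j) a -> Gamma Kf (g j) a' ->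
    [set actk a x | x in horoball (hgt j c)]
      `&` [set actk a' x | x in horoball (hgt j c')] !=set0 ->
    [set actk a x | x in horoball (hgt j c)]
      = [set actk a' x | x in horoball (hgt j c')])
  (hstab : forall j c a,
    (Gamma Kf (g j) a /\
       [set actk a x | x in horoball (hgt j c)] = horoball (hgt j c))
    <-> cusp_group Kf (g j) xi (gam j c) a)
  (cusp : forall j : 'I_h, 'I_(r j) -> nat -> Y Kf (g j))
  (hcusp : forall j c n x, (1 <= n)%N -> hgt j c x = n%:Z ->
    yproj Kf (g j) x = cusp j c n)
  (d : 'I_h -> nat) (core : forall j : 'I_h, 'I_(d j) -> Y Kf (g j))
  (hcore_inj : forall j, injective (core j))
  (hcore : forall j (y : Y Kf (g j)),
    (exists i, core j i = y) <-> ~ (exists c n, (1 <= n)%N /\ y = cusp j c n))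
  (wid : forall j : 'I_h, 'I_(r j) -> R)
  (hwid : forall j c n, (1 <= n)%N ->
    lam R (cusp j c n) = wid j c * (#|Fq|.+1)%:R * (#|Fq|%:R ^- n))
  (H : forall j : 'I_h, 'M[R[i]]_(d j)) (V : forall j : 'I_h, 'M[R[i]]_(d j, r j))
  (hJ : forall j (f : Y Kf (g j) -> R[i]),
    conjU (core j) (cusp j) (Adj varpi f)
      = jacobi #|Fq| (H j) (V j) (conjU (core j) (cusp j) f)) :
  ((forall j j' (a a' : PGL2 k),
      (exists p w, [/\ parabolic xi p, Kf w &
         ((diagf oo Kc a')^-1 * g j' = diagf oo Kc p * ((diagf oo Kc a)^-1 * g j) * w)%g])
      <-> (j = j' /\ exists b p,
             [/\ Gamma Kf (g j) b, parabolic xi p & a' = (b * a * p)%g])) /\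
   (forall x, Gf x -> exists j (a : PGL2 k) p w, [/\ parabolic xi p, Kf w &
      x = (diagf oo Kc p * ((diagf oo Kc a)^-1 * g j) * w)%g])) /\
  exists FEis : (Yall Kf g -> R[i]) -> R -> cusps r -> R[i],
    [/\ unitary_extension (lam_all R Kf g) (L2Eis_ad R varpi Kf g)
          (Eis_transform #|Fq| xi hP gam kap wid) FEis,
        forall F', unitary_extension (lam_all R Kf g) (L2Eis_ad R varpi Kf g)
            (Eis_transform #|Fq| xi hP gam kap wid) F' ->
          forall f, L2Eis_ad R varpi Kf g f -> ae_eq0pi (F' f) (FEis f),
        (forall F : Goo oo Kc -> Gprod oo Kc -> R[i], automorphic Kf F ->
          L2Eis_ad R varpi Kf g (res Kf g F) ->
          L2Eis_ad R varpi Kf g (res Kf g (Too varpi F)) /\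
          ae_eq0pi (FEis (res Kf g (Too varpi F)))
            (fun t c => (2 * Num.sqrt #|Fq|%:R * cos t)%:C * FEis (res Kf g F) t c))
      & (forall j : 'I_h,
           (forall f, L2Eis R varpi Kf g j f ->
              ac_subspace (fun=> 1) (jacobi #|Fq| (H j) (V j))
                (conjU (core j) (cusp j) f) /\
              l2norm2 (fun=> 1) (conjU (core j) (cusp j) f)
                = l2norm2 (fun y : Y Kf (g j) => lam R y) f) /\
           (forall u, ac_subspace (fun=> 1) (jacobi #|Fq| (H j) (V j)) u ->
              exists2 f, L2Eis R varpi Kf g j f & conjU (core j) (cusp j) f = u)) /\
        exists Fac : forall j : 'I_h,
            (jidx (d j) (r j) -> R[i]) -> R -> 'I_(r j) -> R[i],
          (forall j, unitary_extension (fun=> 1)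
             (ac_subspace (fun=> 1) (jacobi #|Fq| (H j) (V j)))
             (jacobi_transform #|Fq| (H j) (V j)) (Fac j)) /\
          (forall f, L2Eis_ad R varpi Kf g f -> ae_eq0pi (FEis f)
             (fun t (c : cusps r) => let: existT j i := c in
                Fac j (conjU (core j) (cusp j) (component f j)) t i))].
Proof.
split; first by split; [exact: adelic_cusp_eq|exact: adelic_cusp_surj].
have q0 : (0 < #|Fq|)%N by rewrite (ltn_trans _ (card_finNzRing_gt1 Fq)).
have lamp j y := lam_gt0 hoo hvarpi hKf hxi (hgam j) (hhgt j) (hdisj j) (hstab j) R y.
have Hh j := H_hermitian hoo hvarpi hKf hxi (hgam j) (hhgt j) (hdisj j) (hstab j) (hcusp j) (@hcore_inj j) (hcore j) (hJ j).
have acE j f := conjU_ac hoo hvarpi hKf hxi (hgam j) (hhgt j) (hdisj j) (hstab j) (hcusp j) (@hcore_inj j) (hcore j) (hJ j) f.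
have nE j f := conjU_norm hoo hvarpi hKf hxi (hgam j) (hhgt j) (hdisj j) (hstab j) (hcusp j) (@hcore_inj j) (hcore j) (f : Y Kf (g j) -> R[i]).
have iE j f f' := conjU_ip hoo hvarpi hKf hxi (hgam j) (hhgt j) (hdisj j) (hstab j) (hcusp j) (@hcore_inj j) (hcore j) (f : Y Kf (g j) -> R[i]) f'.
have oE j u := conjU_onto hoo hvarpi hKf hxi (hgam j) (hhgt j) (hdisj j) (hstab j) (hcusp j) (@hcore_inj j) (hcore j) (u : jidx (d j) (r j) -> R[i]).
have finE j f := stab_conj_finsupp hoo hvarpi hKf hxi (hgam j) (hhgt j) (hdisj j) (hstab j) (hcusp j) (@hcore_inj j) (hcore j) (f := f : Y Kf (g j) -> R[i]).
have spec j := jacobi_spectral (V j) q0 (Hh j).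
pose Fac j := projT1 (cid (spec j).2).
have FacP j : unitary_extension (fun=> 1) (ac_subspace (fun=> 1) (jacobi #|Fq| (H j) (V j)))
    (jacobi_transform #|Fq| (H j) (V j)) (Fac j) /\
  forall f, ac_subspace (fun=> 1) (jacobi #|Fq| (H j) (V j)) f ->
    ac_subspace (fun=> 1) (jacobi #|Fq| (H j) (V j)) (jacobi #|Fq| (H j) (V j) f) /\
    ae_eq0pi (Fac j (jacobi #|Fq| (H j) (V j) f)) (fun t c => (2 * Num.sqrt #|Fq|%:R * cos t)%:C * Fac j f t c) :=
  projT2 (cid (spec j).2).
have UTj j := unitary_transfer (fun f => iff_sym (acE j f)) (@stab_conj_lin _ _ _ _ _ _ R _ (cusp j) (core j)) (nE j) (iE j) (oE j) (@finE j) (FacP j).1.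
pose FEis := Usum (fun j f => Fac j (conjU (core j) (cusp j) f)).
have UX : unitary_extension (lam_all R Kf g) (L2Eis_ad R varpi Kf g)
    (Eis_transform #|Fq| xi hP gam kap wid) FEis.
  (* It remains to compare the Eisenstein transform with the transported Jacobi transforms; the
     finitely many angles at which [Fmx] may be singular are discarded. *)
  apply: (unitary_sum lamp UTj) => f ff; apply: ae_fibres => j.
  have [l lP] := Fmx_unit_finite (V j) q0 (Hh j).
  apply: ae_S (ae_notin l) => t tl; rewrite /= in_itv /= => t0; apply/funext => i.
  pose E := res Kf g (Eis Kf #|Fq| xi hP ((diagf oo Kc (gam j i))^-1 * g j)%g (kap j i) (s_theta #|Fq| t)).
  have EE (y : Y Kf (g j)) : E (existT _ j y) = mero_continuation (fun s => fE (hgam j) (hgt j) #|Fq| s i y) (s_theta #|Fq| t).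
    rewrite /E /res /Eis /= (_ : (fun s => _) = fun s => fE (hgam j) (hgt j) #|Fq| s i y)//.
    apply/funext => s.
    exact: (Eis_sumE hoo hvarpi hKf hxi (hgam j) (hhgt j) (hstab j) #|Fq| (hkap j) i s y).
  (* The series of a cusp of component [j] vanishes identically in [s] on the other components, and
     the continuation of the zero function is 0. *)
  have E0 x : tag x != j -> E x = 0.
    case: x => j' y /= jj; rewrite /E /res /Eis /= (_ : (fun s => _) = fun=> 0) ?mero_continuation0//.
    apply/funext => s; apply: Eis_sum_other => a w Kw e.
    by move/eqP: jj; apply; rewrite (class_unique hKf hgG hg Kw e).
  have inj : injective (existT (fun j => Y Kf (g j) : Type) j) by move=> y y' /eqP; rewrite eq_Tagged => /eqP.
  have ipE : ip (fun y : Y Kf (g j) => lam R y) (fibre f (j := j)) (fun y => E (existT _ j y)) = ip (lam_all R Kf g) f E.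
    apply/esym; apply: (csum_inj inj) => -[j' y] /negP ny.
    have jj : j' != j by apply/eqP => e; case: ny; apply/mem_set; subst j'; exists y.
    rewrite E0// [X in _ * (_ * X)](_ : _ = 0) ?mulr0//.
    by apply: complexP; rewrite /= ?oppr0.
  rewrite -(Eis_transform_jacobi hoo hvarpi hKf hxi (hhgt j) (hdisj j) (hstab j) q0 (hcusp j) (@hcore_inj j) (hcore j) (@hwid j) (hJ j) erefl (finsupp_fibre j ff) (lP t t0 tl) EE) ipE.
  by [].
have Dlc a f f' : L2Eis_ad R varpi Kf g f -> L2Eis_ad R varpi Kf g f' ->
    L2Eis_ad R varpi Kf g (fun x => a * f x + f' x).
  move=> Df Df' j; apply/acE.
  have := (spec j).1 a _ _ ((acE j _).2 (Df j)) ((acE j _).2 (Df' j)).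
  by rewrite -stab_conj_lin.
exists FEis; split=> //.
- move=> F' UF' f Df; apply: (unitary_extension_unique _ _ Dlc UX UF' Df).
    by move=> y; exact: lamp.
  by move=> f' Df'; exact: (Dsum_l2 lamp UTj Df').
- move=> F aF DF.
  have e j : component (res Kf g (Too varpi F)) j = Adj varpi (component (res Kf g F) j).
    by apply/funext => y; exact: (Too_Adj varpi hKf y aF (hgG j)).
  have DFj j := (acE j _).2 (DF j).
  split=> [j|]; first by rewrite e; apply/acE; rewrite -[stab_conj _ _ _]/(conjU _ _ _) hJ; exact: ((FacP j).2 _ (DFj j)).1.
  apply: ae_fibres => j; have := ((FacP j).2 _ (DFj j)).2.
  by rewrite -[stab_conj _ _ _]/(conjU _ _ _) -hJ -e.
split=> [j|].
  split=> [f Df|u au]; first by split; [exact/acE|exact: nE].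
  have [f fu] := oE j u; exists f => //; apply/acE; rewrite fu; exact: au.
exists Fac; split=> [j|f Df]; first exact: (FacP j).1.
by apply/ae0piP => -[j i]; exact: ae_eq_refl.
Qed.
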